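(* Consider the linear model $\mathbf{y}=\mathbf{X}\boldsymbol{\beta}+\boldsymbol{\varepsilon}$ and assume conditions A1), A2) and A3) stated in the context. Let $s=p^{1-\eta}$ for some $\eta\in(0,1)$ and suppose $\mu_{min}\ge\sqrt{2(\gamma^*+c)\log p}$ for some constant $c>0$. Then the estimator $\hat\pi^*$ with bounding sequence $c_p^*$ at the order of $(s_{max}/n)^{1/4}\log p$, with $\tau_0\in(2\gamma^*,2\gamma^*+c)$ and $\tau_1>2(\gamma^*+c)$, consistently estimates the proportion $\pi=s/p$ of relevant predictors, i.e., for any $\delta>0$, $$P\left(|\hat\pi^*/\pi-1|<\delta\right)\to1 ,$$ and, consequently, $\hat s=\hat\pi^*p$ satisfies $$P\left(|\hat s/s-1|<\delta\right)\to1\qquad (p\to\infty).$$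
   Context: Model. Asymptotics are as $p\to\infty$; $n$, $s$, $s_{max}$, $\boldsymbol\beta$, $\boldsymbol\Sigma$ etc. may depend on $p$. $\mathbf{y}=\mathbf{X}\boldsymbol\beta+\boldsymbol\varepsilon$ with $\mathbf{X}=[\mathbf{x}_1,\dots,\mathbf{x}_p]\in\mathbb{R}^{n\times p}$, $\boldsymbol\beta\in\mathbb{R}^p$, and, given $\mathbf{X}$, $\boldsymbol\varepsilon\sim\mathcal{N}_n(0,\sigma^2\mathbf{I})$, with $\sigma^2=O(1)$. $I_1=\{j:\beta_j\ne0\}$, $s=|I_1|$, $\pi=s/p$. $\Phi$ is the standard normal CDF, $\bar\Phi=1-\Phi$. Debiased Lasso. $\hat{\boldsymbol\beta}=\arg\min_{\boldsymbol\beta\in\mathbb{R}^p}(\|\mathbf{y}-\mathbf{X}\boldsymbol\beta\|_2^2/n+2\lambda\|\boldsymbol\beta\|_1)$. With $\mathbf{X}_{-j}$ denoting $\mathbf{X}$ with its $j$th column removed, $\hat{\boldsymbol\gamma}_j=\arg\min_{\boldsymbol\gamma\in\mathbb{R}^{p-1}}(n^{-1}\|\mathbf{x}_j-\mathbf{X}_{-j}\boldsymbol\gamma\|_2^2+2\lambda_j\|\boldsymbol\gamma\|_1)$ with components $\hat\gamma_{j,k}$, $k\ne j$, and $\hat\tau_j^2=n^{-1}\|\mathbf{x}_j-\mathbf{X}_{-j}\hat{\boldsymbol\gamma}_j\|_2^2+2\lambda_j\|\hat{\boldsymbol\gamma}_j\|_1$. $\hat{\boldsymbol\Theta}$ is the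 $p\times p$ matrix with $\hat{\boldsymbol\Theta}_{jj}=\hat\tau_j^{-2}$ and $\hat{\boldsymbol\Theta}_{jk}=-\hat\tau_j^{-2}\hat\gamma_{j,k}$ for $k\neq j$. The debiased Lasso estimator is $\hat{\mathbf{b}}=\hat{\boldsymbol\beta}+n^{-1}\hat{\boldsymbol\Theta}\mathbf{X}^T(\mathbf{y}-\mathbf{X}\hat{\boldsymbol\beta})$. Put $\hat{\boldsymbol\Sigma}=n^{-1}\mathbf{X}^T\mathbf{X}$, $\hat{\boldsymbol\Omega}=\hat{\boldsymbol\Theta}\hat{\boldsymbol\Sigma}\hat{\boldsymbol\Theta}^T$, $z_j=\sqrt{n}\,\hat b_j\,\sigma^{-1}\hat{\boldsymbol\Omega}_{jj}^{-1/2}$, $\mathbf{w}=n^{-1/2}\hat{\boldsymbol\Theta}\mathbf{X}^T\boldsymbol\varepsilon$ and $w_j'=w_j/(\sigma\hat{\boldsymbol\Omega}_{jj}^{1/2})$ (so $w'_j\sim\mathcal{N}(0,1)$ given $\mathbf{X}$). Precision matrix sparsity. $\boldsymbol\Theta=\boldsymbol\Sigma^{-1}$, $s_j=|\{k\ne j:\boldsymbol\Theta_{jk}\ne0\}|$, $s_{max}=\max_{1\le j\le p}s_j$. Conditions. A1) The rows of $\mathbf{X}$ are i.i.d. $\mathcal{N}_p(0,\boldsymbol\Sigma)$, where: (a) $\max_j\boldsymbol\Sigma_{jj}\le1$; (b) all eigenvalues of $\boldsymbol\Sigma$ lie in $[C_{min},C_{max}]$ for constants $0<C_{min}\le C_{max}<\infty$;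 (c) $\rho(\boldsymbol\Sigma,C_0s)\le\rho$ for some constant $\rho>0$, where $C_0=32C_{max}C_{min}^{-1}+1$ and $\rho(\mathbf{A},k)=\max_{T\subseteq\{1,\dots,p\},|T|\le k}\|(\mathbf{A}_{T,T})^{-1}\|_{1,\infty}$, $\mathbf{A}_{T,T}$ is the submatrix with rows and columns indexed by $T$, and $\|\cdot\|_{1,\infty}$ is the maximum $\ell_1$-norm of the rows. A2) $\lambda=8\sigma\sqrt{n^{-1}\log p}$, and $\lambda_j=\tilde\kappa\sqrt{n^{-1}\log p}$, $j=1,\dots,p$, for a suitably large universal constant $\tilde\kappa$. A3) $\max\{s,s_{max}\}=o(n/\log p)$, $\min\{s_{max},s\}=o(\sqrt{n}/\log p)$ and $s=o(n/(\log p)^2)$. Further definitions. $\gamma_1^*=2\eta-\min\{1,\frac{\log(n/s_{max})}{2\log p}\}$, $\gamma_2^*=2-2\eta-\frac{\log n}{2\log p}$, $\gamma^*=\max\{\gamma_1^*,\gamma_2^*\}$. $\mu_{min}=\min_{j\in I_1}\sqrt{n}|\beta_j|\sigma^{-1}\boldsymbol\Theta_{jj}^{-1/2}$. Proportion estimator. $F_p(t)=p^{-1}\sum_{j=1}^p1_{\{|z_j|>t\}}$, $G_p(t)=p^{-1}\sum_{j=1}^p1_{\{|w_j'|>t\}}$, $\bar\sigma(t)=\sqrt{2\bar\Phi(t)(1-2\bar\Phi(t))}$, $\mathsf{H}(t)=(G_p(t)-2\bar\Phi(t))/\bar\sigma(t)$. For constants $0<\tau_0<\tau_1$ let $\mathbb{T}=[\sqrt{\tau_0\log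 p},\sqrt{\tau_1\log p}]\cap\mathbb{N}$ and $V_p^*=\max_{t\in\mathbb{T}}\mathsf{H}(t)$. The bounding sequence $c_p^*$ is the $(1-\alpha_p)$-th quantile of $V_p^*$ for some $\alpha_p=o(1)$ (so that $P(V_p^*>c_p^* )\to0$). Then $$\hat\pi^*=\max_{t\in\mathbb{T}}\frac{F_p(t)-2\bar\Phi(t)-c_p^*\bar\sigma(t)}{1-2\bar\Phi(t)}.$$ *)

(* Defs.v *)
From mathcomp Require Import all_boot all_order all_algebra.
From mathcomp Require Import all_classical all_reals all_analysis.

Set Implicit Arguments.
Unset Strict Implicit.
Unset Printing Implicit Defensive.

Import Order.TTheory GRing.Theory Num.Theory.
Import numFieldNormedType.Exports.

Local Open Scope classical_set_scope.
Local Open Scope ring_scope.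

Section Norms.
Context {R : realType}.

(* The norm of the library on matrices is the sup norm, hence these. *)
Definition sqnorm2 m (v : 'cV[R]_m) : R := \sum_i v i 0 ^+ 2.
Definition norm1 m (v : 'cV[R]_m) : R := \sum_i `|v i 0|.
Definition norm1inf m (A : 'M[R]_m) : R :=
  \big[Num.max/0]_(i < m) \sum_j `|A i j|.

End Norms.

Section RandomMatrices.
Context {R : realType} {d : measure_display} {T : measurableType d}.
Variable P : probability T R.

Definition random_mx m q (M : T -> 'M[R]_(m, q)) :=
  forall i j, measurable_fun setT (fun w => M w i j).

Definition sigma_mx m q (M : T -> 'M[R]_(m, q)) : set (set T) :=
  <<s [set E | exists i j (B : set R),
         measurable B /\ E = (fun w => M w i j) @^-1` B] >>.

(* Since the whole space belongs to each sigma-algebra, the product rule on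
   the full finite family contains the product rule on its subfamilies. *)
Definition indep_sigma (I : finType) (F : I -> set (set T)) :=
  forall E : I -> set T, (forall i, F i (E i)) ->
    P (\bigcap_i E i) = (\prod_i P (E i))%E.

(* The univariate law N(0, v); normal_prob 0 0 is not the Dirac mass. *)
Definition centered_normal (v : R) : set R -> \bar R :=
  if 0 < v then normal_prob 0 (Num.sqrt v) else dirac (0 : R).

(* x ~ N_m(0, S): every linear combination a^T x is N(0, a^T S a). *)
Definition gaussian_vec m (x : T -> 'cV[R]_m) (S : 'M[R]_m) :=
  [/\ S^T = S,
      (forall a : 'cV[R]_m, 0 <= (a^T *m S *m a) 0 0) &
      forall (a : 'cV[R]_m) (B : set R), measurable B ->
        P ((fun w => (a^T *m x w) 0 0) @^-1` B) =
        centered_normal ((a^T *m S *m a) 0 0) B].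

(* The rows of X are i.i.d. N_q(0, S). *)
Definition iid_gaussian_rows m q (X : T -> 'M[R]_(m, q)) (S : 'M[R]_q) :=
  indep_sigma (fun i : 'I_m => sigma_mx (fun w => row i (X w))) /\
  forall i, gaussian_vec (fun w => (row i (X w))^T) S.

(* Given X, e ~ N_m(0, v I): as the conditional law of e given X does not
   depend on X, P(A /\ e \in B) = P(A) N_m(0, v I)(B) for A in sigma(X). *)
Definition gaussian_noise_given m q (X : T -> 'M[R]_(m, q))
    (e : T -> 'cV[R]_m) (v : R) :=
  (forall A B, sigma_mx X A -> sigma_mx e B ->
     P (A `&` B) = (P A * P B)%E) /\
  gaussian_vec e v%:M.

Definition quantile (V : T -> R) (q : R) : R :=
  inf [set x | (q%:E <= P [set w | (V w <= x)%R])%E].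

End RandomMatrices.

Section Lasso.
Context {R : realType}.

Definition lasso_obj n p (X : 'M[R]_(n, p)) (y : 'cV[R]_n) (lam : R)
    (b : 'cV[R]_p) : R :=
  sqnorm2 (y - X *m b) / n%:R + 2 * lam * norm1 b.

Definition is_lasso n p (X : 'M[R]_(n, p)) (y : 'cV[R]_n) (lam : R)
    (b : 'cV[R]_p) :=
  forall b', lasso_obj X y lam b <= lasso_obj X y lam b'.

(* g j lists the coefficients of the columns k != j of X, in increasing order
   of k: the coefficient of column k is indexed by unlift j k. *)
Definition is_nodewise_lasso n p (X : 'M[R]_(n, p)) (lamj : 'I_p -> R)
    (g : 'I_p -> 'cV[R]_(p.-1)) :=
  forall j, is_lasso (col' j X) (col j X) (lamj j) (g j).

Variables (n p : nat) (X : 'M[R]_(n, p)) (eps : 'cV[R]_n).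
Variables (beta : 'cV[R]_p) (sigma : R) (lamj : 'I_p -> R).
Variables (betahat : 'cV[R]_p) (gammahat : 'I_p -> 'cV[R]_(p.-1)).

Definition response : 'cV[R]_n := X *m beta + eps.

Definition tauhat2 (j : 'I_p) : R :=
  lasso_obj (col' j X) (col j X) (lamj j) (gammahat j).

Definition Thetahat : 'M[R]_p :=
  \matrix_(j, k) if unlift j k is Some k'
                 then - (tauhat2 j)^-1 * gammahat j k' 0
                 else (tauhat2 j)^-1.

Definition debiased : 'cV[R]_p :=
  betahat + n%:R^-1 *: (Thetahat *m X^T *m (response - X *m betahat)).

Definition Sigmahat : 'M[R]_p := n%:R^-1 *: (X^T *m X).

Definition Omegahat : 'M[R]_p := Thetahat *m Sigmahat *m Thetahat^T.

Definition zstat (j : 'I_p) : R :=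
  Num.sqrt n%:R * debiased j 0 / sigma / Num.sqrt (Omegahat j j).

Definition wnoise : 'cV[R]_p :=
  (Num.sqrt n%:R)^-1 *: (Thetahat *m X^T *m eps).

Definition wstd (j : 'I_p) : R :=
  wnoise j 0 / (sigma * Num.sqrt (Omegahat j j)).

End Lasso.

Section ProportionEstimator.
Context {R : realType}.

Definition Phi (t : R) : R := fine (normal_prob 0 1 `]-oo, t]).
Definition Phibar (t : R) : R := 1 - Phi t.

Definition exceed_prop p (z : 'I_p -> R) (t : R) : R :=
  #|[set j | t < `|z j|]|%:R / p%:R.

Definition sigmabar (t : R) : R :=
  Num.sqrt (2 * Phibar t * (1 - 2 * Phibar t)).

Definition Hstat p (w' : 'I_p -> R) (t : R) : R :=
  (exceed_prop w' t - 2 * Phibar t) / sigmabar t.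

Definition Tgrid (p : nat) (tau0 tau1 : R) : set nat :=
  [set t | Num.sqrt (tau0 * ln p%:R) <= t%:R <= Num.sqrt (tau1 * ln p%:R)].

(* The grid is finite, so that sup is the maximum when it is nonempty, which
   holds for all large p. *)
Definition Vstar p (w' : 'I_p -> R) (tau0 tau1 : R) : R :=
  sup [set Hstat w' t%:R | t in Tgrid p tau0 tau1].

Definition pihat p (z : 'I_p -> R) (tau0 tau1 cp : R) : R :=
  sup [set (exceed_prop z t%:R - 2 * Phibar t%:R - cp * sigmabar t%:R)
             / (1 - 2 * Phibar t%:R) | t in Tgrid p tau0 tau1].

End ProportionEstimator.

Section ModelQuantities.
Context {R : realType}.

Definition relevant p (beta : 'cV[R]_p) : {set 'I_p} :=
  [set j | beta j 0 != 0]%SET.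

Definition sparsity p (beta : 'cV[R]_p) : nat := #|relevant beta|.

Definition row_sparsity p (Sigma : 'M[R]_p) (j : 'I_p) : nat :=
  #|[set k | (k != j) && (invmx Sigma j k != 0)]%SET|.

Definition smax p (Sigma : 'M[R]_p) : nat := \max_(j < p) row_sparsity Sigma j.

(* rho(A, k), for a real bound k on the size of T. *)
Definition rho_mx p (A : 'M[R]_p) (k : R) : R :=
  \big[Num.max/0]_(T : {set 'I_p} | #|T|%:R <= k)
    norm1inf (invmx (mxsub (@enum_val _ (mem T)) (@enum_val _ (mem T)) A)).

(* When sm = 0, log(n/sm) is +oo and the minimum is 1; in the library, n/0 = 0
   and ln 0 = 0. *)
Definition gamma1 (eta : R) (p n sm : nat) : R :=
  2 * eta - (if sm == 0%N then 1
             else Num.min 1 (ln (n%:R / sm%:R) / (2 * ln p%:R))).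

Definition gamma2 (eta : R) (p n : nat) : R :=
  2 - 2 * eta - ln n%:R / (2 * ln p%:R).

Definition gammastar (eta : R) (p n sm : nat) : R :=
  Num.max (gamma1 eta p n sm) (gamma2 eta p n).

Definition mu_min p (n : nat) (beta : 'cV[R]_p) (sigma : R)
    (Sigma : 'M[R]_p) : R :=
  inf [set Num.sqrt n%:R * `|beta j 0| / sigma
             / Num.sqrt (invmx Sigma j j) | j in [set` relevant beta]].

End ModelQuantities.

Section Conditions.
Context {R : realType}.

Definition condA1 d (T : measurableType d) (P : probability T R) n p
    (X : T -> 'M[R]_(n, p)) (Sigma : 'M[R]_p) (s : nat) (Cmin Cmax rho : R) :=
  [/\ iid_gaussian_rows P X Sigma,
      (forall j, Sigma j j <= 1),
      (forall a, eigenvalue Sigma a -> Cmin <= a <= Cmax) &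
      rho_mx Sigma ((32 * Cmax / Cmin + 1) * s%:R) <= rho].

Definition condA2 (p n : nat) (sigma kappa lam : R) (lamj : 'I_p -> R) :=
  lam = 8 * sigma * Num.sqrt (ln p%:R / n%:R) /\
  forall j, lamj j = kappa * Num.sqrt (ln p%:R / n%:R).

Definition condA3 (p n s sm : nat -> nat) :=
  [/\ (fun k => (maxn (s k) (sm k))%:R : R) =o_\oo
        (fun k => (n k)%:R / ln (p k)%:R : R),
      (fun k => (minn (sm k) (s k))%:R : R) =o_\oo
        (fun k => Num.sqrt (n k)%:R / ln (p k)%:R : R) &
      (fun k => (s k)%:R : R) =o_\oo
        (fun k => (n k)%:R / ln (p k)%:R ^+ 2 : R)].

End Conditions.

(* Main.v *)
From HB Require Import structures.
Require Import Defs.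
From mathcomp Require Import all_boot all_order all_algebra.
From mathcomp Require Import all_classical all_reals all_analysis.
From mathcomp Require Import measurable_realfun.
From mathcomp Require Import ring lra.

(* On a design satisfying a restricted isometry (Maurey's method and chi-square
   tails), [z_j] is the sum of a signal, of [w'_j], and of a bias that is at most
   a width [D] outside a small set [J] of indices. The exceedance proportion of
   [z] is then squeezed between those of [w'] up to [|J| / p], to the proportion
   of [w'_j] in a shell of width [2 D] around [t], and, from below, to the
   relevant indices with [|w'_j|] large. Given [X], the covariance of
   [1(|w'_i| > t)] and [1(|w'_j| > t)] is at most [r^2] times the variance, [r]
   being the correlation, and the Gram matrix of the nodewise residuals is nearly
   diagonal; so the exceedance proportion of [w'] concentrates. If [s_max = 0]
   then [c*] must be [0], which is impossible: the columns of [X] are independent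
   and [V_p] is positive with probability bounded below, or [V_p] avoids a
   neighbourhood of [0]. *)

Set Implicit Arguments.
Unset Strict Implicit.
Unset Printing Implicit Defensive.

Import Order.TTheory GRing.Theory Num.Theory.
Import numFieldNormedType.Exports.

Local Open Scope classical_set_scope.
Local Open Scope ring_scope.

(** * Bounded expectations *)

(** The two halves use [cs] differently. In the upper bound [cs] is a quantile of the maximum of
    [Hstat], so all grid points are handled at once and no uniform concentration is needed. In the
    lower bound one grid point [t] suffices, with [t^2] between [(tau0 + c/4) ln p] and
    [(tau0 + c/2) ln p]: the variance is bounded at this [t] only, and the order of [cs] serves here
    and in excluding [s_max = 0]. The margin [c/4] yields a power of [p] that absorbs all
    logarithms. The bias is controlled for all indices but a fraction of [s] of them; a constant
    [K], chosen from [delta] before [k] grows, makes this fraction small at the price of a width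
    multiplied by [K]. Gaussian vectors are given by their one-dimensional projections, so joint
    laws and independence are recovered from expectations of [cos (linear form + phase)]: the phase
    replaces complex exponentials and multivariate densities never occur. A Lasso minimiser may fail
    to be unique; conditioning on [X] rests on the residual, which is unique. *)

Notation sqrt := Num.sqrt.
Notation mfunT := (measurable_fun setT).

Lemma le_of_eq {disp} {T : porderType disp} (x y : T) : x = y -> (x <= y)%O.
Proof. by move=> ->. Qed.

Section BoundedExpectation.
Context {R : realType} {d} {T : measurableType d}.
Variable P : probability T R.
Implicit Types f g : T -> R.

(** Cosines and indicators belong to this class and it is closed under sums and products; inside it
    [Ex] is linear with no integrability condition, which keeps the computations in the reals. *)
Definition bmf f := mfunT f /\ exists M, forall x, `|f x| <= M.

Definition Ex f : R := \int[P]_x f x.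

Lemma bmf_cst (c : R) : bmf (fun=> c).
Proof. by split; [exact: measurable_cst|exists `|c|]. Qed.

Lemma bmfD f g : bmf f -> bmf g -> bmf (fun x => f x + g x).
Proof.
move=> [mf [M hM]] [mg [N hN]]; split; first exact: measurable_funD.
by exists (M + N) => x; apply: le_trans (ler_normD _ _) (lerD (hM x) (hN x)).
Qed.

Lemma bmfM f g : bmf f -> bmf g -> bmf (fun x => f x * g x).
Proof.
move=> [mf [M hM]] [mg [N hN]]; split; first exact: measurable_funM.
by exists (M * N) => x; rewrite normrM ler_pM.
Qed.

Lemma bmfZ (c : R) f : bmf f -> bmf (fun x => c * f x).
Proof. by move=> bf; apply: bmfM => //; exact: bmf_cst. Qed.

Lemma bmfN f : bmf f -> bmf (fun x => - f x).
Proof.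
move=> bf; have := bmfZ (-1) bf; rewrite (_ : (fun x => -1 * f x) = (fun x => - f x))//.
by apply/funext => x; rewrite mulN1r.
Qed.

Lemma bmfB f g : bmf f -> bmf g -> bmf (fun x => f x - g x).
Proof. by move=> bf bg; apply: bmfD => //; exact: bmfN. Qed.

Lemma bmf_indic (A : set T) : measurable A -> bmf (\1_A : T -> R).
Proof.
move=> mA; split; first exact: measurable_indic.
by exists 1 => x; rewrite indicE; case: (_ \in _); rewrite ?normr1 ?normr0.
Qed.

Lemma bmf_sum (I : Type) (r : seq I) (F : I -> T -> R) :
  (forall i, bmf (F i)) -> bmf (fun x => \sum_(i <- r) F i x).
Proof.
move=> bF; elim: r => [|i r IH].
  by under eq_fun do rewrite big_nil; exact: bmf_cst.
by under eq_fun do rewrite big_cons; exact: bmfD.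
Qed.

Lemma bmf_prod (I : Type) (r : seq I) (F : I -> T -> R) :
  (forall i, bmf (F i)) -> bmf (fun x => \prod_(i <- r) F i x).
Proof.
move=> bF; elim: r => [|i r IH].
  by under eq_fun do rewrite big_nil; exact: bmf_cst.
by under eq_fun do rewrite big_cons; exact: bmfM.
Qed.

Lemma bmf_cos f : mfunT f -> bmf (fun x => cos (f x)).
Proof.
move=> mf; split; last by exists 1 => x; rewrite ler_norml cos_geN1 cos_le1.
apply: measurableT_comp mf.
by apply: continuous_measurable_fun; exact: continuous_cos.
Qed.

Lemma bmf_int f : bmf f -> P.-integrable setT (EFin \o f).
Proof.
move=> [mf [M hM]]; apply: measurable_bounded_integrable => //.
  by rewrite -ge0_fin_numE// fin_num_measure.
exists M; split; first exact: num_real.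
by move=> N MN x _; apply: le_trans (hM x) (ltW MN).
Qed.

Lemma ExE f : bmf f -> (\int[P]_x (f x)%:E = (Ex f)%:E)%E.
Proof.
move=> bf; rewrite /Ex /Rintegral fineK//.
by apply: (integrable_fin_num measurableT); exact: bmf_int.
Qed.

Lemma Ex_ext f g : f =1 g -> Ex f = Ex g.
Proof. by move=> fg; congr (Ex _); exact/funext. Qed.

Lemma ExD f g : bmf f -> bmf g -> Ex (fun x => f x + g x) = Ex f + Ex g.
Proof. by move=> bf bg; apply: RintegralD => //; exact: bmf_int. Qed.

Lemma ExB f g : bmf f -> bmf g -> Ex (fun x => f x - g x) = Ex f - Ex g.
Proof. by move=> bf bg; apply: RintegralB => //; exact: bmf_int. Qed.

Lemma ExZ (c : R) f : bmf f -> Ex (fun x => c * f x) = c * Ex f.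
Proof. by move=> bf; apply: RintegralZl => //; exact: bmf_int. Qed.

Lemma Ex_cst (c : R) : Ex (fun=> c) = c.
Proof. rewrite /Ex /Rintegral integral_cst//=.
have -> : P [set: T] = 1%E by exact: probability_setT.
by rewrite mule1. Qed.

Lemma Ex_le f g : bmf f -> bmf g -> (forall x, f x <= g x) -> Ex f <= Ex g.
Proof. by move=> bf bg fg; apply: le_Rintegral => //; exact: bmf_int. Qed.

Lemma Ex_ge0 f : (forall x, 0 <= f x) -> 0 <= Ex f.
Proof. by move=> f0; exact: Rintegral_ge0. Qed.

Lemma Ex_sum (I : Type) (r : seq I) (F : I -> T -> R) :
  (forall i, bmf (F i)) ->
  Ex (fun x => \sum_(i <- r) F i x) = \sum_(i <- r) Ex (F i).
Proof.
move=> bF; elim: r => [|i r IH].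
  by under Ex_ext do rewrite big_nil; rewrite Ex_cst big_nil.
under Ex_ext do rewrite big_cons.
by rewrite ExD ?IH ?big_cons//; exact: bmf_sum.
Qed.

Lemma Ex_abs f : bmf f -> `|Ex f| <= Ex (fun x => `|f x|).
Proof. by move=> bf; apply: le_normr_Rintegral => //; exact: bmf_int. Qed.

Lemma Ex_indic (A : set T) : measurable A -> Ex \1_A = fine (P A).
Proof. by move=> mA; rewrite /Ex /Rintegral integral_indic// setIT. Qed.

Lemma Ex_dct (f_ : nat -> T -> R) f (M : R) :
  (forall n, mfunT (f_ n)) -> (forall n x, `|f_ n x| <= M) ->
  (forall x, f_ ^~ x @ \oo --> f x) -> mfunT f ->
  Ex (f_ n) @[n --> \oo] --> Ex f.
Proof.
move=> mf_ hM cf mf.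
have bf_ n : bmf (f_ n) by split => //; exists M.
have hf x : `|f x| <= M.
  have cn : `|f_ n x| @[n --> \oo] --> `|f x| by apply: cvg_norm; exact: cf.
  by rewrite -(cvg_lim _ cn)//; apply: limr_le; [exact: cvgP cn|exact: nearW].
have bf : bmf f by split => //; exists M.
have := @dominated_convergence _ _ _ P setT measurableT
  (fun n => EFin \o f_ n) (EFin \o f) (cst M%:E).
case.
- by move=> n; exact/measurable_EFinP.
- exact/measurable_EFinP.
- by apply: aeW => x _; apply: cvg_EFin; [exact: nearW|exact: cf].
- exact: (bmf_int (bmf_cst M)).
- by apply: aeW => x n _ /=; rewrite lee_fin.
move=> _ _ /=; under eq_fun do rewrite (ExE (bf_ _)).
rewrite (ExE bf) => /fine_cvgP[_]; exact.
Qed.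

End BoundedExpectation.

Section Fubini2.
Context {R : realType} {d1 d2 : measure_display}.
Context {T1 : measurableType d1} {T2 : measurableType d2}.
Variables (P : probability T1 R) (Q : probability T2 R).

Lemma bmf_pair1 (F : T1 * T2 -> R) x : bmf F -> bmf (fun y => F (x, y)).
Proof.
move=> [mF [M hM]]; split; last by exists M => y.
exact: measurable_fun_pair2.
Qed.

Lemma bmf_pair2 (F : T1 * T2 -> R) y : bmf F -> bmf (fun x => F (x, y)).
Proof.
move=> [mF [M hM]]; split; last by exists M => x.
exact: measurable_fun_pair1.
Qed.

Lemma bmf_prod_int (F : T1 * T2 -> R) :
  bmf F -> (P \x Q)%E.-integrable setT (EFin \o F).
Proof.
by move=> bF; apply: (@bmf_int _ _ _ (P \x Q)%E).
Qed.

Lemma bmf_Ex1 (F : T1 * T2 -> R) :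
  bmf F -> bmf (fun x => Ex Q (fun y => F (x, y))).
Proof.
move=> bF; split.
  have h : mfunT (fun x => \int[Q]_y (EFin \o F) (x, y))%E.
    by apply: measurable_fubini_F; exact: bmf_prod_int.
  apply/measurable_EFinP; apply: eq_measurable_fun h => x _ /=.
  by rewrite ExE//; exact: bmf_pair1.
have [mF [M hM]] := bF.
exists M => x; apply: le_trans (Ex_abs _ (bmf_pair1 x bF)) _.
rewrite -[leRHS](Ex_cst Q); apply: Ex_le => //; last exact: bmf_cst.
split; last by exists M => y; rewrite normr_id.
by apply: measurableT_comp => //; exact: measurable_fun_pair2.
Qed.

Lemma bmf_Ex2 (F : T1 * T2 -> R) :
  bmf F -> bmf (fun y => Ex P (fun x => F (x, y))).
Proof.
move=> bF; split.
  have h : mfunT (fun y => \int[P]_x (EFin \o F) (x, y))%E.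
    by apply: (@measurable_fubini_G _ _ _ _ _ P Q); exact: bmf_prod_int.
  apply/measurable_EFinP; apply: eq_measurable_fun h => y _ /=.
  by rewrite ExE//; exact: bmf_pair2.
have [mF [M hM]] := bF.
exists M => y; apply: le_trans (Ex_abs _ (bmf_pair2 y bF)) _.
rewrite -[leRHS](Ex_cst P); apply: Ex_le => //; last exact: bmf_cst.
split; last by exists M => x; rewrite normr_id.
by apply: measurableT_comp => //; exact: measurable_fun_pair1.
Qed.

Lemma Ex_fubini (F : T1 * T2 -> R) : bmf F ->
  Ex P (fun x => Ex Q (fun y => F (x, y))) = Ex Q (fun y => Ex P (fun x => F (x, y))).
Proof.
move=> bF; apply: EFin_inj; rewrite -!ExE; last 2 first.
- exact: bmf_Ex2.
- exact: bmf_Ex1.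
transitivity (\int[P]_x \int[Q]_y (F (x, y))%:E)%E.
  by apply: eq_integral => x _; rewrite ExE//; exact: bmf_pair1.
rewrite (Fubini (bmf_prod_int bF)).
by apply: eq_integral => x _; rewrite ExE//; exact: bmf_pair2.
Qed.

End Fubini2.

Section RealProbability.
Context {R : realType} {d} {T : measurableType d}.
Variable P : probability T R.
Implicit Types A B : set T.

Definition Pr A : R := fine (P A).

Lemma PrE A : measurable A -> P A = (Pr A)%:E.
Proof. by move=> mA; rewrite fineK// fin_num_measure. Qed.

Lemma Pr_ge0 A : 0 <= Pr A.
Proof. by rewrite fine_ge0. Qed.

Lemma Pr_le1 A : measurable A -> Pr A <= 1.
Proof. by move=> mA; rewrite -lee_fin -PrE//; exact: probability_le1. Qed.

Lemma Pr_le A B : measurable A -> measurable B -> A `<=` B -> Pr A <= Pr B.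
Proof. by move=> mA mB AB; rewrite -lee_fin -!PrE// le_measure// inE. Qed.

Lemma Pr_setT : Pr setT = 1.
Proof. by rewrite /Pr (_ : P setT = 1%E)//; exact: probability_setT. Qed.

Lemma Pr_set0 : Pr set0 = 0.
Proof. by rewrite /Pr measure0. Qed.

Lemma Pr_setC A : measurable A -> Pr (~` A) = 1 - Pr A.
Proof.
move=> mA; apply: EFin_inj; rewrite -PrE ?EFinB -?PrE//; last exact: measurableC.
exact: probability_setC.
Qed.

Lemma Pr_disjU A B : measurable A -> measurable B -> A `&` B = set0 ->
  Pr (A `|` B) = Pr A + Pr B.
Proof.
move=> mA mB AB; apply: EFin_inj; rewrite EFinD -!PrE//; last exact: measurableU.
exact: measureU.
Qed.

Lemma Pr_subU A B : measurable A -> measurable B -> Pr (A `|` B) <= Pr A + Pr B.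
Proof.
move=> mA mB; rewrite -lee_fin EFinD -!PrE//; last exact: measurableU.
exact: measureU2.
Qed.

Lemma measurable_bigsetU (I : Type) (r : seq I) (F : I -> set T) :
  (forall i, measurable (F i)) -> measurable (\big[setU/set0]_(i <- r) F i).
Proof.
move=> mF; elim: r => [|i r IH]; first by rewrite big_nil.
by rewrite big_cons; exact: measurableU.
Qed.

Lemma Pr_bigU (I : Type) (r : seq I) (F : I -> set T) :
  (forall i, measurable (F i)) ->
  Pr (\big[setU/set0]_(i <- r) F i) <= \sum_(i <- r) Pr (F i).
Proof.
move=> mF; elim: r => [|i r IH]; first by rewrite !big_nil Pr_set0.
rewrite !big_cons (le_trans (Pr_subU _ _))//; first exact: measurable_bigsetU.
by rewrite lerD2l.
Qed.

Lemma Pr_markov (f : T -> R) (a : R) : bmf f -> (forall x, 0 <= f x) -> 0 < a ->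
  Pr [set x | a <= f x] <= Ex P f / a.
Proof.
move=> bf f0 a0; have [mf _] := bf.
have mA : measurable [set x | a <= f x].
  rewrite (_ : [set x | _] = f @^-1` `[a, +oo[%classic); last first.
    by apply/seteqP; split => x /=; rewrite in_itv/= andbT.
  by rewrite -[X in measurable X]setTI; exact: mf.
rewrite ler_pdivlMr// mulrC -[Pr _]Ex_indic// -ExZ; last exact: bmf_indic.
apply: Ex_le => //; first by apply: bmfZ; exact: bmf_indic.
move=> x; rewrite indicE; case: (boolP (x \in _)) => [|_]; last by rewrite mulr0.
by rewrite inE/= mulr1.
Qed.

End RealProbability.

Lemma integral_law_eq {R : realType} d (T : measurableType d) e (U : measurableType e)
    d' (T' : measurableType d') (P : {measure set T -> \bar R}) (Q : {measure set U -> \bar R})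
    (X : T -> T') (Y : U -> T') (f : T' -> \bar R) :
  mfunT X -> mfunT Y ->
  (forall A, measurable A -> P (X @^-1` A) = Q (Y @^-1` A)) ->
  mfunT f -> (forall x, 0 <= f x)%E ->
  (\int[P]_x f (X x) = \int[Q]_x f (Y x))%E.
Proof.
move=> mX mY law mf f0.
transitivity (\int[pushforward P X]_y f y)%E; first by rewrite (ge0_integral_pushforward mX).
rewrite -[RHS](ge0_integral_pushforward mY _ measurableT mf)//.
by apply: eq_measure_integral => A mA _; exact: law.
Qed.

(** * Independent sub-sigma-algebras and product laws *)

Section Decoupling.
Context {R : realType} {d} {T : measurableType d}.
Variable P : probability T R.

(* [F1] and [F2] are independent sub-sigma-algebras: the law of [w |-> (w, w)]
   on (T, F1) x (T, F2) is the product law. *)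
Variables G1 G2 : set (set T).
Let T1 : measurableType _ := g_sigma_algebraType G1.
Let T2 : measurableType _ := g_sigma_algebraType G2.
Hypotheses (G1m : <<s G1 >> `<=` measurable) (G2m : <<s G2 >> `<=` measurable)
  (ind : forall A B, <<s G1 >> A -> <<s G2 >> B -> P (A `&` B) = (P A * P B)%E).

(** The identity read as a random variable into [T] with a smaller sigma-algebra; its distribution
    is the restriction of [P]. *)
Let i1 : T -> T1 := id.
Let i2 : T -> T2 := id.

Let mi1 : mfunT i1.
Proof. by move=> _ A mA; rewrite setTI; exact: G1m. Qed.

Let mi2 : mfunT i2.
Proof. by move=> _ A mA; rewrite setTI; exact: G2m. Qed.

HB.instance Definition _ := isMeasurableFun.Build _ _ _ _ i1 mi1.
HB.instance Definition _ := isMeasurableFun.Build _ _ _ _ i2 mi2.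

Let P1 : probability T1 R := distribution P i1.
Let P2 : probability T2 R := distribution P i2.

Let dg (w : T) : T1 * T2 := (i1 w, i2 w).

Let mdg : mfunT dg.
Proof. exact: measurable_fun_pair. Qed.

HB.instance Definition _ := isMeasurableFun.Build _ _ _ _ dg mdg.

(** This takes the place of conditioning on [X]: a bound valid for each frozen first argument
    integrates to an unconditional one. Independence on rectangles is enough, by uniqueness of the
    product measure. *)
Lemma decouple (f : T1 * T2 -> \bar R) : mfunT f ->
  (forall z, (0 <= f z)%E) ->
  (\int[P]_w f (w, w) = \int[P]_w1 \int[P]_w2 f (w1, w2))%E.
Proof.
move=> mf f0.
transitivity (\int[distribution P dg]_z f z)%E.
  by rewrite ge0_integral_distribution.
transitivity (\int[P1 \x P2]_z f z)%E.
  apply/esym; apply: eq_measure_integral => A mA _.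
  exact: product_measure_unique.
rewrite fubini_tonelli1// [LHS]ge0_integral_distribution//; last first.
- by move=> x; exact: integral_ge0.
- exact: measurable_fun_fubini_tonelli_F.
apply: eq_integral => w1 _ /=.
rewrite /fubini_F [LHS]ge0_integral_distribution//.
exact: measurable_fun_pair2.
Qed.

End Decoupling.

(** * The standard normal law: characteristic function and tails *)

Section StandardNormal.
Context {R : realType}.
Notation mu := (@lebesgue_measure R).
Notation nu := (@normal_prob R 0 1).

Definition phi0 : R := normal_peak 1.

Lemma phi0_gt0 : 0 < phi0. Proof. by apply: normal_peak_gt0; exact: oner_neq0. Qed.

(** [phi0] is [1 / sqrt (2 pi)] and [pi >= 2] is enough. The resulting [2 phi0 <= 1] removes
    constants from the tail and shell bounds. *)
Lemma phi0_le : phi0 <= 2^-1.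
Proof.
rewrite /phi0 /normal_peak expr1n mul1r lef_pV2 ?posrE ?sqrtr_gt0//; last first.
  by rewrite mulrn_wgt0// pi_gt0.
rewrite -(@ler_pXn2r _ 2)// ?nnegrE ?sqrtr_ge0// sqr_sqrtr; last first.
  by rewrite mulrn_wge0// pi_ge0.
by have := @pi_ge2 R; rewrite -mulr_natr expr2; lra.
Qed.

Definition gpdf (x : R) : R := phi0 * expR (- (x ^+ 2) / 2).

Lemma gpdfE : normal_pdf 0 1 = gpdf.
Proof.
apply/funext => x; rewrite normal_pdfE ?oner_neq0// /normal_fun subr0 expr1n /gpdf.
by rewrite /phi0 -[1 *+ 2]/(2%:R).
Qed.

Lemma gpdf_ge0 x : 0 <= gpdf x.
Proof. by rewrite mulr_ge0 ?expR_ge0// ltW// phi0_gt0. Qed.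

Lemma measurable_gpdf : mfunT gpdf.
Proof. by rewrite -gpdfE; exact: measurable_normal_pdf. Qed.

Lemma integrable_gpdf : mu.-integrable setT (EFin \o gpdf).
Proof. by rewrite -gpdfE; exact: integrable_normal_pdf. Qed.

Lemma nuE (A : set R) : nu A = (\int[mu]_(x in A) (gpdf x)%:E)%E.
Proof. by rewrite /normal_prob gpdfE. Qed.

Lemma integral_nu (f : R -> \bar R) : mfunT f -> (forall x, (0 <= f x)%E) ->
  (\int[nu]_x f x = \int[mu]_x (f x * (gpdf x)%:E))%E.
Proof.
move=> mf f0; have dom := @normal_prob_dominates R 0 1.
have mg : mfunT (EFin \o gpdf : R -> \bar R) by apply/measurable_EFinP; exact: measurable_gpdf.
have i1 := Radon_Nikodym_SigmaFinite.f_integrable dom.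
rewrite -(Radon_Nikodym_SigmaFinite.change_of_variables dom f0 measurableT mf).
apply: ae_eq_integral => //; try by apply: emeasurable_funM => //; exact: measurable_int i1.
apply: ae_eqe_mul2l; apply: integral_ae_eq => // E _ mE.
by rewrite -Radon_Nikodym_SigmaFinite.f_integral// -nuE.
Qed.

Lemma Ex_nu (f : R -> R) : bmf f -> Ex nu f = \int[mu]_x (f x * gpdf x).
Proof.
move=> bf; have [mf [M hM]] := bf.
have M0 : 0 <= M by apply: le_trans (hM 0).
have ifg : mu.-integrable setT (EFin \o (fun x => f x * gpdf x)).
  apply: (le_integrable measurableT _ _ (integrableZl measurableT M integrable_gpdf)).
    by apply/measurable_EFinP/measurable_funM => //; exact: measurable_gpdf.
  move=> x _ /=; rewrite lee_fin normrM [X in _ <= X]normrM.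
  by rewrite ler_wpM2r// (le_trans (hM x))// ler_norm.
(* The change of density is available for nonnegative integrands, so [f] is raised by its bound
   [M]. *)
have bfM : bmf (fun x => f x + M) by apply: bmfD => //; exact: bmf_cst.
have fM0 x : 0 <= f x + M by have := hM x; rewrite ler_norml => /andP[]; lra.
have e : Ex nu (fun x => f x + M) = \int[mu]_x (f x * gpdf x + M * gpdf x).
  rewrite /Ex /Rintegral integral_nu//.
  - by congr fine; apply: eq_integral => x _; rewrite -EFinM mulrDl.
  - by apply/measurable_EFinP; case: bfM.
have := e; rewrite ExD ?Ex_cst//; last exact: bmf_cst.
rewrite RintegralD//; last exact: (integrableZl measurableT M integrable_gpdf).
rewrite RintegralZl//; last exact: integrable_gpdf.
have -> : \int[mu]_x gpdf x = 1.
  by rewrite /Rintegral -gpdfE integral_normal_pdf.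
by rewrite mulr1; move/addIr.
Qed.

Lemma integrable_xgpdf : mu.-integrable setT (EFin \o (fun x : R => `|x| * gpdf x)).
Proof.
have s2 : sqrt 2 != 0 :> R by rewrite gt_eqF// sqrtr_gt0.
(* The dominating function [2 phi0 exp (- x^2 / 4)] is a multiple of the normal density of variance
   2: half of the exponent is spent on absorbing [|x|]. *)
pose K : R := 2 * phi0 / normal_peak (sqrt 2).
apply: (le_integrable measurableT _ _
  (integrableZl measurableT K (integrable_normal_pdf 0 (sqrt 2)))).
  apply/measurable_EFinP/measurable_funM; last exact: measurable_gpdf.
  exact: normr_measurable.
move=> x _ /=; rewrite lee_fin normrM normr_id (ger0_norm (gpdf_ge0 _)).
rewrite (le_trans _ (ler_norm _))// normal_pdfE// /normal_fun subr0 sqr_sqrtr//.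
have -> : K * (normal_peak (sqrt 2) * expR (- x ^+ 2 / (2 *+ 2))) =
    2 * phi0 * expR (- x ^+ 2 / 4).
  rewrite /K mulrA divfK ?gt_eqF ?normal_peak_gt0//; congr (_ * expR (_ / _)).
  by rewrite -mulr_natr -natrM.
rewrite /gpdf; have -> : - x ^+ 2 / 2 = - x ^+ 2 / 4 + - x ^+ 2 / 4 by lra.
rewrite expRD.
have h : 1 + x ^+ 2 / 4 <= expR (x ^+ 2 / 4) by exact: expR_ge1Dx.
have hx : `|x| <= 1 + x ^+ 2 / 4 by have := real_normK (num_real x); have := sqr_ge0 (`|x| / 2 - 1); nra.
have hxa : `|x| * expR (- x ^+ 2 / 4) <= 1.
  rewrite mulNr expRN ler_pdivrMr ?expR_gt0// mul1r.
  exact: le_trans hx h.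
rewrite (_ : _ * _ = (`|x| * expR (- x ^+ 2 / 4)) * (phi0 * expR (- x ^+ 2 / 4))); last by ring.
have p : 0 <= phi0 * expR (- x ^+ 2 / 4) :> R by rewrite mulr_ge0 ?expR_ge0// ltW// phi0_gt0.
have := ler_wpM2r p hxa; lra.
Qed.

Lemma is_derive_cos_lin (s t x : R) :
  is_derive x 1 (fun x => cos (s * x + t)) (- s * sin (s * x + t)).
Proof.
have -> : (fun x => cos (s * x + t)) = cos \o (fun x => s * x + t) by [].
have h : is_derive x 1 (fun x : R => s * x + t) s.
  by apply: is_derive_eq; rewrite addr0 /= scaler1 ?scaler0 ?addr0.
rewrite mulrC mulrN -mulNr.
exact: is_derive1_comp.
Qed.

Lemma is_derive_sin_lin (s t x : R) :
  is_derive x 1 (fun x => sin (s * x + t)) (s * cos (s * x + t)).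
Proof.
have -> : (fun x => sin (s * x + t)) = sin \o (fun x => s * x + t) by [].
have h : is_derive x 1 (fun x : R => s * x + t) s.
  by apply: is_derive_eq; rewrite addr0 /= scaler1 ?scaler0 ?addr0.
rewrite mulrC.
exact: is_derive1_comp.
Qed.

Lemma is_derive_gpdf (x : R) : is_derive x 1 gpdf (- x * gpdf x).
Proof.
have h : is_derive x 1 (fun x : R => - x ^+ 2 / 2) (- x).
  by apply: is_derive_eq; rewrite /GRing.scale/= ?scaler0; lra.
have h2 : is_derive x 1 (expR \o (fun x : R => - x ^+ 2 / 2))
   (expR (- x ^+ 2 / 2) * (- x)) by exact: is_derive1_comp.
rewrite /gpdf.
have -> : (fun x => phi0 * expR (- x ^+ 2 / 2)) =
  phi0 \*: (expR \o (fun x : R => - x ^+ 2 / 2)) by [].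
by apply: is_derive_eq; rewrite /GRing.scale/=; ring.
Qed.


Lemma is_derive1_cts (f : R -> R) (x df : R) : is_derive x 1 f df -> {for x, continuous f}.
Proof. by move=> h; apply/differentiable_continuous/derivable1_diffP; apply: ex_derive. Qed.

(** Algebraic decay is all that the boundary terms of the integrations by parts require. *)
Lemma gpdf_le (x : R) : gpdf x <= (1 + x ^+ 2)^-1.
Proof.
rewrite /gpdf -[leRHS]mul1r mulNr expRN.
have h : 1 + x ^+ 2 / 2 <= expR (x ^+ 2 / 2) by exact: expR_ge1Dx.
have p : 0 < 1 + x ^+ 2 by have := sqr_ge0 x; lra.
rewrite ler_pdivrMr ?expR_gt0// mulrAC ler_pdivlMr// mul1r.
have := phi0_le; have := phi0_gt0; have := sqr_ge0 x; nra.
Qed.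

Lemma integrable_bounded_gpdf (f : R -> R) : mfunT f ->
  (exists M N, forall x, `|f x| <= M + N * `|x|) ->
  mu.-integrable setT (EFin \o (fun x => f x * gpdf x)).
Proof.
move=> mf [M [N hf]].
have i1 := integrableZl measurableT M integrable_gpdf.
have i2 := integrableZl measurableT N integrable_xgpdf.
apply: (le_integrable measurableT _ _ (integrableD measurableT i1 i2)).
  by apply/measurable_EFinP/measurable_funM => //; exact: measurable_gpdf.
move=> x _.
rewrite [X in (_ <= `|X|)%E](_ : _ = ((M + N * `|x|) * gpdf x)%:E); last first.
  transitivity ((M * gpdf x + N * (`|x| * gpdf x))%:E) => //.
  by congr EFin; ring.
rewrite /= lee_fin normrM (ger0_norm (gpdf_ge0 _)).
by rewrite (le_trans _ (ler_norm _))// ler_wpM2r// ?gpdf_ge0.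
Qed.

(** Stein's identity [E (f' - x f) = 0] for [f x = sin (s x + t)]: the integrand is the derivative
    of [f * gpdf], and the boundary terms vanish along growing intervals. *)
Lemma stein_sin (s t : R) :
  \int[mu]_x ((s * cos (s * x + t) - x * sin (s * x + t)) * gpdf x) = 0.
Proof.
pose H x := sin (s * x + t) * gpdf x.
pose k x := s * cos (s * x + t) - x * sin (s * x + t).
pose h x := k x * gpdf x.
have dH (x : R) : is_derive x 1 H (h x).
  have h1 := is_derive_sin_lin s t x; have h2 := is_derive_gpdf x.
  by apply: is_derive_eq; rewrite /h /k /GRing.scale/=; ring.
have ck : continuous k.
  move=> x; have cc := is_derive1_cts (is_derive_cos_lin s t x).
  have cs := is_derive1_cts (is_derive_sin_lin s t x).
  rewrite /continuous_at /k; apply: (@cvgB _ R^o).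
    by apply: cvgM; [exact: cvg_cst|exact: cc].
  by apply: cvgM; [exact: cvg_id|exact: cs].
have ch : continuous h.
  move=> x; apply: continuousM; first exact: ck.
  exact: is_derive1_cts (is_derive_gpdf x).
have mk : mfunT k by exact: continuous_measurable_fun.
have kM x : `|k x| <= `|s| + 1 * `|x|.
  rewrite (le_trans (ler_normB _ _))// mul1r lerD// normrM ler_piMr//.
    by rewrite ler_norml cos_geN1 cos_le1.
  by rewrite ler_norml sin_geN1 sin_le1.
have ih : mu.-integrable setT (EFin \o h).
  by apply: integrable_bounded_gpdf => //; exists `|s|, 1.
pose B (n : nat) : set R := `[- n.+1%:R, n.+1%:R]%classic.
have mB n : measurable (B n) by exact: measurable_itv.
have ftc n : (\int[mu]_(x in B n) (h x)%:E = (H n.+1%:R)%:E - (H (- n.+1%:R))%:E)%E.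
  apply: continuous_FTC2.
  - by rewrite (@lt_trans _ _ 0)// oppr_lt0.
  - exact: continuous_subspaceT.
  - split => [x _||].
    + by apply: ex_derive; exact: dH.
    + by apply: cvg_at_right_filter; exact: is_derive1_cts (dH _).
    + by apply: cvg_at_left_filter; exact: is_derive1_cts (dH _).
  - by move=> x _; rewrite derive1E; apply: derive_val.
have Hle x : `|H x| <= (1 + x ^+ 2)^-1.
  rewrite normrM (ger0_norm (gpdf_ge0 _)) -[leRHS]mul1r ler_pM// ?gpdf_ge0//.
    by rewrite ler_norml sin_geN1 sin_le1.
  exact: gpdf_le.
have lim0 : (fun n => \int[mu]_(x in B n) (h x)%:E)%E @ \oo --> 0%E.
  under eq_fun do rewrite ftc -EFinB.
  apply: cvg_EFin; first exact: nearW.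
  apply/norm_cvg0P; apply: (@squeeze_cvgr _ _ _ _ (fun=> 0) (fun n => 2 * (n.+1%:R)^-1)).
  - apply: nearW => n /=; rewrite normr_ge0/= (le_trans (ler_normB _ _))//.
    have hh (x : R) : x ^+ 2 = n.+1%:R ^+ 2 -> `|H x| <= n.+1%:R^-1.
      move=> e; have N1 : 1 <= n.+1%:R :> R by rewrite ler1n.
      have N0 : 0 < n.+1%:R :> R by rewrite ltr0n.
      have p : 0 < 1 + n.+1%:R ^+ 2 :> R by nra.
      by rewrite (le_trans (Hle x))// e lef_pV2 ?posrE//; nra.
    by rewrite mulr_natl mulr2n lerD// hh// sqrrN.
  - exact: cvg_cst.
  - rewrite -[X in _ --> X](mulr0 2); apply: cvgMr.
    exact: cvg_harmonic.
have lim1 : (fun n => \int[mu]_(x in B n) (h x)%:E)%E @ \oo --> (\int[mu]_x (h x)%:E)%E.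
  have := @dominated_convergence _ _ _ mu setT measurableT
    (fun n => (EFin \o h) \_ (B n)) (EFin \o h) (fun x => `|(EFin \o h) x|%E).
  case.
  - move=> n; apply/(measurable_restrictT _ (mB n)) => //.
    by apply: measurable_funTS; exact: measurable_int ih.
  - exact: measurable_int ih.
  - apply: aeW => x _; apply: cvg_near_cst.
    near=> n; rewrite patchE mem_set// /B /= in_itv/= -ler_norml.
    near: n; apply: (@filterS _ _ _ (fun n => `|x| <= n%:R)); last exact: nbhs_infty_ger.
    by move=> n /le_trans; apply; rewrite ler_nat.
  - exact: integrable_abse.
  - apply: aeW => x n _; rewrite patchE; case: ifPn => // _.
    by rewrite abse0.
  move=> _ _ /=.
  by under [X in X @ _ --> _ -> _]eq_fun do rewrite -integral_mkcond.
by rewrite /Rintegral -(cvg_unique _ lim0 lim1).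
Unshelve. all: by end_near. Qed.

(** Differentiation under the integral brings out [- x sin (s x + t)], with [|x| gpdf x] as
    dominating function; Stein's identity then trades the factor [x] for [s]. *)
Lemma is_derive_Fourier (t s : R) :
  is_derive s 1 (fun s => \int[mu]_x (cos (s * x + t) * gpdf x))
    (- s * \int[mu]_x (cos (s * x + t) * gpdf x)).
Proof.
pose f s x := cos (s * x + t) * gpdf x.
have mc (s0 : R) : measurable_fun [set: R] (fun x => cos (s0 * x + t)).
  apply: continuous_measurable_fun => x.
  exact: is_derive1_cts (is_derive_cos_lin _ _ _).
have ms (s0 : R) : measurable_fun [set: R] (fun x => sin (s0 * x + t)).
  apply: continuous_measurable_fun => x.
  exact: is_derive1_cts (is_derive_sin_lin _ _ _).
have df (s0 x : R) : is_derive s0 1 (f^~ x) (- (x * sin (s0 * x + t)) * gpdf x).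
  have h : is_derive s0 1 (fun s => cos (x * s + t)) (- x * sin (x * s0 + t)).
    exact: is_derive_cos_lin.
  rewrite /f (_ : (fun s => _) = (gpdf x) \*: (fun s => cos (x * s + t))); last first.
    by apply/funext => z; rewrite /= mulrC [x * z]mulrC.
  by apply: is_derive_eq; rewrite /GRing.scale/= [x * s0]mulrC; ring.
have intf s0 : mu.-integrable setT (EFin \o f s0).
  apply: integrable_bounded_gpdf => //; exists 1, 0 => x.
  by rewrite mul0r addr0 ler_norml cos_geN1 cos_le1.
have ia : s \in `]s - 1, s + 1[ by rewrite in_itv/=; lra.
have Gub s0 x : `|derive1 (f^~ x) s0| <= `|x| * gpdf x.
  rewrite derive1E (@derive_val _ _ _ _ _ _ _ (df s0 x)) normrM normrN normrM.
  rewrite (ger0_norm (gpdf_ge0 _)) ler_wpM2r ?gpdf_ge0// ler_piMr//.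
  by rewrite ler_norml sin_geN1 sin_le1.
have dr : forall x y, `]s - 1, s + 1[%classic x -> setT y -> derivable (f ^~ y) x 1.
  by move=> x y _ _; apply: ex_derive; exact: df.
have e := @differentiation_under_integral R _ _ mu f setT measurableT s (s - 1) (s + 1)
  ia (fun x _ => intf x) dr (fun x => `|x| * gpdf x)
  (fun x => mulr_ge0 (normr_ge0 x) (gpdf_ge0 x)) integrable_xgpdf (fun x y _ _ => Gub x y).
have dd := @derivable_under_integral R _ _ mu f setT measurableT s (s - 1) (s + 1)
  ia (fun x _ => intf x) dr (fun x => `|x| * gpdf x)
  (fun x => mulr_ge0 (normr_ge0 x) (gpdf_ge0 x)) integrable_xgpdf (fun x y _ _ => Gub x y).
apply: DeriveDef => //.
rewrite -derive1E e.
have -> : \int[mu]_y partial1of2 f s y = \int[mu]_x (- (x * sin (s * x + t)) * gpdf x).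
  apply: eq_Rintegral => x _.
  by rewrite /partial1of2 derive1E (@derive_val _ _ _ _ _ _ _ (df s x)).
have i1 : mu.-integrable setT (EFin \o (fun x => s * (cos (s * x + t) * gpdf x))).
  by apply: (integrableZl measurableT s (intf s)).
have i2 : mu.-integrable setT (EFin \o (fun x => - (x * sin (s * x + t)) * gpdf x)).
  apply: integrable_bounded_gpdf; last first.
    exists 0, 1 => x; rewrite add0r mul1r normrN normrM ler_piMr//.
    by rewrite ler_norml sin_geN1 sin_le1.
  by apply: measurable_funN; exact: measurable_funM.
have := stein_sin s t.
under eq_Rintegral do rewrite mulrBl -mulNr -mulrA.
rewrite RintegralD// RintegralZl//; last exact: intf.
rewrite -/(f s) => h; rewrite mulNr; apply/eqP; rewrite -addr_eq0 addrC h//.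
Qed.

(** By [is_derive_Fourier] the product of the integral with [exp (s^2 / 2)] has derivative 0 in [s],
    and its value at [s = 0] is [cos t]. The phase [t] encodes the real and the imaginary part of
    the characteristic function together. *)
Lemma Ex_cos_normal (s t : R) : Ex nu (fun x => cos (s * x + t)) = expR (- s ^+ 2 / 2) * cos t.
Proof.
have mc (s0 : R) : measurable_fun [set: R] (fun x => s0 * x + t).
  by apply: measurable_funD => //; exact: measurable_funM.
rewrite Ex_nu; last exact: bmf_cos.
pose u s := \int[mu]_x (cos (s * x + t) * gpdf x).
pose g s := u s * expR (s ^+ 2 / 2).
have dg (z : R) : is_derive z 1 g 0.
  have h1 : is_derive z 1 u (- z * u z) := is_derive_Fourier t z.
  have h : is_derive z 1 (fun x : R => x ^+ 2 / 2) z.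
    by apply: is_derive_eq; rewrite /GRing.scale/= ?scaler0; lra.
  have h2 : is_derive z 1 (expR \o (fun x : R => x ^+ 2 / 2)) (expR (z ^+ 2 / 2) * z).
    exact: is_derive1_comp.
  by apply: is_derive_eq; rewrite /GRing.scale/=; ring.
have : g s = g 0 by apply: is_derive_0_is_cst.
rewrite /g expr0n/= mul0r expR0 mulr1 => e.
have u0 : u 0 = cos t.
  rewrite /u; under eq_Rintegral do rewrite mul0r add0r.
  rewrite RintegralZl//; last exact: integrable_gpdf.
  by rewrite /Rintegral -gpdfE integral_normal_pdf mulr1.
by rewrite -/(u s) -u0 -e mulrC -mulrA -expRD mulNr subrr expR0 mulr1.
Qed.

(** The exponent [th x^2 - x^2 / 2] is that of a centred normal density of variance
    [1 / (1 - 2 th)]; the integral is the ratio of the normalising constants. *)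
Lemma integral_expsq (th : R) : th < 2^-1 ->
  (\int[nu]_x (expR (th * x ^+ 2))%:E = ((sqrt (1 - 2 * th))^-1)%:E)%E.
Proof.
move=> th2; have th1 : 0 < 1 - 2 * th by lra.
have sp : 0 < sqrt (1 - 2 * th) by rewrite sqrtr_gt0.
set sg := (sqrt (1 - 2 * th))^-1.
have sg0 : 0 < sg by rewrite invr_gt0.
have sg2 : sg ^+ 2 = (1 - 2 * th)^-1 by rewrite exprVn sqr_sqrtr// ltW.
rewrite integral_nu; last 2 first.
- apply/measurable_EFinP; apply: measurableT_comp => //.
  by apply: measurable_funM => //; exact: measurable_funX.
- by move=> x; rewrite lee_fin expR_ge0.
transitivity (\int[mu]_x (sg%:E * (normal_pdf 0 sg x)%:E))%E.
  apply: eq_integral => x _; rewrite -!EFinM; congr EFin.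
  rewrite normal_pdfE ?gt_eqF// /normal_fun subr0 /gpdf /phi0 /normal_peak.
  rewrite expr1n mul1r -mulrnAr sqrtrM ?sqr_ge0// sqrtr_sqr gtr0_norm//.
  rewrite invfM -[X in sg * X]mulrA mulVKf ?gt_eqF// mulrCA -expRD; congr (_ * expR _).
  by rewrite sg2 -mulr_natr; field; rewrite gt_eqF.
rewrite integralZl//; last exact: integrable_normal_pdf.
by rewrite integral_normal_pdf mule1.
Qed.

Lemma nuF (A : set R) : measurable A -> (nu A = (fine (nu A))%:E)%E.
Proof. by move=> mA; rewrite fineK// fin_num_measure. Qed.

Lemma nu_itv_gt (t : R) : fine (nu `]t, +oo[%classic) = Phibar t.
Proof.
rewrite /Phibar /Phi.
have m1 : measurable (`]-oo, t]%classic : set R) by exact: measurable_itv.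
have : (nu (~` `]-oo, t]%classic) = 1 - nu `]-oo, t]%classic)%E.
  exact: probability_setC.
rewrite setCitvl => ->.
by rewrite (nuF m1) -EFinB.
Qed.

Lemma gpdfN x : gpdf (- x) = gpdf x. Proof. by rewrite /gpdf sqrrN. Qed.

Lemma continuous_gpdf : continuous gpdf.
Proof. by move=> x; exact: is_derive1_cts (is_derive_gpdf x). Qed.

Lemma nu_bndo (a : itv_bound R) (r : R) :
  nu [set` Interval a (BLeft r)] = nu [set` Interval a (BRight r)].
Proof.
rewrite !nuE integral_itv_bndo_bndc//.
by apply/measurable_EFinP/measurable_funTS; exact: measurable_gpdf.
Qed.

Lemma nu_obnd (b : itv_bound R) (r : R) :
  nu [set` Interval (BRight r) b] = nu [set` Interval (BLeft r) b].
Proof.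
rewrite !nuE integral_itv_obnd_cbnd//.
by apply/measurable_EFinP/measurable_funTS; exact: measurable_gpdf.
Qed.

Lemma nu_sym (t : R) : nu `]-oo, - t]%classic = nu `[t, +oo[%classic.
Proof.
rewrite !nuE ge0_integration_by_substitutionNy//.
- by apply: eq_integral => x _ /=; rewrite gpdfN.
- by apply: continuous_subspaceT; exact: continuous_gpdf.
- by move=> x _; exact: gpdf_ge0.
Qed.

Lemma tail_set (t : R) : 0 <= t ->
  [set x | t < `|x|] = `]-oo, - t[%classic `|` `]t, +oo[%classic :> set R.
Proof.
move=> t0; apply/seteqP; split => x /=; rewrite !in_itv/= andbT.
  by have [x0|x0] := leP 0 x; [rewrite ger0_norm//; right|rewrite ltr0_norm// ltrNr; left].
case; last by move=> h; rewrite gtr0_norm//; lra.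
by move=> h; rewrite ltr0_norm; lra.
Qed.

Lemma measurable_tail (t : R) : measurable [set x : R | t < `|x|].
Proof.
rewrite (_ : [set x | _] = Num.norm @^-1` `]t, +oo[%classic); last first.
  by apply/seteqP; split => x /=; rewrite in_itv/= andbT.
by rewrite -[X in measurable X]setTI; apply: normr_measurable => //; exact: measurable_itv.
Qed.

Lemma nu_tail (t : R) : 0 <= t -> fine (nu [set x | t < `|x|]) = 2 * Phibar t.
Proof.
move=> t0; rewrite tail_set// -/(Pr nu _) Pr_disjU//; last first.
  apply/disj_set2P; apply/disj_setPS => z [/=]; rewrite !in_itv/= andbT => zx zt; lra.
transitivity (fine (nu `]-oo, - t[%classic) + fine (nu `]t, +oo[%classic)) => //.
have -> : nu `]-oo, - t[%classic = nu `]t, +oo[%classic.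
  transitivity (nu `]-oo, - t]%classic); first exact: nu_bndo.
  by transitivity (nu `[t, +oo[%classic); [exact: nu_sym|apply/esym; exact: nu_obnd].
by rewrite nu_itv_gt; lra.
Qed.

Lemma Phibar_ge0 (t : R) : 0 <= Phibar t.
Proof. by rewrite -nu_itv_gt fine_ge0. Qed.

Lemma Phibar_itv (a b : R) : a <= b -> Phibar a - Phibar b = fine (nu `]a, b]%classic).
Proof.
move=> ab; rewrite -!nu_itv_gt.
have -> : `]a, +oo[%classic = `]a, b]%classic `|` `]b, +oo[%classic :> set R.
  by rewrite -itv_bndbnd_setU// bnd_simp.
rewrite -!/(Pr nu _) Pr_disjU//; first lra.
apply/disj_set2P; apply/disj_setPS => z [/=]; rewrite !in_itv/= andbT => /andP[_ zx] zt.
lra.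
Qed.

Lemma Phibar_le (a b : R) : a <= b -> Phibar b <= Phibar a.
Proof. by move=> ab; rewrite -subr_ge0 Phibar_itv// fine_ge0. Qed.

Lemma gpdf_mono (a b : R) : 0 <= a -> a <= b -> gpdf b <= gpdf a.
Proof.
by move=> a0 ab; rewrite /gpdf ler_wpM2l ?(ltW phi0_gt0)// ler_expR; nra.
Qed.

Lemma nu_itv_bounds (a b m M : R) : a <= b ->
  (forall x, a <= x <= b -> m <= gpdf x <= M) ->
  m * (b - a) <= fine (nu `]a, b]%classic) <= M * (b - a).
Proof.
move=> ab h.
have mm : measurable (`]a, b]%classic : set R) by exact: measurable_itv.
have mE : measurable_fun `]a, b]%classic (EFin \o gpdf).
  by apply/measurable_EFinP/measurable_funTS; exact: measurable_gpdf.
have cstE (c : R) : (\int[mu]_(x in `]a, b]%classic) c%:E = (c * (b - a))%:E)%E.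
  rewrite integral_cst//= lebesgue_measure_itv/= lte_fin.
  have [_|] := ltP a b; first by rewrite -EFinB -EFinM.
  by move=> ba; rewrite (_ : b = a) ?subrr ?mulr0 ?mule0//; apply/le_anti/andP.
have hm x : x \in `]a, b]%classic -> m <= gpdf x <= M.
  by rewrite inE/= in_itv/= => /andP[/ltW ? ?]; apply: h; apply/andP.
have ig : mu.-integrable `]a, b]%classic (EFin \o gpdf).
  by apply: integrableS integrable_gpdf.
have ic (c : R) : mu.-integrable `]a, b]%classic (fun=> c%:E).
  apply/integrableP; split; first exact: measurable_cst.
  by rewrite integral_cst//= lebesgue_measure_itv/=; case: ifP => _;
    rewrite -?EFinB -?EFinM ?mule0 ltry.
rewrite -!lee_fin -nuF// nuE -!cstE; apply/andP; split.
  by apply: le_integral => // x /hm /andP[]; rewrite lee_fin.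
by apply: le_integral => // x /hm /andP[]; rewrite lee_fin.
Qed.

Lemma nu_shell (a b : R) : 0 <= a -> a <= b ->
  2 * Phibar a - 2 * Phibar b <= (b - a) * expR (- a ^+ 2 / 2).
Proof.
move=> a0 ab; rewrite -mulrBr Phibar_itv//.
have /andP[_ h] := @nu_itv_bounds a b 0 (gpdf a) ab
  (fun x h => introT andP (conj (gpdf_ge0 x) (gpdf_mono a0 (proj1 (andP h))))).
have := phi0_le; rewrite /gpdf in h.
have := expR_ge0 (- a ^+ 2 / 2); set e := expR _ in h * => e0 p.
rewrite (le_trans (ler_wpM2l _ h))//.
have : 0 <= (b - a) * e by rewrite mulr_ge0// subr_ge0.
have -> : 2 * (phi0 * e * (b - a)) = (2 * phi0) * ((b - a) * e) by ring.
nra.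
Qed.

(** Only []t, t + 1]] is kept, where the density is at least its value at the right end. The loss is
    at most of order [exp t], which on the grid grows more slowly than any power of [p]. *)
Lemma Phibar_ge (t : R) : 0 <= t -> gpdf (t + 1) <= Phibar t.
Proof.
move=> t0; have t1 : t <= t + 1 by lra.
have /andP[h _] := @nu_itv_bounds t (t + 1) (gpdf (t + 1)) (gpdf 0) t1
  (fun x h => introT andP (conj (gpdf_mono (le_trans t0 (proj1 (andP h))) (proj2 (andP h)))
     (gpdf_mono (lexx 0) (le_trans t0 (proj1 (andP h)))))).
have := Phibar_itv t1; have := Phibar_ge0 (t + 1); lra.
Qed.

Lemma nu_itv_lin (a b c : R) : a <= b -> 
  (\int[mu]_(x in `]a, b]%classic) (c * x)%:E = (c * (b ^+ 2 - a ^+ 2) / 2)%:E)%E.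
Proof.
rewrite le_eqVlt => /predU1P[->|ab].
  by rewrite set_itv_ge ?bnd_simp ?ltxx// integral_set0 subrr mulr0 mul0r.
have cl : continuous (fun x : R => c * x).
  by move=> x; apply: cvgM; [exact: cvg_cst|exact: cvg_id].
have dF (x : R) : is_derive x 1 (fun x : R => c * x ^+ 2 / 2) (c * x).
  by apply: is_derive_eq; rewrite /GRing.scale/= ?scaler0; lra.
rewrite integral_itv_obnd_cbnd; last first.
  by apply/measurable_EFinP/measurable_funTS; exact: continuous_measurable_fun.
rewrite (@continuous_FTC2 _ _ (fun x : R => c * x ^+ 2 / 2))//.
- by rewrite -EFinB; congr EFin; lra.
- exact: continuous_subspaceT.
- split => [x _||].
  + by apply: ex_derive; exact: dF.
  + by apply: cvg_at_right_filter; exact: is_derive1_cts (dF _).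
  + by apply: cvg_at_left_filter; exact: is_derive1_cts (dF _).
- by move=> x _; rewrite derive1E; apply: derive_val.
Qed.

(* [s |-> Phibar (c * sqrt s)] is convex: this is its tangent inequality. *)
Lemma Phibar_tangent (a b : R) : 0 < a -> 0 <= b ->
  Phibar a - gpdf a / a * ((b ^+ 2 - a ^+ 2) / 2) <= Phibar b.
Proof.
move=> a0 b0.
have ig (x y : R) : mu.-integrable `]x, y]%classic (EFin \o gpdf).
  by apply: integrableS integrable_gpdf.
have il (x y c : R) : mu.-integrable `]x, y]%classic (fun z => (c * z)%:E).
  apply: integrableS (_ : mu.-integrable `[x, y]%classic _) => //.
    by apply: subset_itv; rewrite bnd_simp.
  apply: continuous_compact_integrable; first exact: segment_compact.
  apply: continuous_subspaceT => z.
  by apply: cvgM; [exact: cvg_cst|exact: cvg_id].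
(* The line [gpdf a / a * x] meets the density at [a]; it lies above it to the right, where the
   density decreases, and below it on []b, a]]. Its integral is the quadratic term. *)
have [ab|ba] := leP a b.
  have : Phibar a - Phibar b <= gpdf a / a * (b ^+ 2 - a ^+ 2) / 2.
    rewrite Phibar_itv// -lee_fin -nuF// nuE -nu_itv_lin//.
    apply: le_integral => // x; rewrite inE/= in_itv/= => /andP[ax _].
    rewrite lee_fin mulrAC ler_pdivlMr//.
    have := gpdf_mono (ltW a0) (ltW ax); have := gpdf_ge0 a; nra.
  lra.
have : gpdf a / a * (a ^+ 2 - b ^+ 2) / 2 <= Phibar b - Phibar a.
  rewrite (Phibar_itv (ltW ba)) -lee_fin -nuF// nuE -(nu_itv_lin _ (ltW ba)).
  apply: le_integral => // x; rewrite inE/= in_itv/= => /andP[bx xa].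
  rewrite lee_fin mulrAC ler_pdivrMr//.
  have := gpdf_mono (le_trans b0 (ltW bx)) xa; have := gpdf_ge0 a; nra.
lra.
Qed.

(** On [[t, +oo[] the factor [x / t] is at least 1, and [x / t * gpdf x] has the explicit primitive
    [- gpdf x / t]. *)
Lemma Phibar_mills (t : R) : 0 < t -> Phibar t <= gpdf t / t.
Proof.
move=> t0; rewrite -nu_itv_gt -lee_fin -nuF// nuE.
have -> : (gpdf t / t)%:E = (\int[mu]_(x in `[t, +oo[) (x / t * gpdf x)%:E)%E.
  have cxt : continuous (fun x : R => x / t * gpdf x).
    move=> x; apply: cvgM; last exact: continuous_gpdf.
    by apply: cvgM; [exact: cvg_id|exact: cvg_cst].
  have dF (x : R) : is_derive x 1 (fun x : R => - (gpdf x / t)) (x / t * gpdf x).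
    have h := is_derive_gpdf x.
    by apply: is_derive_eq; rewrite /GRing.scale/=; ring.
  rewrite (@ge0_continuous_FTC2y _ _ (fun x : R => - (gpdf x / t)) _ 0).
  - by rewrite EFinN oppeK add0e.
  - move=> x tx; rewrite mulr_ge0 ?gpdf_ge0// divr_ge0// ?ltW//.
    exact: lt_le_trans tx.
  - exact: continuous_subspaceT.
  - rewrite -oppr0; apply: (@cvgN _ R^o); rewrite -[X in _ --> X](mul0r t^-1).
    apply: cvgM; last exact: cvg_cst.
    apply: (@squeeze_cvgr _ _ _ _ (fun=> 0) (fun x => x^-1)).
    + near=> x; rewrite gpdf_ge0/= (le_trans (gpdf_le x))// lef_pV2 ?posrE//.
      * have := sqr_ge0 (x - 1); rewrite sqrrB1; have := sqr_ge0 x.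
        by near: x; exists 0; split => // x x0; nra.
      * by have := sqr_ge0 x; lra.
    + exact: cvg_cst.
    + by apply/(gtr0_cvgV0 (f := id)); [exact: nbhs_pinfty_gt|exact: cvg_id].
  - by move=> x _; apply: ex_derive; exact: dF.
  - by apply: cvg_at_right_filter; exact: is_derive1_cts (dF _).
  - by move=> x _; rewrite derive1E; apply: derive_val.
rewrite -integral_itv_obnd_cbnd; last first.
  apply/measurable_EFinP/measurable_funTS/measurable_funM; last exact: measurable_gpdf.
  by apply: measurable_funM.
apply: ge0_le_integral => //.
- by move=> x _; rewrite lee_fin gpdf_ge0.
- by apply/measurable_EFinP/measurable_funTS; exact: measurable_gpdf.
- apply/measurable_EFinP/measurable_funTS/measurable_funM; last exact: measurable_gpdf.
  by apply: measurable_funM.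
- move=> x; rewrite /= in_itv/= andbT => tx.
  rewrite lee_fin ler_peMl ?gpdf_ge0// ler_pdivlMr// mul1r ltW//.
Unshelve. all: by end_near. Qed.

End StandardNormal.

(** * Uniqueness of characteristic functions *)

(** With [c = x^2], the sequence [n x^n] stays bounded, since [n x^n (1 - x) <= 1 - x^n], and the
    other factor [x^n] tends to 0. *)
Lemma cvg_mulrn_geometric {R : realType} (c : R) : 0 <= c -> c < 1 ->
  (fun n => n%:R * c ^+ n) @ \oo --> (0 : R).
Proof.
move=> c0 c1.
have := @cvg_geometric _ 1 (sqrt c).
have sc0 := sqrtr_ge0 c.
have sc1 : sqrt c < 1 by rewrite -sqrtr1 ltr_sqrt.
rewrite ger0_norm// => /(_ sc1) gc.
pose e := 1 - sqrt c; have e0 : 0 < e by rewrite subr_gt0.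
have bern n : n%:R * sqrt c ^+ n <= e^-1.
  have h : n%:R * sqrt c ^+ n * e <= 1 - sqrt c ^+ n.
    elim: n => [|n IH]; first by rewrite mul0r mul0r expr0 subrr.
    have sn : 0 <= sqrt c ^+ n by rewrite exprn_ge0.
    have sn1 : sqrt c ^+ n <= 1 by rewrite exprn_ile1// ltW.
    have IH2 := ler_wpM2l sc0 IH.
    rewrite exprS -natr1; rewrite /e in IH IH2 *.
    set x := sqrt c in sc0 sc1 sn sn1 IH IH2 *; set y := x ^+ n in sn sn1 IH IH2 *.
    have : 0 <= (1 - x) * (1 - x * y) by rewrite mulr_ge0//; nra.
    nra.
  rewrite -[leRHS]mul1r ler_pdivlMr// (le_trans h)// gerBl exprn_ge0//.
apply: (@squeeze_cvgr _ _ _ _ (fun=> 0) (fun n => e^-1 * sqrt c ^+ n)).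
- apply: nearW => n; rewrite mulr_ge0 ?exprn_ge0//=.
  have -> : c ^+ n = sqrt c ^+ n * sqrt c ^+ n by rewrite -exprMn -expr2 sqr_sqrtr.
  by rewrite mulrA ler_wpM2r// exprn_ge0.
- exact: cvg_cst.
- rewrite -[X in _ --> X](mulr0 e^-1); apply: cvgMr.
  by move: gc; rewrite (_ : geometric 1 _ = (fun n => sqrt c ^+ n))//;
    apply/funext => n; rewrite /geometric/= mul1r.
Qed.

(** Below [1/2], Bernoulli bounds the deficit by [n (2 x)^n]; otherwise [1 - x^n <= exp (- x^n)]
    gives [exp (- n)], the factor [n] in the exponent settling [x = 1/2]. These polynomials turn a
    function with values in [[0, 1]] into an indicator by a bounded pointwise limit. *)
Lemma cvg_step_powers {R : realType} (x : R) : 0 <= x -> x <= 1 ->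
  (fun n => (1 - x ^+ n) ^+ (n * 2 ^ n)%N) @ \oo --> ((x < 2^-1)%R%:R : R).
Proof.
move=> x0 x1.
have [xh|xh] := ltP x 2^-1.
  apply: (@squeeze_cvgr _ _ _ _ (fun n => 1 - n%:R * (2 * x) ^+ n) (fun=> 1)).
  - apply: nearW => n; have xn : 0 <= x ^+ n <= 1 by rewrite exprn_ge0//= exprn_ile1.
    apply/andP; split; last by rewrite exprn_ile1//; lra.
    have bern (N : nat) (a : R) : 0 <= a <= 1 -> 1 - N%:R * a <= (1 - a) ^+ N.
      move=> /andP[a0 a1]; elim: N => [|N IH]; first by rewrite mul0r subr0 expr0.
      have := ler_wpM2l (_ : 0 <= 1 - a) IH; rewrite exprS -natr1 => h.
      have : 0 <= N%:R :> R by [].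
      have := h ltac:(lra); nra.
    by rewrite exprMn mulrA -natrX -natrM; exact: bern.
  - rewrite -[X in _ --> X](subr0 1); apply: (@cvgB _ R^o); first exact: cvg_cst.
    apply: cvg_mulrn_geometric; lra.
  - exact: cvg_cst.
apply: (@squeeze_cvgr _ _ _ _ (fun=> 0) (fun n => (expR (-1)) ^+ n)).
- apply: nearW => n; have xn : 0 <= x ^+ n <= 1 by rewrite exprn_ge0//= exprn_ile1.
  rewrite exprn_ge0 ?subr_ge0; last by case/andP: xn.
  rewrite /= (@le_trans _ _ (expR (- x ^+ n) ^+ (n * 2 ^ n)%N))//.
    by apply: lerXn2r; rewrite ?nnegrE ?expR_ge0 ?expR_ge1Dx//; case/andP: xn => ? ?; lra.
  rewrite -!expRM_natl ler_expR !mulrN lerN2 mulr1 natrM -mulrA ler_peMr//.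
  by rewrite natrX -exprMn exprn_ege1//; lra.
- exact: cvg_cst.
- have e0 := expR_ge0 (-1 : R).
  have e1 : expR (-1) < 1 :> R by rewrite -[X in _ < X]expR0 ltr_expR ltrN10.
  have := @cvg_geometric R 1 (expR (-1)); rewrite ger0_norm// => /(_ e1).
  by rewrite (_ : geometric 1 _ = (fun n => expR (-1) ^+ n))//;
    apply/funext => n; rewrite /geometric/= mul1r.
Qed.

Section Uniqueness.
Context {R : realType} {d} {T : measurableType d}.
Variable P : probability T R.
Variables (I : finType) (Y : I -> T -> R).
Hypothesis mY : forall i, mfunT (Y i).
Implicit Types V W : T -> R.

Let lin (u : I -> R) (w : T) := \sum_i u i * Y i w.

Let mlin u t : mfunT (fun w => lin u w + t).
Proof.
by apply: measurable_funD => //; apply: measurable_sum => i; exact: measurable_funM.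
Qed.

(** The phase [t] makes the condition cover sines as well, and [u = 0] is included, so that an
    orthogonal [V] has mean 0. *)
Definition orth V := bmf V /\
  forall u t, Ex P (fun w => V w * cos (\sum_i u i * Y i w + t)) = 0.

Let bc u t : bmf (fun w => cos (lin u w + t)).
Proof. exact: bmf_cos. Qed.

Lemma orthB V W : orth V -> orth W -> orth (fun w => V w - W w).
Proof.
move=> [bV hV] [bW hW]; split; first exact: bmfB.
move=> u t; under Ex_ext do rewrite mulrBl.
rewrite ExB ?hV ?hW ?subrr//; apply: bmfM => //; exact: bc.
Qed.

Lemma orth_ext V W : V =1 W -> orth V -> orth W.
Proof. by move=> e; rewrite (_ : V = W)//; exact/funext. Qed.

Lemma orth_cvg (V_ : nat -> T -> R) V (M : R) :
  (forall n, orth (V_ n)) -> (forall n w, `|V_ n w| <= M) ->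
  (forall w, V_ ^~ w @ \oo --> V w) -> orth V.
Proof.
move=> hV hM cV.
have mV : mfunT V.
  apply: (measurable_fun_cvg (h := V_)).
    by move=> n; have [[]] := hV n.
  by move=> w _; exact: cV.
have bV : bmf V.
  split => //; exists M => w.
  have cn : `|V_ n w| @[n --> \oo] --> `|V w| by apply: cvg_norm; exact: cV.
  by rewrite -(cvg_lim _ cn)//; apply: limr_le; [exact: cvgP cn|exact: nearW].
split=> // u t.
have := @Ex_dct _ _ _ P (fun n w => V_ n w * cos (lin u w + t))
  (fun w => V w * cos (lin u w + t)) M.
move=> /(_ _ _ _ _)/(_ _) h.
have : Ex P (fun w => V_ n w * cos (lin u w + t)) @[n --> \oo] -->
       Ex P (fun w => V w * cos (lin u w + t)).
  apply: h.
  - by move=> n; have [b _] := hV n; have [] := bmfM b (bc u t).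
  - move=> n w; rewrite normrM -[leRHS]mulr1 ler_pM// ler_norml cos_geN1 cos_le1//.
  - by move=> w; apply: cvgM; [exact: cV|exact: cvg_cst].
  - by have [] := bmfM bV (bc u t).
under eq_fun do rewrite (hV _).2.
by move=> /(cvg_unique _ (cvg_cst 0)) <-.
Qed.

Let bump (i : I) (a s : R) (w : T) := expR (- (a * (Y i w - s)) ^+ 2 / 2).

Let bump01 i a s w : 0 <= bump i a s w <= 1.
Proof.
rewrite expR_ge0/= -expR0 ler_expR mulNr oppr_le0 mulr_ge0// ?sqr_ge0//.
Qed.

Let mbump i a s : mfunT (bump i a s).
Proof.
apply: measurableT_comp => //; apply: measurable_funM => //.
apply: measurableT_comp => //; apply: measurable_funX.
by apply: measurable_funM => //; apply: measurable_funB.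
Qed.

(** The Gaussian bump at [Y i w] is the characteristic function of a standard normal [x] at
    [a (Y i w - s)]. By Fubini the claim reduces to a fixed [x], where a product of two cosines only
    shifts the frequency [u i] by [a x] up or down. *)
Lemma orth_bump V i a s : orth V -> orth (fun w => V w * bump i a s w).
Proof.
move=> [bV hV]; split.
  apply: bmfM => //; split; first exact: mbump.
  by exists 1 => w; have /andP[h0 h1] := bump01 i a s w; rewrite ger0_norm.
move=> u t.
pose F (z : T * R) := V z.1 * cos (a * (Y i z.1 - s) * z.2 + 0) * cos (lin u z.1 + t).
have bF : bmf (F : T * (measurableTypeR R) -> R).
  apply: bmfM; last first.
    apply: bmf_cos; exact: (measurableT_comp (mlin u t) measurable_fst).
  apply: bmfM; last first.
    apply: bmf_cos; apply: measurable_funD => //; apply: measurable_funM => //.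
    apply: measurable_funM => //; apply: measurable_funB => //.
    exact: (measurableT_comp (mY i) measurable_fst).
  have [mV [M hM]] := bV; split; last by exists M => z.
  exact: (measurableT_comp mV measurable_fst).
transitivity (Ex P (fun w => Ex (@normal_prob R 0 1) (fun x => F (w, x)))).
  apply: Ex_ext => w; rewrite /F /=.
  transitivity (V w * cos (lin u w + t) * Ex (@normal_prob R 0 1)
      (fun x => cos (a * (Y i w - s) * x + 0))).
    by rewrite Ex_cos_normal cos0 mulr1 /bump /lin mulrAC.
  rewrite -ExZ; last by apply: bmf_cos; apply: measurable_funD => //; exact: measurable_funM.
  by apply: Ex_ext => x; ring.
rewrite (Ex_fubini _ _ bF).
rewrite -[RHS](Ex_cst (@normal_prob R 0 1)).
apply: Ex_ext => x; rewrite /F /=.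
pose u1 j := u j + (if j == i then a * x else 0).
pose u2 j := u j - (if j == i then a * x else 0).
have e1 w : lin u1 w = lin u w + a * x * Y i w.
  rewrite /lin /u1; under eq_bigr do rewrite mulrDl.
  rewrite big_split/=; congr (_ + _); rewrite (bigD1 i)//= eqxx big1 ?addr0//.
  by move=> j /negbTE ->; rewrite mul0r.
have e2 w : lin u2 w = lin u w - a * x * Y i w.
  rewrite /lin /u2; under eq_bigr do rewrite mulrBl.
  rewrite big_split/= sumrN; congr (_ - _); rewrite (bigD1 i)//= eqxx big1 ?addr0//.
  by move=> j /negbTE ->; rewrite mul0r.
transitivity (Ex P (fun w => 2^-1 * (V w * cos (lin u1 w + (t - a * x * s))) +
    2^-1 * (V w * cos (lin u2 w + (t + a * x * s))))).
  apply: Ex_ext => w; rewrite e1 e2.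
  have -> : lin u w + a * x * Y i w + (t - a * x * s) =
     (lin u w + t) + (a * (Y i w - s) * x + 0) by ring.
  have -> : lin u w - a * x * Y i w + (t + a * x * s) =
     (lin u w + t) - (a * (Y i w - s) * x + 0) by ring.
  move: (lin u w + t) (a * (Y i w - s) * x + 0) => A B.
  by rewrite cosD cosB; field.
rewrite ExD; try by apply: bmfZ; apply: bmfM.
rewrite !ExZ; try by apply: bmfM.
by rewrite !hV !mulr0 addr0.
Qed.

Lemma orth_far V i s rho : 0 < rho -> orth V ->
  orth (fun w => V w * \1_[set w | rho < `|Y i w - s|] w).
Proof.
move=> rho0 oV.
(* The scale at which the bump equals [1/2] exactly at distance [rho] from [s], the jump of the
   limit in [cvg_step_powers]. *)
pose a := sqrt (2 * ln 2) / rho.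
have l2 : 0 < ln 2 :> R by rewrite ln_gt0; lra.
pose g := bump i a s.
have iff w : (g w < 2^-1) = (rho < `|Y i w - s|).
  rewrite /g /bump -[X in _ < X]lnK ?posrE// ltr_expR lnV ?posrE// mulNr ltrN2.
  have -> : (a * (Y i w - s)) ^+ 2 / 2 = ln 2 * (`|Y i w - s| / rho) ^+ 2.
    rewrite /a !exprMn sqr_sqrtr; last by lra.
    by rewrite real_normK ?num_real//; field; rewrite gt_eqF.
  rewrite ltr_pMr// -[X in X < _](expr1n _ 2) ltr_pXn2r ?nnegrE ?ler01//.
    by rewrite ltr_pdivlMr// mul1r.
  by rewrite divr_ge0// ltW.
have opow n W : orth W -> orth (fun w => W w * g w ^+ n).
  elim: n W => [|n IH] W oW.
    by apply: orth_ext oW => w; rewrite expr0 mulr1.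
  by apply: orth_ext (IH _ (orth_bump i a s oW)) => w; rewrite exprS mulrA.
have opow2 n N W : orth W -> orth (fun w => W w * (1 - g w ^+ n) ^+ N).
  elim: N W => [|N IH] W oW.
    by apply: orth_ext oW => w; rewrite expr0 mulr1.
  have := IH _ (orthB oW (opow n _ oW)); apply: orth_ext => w.
  by rewrite exprS -[X in X - _]mulr1 -mulrBr -!mulrA.
have [[_ [M hM]] _] := oV.
apply: (@orth_cvg (fun n w => V w * (1 - g w ^+ n) ^+ (n * 2 ^ n)%N) _ M).
- by move=> n; exact: opow2.
- move=> n w; rewrite normrM -[leRHS]mulr1 ler_pM// normrX exprn_ile1//.
  have /andP[g0 g1] := bump01 i a s w.
  have : 0 <= g w ^+ n <= 1 by rewrite exprn_ge0//= exprn_ile1.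
  by move=> /andP[? ?]; rewrite ger0_norm; lra.
- move=> w; apply: cvgM; first exact: cvg_cst.
  rewrite indicE; have -> : (w \in [set w | rho < `|Y i w - s|]) = (g w < 2^-1).
    by rewrite iff; apply/idP/idP; rewrite inE.
  by have /andP[g0 g1] := bump01 i a s w; exact: cvg_step_powers.
Qed.

Let good (A : set T) := measurable A /\ forall V, orth V -> orth (fun w => V w * \1_A w).

Let good_sigma : sigma_algebra setT good.
Proof.
have goodI A B : good A -> good B -> good (A `&` B).
  move=> [mA gA] [mB gB]; split; first exact: measurableI.
  move=> V oV; apply: orth_ext (gB _ (gA _ oV)) => w.
  by rewrite -mulrA; congr (_ * _); rewrite indicI.
have goodC A : good A -> good (~` A).
  move=> [mA gA]; split; first exact: measurableC.
  move=> V oV; apply: orth_ext (orthB oV (gA _ oV)) => w.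
  rewrite -[X in X - _]mulr1 -mulrBr; congr (_ * _).
  by rewrite !indicE in_setC; case: (_ \in _); rewrite ?subrr ?subr0.
have good0 : good set0.
  split => // V oV; apply: orth_ext (orthB oV oV) => w.
  by rewrite indicE in_set0 mulr0 subrr.
split => //.
- by move=> A gA; rewrite setTD; exact: goodC.
- move=> A gA; split; first by apply: bigcupT_measurable => n; have [] := gA n.
  pose B n := \big[setI/setT]_(k < n) ~` A k.
  have gB n : good (B n).
    rewrite /B; elim/big_ind: _ => //.
      by rewrite -(setCK setT) setCT; exact: goodC.
    by move=> k _; exact: goodC.
  move=> V oV; have [[_ [M hM]] _] := oV.
  apply: (@orth_cvg (fun n w => V w - V w * \1_(B n) w) _ (M + M)).
  + by move=> n; apply: orthB => //; have [_] := gB n; apply.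
  + move=> n w; rewrite (le_trans (ler_normB _ _))// lerD//.
    rewrite normrM -[leRHS]mulr1 ler_pM// indicE; case: (_ \in _); rewrite ?normr1 ?normr0//.
  + move=> w; apply: cvg_near_cst.
    rewrite indicE; case: (boolP (w \in \bigcup_n A n)).
      rewrite inE => -[N _ AN]; exists N.+1 => // n /= Nn.
      rewrite indicE (_ : (w \in B n) = false) ?mulr0 ?subr0 ?mulr1//.
      apply/negbTE; rewrite notin_setE /B -(bigcap_mkord _ (fun k => ~` A k)) => /(_ N Nn); exact.
    rewrite notin_setE => h; apply: nearW => n.
    rewrite indicE (_ : (w \in B n) = true) ?mulr1 ?subrr ?mulr0//.
    by apply/mem_set; rewrite /B -(bigcap_mkord _ (fun k => ~` A k)) => k _ Ak; apply: h; exists k.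
Qed.

Let good_preimage i (B : set R) : measurable B -> good (Y i @^-1` B).
Proof.
pose S := [set B : set R | good (Y i @^-1` B)].
have [g0 gC gU] := good_sigma.
have sS : sigma_algebra setT S.
  split; first by rewrite /S/= preimage_set0.
  - by move=> A; rewrite /S/= !setTD -preimage_setC => h; rewrite -setTD; exact: gC.
  - by move=> A hA; rewrite /S/= preimage_bigcup; exact: gU.
suff : <<s @RGenOInfty.G R >> `<=` S.
  move=> h mB.
  have mB' : (@RGenOInfty.G R).-sigma.-measurable B by rewrite -RGenOInfty.measurableE.
  exact: (h B mB').
apply: smallest_sub => //= _ [x ->].
(* [Y i w > x] exactly when [Y i w] avoids all closed balls of radius [n + 1] around [x - (n + 1)]:
   they share the right end [x] and exhaust the half-line to its left. *)
have far n : good [set w | n.+1%:R < `|Y i w - (x - n.+1%:R)|].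
  split; last by move=> V oV; apply: orth_far => //; rewrite ltr0n.
  have m : mfunT (fun w => `|Y i w - (x - n.+1%:R)|).
    by apply: measurableT_comp => //; apply: measurable_funB.
  rewrite (_ : [set w | _] = (fun w => `|Y i w - (x - n.+1%:R)|) @^-1` `]n.+1%:R, +oo[%classic).
    by rewrite -[X in measurable X]setTI; exact: m.
  by apply/seteqP; split => w /=; rewrite in_itv/= andbT.
rewrite /S/= (_ : Y i @^-1` _ = ~` \bigcup_n (~` [set w | n.+1%:R < `|Y i w - (x - n.+1%:R)|])).
  by rewrite -setTD; apply: (gC); apply: gU => n; rewrite -setTD; exact: (gC).
apply/seteqP; split => w /=; rewrite in_itv/= andbT.
  move=> xw [n _ /=]; apply; apply: lt_le_trans (ler_norm _).
  lra.
move=> h; rewrite ltNge; apply/negP => wx; apply: h.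
exists (Num.truncn (x - Y i w)) => //= /negP; apply.
have := truncnS_gt (x - Y i w); set N := (Num.truncn _).+1 => h.
apply/negP; rewrite -leNgt ler_norml; apply/andP; split; lra.
Qed.

(* A bounded [V] all of whose Fourier coefficients against [Y] vanish is
   orthogonal to the sigma-algebra of [Y]. *)
Lemma orth_sigma V (A : set T) : orth V ->
  <<s [set E | exists i (B : set R), measurable B /\ E = Y i @^-1` B] >> A ->
  measurable A /\ Ex P (fun w => V w * \1_A w) = 0.
Proof.
move=> oV sA.
have [mA gA] : good A.
  apply: sA; split; first exact: good_sigma.
  by move=> _ [i [B [mB ->]]]; exact: good_preimage.
split=> //; have [_ /(_ (fun=> 0) 0) <-] := gA _ oV.
apply: Ex_ext => w; rewrite big1 ?add0r ?cos0 ?mulr1// => i _.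
by rewrite mul0r.
Qed.

End Uniqueness.

Section MeasurableComparison.
Context {R : realType} {d} {T : measurableType d}.

Lemma measurable_setle (f g : T -> R) : mfunT f -> mfunT g ->
  measurable [set w | f w <= g w].
Proof.
move=> mf mg; rewrite (_ : [set w | _] = (fun w => g w - f w) @^-1` `[0, +oo[%classic).
  rewrite -[X in measurable X]setTI; apply: measurable_funB => //; exact: measurable_itv.
by apply/seteqP; split=> w /=; rewrite in_itv/= andbT subr_ge0.
Qed.

Lemma measurable_setlt (f g : T -> R) : mfunT f -> mfunT g ->
  measurable [set w | f w < g w].
Proof.
move=> mf mg; rewrite (_ : [set w | _] = ~` [set w | g w <= f w]).
  by apply: measurableC; exact: measurable_setle.
by apply/seteqP; split=> w /=; rewrite ltNge => /negP.
Qed.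

End MeasurableComparison.

(** * Products and sums over independent sigma-algebras *)

Section SubSigma.
Context {R : realType} {d} {T : measurableType d}.
Variable P : probability T R.

Definition smeas (G : set (set T)) (f : T -> R) :=
  forall B : set R, measurable B -> <<s G >> (f @^-1` B).

Lemma smeasP G f : smeas G f <-> measurable_fun (setT : set (g_sigma_algebraType G)) f.
Proof.
split; first by move=> h _ B mB; rewrite setTI; exact: h.
by move=> h B mB; have := h measurableT B mB; rewrite setTI.
Qed.

Lemma smeas_measurable G f : <<s G >> `<=` measurable -> smeas G f -> mfunT f.
Proof. by move=> Gm h _ B mB; rewrite setTI; apply: Gm; exact: h. Qed.

(* Layer cake: [f x] is the length of [[0, f x[]. *)
Lemma indep2_ge0 (G : set (set T)) (W : T -> \bar R) (c : R) (f : T -> R) :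
  <<s G >> `<=` measurable ->
  mfunT W -> (forall x, 0 <= W x)%E -> 0 <= c ->
  (forall A, <<s G >> A -> \int[P]_x ((\1_A x)%:E * W x) = (Pr P A * c)%:E)%E ->
  smeas G f -> (forall x, 0 <= f x) ->
  (\int[P]_x ((f x)%:E * W x) = \int[P]_x (f x)%:E * c%:E)%E.
Proof.
move=> Gm mW W0 c0 hW sf f0; have mf := smeas_measurable Gm sf.
pose A u := [set x | 0 <= u < f x].
have layer (V : T -> \bar R) : mfunT V -> (forall x, 0 <= V x)%E ->
    (\int[P]_x ((f x)%:E * V x) = \int[@lebesgue_measure R]_u \int[P]_x ((\1_(A u) x)%:E * V x))%E.
  move=> mV V0; pose F (z : T * measurableTypeR R) := ((\1_(A z.2) z.1)%:E * V z.1)%E.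
  have AE (z : T * R) : (\1_(A z.2) z.1 : R) = \1_[set z | 0 <= z.2 < f z.1] z by [].
  have mA : measurable [set z : T * measurableTypeR R | 0 <= z.2 < f z.1].
    rewrite (_ : [set _ | _] = [set z | 0 <= z.2] `&` [set z | z.2 < f z.1]); last first.
      by apply/seteqP; split => z /= => [/andP|] [? ?] //; apply/andP.
    by apply: measurableI; [apply: measurable_setle|apply: measurable_setlt => //; exact: measurableT_comp].
  have mF : mfunT F.
    apply: emeasurable_funM; last exact: measurableT_comp.
    by apply/measurable_EFinP; under eq_fun do rewrite AE; exact: measurable_indic.
  have F0 z : (0 <= F z)%E by rewrite mule_ge0// lee_fin.
  have := @fubini_tonelli _ _ T (measurableTypeR R) R P lebesgue_measure F mF F0 => /= <-.
  apply: eq_integral => x _.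
  have mI : measurable (`[0, f x[%classic : set R) by exact: measurable_itv.
  transitivity (\int[@lebesgue_measure R]_u (V x * (\1_(`[0, f x[%classic : set R) u)%:E))%E; last first.
    by apply: eq_integral => u _; rewrite muleC.
  rewrite ge0_integralZl//; last by apply/measurable_EFinP; exact: measurable_indic.
  rewrite integral_indic// setIT [X in (V x * X)%E](_ : _ = (f x)%:E); first by rewrite muleC.
  rewrite [LHS]lebesgue_measure_itv/= lte_fin; case: ltP => [_|f0']; first by rewrite sube0.
  by congr EFin; apply/esym/le_anti; rewrite f0' f0.
have mfE : mfunT (EFin \o f) by exact/measurable_EFinP.
rewrite -ge0_integralZr//; last by move=> x _; rewrite lee_fin.
rewrite layer// (layer (cst c%:E))//; apply: eq_integral => u _.
have sA : <<s G >> (A u).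
  rewrite (_ : A u = if 0 <= u then f @^-1` `]u, +oo[%classic else set0); last first.
    by apply/seteqP; split => x; rewrite /A /=; case: ifP => //= _; rewrite in_itv/= andbT.
  by case: ifP => _; [apply: sf|exact: sigma_algebra0].
have mI : mfunT (EFin \o (\1_(A u) : T -> R)) by apply/measurable_EFinP/measurable_indic/Gm.
have I0 x : setT x -> (0 <= (EFin \o (\1_(A u) : T -> R)) x)%E by rewrite lee_fin.
have := ge0_integralZr P measurableT mI I0 (c0 : (0 <= c%:E)%E) => /= ->.
have mAu := Gm _ sA; by rewrite (hW _ sA) integral_indic// setIT EFinM -PrE.
Qed.

(** The layer-cake argument asks for nonnegative functions; [f] and [W] are raised by their bounds
    and the extra terms cancel at the end. *)
Lemma indep2_bounded (G : set (set T)) (W f : T -> R) :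
  <<s G >> `<=` measurable -> bmf W ->
  (forall A, <<s G >> A -> Ex P (fun x => \1_A x * W x) = Pr P A * Ex P W) ->
  smeas G f -> (exists M, forall x, `|f x| <= M) ->
  Ex P (fun x => f x * W x) = Ex P f * Ex P W.
Proof.
move=> Gm bW h sf [M hM].
have mf := smeas_measurable Gm sf.
have bf : bmf f by split => //; exists M.
have [mW [N hN]] := bW.
pose W1 x := W x + N; pose f1 x := f x + M.
have bW1 : bmf W1 by apply: bmfD => //; exact: bmf_cst.
have bf1 : bmf f1 by apply: bmfD => //; exact: bmf_cst.
have W10 x : 0 <= W1 x by have := hN x; rewrite ler_norml /W1 => /andP[]; lra.
have f10 x : 0 <= f1 x by have := hM x; rewrite ler_norml /f1 => /andP[]; lra.
have sf1 : smeas G f1.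
  by apply/smeasP; apply: measurable_funD => //; apply/smeasP.
have E1 : Ex P W1 = Ex P W + N by rewrite ExD ?Ex_cst//; exact: bmf_cst.
have E2 : Ex P f1 = Ex P f + M by rewrite ExD ?Ex_cst//; exact: bmf_cst.
have key : (\int[P]_x ((f1 x)%:E * (W1 x)%:E) = \int[P]_x (f1 x)%:E * (Ex P W1)%:E)%E.
  apply: (indep2_ge0 (G := G)) => //.
  - by apply/measurable_EFinP; have [] := bW1.
  - exact: Ex_ge0.
  - move=> A sA; have mA := Gm _ sA.
    under eq_integral do rewrite -EFinM.
    rewrite ExE; last by apply: bmfM => //; exact: bmf_indic.
    congr EFin; under Ex_ext do rewrite mulrDr.
    rewrite ExD; [|by apply: bmfM => //; exact: bmf_indic|
      by apply: bmfM; [exact: bmf_indic|exact: bmf_cst]].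
    rewrite h// E1 mulrDr; congr (_ + _).
    under Ex_ext do rewrite mulrC; rewrite ExZ; last exact: bmf_indic.
    by rewrite Ex_indic// mulrC.
have : Ex P (fun x => f1 x * W1 x) = Ex P f1 * Ex P W1.
  apply: EFin_inj; rewrite -ExE; last exact: bmfM.
  by under eq_integral do rewrite EFinM; rewrite key ExE// EFinM.
rewrite E1 E2.
transitivity (Ex P (fun x => f1 x * W1 x) - N * Ex P f - M * Ex P W - M * N); last first.
  by rewrite H; ring.
rewrite /f1 /W1.
have e : (fun x => (f x + M) * (W x + N)) = (fun x => f x * W x + (N * f x + (M * W x + M * N))).
  by apply/funext => x; ring.
have bMW : bmf (fun x => M * W x + M * N) by apply: bmfD; [exact: bmfZ|exact: bmf_cst].
rewrite e ExD; [|exact: bmfM|by apply: bmfD => //; exact: bmfZ].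
rewrite ExD//; last exact: bmfZ.
rewrite ExD; [|exact: bmfZ|exact: bmf_cst].
by rewrite (ExZ P N bf) (ExZ P M bW) Ex_cst; ring.
Qed.

Variable I : finType.
Variable G : I -> set (set T).
Hypotheses (Gm : forall i, <<s G i >> `<=` measurable) (ind : indep_sigma P (fun i => <<s G i >>)).

Lemma prod_indic (A : I -> set T) x :
  \prod_i (\1_(A i) x : R) = \1_(\bigcap_i A i) x.
Proof.
rewrite [RHS]indicE; case: (boolP (x \in _)) => h.
  rewrite big1// => i _; rewrite indicE mem_set//.
  by move: h; rewrite inE; apply.
have [i hi] : exists i, ~ A i x.
  apply/existsNP => h'; move: h; rewrite notin_setE; apply=> i _; exact: h'.
by rewrite (bigD1 i)//= indicE memNset// mul0r.
Qed.

(** Indicators are replaced by functions one index at a time. The list [s] holds the indices already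
    treated while the others keep arbitrary events: this generality makes the induction hypothesis
    usable in [indep2_ge0] for the next index. *)
Lemma indep_prod_ge0 (f : I -> T -> R) (c : I -> R) :
  (forall i, smeas (G i) (f i)) -> (forall i x, 0 <= f i x) ->
  (forall i, \int[P]_x (f i x)%:E = (c i)%:E)%E ->
  (\int[P]_x (\prod_i f i x)%:E = (\prod_i c i)%:E)%E.
Proof.
move=> sf f0 hc.
have c0 i : 0 <= c i.
  by rewrite -lee_fin -hc integral_ge0// => x _; rewrite lee_fin.
pose g (s : seq I) (A : I -> set T) i x : R := if i \in s then f i x else \1_(A i) x.
pose k (s : seq I) (A : I -> set T) i : R := if i \in s then c i else Pr P (A i).
have key s : uniq s -> forall A, (forall i, <<s G i >> (A i)) ->
    (\int[P]_x (\prod_i g s A i x)%:E = (\prod_i k s A i)%:E)%E.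
  elim: s => [_ A sA|j s IH /= /andP[js us] A sA].
    rewrite /g /k /=.
    under eq_integral do rewrite prod_indic.
    rewrite integral_indic//; last first.
      by apply: fin_bigcap_measurable => [|i _]; [exact: finite_finset|exact: Gm].
    rewrite setIT; transitivity (\prod_i P (A i))%E; first exact: (ind sA).
    by rewrite -prodEFin; apply: eq_bigr => i _; rewrite PrE//; exact: Gm.
  pose W x : R := \prod_(i | i != j) g s A i x.
  pose cW : R := \prod_(i | i != j) k s A i.
  have gs0 i x : 0 <= g s A i x by rewrite /g; case: ifP => _ //; rewrite indicE.
  have mgs i : mfunT (g s A i).
    have [h|/negbTE h] := boolP (i \in s); rewrite /g h.
      exact: smeas_measurable (sf i).
    by apply: measurable_indic; exact: Gm.
  have mW : mfunT W.
    rewrite /W; elim: (index_enum I) => [|i r IHr].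
      by under eq_fun do rewrite big_nil; exact: measurable_cst.
    have [h|/negbTE h] := boolP (i != j); last by under eq_fun do rewrite big_cons h.
    under eq_fun do rewrite big_cons h.
    exact: measurable_funM.
  have cW0 : 0 <= cW.
    by apply: prodr_ge0 => i _; rewrite /k; case: ifP => _ //; exact: Pr_ge0.
  have hB B : <<s G j >> B -> (\int[P]_x ((\1_B x)%:E * (W x)%:E) = (Pr P B * cW)%:E)%E.
    move=> sB; pose A' i := if i == j then B else A i.
    have sA' i : <<s G i >> (A' i) by rewrite /A'; case: eqP => [->|].
    have kj : k s A' j = Pr P B by rewrite /k (negbTE js) /A' eqxx.
    have gj x : g s A' j x = \1_B x by rewrite /g (negbTE js) /A' eqxx.
    have := IH us A' sA'.
    rewrite [X in _ = X%:E -> _](bigD1 j)//= kj.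
    have -> : \prod_(i | i != j) k s A' i = cW.
      by apply: eq_bigr => i ij; rewrite /k /A' (negbTE ij).
    move=> <-; apply: eq_integral => x _; rewrite -EFinM (bigD1 j)//=; congr EFin.
    rewrite gj; congr (_ * _).
    by apply: eq_bigr => i ij; rewrite /g /A' (negbTE ij).
  have mWE : mfunT (EFin \o W) by exact/measurable_EFinP.
  have WE0 x : (0 <= (EFin \o W) x)%E by rewrite lee_fin prodr_ge0.
  have e := @indep2_ge0 (G j) (EFin \o W) cW (f j) (@Gm j) mWE WE0 cW0 hB (sf j) (f0 j).
  transitivity (\int[P]_x ((f j x)%:E * (W x)%:E))%E.
    apply: eq_integral => x _; rewrite -EFinM (bigD1 j)//=; congr EFin.
    rewrite [in LHS]/g inE eqxx; congr (_ * _).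
    by apply: eq_bigr => i ij; rewrite /g inE (negbTE ij).
  rewrite [LHS]e.
  rewrite hc -EFinM [in RHS](bigD1 j)//=; congr EFin.
  have -> : k (j :: s) A j = c j by rewrite /k inE eqxx.
  congr (_ * _).
  by apply: eq_bigr => i ij; rewrite /k inE (negbTE ij).
transitivity (\int[P]_x (\prod_i g (enum I) (fun=> setT) i x)%:E)%E.
  by apply: eq_integral => x _; congr EFin; apply: eq_bigr => i _; rewrite /g mem_enum.
rewrite key//.
  by congr EFin; apply: eq_bigr => i _; rewrite /k mem_enum.
- exact: enum_uniq.
- move=> i; exact: (@measurableT _ (g_sigma_algebraType (G i))).
Qed.

(* Sums of independent symmetric variables, one of them for each sigma-algebra,
   whose characteristic functions are [e i]. *)
Lemma indep_cos_sum (th : I -> T -> R) (e : I -> R) :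
  (forall i, smeas (G i) (th i)) ->
  (forall i t, Ex P (fun x => cos (th i x + t)) = e i * cos t) ->
  forall t, Ex P (fun x => cos (\sum_i th i x + t)) = (\prod_i e i) * cos t.
Proof.
move=> sth he.
have mth i : mfunT (th i) by exact: smeas_measurable (sth i).
have msum (s : seq I) t : mfunT (fun x => \sum_(i <- s) th i x + t).
  by apply: measurable_funD => //; exact: measurable_sum.
have bB (s : seq I) (A : I -> set T) : (forall i, <<s G i >> (A i)) ->
    bmf (fun x => \prod_(i | i \notin s) (\1_(A i) x : R)).
  move=> sA; elim: (index_enum I) => [|i r IHr].
    by under eq_fun do rewrite big_nil; exact: bmf_cst.
  have [h|/negbTE h] := boolP (i \notin s); last by under eq_fun do rewrite big_cons h.
  under eq_fun do rewrite big_cons h.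
  by apply: bmfM => //; apply: bmf_indic; exact: Gm.
have key (s : seq I) : uniq s -> forall A, (forall i, <<s G i >> (A i)) -> forall t,
    Ex P (fun x => cos (\sum_(i <- s) th i x + t) * \prod_(i | i \notin s) (\1_(A i) x : R)) =
    (\prod_(i <- s) e i) * cos t * \prod_(i | i \notin s) Pr P (A i).
  elim: s => [_ A sA t|j s IH /= /andP[js us] A sA t].
    under Ex_ext do rewrite big_nil add0r /= prod_indic.
    rewrite big_nil mul1r ExZ; last first.
      by apply: bmf_indic; apply: fin_bigcap_measurable => [|i _]; [exact: finite_finset|exact: Gm].
    rewrite Ex_indic; last by apply: fin_bigcap_measurable => [|i _]; [exact: finite_finset|exact: Gm].
    congr (_ * _); apply: EFin_inj; rewrite -[LHS]PrE; last first.
      by apply: fin_bigcap_measurable => [|i _]; [exact: finite_finset|exact: Gm].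
    rewrite (ind sA) -prodEFin; apply: eq_bigr => i _; rewrite PrE//; exact: Gm.
  pose B x : R := \prod_(i | i \notin j :: s) \1_(A i) x.
  pose W t x := cos (\sum_(i <- s) th i x + t) * B x.
  have bW t' : bmf (W t') by apply: bmfM; [exact: bmf_cos|exact: bB].
  pose cB := \prod_(i | i \notin j :: s) Pr P (A i).
  have hW t' D : <<s G j >> D ->
      Ex P (fun x => \1_D x * W t' x) = Pr P D * ((\prod_(i <- s) e i) * cos t' * cB).
    move=> sD; pose A' i := if i == j then D else A i.
    have sA' i : <<s G i >> (A' i) by rewrite /A'; case: eqP => [->|].
    have e1 (F : I -> R) : \prod_(i | i \notin s) F i = F j * \prod_(i | i \notin j :: s) F i.
      rewrite (bigD1 j)//=; congr (_ * _); apply: eq_bigl => i.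
      by rewrite inE negb_or andbC.
    have e2 (U V : Type) (F : set T -> R) : \prod_(i | i \notin j :: s) F (A' i) = \prod_(i | i \notin j :: s) F (A i).
      by apply: eq_bigr => i; rewrite inE negb_or => /andP[ij _]; rewrite /A' (negbTE ij).
    have := IH us A' sA' t'; rewrite e1 (e2 R R (Pr P)) /A' eqxx -/cB => h.
    transitivity ((\prod_(i <- s) e i) * cos t' * (Pr P D * cB)); last by ring.
    rewrite -h; apply: Ex_ext => x; rewrite e1 eqxx /W /B.
    rewrite (e2 R R (fun S => \1_S x)); ring.
  have EW t' : Ex P (W t') = (\prod_(i <- s) e i) * cos t' * cB.
    have := hW t' setT (@measurableT _ (g_sigma_algebraType (G j))).
    rewrite Pr_setT mul1r => <-; apply: Ex_ext => x.
    by rewrite indicT /= mul1r.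
  have iW t' (f : T -> R) : smeas (G j) f -> (exists M, forall x, `|f x| <= M) ->
      Ex P (fun x => f x * W t' x) = Ex P f * ((\prod_(i <- s) e i) * cos t' * cB).
    move=> sf bf; rewrite -EW; apply: (indep2_bounded (G := G j)) => // D sD.
    by rewrite hW// EW.
  have sc t' : smeas (G j) (fun x => cos (th j x + t')).
    apply/smeasP; apply: measurableT_comp.
      by apply: continuous_measurable_fun; exact: continuous_cos.
    by apply: measurable_funD => //; apply/smeasP.
  have bc t' : exists M, forall x, `|cos (th j x + t')| <= M.
    by exists 1 => x; rewrite ler_norml cos_geN1 cos_le1.
  (* The addition formula, with sines written as cosines of phase [- pi / 2] so that [iW] and [he]
     apply to both terms. The second term has mean 0, as [cos (pi / 2) = 0]. *)
  transitivity (Ex P (fun x => cos (th j x + 0) * W t x - cos (th j x - pi / 2) * W (t - pi / 2) x)).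
    apply: Ex_ext => x; rewrite big_cons -addrA [cos (th j x + (_ + _))]cosD [th j x + 0]addr0 /W.
    rewrite [\sum_(i <- s) th i x + (t - pi / 2)]addrA !cosBpihalf.
    by rewrite -/(B x); ring.
  have bcW t1 t2 : bmf (fun x => cos (th j x + t1) * W t2 x).
    by apply: bmfM => //; apply: bmf_cos; apply: measurable_funD.
  rewrite ExB//.
  rewrite (iW _ (fun x => cos (th j x + 0)))// (iW _ (fun x => cos (th j x + - (pi / 2))))//.
  rewrite !he cos0 cosN cos_pihalf !mulr0 mul0r subr0 big_cons /cB; ring.
move=> t; have := key (enum I) (enum_uniq I) (fun=> setT)
  (fun i => @measurableT _ (g_sigma_algebraType (G i))) t.
rewrite [X in _ = _ * X -> _]big_pred0; last by move=> i; rewrite mem_enum.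
rewrite mulr1 big_enum/= => <-; apply: Ex_ext => x.
rewrite [X in _ = _ * X]big_pred0; last by move=> i; rewrite mem_enum.
by rewrite mulr1 big_enum.
Qed.

End SubSigma.

(** * Gaussian vectors and independence of columns *)

Section GaussianVectors.
Context {R : realType} {d} {T : measurableType d}.
Variable P : probability T R.
Notation nu := (@normal_prob R 0 1).

Lemma random_mxP m q (M : T -> 'M[R]_(m, q)) :
  random_mx M -> <<s [set E | exists i j (B : set R),
         measurable B /\ E = (fun w => M w i j) @^-1` B] >> `<=` (measurable : set (set T)).
Proof.
move=> mM; apply: smallest_sub; first exact: sigma_algebra_measurable.
move=> _ [i [j [B [mB ->]]]]; rewrite -[X in measurable X]setTI; exact: mM.
Qed.

Lemma sigma_mx_measurable m q (M : T -> 'M[R]_(m, q)) :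
  random_mx M -> sigma_mx M `<=` (measurable : set (set T)).
Proof. exact: random_mxP. Qed.

Definition gen_mx m q (M : T -> 'M[R]_(m, q)) : set (set T) :=
  [set E | exists i j (B : set R), measurable B /\ E = (fun w => M w i j) @^-1` B].

Lemma smeas_entry m q (M : T -> 'M[R]_(m, q)) i j : smeas (gen_mx M) (fun w => M w i j).
Proof. by move=> B mB; apply: sub_gen_smallest; exists i, j, B. Qed.

Lemma smeas_cst (G : set (set T)) (c : R) : smeas G (fun=> c).
Proof. by apply/smeasP; exact: measurable_cst. Qed.

Lemma smeasD (G : set (set T)) (f g : T -> R) : smeas G f -> smeas G g ->
  smeas G (fun x => f x + g x).
Proof. by move=> /smeasP mf /smeasP mg; apply/smeasP; exact: measurable_funD. Qed.

Lemma smeasM (G : set (set T)) (f g : T -> R) : smeas G f -> smeas G g ->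
  smeas G (fun x => f x * g x).
Proof. by move=> /smeasP mf /smeasP mg; apply/smeasP; exact: measurable_funM. Qed.

Lemma smeas_sum (G : set (set T)) (I : Type) (r : seq I) (F : I -> T -> R) :
  (forall i, smeas G (F i)) -> smeas G (fun x => \sum_(i <- r) F i x).
Proof.
move=> hF; elim: r => [|i r IH].
  by under eq_fun do rewrite big_nil; exact: smeas_cst.
by under eq_fun do rewrite big_cons; exact: smeasD.
Qed.

Lemma smeas_comp (G : set (set T)) (f : T -> R) (h : R -> R) :
  mfunT h -> smeas G f -> smeas G (h \o f).
Proof. by move=> mh /smeasP mf; apply/smeasP; exact: measurableT_comp. Qed.

Definition lin1 m (a : 'cV[R]_m) (x : T -> 'cV[R]_m) (w : T) : R := (a^T *m x w) 0 0.

Lemma lin1E m (a : 'cV[R]_m) (x : T -> 'cV[R]_m) w : lin1 a x w = \sum_i a i 0 * x w i 0.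
Proof. by rewrite /lin1 mxE; apply: eq_bigr => i _; rewrite mxE. Qed.

Lemma measurable_lin1 m (a : 'cV[R]_m) (x : T -> 'cV[R]_m) :
  random_mx x -> mfunT (lin1 a x).
Proof.
move=> mx; rewrite (_ : lin1 a x = fun w => \sum_i a i 0 * x w i 0); last first.
  by apply/funext => w; exact: lin1E.
by apply: measurable_sum => i; apply: measurable_funM => //; exact: mx.
Qed.

Section Law.
Variables (m : nat) (x : T -> 'cV[R]_m) (S : 'M[R]_m).
Hypotheses (mx : random_mx x) (gx : gaussian_vec P x S).

(** The law is written as the image of N(0, 1) under a scaling, a form that includes the degenerate
    variance 0 and so spares a case distinction in every later use. For positive variance [a] is
    first normalised. *)
Lemma gaussian_lin_law (a : 'cV[R]_m) (A : set R) : measurable A ->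
  P (lin1 a x @^-1` A) =
  nu ((fun z => sqrt ((a^T *m S *m a) 0 0) * z) @^-1` A).
Proof.
move=> mA; have [_ pS law] := gx.
set v := (a^T *m S *m a) 0 0; have := pS a; rewrite -/v le_eqVlt => /orP[/eqP v0|v0].
  rewrite law// -/v -v0 /centered_normal ltxx sqrtr0 diracE.
  rewrite (_ : _ @^-1` A = if 0 \in A then setT else set0).
    by case: ifP => _; rewrite ?probability_setT// measure0.
  apply/seteqP; split => z /=; rewrite mul0r; case: ifP => //.
    by move=> /negP h hA; apply: h; rewrite inE.
  by rewrite inE.
have sv : 0 < sqrt v by rewrite sqrtr_gt0.
pose b := (sqrt v)^-1 *: a.
have vb : (b^T *m S *m b) 0 0 = 1.
  rewrite /b [(_ *: a)^T]linearZ/= -!scalemxAl -scalemxAr scalerA mxE -/v.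
  by rewrite -invfM -expr2 sqr_sqrtr ?mulVf ?gt_eqF ?ltW.
have mA' : measurable ((fun z => sqrt v * z) @^-1` A).
  rewrite -[X in measurable X]setTI.
  by apply: (measurable_funM (measurable_cst _) (@measurable_id _ _ setT)).
have := law b _ mA'; rewrite vb /centered_normal ltr01 sqrtr1 => <-.
have e w : sqrt v * (b^T *m x w) 0 0 = lin1 a x w.
  rewrite /lin1 /b [(_ *: a)^T]linearZ/= -scalemxAl [X in _ * X]mxE.
  by rewrite mulrA divff ?gt_eqF// mul1r.
by congr (P _); apply/seteqP; split => w /=; rewrite e.
Qed.

Lemma gaussian_lin_integral (a : 'cV[R]_m) (f : R -> \bar R) :
  mfunT f -> (forall z, 0 <= f z)%E ->
  (\int[P]_w f (lin1 a x w) =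
   \int[nu]_z f (sqrt ((a^T *m S *m a) 0 0) * z)%R)%E.
Proof.
move=> mf f0; set s := sqrt _.
apply: (integral_law_eq (Q := nu) (Y := fun z => s * z) (T' := measurableTypeR R)) => //.
- exact: measurable_lin1.
- exact: measurable_funM.
- exact: gaussian_lin_law.
Qed.

Lemma gaussian_lin_Ex (a : 'cV[R]_m) (f : R -> R) : bmf f ->
  Ex P (fun w => f (lin1 a x w)) =
  Ex nu (fun z => f (sqrt ((a^T *m S *m a) 0 0) * z)).
Proof.
move=> bf; have [mf [M hM]] := bf; set s := sqrt _.
have ml := measurable_lin1 a mx.
have b1 : bmf (fun w => f (lin1 a x w)).
  by split; [exact: measurableT_comp mf ml|exists M].
have b2 : bmf (fun z : measurableTypeR R => f (s * z)).
  by split; [apply: measurableT_comp => //; exact: measurable_funM|exists M].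
apply: (@addIr _ M).
rewrite -[X in _ + X = _](Ex_cst P) -[X in _ = _ + X](Ex_cst nu).
rewrite -!ExD//; try exact: bmf_cst.
apply: EFin_inj; rewrite -!ExE; try by apply: bmfD => //; exact: bmf_cst.
apply: (@gaussian_lin_integral a (fun y => (f y + M)%:E)).
- by apply/measurable_EFinP; apply: measurable_funD.
- by move=> z; rewrite lee_fin; have := hM z; rewrite ler_norml => /andP[]; lra.
Qed.

Lemma gaussian_cos (a : 'cV[R]_m) (t : R) :
  Ex P (fun w => cos (lin1 a x w + t)) =
  expR (- ((a^T *m S *m a) 0 0) / 2) * cos t.
Proof.
have [_ pS _] := gx.
rewrite (gaussian_lin_Ex a (f := fun y => cos (y + t))); last first.
  by apply: bmf_cos; exact: measurable_funD.
by rewrite Ex_cos_normal sqr_sqrtr.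
Qed.

Lemma gaussian_expsq (a : 'cV[R]_m) (th : R) : 2 * th * (a^T *m S *m a) 0 0 < 1 ->
  (\int[P]_w (expR (th * lin1 a x w ^+ 2))%:E =
   ((sqrt (1 - 2 * th * (a^T *m S *m a) 0 0))^-1)%:E)%E.
Proof.
move=> h; have [_ pS _] := gx.
rewrite (gaussian_lin_integral a (f := fun y => (expR (th * y ^+ 2))%:E)).
- set v := (_ *m _) 0 0 in h *.
  under eq_integral do rewrite exprMn mulrA (sqr_sqrtr (pS a)).
  by rewrite integral_expsq -/v; [rewrite mulrA|lra].
- apply/measurable_EFinP; apply: measurableT_comp => //.
  by apply: measurable_funM => //; exact: measurable_funX.
- by move=> z; rewrite lee_fin expR_ge0.
Qed.

Lemma gaussian_tail (a : 'cV[R]_m) (t : R) : 0 <= t -> (a^T *m S *m a) 0 0 = 1 ->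
  Pr P [set w | t < `|lin1 a x w|] = 2 * Phibar t.
Proof.
move=> t0 a1; rewrite -nu_tail// /Pr; congr fine.
rewrite (_ : [set w | _] = lin1 a x @^-1` [set z | t < `|z|])//.
rewrite gaussian_lin_law ?a1 ?sqrtr1; last exact: measurable_tail.
by congr (nu _); apply/seteqP; split => z /=; rewrite mul1r.
Qed.

End Law.

Lemma rows_cos m q (X : T -> 'M[R]_(m, q)) (S : 'M[R]_q) :
  random_mx X -> iid_gaussian_rows P X S ->
  forall (C : 'M[R]_(m, q)) t,
  Ex P (fun w => cos (\sum_i \sum_j C i j * X w i j + t)) =
  expR (- (\sum_i (row i C *m S *m (row i C)^T) 0 0) / 2) * cos t.
Proof.
move=> mX [ind gr] C t.
have mr i : random_mx (fun w => row i (X w)).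
  move=> a b; rewrite (_ : (fun w => _) = (fun w => X w i b)) //.
  by apply/funext => w; rewrite mxE.
have mrT i : random_mx (fun w => (row i (X w))^T).
  move=> a b; rewrite (_ : (fun w => _) = (fun w => X w i a)) //.
  by apply/funext => w; rewrite !mxE.
have := @indep_cos_sum _ _ _ P 'I_m (fun i => gen_mx (fun w => row i (X w)))
  (fun i => sigma_mx_measurable (mr i)) ind
  (fun i w => \sum_j C i j * X w i j)
  (fun i => expR (- ((row i C *m S *m (row i C)^T) 0 0) / 2)).
move=> ->.
- rewrite -expR_sum; congr (expR _ * _).
  by rewrite -mulr_suml sumrN.
- move=> i; apply: smeas_sum => j; apply: smeasM; first exact: smeas_cst.
  have := smeas_entry (M := fun w => row i (X w)) 0 j.
  by congr (smeas _ _); apply/funext => w; rewrite mxE.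
- move=> i u; have := gaussian_cos (mrT i) (gr i) (row i C)^T u.
  rewrite trmxK => <-; apply: Ex_ext => w; congr (cos (_ + _)).
  by rewrite lin1E; apply: eq_bigr => j _; rewrite !mxE.
Qed.

(* Entries with a diagonal covariance: the columns are independent. *)
Lemma columns_indep m q (X : T -> 'M[R]_(m, q)) (v : 'I_q -> R) :
  random_mx X ->
  (forall (C : 'M[R]_(m, q)) t,
    Ex P (fun w => cos (\sum_i \sum_j C i j * X w i j + t)) =
    expR (- (\sum_i \sum_j C i j ^+ 2 * v j) / 2) * cos t) ->
  indep_sigma P (fun j => sigma_mx (fun w => col j (X w))).
Proof.
move=> mX hcos A sA.
have mc j : random_mx (fun w => col j (X w)).
  move=> a b; rewrite (_ : (fun w => _) = (fun w => X w a j)) //.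
  by apply/funext => w; rewrite mxE.
have mA j : measurable (A j) by exact: sigma_mx_measurable (mc j) _ (sA j).
pose L (C : 'M[R]_(m, q)) w := \sum_i \sum_j C i j * X w i j.
pose Q (C : 'M[R]_(m, q)) := \sum_i \sum_j C i j ^+ 2 * v j.
have mL (C : 'M[R]_(m, q)) t : mfunT (fun w => L C w + t).
  apply: measurable_funD => //; apply: measurable_sum => i; apply: measurable_sum => j.
  by apply: measurable_funM => //; exact: mX.
have bcos (C : 'M[R]_(m, q)) t : bmf (fun w => cos (L C w + t)) by exact: bmf_cos.
have bpr (s : seq 'I_q) : bmf (fun w => \prod_(j <- s) (\1_(A j) w : R)).
  by apply: bmf_prod => j; exact: bmf_indic.
have key (s : seq 'I_q) : uniq s -> forall C : 'M[R]_(m, q), (forall i j, j \in s -> C i j = 0) -> forall t,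
   Ex P (fun w => (\prod_(j <- s) (\1_(A j) w : R)) * cos (L C w + t)) =
   (\prod_(j <- s) Pr P (A j)) * (expR (- Q C / 2) * cos t).
  elim: s => [_ C _ t|j0 s IH /= /andP[js us] C C0 t].
    under Ex_ext do rewrite big_nil mul1r.
    by rewrite big_nil mul1r hcos.
  have C0s i j : j \in s -> C i j = 0 by move=> h; apply: C0; rewrite inE h orbT.
  pose V0 w := (\prod_(j <- s) (\1_(A j) w : R)) * cos (L C w + t).
  pose k := (\prod_(j <- s) Pr P (A j)) * (expR (- Q C / 2) * cos t).
  have bV0 : bmf V0 by exact: bmfM.
  (* The centred product over the columns already treated. Orthogonality to all trigonometric
     functions of column [j0] yields orthogonality to the event [A j0], which is the induction
     step. *)
  pose V w := V0 w - k.
  have bV : bmf V by apply: bmfB => //; exact: bmf_cst.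
  pose Y i w := X w i j0.
  have mY i : mfunT (Y i) by exact: mX.
  pose U (u : 'I_m -> R) : 'M[R]_(m, q) := \matrix_(i, j) (if j == j0 then u i else 0).
  have LU u w : L (U u) w = \sum_i u i * Y i w.
    apply: eq_bigr => i _; rewrite (bigD1 j0)//= big1 ?addr0 ?mxE ?eqxx//.
    by move=> j /negbTE jj; rewrite mxE jj mul0r.
  have LD C1 C2 w : L (C1 + C2) w = L C1 w + L C2 w.
    rewrite /L -big_split; apply: eq_bigr => i _ /=; rewrite -big_split/=.
    by apply: eq_bigr => j _; rewrite mxE mulrDl.
  have LN C1 w : L (- C1) w = - L C1 w.
    rewrite /L -sumrN; apply: eq_bigr => i _ /=; rewrite -sumrN.
    by apply: eq_bigr => j _; rewrite mxE mulNr.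
  (* [C] vanishes on column [j0] and [U u] outside it, so that there is no cross term. *)
  have QD u (e : R) : e ^+ 2 = 1 -> Q (C + e *: U u) = Q C + Q (U u).
    move=> e1; rewrite /Q -big_split; apply: eq_bigr => i _ /=; rewrite -big_split/=.
    apply: eq_bigr => j _; rewrite !mxE -mulrDl; congr (_ * _).
    case: eqP => [->|_]; last by rewrite mulr0 addr0 expr0n addr0.
    by rewrite C0 ?inE ?eqxx// add0r expr0n add0r exprMn e1 mul1r.
  have oV : orth P Y V.
    split=> // u t'.
    transitivity (Ex P (fun w => 2^-1 * ((\prod_(j <- s) (\1_(A j) w : R)) * cos (L (C + 1 *: U u) w + (t + t'))) +
       2^-1 * ((\prod_(j <- s) (\1_(A j) w : R)) * cos (L (C + (-1) *: U u) w + (t - t'))) - k * cos (L (U u) w + t'))).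
      apply: Ex_ext => w; rewrite scale1r scaleN1r !LD LN /V /V0 LU.
      set D := \sum_i u i * Y i w.
      have -> : L C w + D + (t + t') = (L C w + t) + (D + t') by ring.
      have -> : L C w - D + (t - t') = (L C w + t) - (D + t') by ring.
      move: (L C w + t) (D + t') => a b.
      by rewrite cosD cosB; field.
    have b1 C' t'' : bmf (fun w => 2^-1 * ((\prod_(j <- s) (\1_(A j) w : R)) * cos (L C' w + t''))).
      by apply: bmfZ; exact: bmfM.
    rewrite ExB; [|exact: bmfD|by apply: bmfZ].
    rewrite ExD// !ExZ; try exact: bmfM; last exact: bcos.
    have Cs e i j : j \in s -> (C + e *: U u) i j = 0.
      move=> h; rewrite !mxE C0s// (_ : j == j0 = false) ?mulr0 ?addr0//.
      by apply/negbTE; apply: contraNneq js => <-.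
    rewrite !IH//; try exact: Cs.
    rewrite !QD ?expr1n ?sqrrN ?expr1n// hcos -/(Q _) /k cosD cosB.
    rewrite (_ : - (Q C + Q (U u)) / 2 = - Q C / 2 + - Q (U u) / 2); last by ring.
    by rewrite expRD; field.
  have : Ex P (fun w => V w * \1_(A j0) w) = 0.
    apply: (orth_sigma mY oV _).2.
    have := sA j0; apply: sub_smallest2r => //.
    move=> _ [i [z [B [mB ->]]]]; exists i, B; split => //.
    by apply/seteqP; split => w /=; rewrite mxE.
  rewrite /V; under Ex_ext do rewrite mulrBl.
  rewrite ExB; [|by apply: bmfM => //; exact: bmf_indic|by apply: bmfZ; exact: bmf_indic].
  rewrite ExZ; last exact: bmf_indic.
  rewrite Ex_indic// => /eqP; rewrite subr_eq0 => /eqP h.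
  rewrite big_cons -mulrA -/k mulrC -h; apply: Ex_ext => w.
  by rewrite big_cons /V0; ring.
have := key (enum 'I_q) (enum_uniq _) 0 (fun i j _ => mxE _ _ _ _) 0.
rewrite /Q cos0 => h.
have mI : measurable (\bigcap_i A i).
  by apply: fin_bigcap_measurable => //; exact: finite_finset.
transitivity ((Pr P (\bigcap_i A i))%:E); first exact: PrE.
transitivity ((\prod_j Pr P (A j))%:E); last first.
  by rewrite -prodEFin; apply: eq_bigr => j _; rewrite PrE.
rewrite /Pr -(Ex_indic P mI).
have Q0 : \sum_(i < m) \sum_(j < q) (0 : 'M[R]_(m, q)) i j ^+ 2 * v j = 0.
  by rewrite big1// => i _; rewrite big1// => j _; rewrite mxE expr0n mul0r.
congr EFin; move: h; rewrite Q0 oppr0 mul0r expR0 !mulr1 !big_enum/= => <-.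
apply: Ex_ext => w.
have L0 : L 0 w = 0.
  by rewrite /L big1// => i _; rewrite big1// => j _; rewrite mxE mul0r.
by rewrite -prod_indic L0 add0r cos0 mulr1 big_enum.
Qed.

End GaussianVectors.

(** * Restricted isometry *)

Section QuadraticForms.
Context {R : realType}.

Definition bform m (A : 'M[R]_m) (u v : 'cV[R]_m) : R := (u^T *m A *m v) 0 0.
Definition qform m (A : 'M[R]_m) (u : 'cV[R]_m) : R := bform A u u.

Lemma bformE m (A : 'M[R]_m) u v : bform A u v = \sum_i \sum_j u i 0 * A i j * v j 0.
Proof.
rewrite /bform mxE exchange_big /=; apply: eq_bigr => j _.
by rewrite mxE mulr_suml; apply: eq_bigr => i _; rewrite mxE.
Qed.

Lemma bformDl m (A : 'M[R]_m) u u' v : bform A (u + u') v = bform A u v + bform A u' v.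
Proof. by rewrite /bform linearD/= !mulmxDl mxE. Qed.

Lemma bformDr m (A : 'M[R]_m) u v v' : bform A u (v + v') = bform A u v + bform A u v'.
Proof. by rewrite /bform mulmxDr mxE. Qed.

Lemma bformZl m (A : 'M[R]_m) k u v : bform A (k *: u) v = k * bform A u v.
Proof. by rewrite /bform [(k *: u)^T]linearZ/= -!scalemxAl mxE. Qed.

Lemma bformZr m (A : 'M[R]_m) k u v : bform A u (k *: v) = k * bform A u v.
Proof. by rewrite /bform -scalemxAr mxE. Qed.

Lemma bform_sym m (A : 'M[R]_m) u v : A^T = A -> bform A u v = bform A v u.
Proof.
move=> sA; rewrite /bform -[in LHS](trmxK (u^T *m A *m v)) mxE !trmx_mul trmxK sA mulmxA.
by [].
Qed.

Lemma bformBm m (A B : 'M[R]_m) u v : bform (A - B) u v = bform A u v - bform B u v.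
Proof. by rewrite /bform mulmxBr mulmxBl !mxE. Qed.

Lemma bform0l m (A : 'M[R]_m) v : bform A 0 v = 0.
Proof. by rewrite /bform trmx0 !mul0mx mxE. Qed.

Lemma qformZ m (A : 'M[R]_m) k u : qform A (k *: u) = k ^+ 2 * qform A u.
Proof. by rewrite /qform bformZl bformZr mulrA. Qed.

Lemma qformD m (A : 'M[R]_m) u v : A^T = A ->
  qform A (u + v) = qform A u + 2 * bform A u v + qform A v.
Proof. by move=> sA; rewrite /qform bformDl !bformDr (bform_sym v u sA); ring. Qed.

Lemma qformB m (A : 'M[R]_m) u v : A^T = A ->
  qform A (u - v) = qform A u - 2 * bform A u v + qform A v.
Proof.
move=> sA; rewrite -scaleN1r qformD// bformZr qformZ; ring.
Qed.

Lemma qform_conj m q (A : 'M[R]_m) (D : 'M[R]_(m, q)) u :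
  qform (D^T *m A *m D) u = qform A (D *m u).
Proof. by rewrite /qform /bform trmx_mul !mulmxA. Qed.

Lemma qform_gram n m (X : 'M[R]_(n, m)) u : qform (X^T *m X) u = sqnorm2 (X *m u).
Proof.
rewrite /qform /bform !mulmxA -trmx_mul -mulmxA mxE.
by apply: eq_bigr => i _; rewrite mxE expr2.
Qed.

Definition scol N (j : 'I_N * bool) : 'cV[R]_N := (-1) ^+ j.2 *: delta_mx j.1 0.

Definition ssum m N (f : {ffun 'I_m -> 'I_N * bool}) : 'cV[R]_N := \sum_k scol (f k).

Lemma bform_scol N (A : 'M[R]_N) j j' :
  bform A (scol j) (scol j') = (-1) ^+ j.2 * (-1) ^+ j'.2 * A j.1 j'.1.
Proof.
rewrite /scol bformZl bformZr mulrA; congr (_ * _).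
rewrite bformE (bigD1 j.1)//= (bigD1 j'.1)//= !mxE !eqxx/= mul1r mulr1.
rewrite big1 ?addr0; last by move=> k kj; rewrite !mxE (negbTE kj) mulr0.
rewrite big1 ?addr0// => i ij; rewrite big1// => k _.
by rewrite mxE (negbTE ij)/= !mul0r.
Qed.

Lemma qform_ssum m N (A : 'M[R]_N) (f : {ffun 'I_m -> 'I_N * bool}) :
  qform A (ssum f) = \sum_k \sum_l bform A (scol (f k)) (scol (f l)).
Proof.
rewrite /qform /ssum.
have hl v : bform A (\sum_k scol (f k)) v = \sum_k bform A (scol (f k)) v.
  elim/big_rec2: _ => [|i a b _ <-]; first exact: bform0l.
  by rewrite bformDl.
rewrite hl; apply: eq_bigr => k _.
elim/big_rec2: _ => [|i a b _ <-]; last by rewrite bformDr.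
by rewrite /bform mulmx0 mxE.
Qed.

(* Maurey's empirical method: a bound on integer combinations of [m] signed
   basis vectors extends to all vectors, at the price of a term in the l1-norm,
   since [c] is the mean of a random such combination, suitably scaled. *)
Lemma maurey N m (A B : 'M[R]_N) (x b : R) : (1 < m)%N -> 0 <= x ->
  (forall i, B i i <= b) ->
  (forall f : {ffun 'I_m -> 'I_N * bool}, `|qform A (ssum f)| <= x * qform B (ssum f)) ->
  forall c, `|qform A c| <= x * qform B c + 4 * x * b * norm1 c ^+ 2 / m%:R.
Proof.
move=> m1 x0 hb h c.
have m0 : (0 < m)%N by rewrite (ltn_trans _ m1).
have mR : 1 < m%:R :> R by rewrite ltr1n.
have diag (M : 'M[R]_N) i :
    qform M (ssum [ffun _ : 'I_m => (i, false)]) = m%:R ^+ 2 * M i i.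
  rewrite qform_ssum; under eq_bigr do under eq_bigr do rewrite !ffunE bform_scol /= expr0 !mul1r.
  rewrite sumr_const card_ord sumr_const card_ord -[LHS]mulr_natl -[X in _ * X = _]mulr_natl.
  by rewrite mulrA -expr2.
have Aii i : `|A i i| <= x * B i i.
  have := h [ffun _ => (i, false)]; rewrite !diag normrM ger0_norm ?exprn_ge0//.
  by rewrite mulrCA ler_pM2l// exprn_gt0// (lt_trans ltr01).
set L := norm1 c.
have L0 : 0 <= L by apply: sumr_ge0.
have [Lz|Lnz] := eqVneq L 0.
  have c0 : c = 0.
    apply/matrixP => i j; rewrite ord1 mxE; apply/eqP; rewrite -normr_eq0; apply/eqP.
    by move/psumr_eq0P : Lz; apply.
  by rewrite c0 /qform !bform0l normr0 mulr0 Lz expr0n/= mulr0 mul0r addr0.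
have Lp : 0 < L by rewrite lt_neqAle eq_sym Lnz.
(* A probability on signed basis vectors: index [i] is drawn with probability [|c i| / L] and always
   with the sign of [c i], so that one draw has mean [c / L]. *)
pose w (j : 'I_N * bool) : R := if (c j.1 0 < 0)%R == j.2 then `|c j.1 0| / L else 0.
have w0 j : 0 <= w j by rewrite /w; case: ifP => // _; rewrite divr_ge0.
have sumw (F : 'I_N * bool -> R) : \sum_j w j * F j =
    \sum_i `|c i 0| / L * F (i, (c i 0 < 0)%R).
  transitivity (\sum_i \sum_b w (i, b) * F (i, b)).
    by rewrite pair_bigA /=; apply: eq_bigr => -[i b'] _.
  apply: eq_bigr => i _; rewrite big_bool /w/=.
  by case: (c i 0 < 0); rewrite /= mul0r ?addr0 ?add0r.
have w1 : \sum_j w j = 1.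
  under eq_bigr do rewrite -[w _]mulr1.
  rewrite sumw; under eq_bigr do rewrite mulr1.
  by rewrite -mulr_suml -/(norm1 c) -/L divff.
have sgc i : (-1) ^+ (c i 0 < 0)%R * `|c i 0| = c i 0.
  have [cp|cn] := leP 0 (c i 0); first by rewrite expr0 mul1r ger0_norm.
  by rewrite expr1 mulN1r ltr0_norm// opprK.
(* Expectation over [m] independent draws, written as a finite sum, so that no probability space is
   involved. *)
pose Em (F : {ffun 'I_m -> 'I_N * bool} -> R) :=
  \sum_(f : {ffun 'I_m -> 'I_N * bool}) (\prod_(k < m) w (f k)) * F f.
have Emle F G : (forall f, F f <= G f) -> Em F <= Em G.
  by move=> FG; apply: ler_sum => f _; rewrite ler_wpM2l ?prodr_ge0.
have Em2 (g : 'I_N * bool -> 'I_N * bool -> R) k l : k != l ->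
    Em (fun f => g (f k) (f l)) = \sum_j \sum_j' w j * w j' * g j j'.
  move=> kl; rewrite /Em.
  transitivity (\sum_j \sum_j' \sum_(f : {ffun 'I_m -> 'I_N * bool})
     \prod_i (w (f i) * (if i == k then (f i == j)%:R else if i == l then (f i == j')%:R else 1) ) * g j j').
    under [RHS]eq_bigr do rewrite exchange_big /=.
    rewrite exchange_big /=; apply: eq_bigr => f _.
    have e j j' : \prod_i (w (f i) * (if i == k then (f i == j)%:R else if i == l then (f i == j')%:R else 1)) =
        (\prod_i w (f i)) * ((f k == j)%:R * (f l == j')%:R).
      rewrite big_split/=; congr (_ * _).
      rewrite (bigD1 k)//= eqxx; congr (_ * _).
      have lk : l != k by rewrite eq_sym.
      rewrite (bigD1 l)//= (negbTE lk) eqxx big1 ?mulr1//.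
      by move=> i /andP[/negbTE -> /negbTE ->].
    rewrite (bigD1 (f k))//= (bigD1 (f l))//= e !eqxx !mulr1.
    rewrite [X in _ = _ + X + _]big1 ?addr0; last first.
      by move=> j' jl; rewrite e [f l == _]eq_sym (negbTE jl) !mulr0 mul0r.
    rewrite [X in _ = _ + X]big1 ?addr0// => j jk; rewrite big1// => j' _.
    by rewrite e [f k == _]eq_sym (negbTE jk) mul0r mulr0 mul0r.
  apply: eq_bigr => j _; apply: eq_bigr => j' _.
  rewrite -mulr_suml; congr (_ * _).
  rewrite -(bigA_distr_bigA (fun i z => w z * (if i == k then (z == j)%:R else if i == l then (z == j')%:R else 1))).
  have pick z : \sum_y w y * (y == z)%:R = w z.
    rewrite (bigD1 z)//= eqxx mulr1 big1 ?addr0// => y /negbTE ->; by rewrite mulr0.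
  have lk : l != k by rewrite eq_sym.
  rewrite (bigD1 k)//= eqxx pick (bigD1 l)//= (negbTE lk) eqxx pick.
  rewrite big1 ?mulr1// => i /andP[/negbTE ik /negbTE il].
  by rewrite ik il; under eq_bigr do rewrite mulr1.
have Em1 (g : 'I_N * bool -> R) k : Em (fun f => g (f k)) = \sum_j w j * g j.
  rewrite /Em.
  transitivity (\sum_j \sum_(f : {ffun 'I_m -> 'I_N * bool})
     \prod_i (w (f i) * (if i == k then (f i == j)%:R else 1) ) * g j).
    rewrite exchange_big /=; apply: eq_bigr => f _.
    have e j : \prod_i (w (f i) * (if i == k then (f i == j)%:R else 1)) =
        (\prod_i w (f i)) * (f k == j)%:R.
      rewrite big_split/=; congr (_ * _).
      by rewrite (bigD1 k)//= eqxx big1 ?mulr1// => i /negbTE ->.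
    rewrite (bigD1 (f k))//= e eqxx mulr1 [X in _ = _ + X]big1 ?addr0// => j jk.
    by rewrite e [f k == _]eq_sym (negbTE jk) mulr0 mul0r.
  apply: eq_bigr => j _; rewrite -mulr_suml; congr (_ * _).
  rewrite -(bigA_distr_bigA (fun i z => w z * (if i == k then (z == j)%:R else 1))).
  rewrite (bigD1 k)//= eqxx (bigD1 j)//= eqxx mulr1.
  rewrite [X in (_ + X) * _]big1 ?addr0; last by move=> y /negbTE ->; rewrite mulr0.
  rewrite big1 ?mulr1// => i /negbTE ->.
  by under eq_bigr do rewrite mulr1.
(* The [m (m - 1)] pairs of distinct draws reproduce [qform M c]; the [m] diagonal pairs leave the
   diagonal of [M], the source of the l1 term. *)
have Emq (M : 'M[R]_N) : Em (fun f => qform M (ssum f)) =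
    (m%:R * (m%:R - 1)) / L ^+ 2 * qform M c + m%:R / L * \sum_i `|c i 0| * M i i.
  pose be j j' := bform M (scol j) (scol j').
  have -> : Em (fun f => qform M (ssum f)) = \sum_k \sum_l Em (fun f => be (f k) (f l)).
    rewrite /Em; under eq_bigr do rewrite qform_ssum mulr_sumr.
    rewrite exchange_big/=; apply: eq_bigr => k _.
    by rewrite [RHS]exchange_big /=; apply: eq_bigr => f _; rewrite mulr_sumr.
  have on k : Em (fun f => be (f k) (f k)) = (\sum_i `|c i 0| * M i i) / L.
    rewrite (Em1 (fun j => be j j)) sumw mulr_suml; apply: eq_bigr => i _.
    rewrite /be bform_scol /= -expr2 -exprM mulnC exprM sqrrN expr1n.
    by rewrite expr1n mul1r mulrAC.
  have off k l : k != l -> Em (fun f => be (f k) (f l)) = qform M c / L ^+ 2.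
    move=> kl; rewrite Em2// /qform bformE mulr_suml.
    transitivity (\sum_j w j * \sum_j' w j' * be j j').
      by apply: eq_bigr => j _; rewrite mulr_sumr; apply: eq_bigr => j' _; rewrite mulrA.
    rewrite sumw; apply: eq_bigr => i _; rewrite sumw mulr_suml mulr_sumr.
    apply: eq_bigr => j _; rewrite /be bform_scol /=.
    by rewrite -[in RHS](sgc i) -[in RHS](sgc j); field.
  transitivity (\sum_(k < m) ((\sum_i `|c i 0| * M i i) / L + (m%:R - 1) * (qform M c / L ^+ 2))).
    apply: eq_bigr => k _; rewrite (bigD1 k)//= on; congr (_ + _).
    under eq_bigr do rewrite off 1?eq_sym//.
    by rewrite sumr_const cardC1 card_ord -[LHS]mulr_natl -subn1 natrB.
  by rewrite sumr_const card_ord -[LHS]mulr_natl; field.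
pose Sd (M : 'M[R]_N) := \sum_i `|c i 0| * M i i.
have SdA : `|Sd A| <= x * (b * L).
  rewrite (le_trans (ler_norm_sum _ _ _))// /L /norm1 !mulr_sumr.
  apply: ler_sum => i _; rewrite normrM normr_id mulrC.
  rewrite [leRHS]mulrA ler_wpM2r// (le_trans (Aii i))// ler_wpM2l//.
have SdB : Sd B <= b * L.
  by rewrite mulr_sumr; apply: ler_sum => i _; rewrite mulrC ler_wpM2r.
have key : `|Em (fun f => qform A (ssum f))| <= x * Em (fun f => qform B (ssum f)).
  have -> : x * Em (fun f => qform B (ssum f)) = Em (fun f => x * qform B (ssum f)).
    by rewrite /Em mulr_sumr; apply: eq_bigr => f _; rewrite mulrCA.
  rewrite ler_norml; apply/andP; split.
    rewrite -[X in - X]mul1r -mulN1r mul1r /Em mulr_sumr -/(Em _).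
    apply: ler_sum => f _; rewrite mulrCA ler_wpM2l ?prodr_ge0// mulN1r.
    by have := h f; rewrite ler_norml => /andP[].
  by apply: Emle => f; have := h f; rewrite ler_norml => /andP[].
rewrite !Emq -!/(Sd _) in key.
set qA := qform A c in key *; set qB := qform B c in key *.
pose r := m%:R * (m%:R - 1) / L ^+ 2.
have r0 : 0 < r by rewrite divr_gt0 ?exprn_gt0// mulr_gt0 ?subr_gt0// (lt_trans ltr01).
have key2 : r * `|qA| <= r * (x * qB) + 2 * (m%:R * x * b).
  have e1 : m%:R / L * (x * (b * L)) = m%:R * x * b by field.
  have mL0 : 0 <= m%:R / L by rewrite divr_ge0.
  have h1 : `|m%:R / L * Sd A| <= m%:R * x * b.
    by rewrite normrM (ger0_norm mL0) -e1 ler_wpM2l.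
  have h2 : x * (m%:R / L * Sd B) <= m%:R * x * b.
    by rewrite -e1 mulrCA ler_wpM2l// ler_wpM2l.
  have h3 : r * `|qA| <= `|r * qA + m%:R / L * Sd A| + `|m%:R / L * Sd A|.
    rewrite -[X in X * _ <= _](ger0_norm (ltW r0)) -normrM.
    by rewrite -[X in `|X| <= _](addrK (m%:R / L * Sd A)); exact: ler_normB.
  rewrite -/r mulrDr in key; lra.
have : `|qA| <= x * qB + 2 * (m%:R * x * b) / r.
  by rewrite -(ler_pM2l r0) mulrDr (le_trans key2)// lerD2l [leRHS]mulrC divfK ?gt_eqF.
move=> /le_trans; apply; rewrite lerD2l.
have b0 : 0 <= x * b.
  have [i _] : exists i, true && (c i 0 != 0).
    apply/existsP; apply: contraNT Lnz; rewrite negb_exists => /forallP hh.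
    apply/eqP; apply: big1 => i _; have := hh i; rewrite /= negbK => /eqP ->.
    by rewrite normr0.
  have := le_trans (normr_ge0 _) (Aii i) => hB.
  by rewrite (le_trans hB)// ler_wpM2l.
have -> : 2 * (m%:R * x * b) / r = 2 * (x * b) * L ^+ 2 / (m%:R - 1).
  rewrite /r; field; rewrite (gt_eqF Lp) (gt_eqF (lt_trans ltr01 mR)) subr_eq0.
  by rewrite (gt_eqF mR).
(* The constant 4 comes from [1 / (m - 1) <= 2 / m], that is from [1 < m]. *)
have -> : 4 * x * b * L ^+ 2 / m%:R = 2 * (x * b) * L ^+ 2 * (2 / m%:R) by ring.
rewrite ler_wpM2l ?(mulr_ge0 _ (exprn_ge0 _ _)) ?(mulr_ge0 _ b0)//.
rewrite -[(_ - _)^-1]mul1r ler_pdivrMr ?subr_gt0// mulrAC ler_pdivlMr ?(lt_trans ltr01)//.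
have : 2 <= m%:R :> R by rewrite ler_nat.
lra.
Qed.

End QuadraticForms.

(** * Chi-square tails and the union bound over signed sums *)

Section ChiSquare.
Context {R : realType} {d} {T : measurableType d}.
Variable P : probability T R.

Lemma mem_bigsetU (I : finType) (F : I -> set T) i w : F i w ->
  (\big[setU/set0]_j F j) w.
Proof. by move=> Fi; rewrite (bigD1 i)//=; left. Qed.

Lemma Pr_le_integral (A : set T) (g : T -> R) (I : R) : measurable A ->
  mfunT g -> (forall w, 0 <= g w) -> (forall w, A w -> 1 <= g w) ->
  (\int[P]_w (g w)%:E = I%:E)%E -> Pr P A <= I.
Proof.
move=> mA mg g0 Ag gI.
rewrite -lee_fin -gI -PrE//.
have -> : P A = (\int[P]_w (\1_A w)%:E)%E by rewrite integral_indic// setIT.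
apply: ge0_le_integral => //.
- by apply/measurable_EFinP; exact: measurable_indic.
- by apply/measurable_EFinP.
- move=> w _; rewrite lee_fin indicE; have [/set_mem wA|_] := boolP (w \in A) => //.
  exact: Ag.
Qed.

(** The expansion of [- ln (1 - y) / 2] starts with [y / 2 + y^2 / 4]; doubling the quadratic term
    pays for the remainder when [|y| <= 1/4]. *)
Lemma inv_sqrt_le (y : R) : `|y| <= 4^-1 -> (sqrt (1 - y))^-1 <= expR (y / 2 + y ^+ 2 / 2).
Proof.
rewrite ler_norml => /andP[y1 y2].
set u := y / 2 + y ^+ 2 / 2.
have e0 : 0 < expR u by exact: expR_gt0.
have s0 : 0 < sqrt (1 - y) by rewrite sqrtr_gt0; lra.
rewrite -[leLHS]mul1r ler_pdivrMr//.
rewrite -(@ler_pXn2r _ 2)// ?nnegrE ?mulr_ge0 ?ler01 ?(ltW e0) ?(ltW s0)// exprMn sqr_sqrtr; last by lra.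
rewrite expr1n.
have h : 1 + u <= expR u by exact: expR_ge1Dx.
(* For [y <= 0], [(1 + y + y^2) (1 - y) = 1 - y^3] is at least 1; for [y > 0] it is not, and the
   larger square [(1 + u)^2] is used. *)
have [y0|y0] := leP y 0.
  have h2 : 1 + (y + y ^+ 2) <= expR u ^+ 2.
    rewrite [expR u ^+ 2]expr2 -expRD (_ : u + u = y + y ^+ 2); first exact: expR_ge1Dx.
    by rewrite /u; field.
  apply: (@le_trans _ _ ((1 + (y + y ^+ 2)) * (1 - y))); last by apply: ler_wpM2r => //; lra.
  nra.
have h2 : (1 + u) ^+ 2 <= expR u ^+ 2.
  by rewrite ler_pXn2r// nnegrE ?ltW// /u; nra.
apply: (@le_trans _ _ ((1 + u) ^+ 2 * (1 - y))); last by apply: ler_wpM2r => //; lra.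
have -> : (1 + u) ^+ 2 * (1 - y) = 1 + y ^+ 2 * ((1 - y) * (1 + y) ^+ 2 / 4 - y).
  by rewrite /u; field.
rewrite lerDl mulr_ge0 ?sqr_ge0// subr_ge0 ler_pdivlMr//; nra.
Qed.

Lemma sqnorm2_ge0 m (v : 'cV[R]_m) : 0 <= sqnorm2 v.
Proof. by apply: sumr_ge0 => i _; exact: sqr_ge0. Qed.

Variables (n p : nat) (X : T -> 'M[R]_(n, p)) (S : 'M[R]_p).
Hypotheses (mX : random_mx X) (gX : iid_gaussian_rows P X S).

Lemma random_row i : random_mx (fun w => row i (X w)).
Proof.
by move=> a b; under eq_fun do rewrite mxE; exact: mX.
Qed.

Lemma random_rowT i : random_mx (fun w => (row i (X w))^T).
Proof.
by move=> a b; under eq_fun do rewrite !mxE; exact: mX.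
Qed.

Lemma random_mulmxr q (V : 'M[R]_(p, q)) : random_mx (fun w => X w *m V).
Proof.
move=> a b; under eq_fun do rewrite mxE.
by apply: measurable_sum => i; apply: measurable_funM => //; exact: mX.
Qed.

Lemma measurable_sqnorm2 m (x : T -> 'cV[R]_m) : random_mx x ->
  mfunT (fun w => sqnorm2 (x w)).
Proof.
by move=> mx; apply: measurable_sum => i; apply: measurable_funX; exact: mx.
Qed.

Lemma chi_mgf (V : 'cV[R]_p) (th : R) : 2 * th * qform S V < 1 ->
  (\int[P]_w (expR (th * sqnorm2 (X w *m V)))%:E =
   ((sqrt (1 - 2 * th * qform S V))^-1 ^+ n)%:E)%E.
Proof.
move=> h; have [ind gr] := gX.
have e w : expR (th * sqnorm2 (X w *m V)) =
    \prod_i expR (th * lin1 V (fun w => (row i (X w))^T) w ^+ 2).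
  rewrite /sqnorm2 mulr_sumr expR_sum; apply: eq_bigr => i _.
  congr (expR (_ * _ ^+ 2)); rewrite lin1E mxE; apply: eq_bigr => j _.
  by rewrite !mxE mulrC.
under eq_integral do rewrite e.
rewrite (indep_prod_ge0 (G := fun i => gen_mx (fun w => row i (X w)))
  (fun i => sigma_mx_measurable (random_row i)) ind
  (c := fun=> (sqrt (1 - 2 * th * qform S V))^-1)).
- by rewrite prodr_const card_ord.
- move=> i; apply: (smeas_comp (h := fun z => expR (th * z ^+ 2))).
    apply: measurableT_comp => //; apply: measurable_funM => //.
  rewrite (_ : lin1 _ _ = fun w => \sum_j V j 0 * X w i j); last first.
    by apply/funext => w; rewrite lin1E; apply: eq_bigr => j _; rewrite !mxE.
  apply: smeas_sum => j; apply: smeasM; first exact: smeas_cst.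
  have := smeas_entry (M := fun w => row i (X w)) 0 j.
  by congr (smeas _ _); apply/funext => w; rewrite mxE.
- by move=> i w; exact: expR_ge0.
- by move=> i; rewrite (gaussian_expsq (random_rowT i) (gr i)).
Qed.

(** The sign of [y] selects the tail, so one computation serves both; a relative deviation [x]
    corresponds to [|y| = x / 4]. With [2 th v = y] the exponent per row is at most
    [- 2 y^2 + y^2 / 2]. *)
Lemma chi_chernoff (V : 'cV[R]_p) (y : R) : 0 < qform S V -> `|y| <= 4^-1 ->
  Pr P [set w | 4 * y ^+ 2 * (n%:R * qform S V) <=
     y * (sqnorm2 (X w *m V) - n%:R * qform S V)]
  <= expR (- (3 / 2 * y ^+ 2 * n%:R)).
Proof.
set v := qform S V => v0 y4.
pose th := y / (2 * v).
have e2 : 2 * th * v = y by rewrite /th; field; rewrite gt_eqF.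
have y1 : y < 1 by move: y4; rewrite ler_norml => /andP[]; lra.
have msq := measurable_sqnorm2 (random_mulmxr V).
pose c := - (y / 2 + 2 * y ^+ 2) * n%:R.
have -> : [set w | 4 * y ^+ 2 * (n%:R * v) <= y * (sqnorm2 (X w *m V) - n%:R * v)] =
   (fun w => th * sqnorm2 (X w *m V) + c) @^-1` `[0, +oo[%classic.
  apply/seteqP; split=> w /=; rewrite in_itv/= andbT.
    rewrite -subr_ge0 => h.
    rewrite (_ : _ + _ = (y * (sqnorm2 (X w *m V) - n%:R * v) - 4 * y ^+ 2 * (n%:R * v)) / (2 * v)).
      by rewrite divr_ge0// mulr_ge0// ltW.
    by rewrite /th /c; field; rewrite gt_eqF.
  rewrite -subr_ge0 => h.
  rewrite -subr_ge0 (_ : _ - _ = (th * sqnorm2 (X w *m V) + c) * (2 * v)).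
    by apply: mulr_ge0; [rewrite -[_ + _]subr0|rewrite mulr_ge0// ltW].
  by rewrite /th /c; field; rewrite gt_eqF.
have mf : mfunT (fun w => th * sqnorm2 (X w *m V) + c).
  by apply: measurable_funD => //; exact: measurable_funM.
apply: le_trans (_ : expR c * ((sqrt (1 - y))^-1 ^+ n) <= _).
  apply: (Pr_le_integral (g := fun w => expR (th * sqnorm2 (X w *m V) + c))).
  - by rewrite -[X in measurable X]setTI; apply: mf => //; exact: measurable_itv.
  - exact: measurableT_comp.
  - by move=> w; exact: expR_ge0.
  - by move=> w /=; rewrite in_itv/= andbT => h; rewrite -expR0 ler_expR.
  - under eq_integral do rewrite expRD mulrC EFinM.
    rewrite ge0_integralZl//.
    + by rewrite chi_mgf -/v e2.
    + by apply/measurable_EFinP; apply: measurableT_comp => //; exact: measurable_funM.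
apply: (@le_trans _ _ (expR c * expR (y / 2 + y ^+ 2 / 2) ^+ n)).
  rewrite ler_pM2l ?expR_gt0// lerXn2r ?nnegrE ?invr_ge0 ?sqrtr_ge0 ?expR_ge0//.
  exact: inv_sqrt_le.
rewrite -expRM_natl -expRD ler_expR /c -mulr_natl; lra.
Qed.

Lemma chi_tail (V : 'cV[R]_p) (x : R) : 0 < qform S V -> 0 < x -> x <= 1 -> (0 < n)%N ->
  Pr P [set w | x * (n%:R * qform S V) < `|sqnorm2 (X w *m V) - n%:R * qform S V|]
  <= 2 * expR (- (3 / 32 * x ^+ 2 * n%:R)).
Proof.
set v := qform S V => v0 x0 x1 n0.
have msq := measurable_sqnorm2 (random_mulmxr V).
have h y : `|y| <= 4^-1 -> measurable [set w | 4 * y ^+ 2 * (n%:R * v) <= y * (sqnorm2 (X w *m V) - n%:R * v)].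
  move=> _; apply: measurable_setle => //; apply: measurable_funM => //.
  exact: measurable_funB.
have x4 : `|x / 4| <= 4^-1 by rewrite ger0_norm; lra.
have x4' : `|- (x / 4)| <= 4^-1 by rewrite normrN.
apply: (le_trans (Pr_le P (B := [set w | 4 * (x / 4) ^+ 2 * (n%:R * v) <= (x / 4) * (sqnorm2 (X w *m V) - n%:R * v)] `|`
   [set w | 4 * (- (x / 4)) ^+ 2 * (n%:R * v) <= (- (x / 4)) * (sqnorm2 (X w *m V) - n%:R * v)]) _ _ _)).
- apply: measurable_setlt => //; apply: measurableT_comp => //.
  exact: measurable_funB.
- by apply: measurableU; exact: h.
- move=> w /=; set D := sqnorm2 _ - _; have [D0|D0] := leP 0 D.
    by rewrite ger0_norm// => hh; left; nra.
  by rewrite ltr0_norm// => hh; right; nra.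
apply: (le_trans (Pr_subU _ (h _ x4) (h _ x4'))).
have e1 := chi_chernoff v0 x4; have e2 := chi_chernoff v0 x4'.
rewrite (_ : 3 / 2 * (x / 4) ^+ 2 * n%:R = 3 / 32 * x ^+ 2 * n%:R) in e1; last by field.
rewrite (_ : 3 / 2 * (- (x / 4)) ^+ 2 * n%:R = 3 / 32 * x ^+ 2 * n%:R) in e2; last by field.
by apply: le_trans (lerD e1 e2) _; lra.
Qed.

Lemma qform_gram_dev (V : 'cV[R]_p) w : (0 < n)%N ->
  qform (Sigmahat (X w) - S) V = (sqnorm2 (X w *m V) - n%:R * qform S V) / n%:R.
Proof.
move=> n0; rewrite /qform bformBm -!/(qform _ _) /Sigmahat.
have -> : qform (n%:R^-1 *: ((X w)^T *m X w)) V = n%:R^-1 * qform ((X w)^T *m X w) V.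
  by rewrite /qform /bform -scalemxAr -scalemxAl mxE.
rewrite qform_gram mulrBl mulrC; congr (_ - _).
by rewrite mulrAC divff ?mul1r// pnatr_eq0 -lt0n.
Qed.

(** There are [(2 N)^m] signed sums of [m] atoms. Those that [D] sends to 0 are left out of the
    union: there the claim is trivial, and the tail bound asks for a positive variance. *)
Lemma rip (N m : nat) (D : 'M[R]_(p, N)) (x : R) :
  (forall V, V != 0 -> 0 < qform S V) -> 0 < x -> x <= 1 -> (0 < n)%N ->
  exists B : set T, [/\ measurable B,
    Pr P B <= (2 * N)%:R ^+ m * (2 * expR (- (3 / 32 * x ^+ 2 * n%:R))) &
    forall w, ~ B w -> forall f : {ffun 'I_m -> 'I_N * bool},
      `|qform (Sigmahat (X w) - S) (D *m ssum f)| <= x * qform S (D *m ssum f)].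
Proof.
move=> pd x0 x1 n0.
pose F (f : {ffun 'I_m -> 'I_N * bool}) : set T :=
  if D *m ssum f == 0 then set0 else
  [set w | x * (n%:R * qform S (D *m ssum f)) <
      `|sqnorm2 (X w *m (D *m ssum f)) - n%:R * qform S (D *m ssum f)|].
have mF f : measurable (F f).
  rewrite /F; case: eqP => // _.
  set V := D *m ssum f; have msq := measurable_sqnorm2 (random_mulmxr V).
  apply: measurable_setlt => //; apply: measurableT_comp => //.
  exact: measurable_funB.
exists (\big[setU/set0]_(f : {ffun 'I_m -> 'I_N * bool}) F f); split.
- exact: measurable_bigsetU.
- apply: (le_trans (Pr_bigU _ _ mF)).
  apply: (@le_trans _ _ (\sum_(f : {ffun 'I_m -> 'I_N * bool}) 2 * expR (- (3 / 32 * x ^+ 2 * n%:R)))).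
    apply: ler_sum => f _; rewrite /F; case: (eqVneq (D *m ssum f) 0) => [_|/pd qp].
      by rewrite Pr_set0 mulr_ge0 ?expR_ge0.
    exact: chi_tail.
  rewrite sumr_const card_ffun card_prod card_bool !card_ord mulnC.
  by rewrite -[leLHS]mulr_natl natrX.
- move=> w wB f.
  have [->|nz] := eqVneq (D *m ssum f) 0.
    by rewrite /qform !bform0l normr0 mulr0.
  have /= : ~ F f w.
    by move=> Ff; apply: wB; exact: mem_bigsetU Ff.
  rewrite /F (negbTE nz) => /negP; rewrite -leNgt => h.
  rewrite qform_gram_dev// normrM normfV (ger0_norm (ler0n _ _)).
  by rewrite ler_pdivrMr ?ltr0n// -mulrA [_ * n%:R]mulrC.
Qed.

End ChiSquare.

(** * Lasso and nodewise Lasso *)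

Section Eigenvalues.
Context {R : realType}.

Lemma sqnorm2E m (V : 'cV[R]_m) : sqnorm2 V = qform 1%:M V.
Proof.
rewrite /qform /bform mulmx1 mxE; apply: eq_bigr => i _.
by rewrite mxE expr2.
Qed.

Lemma sqnorm2Z m (a : R) (V : 'cV[R]_m) : sqnorm2 (a *: V) = a ^+ 2 * sqnorm2 V.
Proof. by rewrite !sqnorm2E qformZ. Qed.

Lemma sqnorm2_eq0 m (V : 'cV[R]_m) : sqnorm2 V = 0 -> V = 0.
Proof.
move=> /psumr_eq0P h; apply/matrixP => i j; rewrite ord1 mxE; apply/eqP.
by rewrite -sqrf_eq0 (h (fun k _ => sqr_ge0 _) i isT).
Qed.

Lemma sqnorm2_gt0 m (V : 'cV[R]_m) : V != 0 -> 0 < sqnorm2 V.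
Proof.
move=> V0; rewrite lt_neqAle sqnorm2_ge0 andbT eq_sym.
by apply: contraNneq V0 => /sqnorm2_eq0 ->.
Qed.

Lemma sqnorm2_delta m (j : 'I_m) : sqnorm2 (delta_mx j 0 : 'cV[R]_m) = 1.
Proof.
rewrite /sqnorm2 (bigD1 j)//= mxE !eqxx expr1n big1 ?addr0// => i /negbTE ij.
by rewrite mxE ij expr0n.
Qed.

Lemma bform_mulr m (A : 'M[R]_m) (U V : 'cV[R]_m) : bform A U V = bform 1%:M U (A *m V).
Proof. by rewrite /bform mulmx1 mulmxA. Qed.

Lemma bform1E m (U V : 'cV[R]_m) : bform 1%:M U V = \sum_i U i 0 * V i 0.
Proof. by rewrite /bform mulmx1 mxE; apply: eq_bigr => i _; rewrite mxE. Qed.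

Lemma bform1_delta m (j : 'I_m) (V : 'cV[R]_m) : bform 1%:M (delta_mx j 0) V = V j 0.
Proof.
rewrite bform1E (bigD1 j)//= mxE !eqxx mul1r big1 ?addr0// => i /negbTE ij.
by rewrite mxE ij mul0r.
Qed.

Lemma bform_delta m (A : 'M[R]_m) (i j : 'I_m) :
  bform A (delta_mx i 0) (delta_mx j 0) = A i j.
Proof. by rewrite bform_mulr bform1_delta -colE mxE. Qed.

Lemma continuous_sum_fun (U : topologicalType) (I : Type) (r : seq I) (F : I -> U -> R) :
  (forall i, continuous (F i)) -> continuous (fun x => \sum_(i <- r) F i x).
Proof.
move=> cF; elim: r => [|i r IH] x.
  by under eq_fun do rewrite big_nil; exact: cvg_cst.
by under eq_fun do rewrite big_cons; apply: cvgD; [exact: cF|exact: IH].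
Qed.

Lemma continuous_mul_fun (U : topologicalType) (f g : U -> R) :
  continuous f -> continuous g -> continuous (fun x => f x * g x).
Proof. by move=> cf cg x; apply: cvgM; [exact: cf|exact: cg]. Qed.

(* At a minimiser [v] of the quadratic form on the unit sphere the first
   order condition reads [S v = m v], so that the minimum is an eigenvalue. *)
Lemma qform_eig_ge m (S : 'M[R]_m) (c : R) : S^T = S ->
  (forall a, eigenvalue S a -> c <= a) -> forall V, c * sqnorm2 V <= qform S V.
Proof.
case: m S => [S _ _ V|m S sS hc V].
  by rewrite /sqnorm2 big_ord0 mulr0 /qform bformE big_ord0.
pose K := [set v : 'rV[R]_m.+1 | sqnorm2 v^T = 1].
have cN : continuous (fun v : 'rV[R]_m.+1 => sqnorm2 v^T).
  apply: continuous_sum_fun => i x; under eq_fun do rewrite mxE.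
  apply: (@continuous_comp _ _ _ (fun M : 'rV[R]_m.+1 => M 0 i) (fun z : R => z ^+ 2)).
    exact: coord_continuous.
  exact: exprn_continuous.
have cQ : continuous (fun v : 'rV[R]_m.+1 => qform S v^T).
  rewrite /qform; under eq_fun do rewrite bformE.
  apply: continuous_sum_fun => i; apply: continuous_sum_fun => j.
  under eq_fun do rewrite !mxE.
  apply: continuous_mul_fun; last exact: coord_continuous.
  by apply: continuous_mul_fun; [exact: coord_continuous|exact: cst_continuous].
have cK : compact K.
  apply: bounded_closed_compact.
    exists 1; split; first exact: num_real.
    move=> M M1 v; rewrite /K /= => v1.
    rewrite /Num.norm/= mx_normrE; apply: bigmax_le; first by rewrite ltW// (lt_trans ltr01).
    move=> -[i j] _ /=; rewrite ord1 (le_trans _ (ltW M1))//.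
    rewrite -(@ler_pXn2r _ 2)// ?nnegrE// expr1n -normrX ger0_norm ?sqr_ge0// -v1.
    rewrite /sqnorm2 (bigD1 j)//= mxE lerDl sumr_ge0// => k _; exact: sqr_ge0.
  rewrite (_ : K = (fun v : 'rV[R]_m.+1 => sqnorm2 v^T) @^-1` [set 1])//.
  by apply: closed_comp => // x _; exact: cN.
have K0 : K !=set0.
  by exists (delta_mx 0 0); rewrite /K/= trmx_delta sqnorm2_delta.
have [v /set_mem vK vmin] := EVT_min_rV K0 cK (continuous_subspaceT cQ).
set mu := qform S v^T in vmin.
have hm W : mu * sqnorm2 W <= qform S W.
  have [->|W0] := eqVneq W 0.
    by rewrite sqnorm2E /qform !bform0l mulr0.
  have w0 := sqnorm2_gt0 W0; set s := sqnorm2 W in w0 *.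
  have sK : (sqrt s)^-1 *: W^T \in K.
    rewrite inE /K/= [_^T]linearZ/= trmxK sqnorm2Z exprVn sqr_sqrtr ?ltW// mulVf//.
    by rewrite gt_eqF.
  have := vmin _ sK; rewrite [(_ *: _)^T]linearZ/= trmxK qformZ exprVn sqr_sqrtr ?(ltW w0)//.
  by rewrite mulrC ler_pdivlMr.
have ort W : bform S v^T W = mu * bform 1%:M v^T W.
  apply/eqP; rewrite -subr_eq0; set b := _ - _.
  have hh t : 0 <= 2 * t * b + t ^+ 2 * (qform S W - mu * sqnorm2 W).
    have := hm (v^T + t *: W).
    rewrite !sqnorm2E !qformD ?trmx1// !bformZr !qformZ -!sqnorm2E vK -/mu /b; lra.
  set g := qform S W - _ in hh.
  have g0 : 0 <= g by rewrite subr_ge0.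
  apply/negP => /negP b0.
  (* At this [t] the quadratic is negative unless [b = 0]; the [+ 1] covers [g = 0]. *)
  have := hh (- b / (g + 1)).
  have -> : 2 * (- b / (g + 1)) * b + (- b / (g + 1)) ^+ 2 * g =
     - (b ^+ 2 * (g + 2)) / (g + 1) ^+ 2 by field; rewrite gt_eqF//; lra.
  rewrite leNgt => /negP; apply; rewrite mulNr oppr_lt0 divr_gt0 ?exprn_gt0//; last by lra.
  by rewrite mulr_gt0 ?exprn_even_gt0//; lra.
have eig : eigenvalue S mu.
  apply/eigenvalueP; exists v.
    apply/rowP => j; rewrite !mxE.
    have := ort (delta_mx j 0); rewrite bform_sym ?trmx1//.
    rewrite bform_mulr bform1_delta [bform _ v^T _]bform_sym ?trmx1// bform1_delta !mxE => <-.
    apply: eq_bigr => i _; rewrite mxE mulrC; congr (_ * _).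
    by rewrite -[in LHS]sS mxE.
  by apply: contraTneq isT => v0; move: vK; rewrite /K/= v0 trmx0 sqnorm2E /qform bform0l => /eqP; rewrite eq_sym oner_eq0.
apply: le_trans (hm V); apply: ler_wpM2r; [exact: sqnorm2_ge0|exact: hc].
Qed.

Lemma qform_eig_le m (S : 'M[R]_m) (c : R) : S^T = S ->
  (forall a, eigenvalue S a -> a <= c) -> forall V, qform S V <= c * sqnorm2 V.
Proof.
move=> sS hc V; rewrite -lerN2 -mulNr.
have -> : - qform S V = qform (- S) V by rewrite /qform /bform mulmxN mulNmx [RHS]mxE.
apply: qform_eig_ge; first by rewrite linearN/= sS.
move=> a /eigenvalueP[v va v0]; rewrite lerNl; apply: hc.
by apply/eigenvalueP; exists v => //; rewrite scaleNr -va mulmxN opprK.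
Qed.

End Eigenvalues.

Section Precision.
Context {R : realType} {p : nat}.
Variables (S : 'M[R]_p) (cmin : R).
Hypotheses (cmin0 : 0 < cmin) (sS : S^T = S) (Smin : forall V, cmin * sqnorm2 V <= qform S V)
  (Sd : forall j, S j j <= 1).
Notation Th := (invmx S).

Lemma qform_pd V : V != 0 -> 0 < qform S V.
Proof. by move=> V0; apply: lt_le_trans (Smin V); rewrite mulr_gt0// sqnorm2_gt0. Qed.

Lemma cov_unit : S \in unitmx.
Proof.
rewrite -row_free_unit -kermx_eq0; apply/rowV0P => v /sub_kermxP vS.
apply: trmx_inj; rewrite trmx0; apply/eqP/negPn/negP => /qform_pd.
by rewrite /qform /bform trmxK vS mul0mx mxE ltxx.
Qed.

Lemma prec_sym : Th^T = Th.
Proof. by rewrite trmx_inv sS. Qed.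

(** The population counterpart of [vdir]: entry 1 at [j] and minus the coefficients of the
    regression of variable [j] on the others; [(Th j j)^-1] is the residual variance of that
    regression. *)
Definition udir j : 'cV[R]_p := (Th j j)^-1 *: col j Th.

Lemma mul_cov_prec j : S *m col j Th = delta_mx j 0.
Proof. by rewrite colE mulmxA mulmxV ?cov_unit// mul1mx. Qed.

Lemma qform_prec_col j : qform S (col j Th) = Th j j.
Proof.
by rewrite /qform bform_mulr mul_cov_prec bform_sym ?trmx1// bform1_delta mxE.
Qed.

Lemma prec_gt0 j : 0 < Th j j.
Proof.
rewrite -qform_prec_col; apply: qform_pd; apply: contraTneq isT => h.
have := mul_cov_prec j; rewrite h mulmx0 => /matrixP /(_ j 0).
by rewrite !mxE !eqxx => /eqP; rewrite eq_sym oner_eq0.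
Qed.

Lemma udir_self j : udir j j 0 = 1.
Proof. by rewrite !mxE mulVf// gt_eqF// prec_gt0. Qed.

Lemma cov_udir j : S *m udir j = (Th j j)^-1 *: delta_mx j 0.
Proof. by rewrite /udir -scalemxAr mul_cov_prec. Qed.

Lemma bform_udir V j : bform S V (udir j) = (Th j j)^-1 * V j 0.
Proof. by rewrite bform_mulr cov_udir bformZr bform_sym ?trmx1// bform1_delta. Qed.

Lemma qform_udir j : qform S (udir j) = (Th j j)^-1.
Proof. by rewrite /qform bform_udir udir_self mulr1. Qed.

(** A residual variance is at most the variance: the form at [delta_mx j 0 - udir j] is nonnegative
    and equals the difference of the two. *)
Lemma prec_inv_le1 j : (Th j j)^-1 <= 1.
Proof.
apply: le_trans (Sd j).
have : 0 <= qform S (delta_mx j 0 - udir j).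
  by apply: le_trans (Smin _); rewrite mulr_ge0 ?sqnorm2_ge0// ltW.
rewrite qformB// qform_udir /qform bform_udir bform_delta mxE !eqxx mulr1; lra.
Qed.

Lemma sqnorm2_udir j : sqnorm2 (udir j) <= (Th j j)^-1 / cmin.
Proof. by rewrite ler_pdivlMr// mulrC -qform_udir. Qed.

Lemma prec_inv_ge j : cmin <= (Th j j)^-1.
Proof.
rewrite -qform_udir; apply: le_trans (Smin _).
have h : 1 <= sqnorm2 (udir j).
  rewrite /sqnorm2 (bigD1 j)//= udir_self expr1n.
  have : 0 <= \sum_(i < p | i != j) udir j i 0 ^+ 2 by apply: sumr_ge0 => i _; exact: sqr_ge0.
  lra.
by rewrite -[leLHS]mulr1 ler_wpM2l// ltW.
Qed.

(** No spectral decomposition of the inverse: the square of [V - cmin Th V] is expanded and the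
    lower bound on [S] is applied at [Th V]. *)
Lemma qform_prec V : qform Th V <= sqnorm2 V / cmin.
Proof.
have e1 : qform S (Th *m V) = qform Th V.
  rewrite /qform /bform trmx_mul prec_sym -!mulmxA [S *m _]mulmxA mulmxV ?cov_unit// mul1mx.
  by [].
have h1 := Smin (Th *m V).
have h2 : 0 <= sqnorm2 (V - cmin *: (Th *m V)) by exact: sqnorm2_ge0.
rewrite sqnorm2E qformB ?trmx1// bformZr -bform_mulr qformZ -!sqnorm2E -/(qform Th V) in h2.
rewrite e1 in h1; rewrite ler_pdivlMr//.
by have := ler_wpM2l (ltW cmin0) h1; lra.
Qed.

Lemma udir_support j k : k != j -> udir j k 0 != 0 -> Th j k != 0.
Proof.
have e : Th k j = Th j k by rewrite -[in LHS]prec_sym mxE.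
by move=> _; apply: contraNneq => h; rewrite !mxE e h mulr0.
Qed.

Lemma udir_sparsity j : (#|[set k : 'I_p | (k != j) && (udir j k 0%R != 0%R)]%SET| <= smax S)%N.
Proof.
apply: (@leq_trans (row_sparsity S j)); last exact: (@leq_bigmax _ (row_sparsity S)).
apply: subset_leq_card; apply/fintype.subsetP => k; rewrite !inE => /andP[kj].
by rewrite kj => /(udir_support kj).
Qed.

End Precision.

Section LassoDeterministic.
Context {R : realType}.

Lemma first_order_ge0 (a b : R) :
  (forall t, 0 < t -> t <= 1 -> 0 <= t * b + t ^+ 2 * a) -> 0 <= b.
Proof.
move=> h; rewrite leNgt; apply/negP => b0.
pose t := - b / (`|a| + 1 - b).
have a0 := normr_ge0 a.
have d0 : 0 < `|a| + 1 - b by lra.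
have t0 : 0 < t by rewrite divr_gt0// oppr_gt0.
have t1 : t <= 1 by rewrite ler_pdivrMr//; lra.
have := h t t0 t1; rewrite leNgt => /negP; apply.
have : t * a <= t * `|a| by rewrite ler_wpM2l ?ler_norm// ltW.
have : t * (`|a| + 1 - b) = - b by rewrite /t divfK// gt_eqF.
have -> : t * b + t ^+ 2 * a = t * (b + t * a) by ring.
move=> e1 e2; rewrite pmulr_rlt0//; nra.
Qed.

Lemma first_order_eq0 (a b : R) :
  (forall t, `|t| <= 1 -> 0 <= t * b + t ^+ 2 * a) -> b = 0.
Proof.
move=> h; apply/eqP; rewrite eq_le -oppr_ge0; apply/andP; split.
  apply: (@first_order_ge0 a) => t t0 t1.
  have := h (- t); rewrite normrN (ger0_norm (ltW t0)) => /(_ t1); rewrite sqrrN; lra.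
apply: (@first_order_ge0 a) => t t0 t1.
by apply: h; rewrite ger0_norm// ltW.
Qed.

Lemma norm1_ge0 m (v : 'cV[R]_m) : 0 <= norm1 v.
Proof. by apply: sumr_ge0 => i _. Qed.

Lemma norm1Z m (a : R) (v : 'cV[R]_m) : norm1 (a *: v) = `|a| * norm1 v.
Proof. by rewrite /norm1 mulr_sumr; apply: eq_bigr => i _; rewrite mxE normrM. Qed.

Lemma ler_norm1D m (u v : 'cV[R]_m) : norm1 (u + v) <= norm1 u + norm1 v.
Proof. by rewrite /norm1 -big_split/=; apply: ler_sum => i _; rewrite mxE ler_normD. Qed.

Lemma norm1_delta m (k : 'I_m) : norm1 (delta_mx k 0 : 'cV[R]_m) = 1.
Proof.
rewrite /norm1 (bigD1 k)//= mxE !eqxx normr1 big1 ?addr0// => i /negbTE ik.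
by rewrite mxE ik normr0.
Qed.

Lemma sqnorm2B m (u v : 'cV[R]_m) :
  sqnorm2 (u - v) = sqnorm2 u - 2 * bform 1%:M u v + sqnorm2 v.
Proof. by rewrite !sqnorm2E qformB// trmx1. Qed.

Lemma sqnorm2D m (u v : 'cV[R]_m) :
  sqnorm2 (u + v) = sqnorm2 u + 2 * bform 1%:M u v + sqnorm2 v.
Proof. by rewrite !sqnorm2E qformD// trmx1. Qed.

Lemma bform1_mul n m (A : 'M[R]_(n, m)) (u : 'cV[R]_n) (v : 'cV[R]_m) :
  bform 1%:M u (A *m v) = bform 1%:M (A^T *m u) v.
Proof. by rewrite /bform !mulmx1 trmx_mul trmxK mulmxA. Qed.

Lemma bform1_le m (u v : 'cV[R]_m) (c : R) : (forall k, `|u k 0| <= c) ->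
  `|bform 1%:M u v| <= c * norm1 v.
Proof.
move=> h; rewrite bform1E (le_trans (ler_norm_sum _ _ _))// /norm1 mulr_sumr.
by apply: ler_sum => i _; rewrite normrM ler_wpM2r.
Qed.

Lemma sum_sqr_le m (A : {set 'I_m}) (v : 'cV[R]_m) :
  (\sum_(i in A) `|v i 0|) ^+ 2 <= #|A|%:R * sqnorm2 v.
Proof.
set s := \sum_(i in A) _.
have h0 : \sum_(i in A) `|v i 0| ^+ 2 <= sqnorm2 v.
  rewrite /sqnorm2 [leRHS](bigID (mem A))/= -[leLHS]addr0 lerD//.
    by apply: ler_sum => i _; rewrite -normrX ger0_norm ?sqr_ge0.
  by apply: sumr_ge0 => i _; exact: sqr_ge0.
apply: le_trans (ler_wpM2l (ler0n _ _) h0).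
have [A0|A0] := posnP #|A|.
  by rewrite /s big_pred0 ?expr0n ?A0 ?mul0r// => i; rewrite (card0_eq A0).
have k0 : 0 < #|A|%:R :> R by rewrite ltr0n.
have : 0 <= \sum_(i in A) (#|A|%:R * `|v i 0| - s) ^+ 2.
  by apply: sumr_ge0 => i _; exact: sqr_ge0.
have -> : \sum_(i in A) (#|A|%:R * `|v i 0| - s) ^+ 2 =
   #|A|%:R * (#|A|%:R * (\sum_(i in A) `|v i 0| ^+ 2) - s ^+ 2).
  transitivity (\sum_(i in A) (#|A|%:R ^+ 2 * `|v i 0| ^+ 2 + (- 2 * s * #|A|%:R * `|v i 0| + s ^+ 2))).
    by apply: eq_bigr => i _; ring.
  rewrite !big_split/= sumr_const -!mulr_sumr -/s -[s ^+ 2 *+ _]mulr_natl; ring.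
by rewrite pmulr_rge0// subr_ge0.
Qed.

Section Fixed.
Variables (n q : nat) (A : 'M[R]_(n, q)) (y : 'cV[R]_n) (lam : R) (g : 'cV[R]_q).
Hypotheses (n0 : (0 < n)%N) (lam0 : 0 < lam) (hg : is_lasso A y lam g).
Let r := y - A *m g.

Let nR : 0 < n%:R :> R. Proof. by rewrite ltr0n. Qed.

Lemma lasso_perturb (v : 'cV[R]_q) :
  0 <= - 2 * (bform 1%:M (A^T *m r) v / n%:R) + sqnorm2 (A *m v) / n%:R
     + 2 * lam * (norm1 (g + v) - norm1 g).
Proof.
have e : y - A *m (g + v) = r - A *m v by rewrite mulmxDr opprD addrA.
have := hg (g + v); rewrite /lasso_obj -/r e (sqnorm2B r) bform1_mul; lra.
Qed.

Lemma lasso_kkt k : `|(A^T *m r) k 0| / n%:R <= lam.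
Proof.
set c := (A^T *m r) k 0.
have h (e t : R) : `|e| = 1 -> 0 < t -> t <= 1 ->
    0 <= t * (- 2 * (e * c / n%:R) + 2 * lam) + t ^+ 2 * (sqnorm2 (A *m delta_mx k 0) / n%:R).
  move=> e1 t0 t1; have := lasso_perturb ((t * e) *: delta_mx k 0).
  rewrite bformZr bform_sym ?trmx1// bform1_delta -/c -scalemxAr sqnorm2Z.
  have e2 : e ^+ 2 = 1 by rewrite -[e ^+ 2]ger0_norm ?sqr_ge0// normrX e1 expr1n.
  rewrite exprMn e2 mulr1.
  have : norm1 (g + (t * e) *: delta_mx k 0) - norm1 g <= t.
    rewrite lerBlDl (le_trans (ler_norm1D _ _))// lerD2l norm1Z norm1_delta mulr1.
    by rewrite normrM e1 mulr1 ger0_norm// ltW.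
  by move=> hn hh; have := ler_wpM2l (ltW lam0) hn; lra.
have h1 := first_order_ge0 (h 1 ^~ (normr1 _)).
have h2 := first_order_ge0 (h (-1) ^~ (normrN1 _)).
rewrite -[n%:R^-1]gtr0_norm ?invr_gt0// -normrM ler_norml; lra.
Qed.

(** Stationarity along the ray through [g], where the penalty is differentiable: for [|t| <= 1] the
    norm of [(1 + t) g] is [(1 + t) norm1 g]. *)
Lemma lasso_inner : bform 1%:M (A^T *m r) g / n%:R = lam * norm1 g.
Proof.
apply/eqP; rewrite -subr_eq0; apply/eqP; set b := _ - _.
suff : - 2 * b = 0 by lra.
apply: (@first_order_eq0 (sqnorm2 (A *m g) / n%:R)) => t t1.
have := lasso_perturb (t *: g); rewrite bformZr -scalemxAr sqnorm2Z.
have -> : g + t *: g = (1 + t) *: g by rewrite scalerDl scale1r.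
rewrite norm1Z ger0_norm; first by rewrite /b; lra.
by move: t1; rewrite ler_norml; lra.
Qed.

Variables (gs : 'cV[R]_q) (A0 : {set 'I_q}).
Hypotheses (gsA : forall k, k \notin A0 -> gs k 0 = 0)
  (noise : forall k, `|(A^T *m (y - A *m gs)) k 0| / n%:R <= lam / 2).
Let h := g - gs.

(** The objectives at [g] and [gs] are compared. The noise costs [lam * norm1 h], the penalty gives
    back [2 lam] times the mass outside [A0] minus [2 lam] times the mass inside; hence the factors
    1 and 3. *)
Lemma lasso_basic :
  sqnorm2 (A *m h) / n%:R + lam * \sum_(k | k \notin A0) `|h k 0|
  <= 3 * lam * \sum_(k in A0) `|h k 0|.
Proof.
set e := y - A *m gs.
have hr : r = e - A *m h by rewrite /r /e /h mulmxBr; apply/matrixP => i j; rewrite !mxE; ring.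
have := hg gs; rewrite /lasso_obj -/r -/e hr sqnorm2B bform1_mul.
have : `|bform 1%:M (A^T *m e) h| / n%:R <= lam / 2 * norm1 h.
  rewrite ler_pdivrMr// mulrAC; apply: bform1_le => k.
  by have := noise k; rewrite ler_pdivrMr.
have en : norm1 h = \sum_(k in A0) `|h k 0| + \sum_(k | k \notin A0) `|h k 0|.
  by rewrite /norm1 (bigID (mem A0)).
have : norm1 gs - \sum_(k in A0) `|h k 0| + \sum_(k | k \notin A0) `|h k 0| <= norm1 g.
  rewrite /norm1 [in leRHS](bigID (mem A0)) [in leLHS](bigID (mem A0))/=.
  rewrite [X in _ + X - _ + _ <= _]big1 ?addr0; last by move=> k /gsA ->; rewrite normr0.
  rewrite lerD//.
    rewrite -sumrB; apply: ler_sum => k _; rewrite /h mxE mxE.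
    by rewrite lerBlDr -{1}[gs k 0](subKr (g k 0)) (le_trans (ler_normB _ _))// lerD2l.
  by apply: ler_sum => k /gsA e0; rewrite /h mxE mxE e0 subr0.
rewrite en; set a := \sum_(k in A0) _; set b := \sum_(k | _) _.
set B := bform _ _ _; set N := sqnorm2 (A *m h); set E := sqnorm2 e.
have hB := ler_norm B.
move=> h1 h2; rewrite mulrDl mulrBl => h3.
have h4 : B / n%:R <= `|B| / n%:R by rewrite ler_pM2r ?invr_gt0.
have := ler_wpM2l (ltW lam0) h1; lra.
Qed.

Lemma lasso_cone : norm1 h <= 4 * \sum_(k in A0) `|h k 0|.
Proof.
have en : norm1 h = \sum_(k in A0) `|h k 0| + \sum_(k | k \notin A0) `|h k 0|.
  by rewrite /norm1 (bigID (mem A0)).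
have := lasso_basic; rewrite en.
set a := \sum_(k in A0) _; set b := \sum_(k | _) _.
have : 0 <= sqnorm2 (A *m h) / n%:R by rewrite divr_ge0 ?sqnorm2_ge0.
move=> h1 h2; have : lam * b <= lam * (3 * a) by lra.
by rewrite ler_pM2l//; lra.
Qed.

Lemma lasso_cone_sqr : norm1 h ^+ 2 <= 16 * (#|A0|%:R * sqnorm2 h).
Proof.
have h1 := sum_sqr_le A0 h; have h2 := lasso_cone.
have h3 : norm1 h ^+ 2 <= (4 * \sum_(k in A0) `|h k 0|) ^+ 2.
  by rewrite lerXn2r// nnegrE ?norm1_ge0// mulr_ge0// sumr_ge0.
by apply: le_trans h3 _; rewrite exprMn; lra.
Qed.

Variable c : R.
Hypotheses (c0 : 0 < c) (RE : c * sqnorm2 h <= sqnorm2 (A *m h) / n%:R).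

Lemma lasso_rates :
  [/\ \sum_(k in A0) `|h k 0| <= 3 * #|A0|%:R * lam / c,
      norm1 h <= 12 * #|A0|%:R * lam / c,
      sqnorm2 (A *m h) / n%:R <= 9 * #|A0|%:R * lam ^+ 2 / c &
      sqnorm2 h <= 9 * #|A0|%:R * lam ^+ 2 / c ^+ 2].
Proof.
have RE' := RE; have hb := lasso_basic; have hc := lasso_cone; have hs := sum_sqr_le A0 h.
set a := \sum_(k in A0) _ in hb hc hs *; set k := #|A0|%:R in hs *.
have a0 : 0 <= a by apply: sumr_ge0.
have b0 : 0 <= lam * \sum_(k | k \notin A0) `|h k 0| by rewrite mulr_ge0 ?(ltW lam0)// sumr_ge0.
have k0 : 0 <= k by rewrite ler0n.
set Q := sqnorm2 (A *m h) / n%:R in RE' hb *; set N := sqnorm2 h in RE' hs *.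
have hQ : Q <= 3 * lam * a by lra.
have ha : a <= 3 * k * lam / c.
  rewrite ler_pdivlMr//; have [->|az] := eqVneq a 0.
    by rewrite mul0r !mulr_ge0// ltW.
  have ap : 0 < a by rewrite lt_neqAle eq_sym az.
  have h1 : k * (c * N) <= k * (3 * lam * a) by rewrite ler_wpM2l//; lra.
  have h2 : c * a ^+ 2 <= c * (k * N) by rewrite ler_pM2l.
  by rewrite -(ler_pM2l ap); nra.
have hQ2 : Q <= 9 * k * lam ^+ 2 / c.
  apply: le_trans hQ _.
  have -> : 9 * k * lam ^+ 2 / c = 3 * lam * (3 * k * lam / c) by ring.
  by rewrite ler_wpM2l// mulr_ge0// ltW.
split => //.
  rewrite (_ : 12 * k * lam / c = 4 * (3 * k * lam / c)); last by ring.
  lra.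
have -> : 9 * k * lam ^+ 2 / c ^+ 2 = (9 * k * lam ^+ 2 / c) / c by rewrite expr2 invfM !mulrA.
by rewrite ler_pdivlMr// mulrC; apply: le_trans hQ2.
Qed.

End Fixed.
End LassoDeterministic.

Section Embedding.
Context {R : realType} {n p : nat}.
Implicit Types (j : 'I_p) (g : 'cV[R]_(p.-1)) (X : 'M[R]_(n, p)).

Definition emb j g : 'cV[R]_p := \col_k (if unlift j k is Some k' then g k' 0 else 0).

Lemma emb_self j g : emb j g j 0 = 0.
Proof. by rewrite mxE unlift_none. Qed.

Lemma emb_lift j g k : emb j g (lift j k) 0 = g k 0.
Proof. by rewrite mxE liftK. Qed.

Lemma embB j g g' : emb j (g - g') = emb j g - emb j g'.
Proof. by apply/matrixP => k i; rewrite !mxE; case: unlift => [k'|]; rewrite ?mxE ?subr0. Qed.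

Lemma sum_emb (F : 'I_p -> R -> R) j g : F j 0 = 0 ->
  \sum_k F k (emb j g k 0) = \sum_k F (lift j k) (g k 0).
Proof.
move=> F0; rewrite (@bigD1_ord _ _ _ _ j)//= emb_self F0 add0r.
by apply: eq_bigr => k _; rewrite emb_lift.
Qed.

Lemma norm1_emb j g : norm1 (emb j g) = norm1 g.
Proof. by rewrite /norm1 (sum_emb (F := fun=> Num.norm))// normr0. Qed.

Lemma sqnorm2_emb j g : sqnorm2 (emb j g) = sqnorm2 g.
Proof. by rewrite /sqnorm2 (sum_emb (F := fun _ z => z ^+ 2))// expr0n. Qed.

Lemma mulmx_emb X j g : X *m emb j g = col' j X *m g.
Proof.
apply/matrixP => i k; rewrite !mxE ord1 (sum_emb (F := fun k z => X i k * z)) ?mulr0//.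
by apply: eq_bigr => l _; rewrite mxE.
Qed.

Lemma emb_row' j (v : 'cV[R]_p) : v j 0 = 0 -> emb j (row' j v) = v.
Proof.
move=> vj; apply/matrixP => k i; rewrite ord1 mxE; case: unliftP => [k' ->|->].
  by rewrite mxE.
by rewrite vj.
Qed.

End Embedding.

Section Gram.
Context {R : realType} {n p : nat}.
Variable X : 'M[R]_(n, p).

Lemma bform_Sigmahat u v : bform (Sigmahat X) u v = bform 1%:M (X *m u) (X *m v) / n%:R.
Proof.
rewrite /bform /Sigmahat -scalemxAr -scalemxAl mxE mulrC; congr (_ / _).
by rewrite mulmx1 trmx_mul !mulmxA.
Qed.

Lemma qform_Sigmahat u : qform (Sigmahat X) u = sqnorm2 (X *m u) / n%:R.
Proof. by rewrite /qform bform_Sigmahat sqnorm2E. Qed.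

Lemma Sigmahat_sym : (Sigmahat X)^T = Sigmahat X.
Proof. by rewrite /Sigmahat [_^T]linearZ/= trmx_mul trmxK. Qed.

Lemma Sigmahat_delta k (u : 'cV[R]_p) : (Sigmahat X *m u) k 0 = (X^T *m (X *m u)) k 0 / n%:R.
Proof. by rewrite /Sigmahat -scalemxAl mxE -mulmxA mulrC. Qed.

(* Row [j] of [Thetahat] is [vdir j] divided by [tauhat2 j]. *)
Definition vdir (gh : 'I_p -> 'cV[R]_(p.-1)) (j : 'I_p) : 'cV[R]_p :=
  delta_mx j 0 - emb j (gh j).

Definition resid (gh : 'I_p -> 'cV[R]_(p.-1)) (j : 'I_p) : 'cV[R]_n :=
  col j X - col' j X *m gh j.

Lemma mul_vdir gh j : X *m vdir gh j = resid gh j.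
Proof. by rewrite /vdir /resid mulmxBr mulmx_emb colE. Qed.

End Gram.

Section RestrictedEigenvalue.
Context {R : realType} {n p : nat}.
Variables (X : 'M[R]_(n, p)) (S : 'M[R]_p) (cmin cmax x : R) (m : nat).
Hypotheses (Smin : forall V, cmin * sqnorm2 V <= qform S V) (Smax : forall V, qform S V <= cmax * sqnorm2 V)
  (m0 : (0 < m)%N) (x0 : 0 <= x) (xsmall : x * (cmax + 64) <= cmin / 2)
  (RIP : forall a, `|qform (Sigmahat X - S) a| <= x * qform S a + 4 * x * norm1 a ^+ 2 / m%:R).

(** On the cone the l1 term of the isometry is at most [4 x * 16 * sqnorm2 h], whence the 64 in
    [xsmall]; half of the smallest eigenvalue survives. *)
Lemma restricted_eigenvalue (k : nat) (h : 'cV[R]_p) : (k <= m)%N ->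
  norm1 h ^+ 2 <= 16 * (k%:R * sqnorm2 h) ->
  cmin / 2 * sqnorm2 h <= sqnorm2 (X *m h) / n%:R.
Proof.
move=> km hc; rewrite -qform_Sigmahat.
have mR : 0 < m%:R :> R by rewrite ltr0n.
have h1 : norm1 h ^+ 2 / m%:R <= 16 * sqnorm2 h.
  rewrite ler_pdivrMr// (le_trans hc)// -mulrA ler_pM2l// mulrC ler_wpM2l ?sqnorm2_ge0//.
  by rewrite ler_nat.
have h2 := RIP h; rewrite {1}/qform bformBm -!/(qform _ _) in h2.
have h3 : 4 * x * norm1 h ^+ 2 / m%:R <= 4 * x * (16 * sqnorm2 h).
  by rewrite -mulrA ler_wpM2l// mulr_ge0.
have h4 := ler_wpM2l x0 (Smax h).
have h5 := ler_wpM2r (sqnorm2_ge0 h) xsmall.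
have h6 := Smin h.
by move: h2; rewrite ler_norml; lra.
Qed.

End RestrictedEigenvalue.

Section Entries.
Context {R : realType}.
Lemma addmxE m q (A B : 'M[R]_(m, q)) i j : (A + B) i j = A i j + B i j.
Proof. by rewrite mxE. Qed.
Lemma submxE m q (A B : 'M[R]_(m, q)) i j : (A - B) i j = A i j - B i j.
Proof. by rewrite !mxE. Qed.
Lemma scalemxE m q (a : R) (A : 'M[R]_(m, q)) i j : (a *: A) i j = a * A i j.
Proof. by rewrite mxE. Qed.
Lemma deltamxE m (j k : 'I_m) : (delta_mx j 0 : 'cV[R]_m) k 0 = (k == j)%:R.
Proof. by rewrite mxE eqxx andbT. Qed.
End Entries.

Section Decomposition.
Context {R : realType} {n p : nat}.
Variables (X : 'M[R]_(n, p)) (eps : 'cV[R]_n) (beta : 'cV[R]_p) (sigma : R).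
Variables (lamj : 'I_p -> R) (bh : 'cV[R]_p) (gh : 'I_p -> 'cV[R]_(p.-1)).
Notation tau2 := (tauhat2 X lamj gh).
Notation rho := (resid X gh).

Lemma Thetahat_row j : row j (Thetahat X lamj gh) = (tau2 j)^-1 *: (vdir gh j)^T.
Proof.
apply/rowP => k; rewrite !mxE; case: unliftP => [k' ->|->].
  by rewrite eq_sym (negbTE (neq_lift _ _)) sub0r mulrN mulNr.
by rewrite !eqxx subr0 mulr1.
Qed.

Lemma Thetahat_mul j (r : 'cV[R]_n) :
  (Thetahat X lamj gh *m X^T *m r) j 0 = (tau2 j)^-1 * bform 1%:M (rho j) r.
Proof.
have -> : (Thetahat X lamj gh *m X^T *m r) j 0 = (row j (Thetahat X lamj gh *m X^T *m r)) 0 0.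
  by rewrite [RHS]mxE.
rewrite !row_mul Thetahat_row -!scalemxAl mxE; congr (_ * _).
by rewrite /bform mulmx1 -mul_vdir trmx_mul.
Qed.

Lemma Omegahat_diag j :
  Omegahat X lamj gh j j = (tau2 j)^-1 ^+ 2 * (sqnorm2 (rho j) / n%:R).
Proof.
rewrite -mul_vdir -qform_Sigmahat /qform /bform /Omegahat.
set A := Thetahat X lamj gh; set Q := Sigmahat X.
have -> : (A *m Q *m A^T) j j = (row j A *m Q *m (row j A)^T) 0 0.
  by rewrite -row_mul !mxE; apply: eq_bigr => k _; rewrite !mxE.
rewrite Thetahat_row [(_ *: _^T)^T]linearZ/= trmxK -scalemxAr -!scalemxAl mxE mxE.
by rewrite mulrA expr2.
Qed.

Hypotheses (n0 : (0 < n)%N) (sigma0 : 0 < sigma).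
Variable j : 'I_p.
Hypotheses (rho0 : 0 < sqnorm2 (rho j)) (tau0 : 0 < tau2 j).
Let Rj := sqrt (sqnorm2 (rho j) / n%:R).
Let nR : 0 < n%:R :> R. Proof. by rewrite ltr0n. Qed.
Let Rj0 : 0 < Rj. Proof. by rewrite sqrtr_gt0 divr_gt0. Qed.
Let sn0 : 0 < sqrt n%:R :> R. Proof. by rewrite sqrtr_gt0. Qed.

Lemma sqrt_Omegahat : sqrt (Omegahat X lamj gh j j) = (tau2 j)^-1 * Rj.
Proof.
by rewrite Omegahat_diag sqrtrM ?sqr_ge0// sqrtr_sqr ger0_norm// invr_ge0 ltW.
Qed.

(** The factor [tau2 j] cancels, so that given [X] the statistic is a normalised linear form of the
    noise in the nodewise residual. Only that residual has to be understood. *)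
Lemma wstd_resid : wstd X eps sigma lamj gh j =
  bform 1%:M (rho j) eps / (sigma * sqrt (sqnorm2 (rho j))).
Proof.
rewrite /wstd /wnoise mxE Thetahat_mul sqrt_Omegahat.
have -> : sqrt (sqnorm2 (rho j)) = sqrt n%:R * Rj.
  by rewrite /Rj -sqrtrM ?ler0n// mulrC divfK ?gt_eqF.
by field; rewrite !gt_eqF//= ?Rj0 ?tau0 ?sn0.
Qed.

(** [tau2 j] times entry [j] of [(I - Thetahat Sigmahat) (bh - beta)], the error left by debiasing;
    multiplying by [tau2 j] avoids the inverse. *)
Definition bias_term : R :=
  tau2 j * (bh - beta) j 0 - bform (Sigmahat X) (vdir gh j) (bh - beta).

Lemma zstat_decomp : zstat X eps beta sigma lamj bh gh j =
  wstd X eps sigma lamj gh j + sqrt n%:R * (tau2 j * beta j 0 + bias_term) / (sigma * Rj).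
Proof.
rewrite /wstd /wnoise /zstat /debiased addmxE !scalemxE !Thetahat_mul sqrt_Omegahat.
have -> : response X eps beta - X *m bh = eps - X *m (bh - beta).
  by rewrite /response mulmxBr opprB addrA [_ + eps]addrC.
rewrite -scaleN1r bformDr bformZr /bias_term bform_Sigmahat mul_vdir submxE.
have sn2 : n%:R = sqrt n%:R ^+ 2 :> R by rewrite sqr_sqrtr// ler0n.
set B := bform _ _ (X *m _); set W := bform _ _ eps.
have sn1 := sn0; set sn := sqrt n%:R in sn1 sn2 *; rewrite sn2.
by field; rewrite !gt_eqF.
Qed.

End Decomposition.

Section Arithmetic.
Context {R : realType}.

Lemma polarization_arith (a bb c e x th qs qh w : R) :
  `|a + 2 * (th * bb) + c| <= x * (qs + 2 * (th * e) + qh) + w ->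
  `|a + 2 * (- th * bb) + c| <= x * (qs + 2 * (- th * e) + qh) + w ->
  4 * th * bb <= x * (2 * qs + 2 * qh) + 2 * w.
Proof. by rewrite !ler_norml => /andP[? ?] /andP[? ?]; lra. Qed.

Lemma lin3_arith (qs tq z kc k X Y : R) : qs <= kc -> tq <= X -> z <= 2 * k + Y ->
  2 * qs + 2 * tq + 8 * z <= 2 * kc + 16 * k + (2 * X + 8 * Y).
Proof. lra. Qed.

Lemma lin2_arith (D k X : R) : 2 * D * k <= D * k + X -> D * k <= X.
Proof. lra. Qed.

End Arithmetic.

Section Constants.
Context {R : realType}.
Implicit Types cmin kap : R.

(** These constants are explicit and depend only on the eigenvalue bounds and [kap], so that they
    are the same for every model of the sequence. *)
Definition cst_resid cmin kap : R := 12 + (576 * kap + 18 * kap ^+ 2) / cmin.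
Definition cst_pen cmin kap : R := (kap + 24 * kap ^+ 2) / cmin.
Definition cst_gram cmin kap : R :=
  let C := 1 + cst_resid cmin kap + cst_pen cmin kap in
  2 * (C ^+ 2 + kap ^+ 2 + 72 * (C ^+ 2 * kap ^+ 2) + 1152 * kap ^+ 4) / cmin ^+ 2.
Definition cst_dir cmin cmax : R := (2 / cmin + 16) * ((72 * cmax + 9216) / cmin ^+ 2) / 4.
Definition cst_bias cmin kap : R :=
  16 / cmin * (cst_resid cmin kap + 2 * cst_pen cmin kap + 1 + 36 * kap / cmin).
Lemma cst_resid_ge0 cmin kap : 0 < cmin -> 0 <= kap -> 0 <= cst_resid cmin kap.
Proof.
move=> c0 k0; exact: (addr_ge0 (ler0n _ 12) (divr_ge0 (addr_ge0 (mulr_ge0 (ler0n _ _) k0)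
  (mulr_ge0 (ler0n _ _) (sqr_ge0 _))) (ltW c0))).
Qed.

Lemma cst_pen_ge0 cmin kap : 0 < cmin -> 0 <= kap -> 0 <= cst_pen cmin kap.
Proof.
move=> c0 k0; exact: (divr_ge0 (addr_ge0 k0 (mulr_ge0 (ler0n _ _) (sqr_ge0 _))) (ltW c0)).
Qed.

End Constants.

(** * Nodewise residuals and the number of large biases *)

Section Nodewise.
Context {R : realType} {n p : nat}.
Variables (X : 'M[R]_(n, p)) (S : 'M[R]_p) (cmin cmax : R).
Variables (l kap xm x2 q : R) (sm : nat).
Variable gh : 'I_p -> 'cV[R]_(p.-1).
Hypotheses (n0 : (0 < n)%N) (cmin0 : 0 < cmin) (sS : S^T = S) (Smin : forall V, cmin * sqnorm2 V <= qform S V)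
  (Smax : forall V, qform S V <= cmax * sqnorm2 V) (Sd : forall j, S j j <= 1) (smS : (smax S <= sm)%N)
  (l0 : 0 < l) (kap24 : 24 <= kap) (xm0 : 0 <= xm) (xmsmall : xm * (cmax + 64) <= cmin / 2).
Hypothesis RIPm : forall a, `|qform (Sigmahat X - S) a| <=
  xm * qform S a + 4 * xm * norm1 a ^+ 2 / (sm + 2)%:R.
Hypotheses (x2l : x2 <= 12 * l) (RIP2 : forall k j, `|bform (Sigmahat X - S) (delta_mx k 0) (udir S j)| <= x2)
  (RIPu : forall j, `|qform (Sigmahat X - S) (udir S j)| <= x2) (q0 : 0 <= q) (q1 : q <= 1)
  (qE : q ^+ 2 = (sm + 2)%:R * l ^+ 2) (hgh : is_nodewise_lasso X (fun=> kap * l) gh).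

Notation D := (Sigmahat X - S).
Notation u := (udir S).
Notation v := (vdir gh).
Let k0 : 0 < kap. Proof. by apply: lt_le_trans kap24. Qed.
Let lj : 0 < kap * l. Proof. by rewrite mulr_gt0. Qed.
Let d j := v j - u j.
(** The population nodewise coefficients, the target of [gh j]; [A0 j] is their support. *)
Let gs j := - row' j (u j).
Let A0 j := [set k | u j (lift j k) 0 != 0]%SET.
Let nR : 0 < n%:R :> R. Proof. by rewrite ltr0n. Qed.

Lemma cmin_le1 (j : 'I_p) : cmin <= 1.
Proof. exact: le_trans (prec_inv_ge cmin0 Smin j) (prec_inv_le1 cmin0 sS Smin Sd j). Qed.

Lemma sym_dev : D^T = D.
Proof. by rewrite linearB/= Sigmahat_sym sS. Qed.

Let emb_gs j : emb j (gs j) = delta_mx j 0 - u j.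
Proof.
rewrite /gs (_ : - row' j (u j) = row' j (delta_mx j 0 - u j)); last first.
  by apply/matrixP => a b; rewrite !mxE (eq_sym (lift j a)) (negbTE (neq_lift _ _)) sub0r.
by rewrite emb_row'// mxE mxE !eqxx [X in _ + X]mxE (udir_self cmin0 Smin) subrr.
Qed.

Let dE j : d j = - emb j (gh j - gs j).
Proof. by rewrite /d embB emb_gs /vdir; apply/matrixP => a b; rewrite !mxE; ring. Qed.

Let resid_gs j : col j X - col' j X *m gs j = X *m u j.
Proof. by rewrite -mulmx_emb emb_gs mulmxBr colE subKr. Qed.

Let cardA0 j : (#|A0 j| <= sm)%N.
Proof.
apply: leq_trans smS; apply: leq_trans (udir_sparsity sS j).
rewrite -(card_imset _ (@lift_inj _ j)); apply: subset_leq_card.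
apply/fintype.subsetP => x /imsetP[k]; rewrite /A0 !inE => kA ->.
by rewrite kA andbT eq_sym neq_lift.
Qed.

Let gs0 j k : k \notin A0 j -> gs j k 0 = 0.
Proof. by rewrite /A0 inE negbK => /eqP h; rewrite /gs mxE [row' _ _ _ _]mxE h oppr0. Qed.

(** The population residual is uncorrelated with the other variables, so only the deviation of
    [Sigmahat] from [S] remains, at most [12 l]; [24 <= kap] makes it half of the nodewise
    penalty. *)
Let gs_noise j k : `|((col' j X)^T *m (col j X - col' j X *m gs j)) k 0| / n%:R <= kap * l / 2.
Proof.
rewrite resid_gs -[n%:R^-1]gtr0_norm ?invr_gt0// -normrM.
have -> : ((col' j X)^T *m (X *m u j)) k 0 = (X^T *m (X *m u j)) (lift j k) 0.
  by rewrite !mxE; apply: eq_bigr => i _; rewrite !mxE.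
rewrite -Sigmahat_delta -bform1_delta -bform_mulr.
have e : bform (Sigmahat X) (delta_mx (lift j k) 0) (u j) = bform D (delta_mx (lift j k) 0) (u j).
  rewrite bformBm (bform_udir cmin0 Smin) mxE -[X in _ = _ - X]mulrC.
  by rewrite (negbTE (neq_lift _ _)) mul0r subr0.
have : 24 * l <= kap * l by rewrite ler_pM2r.
by move=> h; rewrite e (le_trans (RIP2 _ _))// (le_trans x2l)//; lra.
Qed.

Let cone j := lasso_cone_sqr n0 lj (hgh j) (@gs0 j) (gs_noise j).

Let RE j : cmin / 2 * sqnorm2 (gh j - gs j) <= sqnorm2 (col' j X *m (gh j - gs j)) / n%:R.
Proof.
rewrite -(sqnorm2_emb j) -mulmx_emb.
apply: (restricted_eigenvalue Smin Smax _ xm0 xmsmall RIPm) (leq_trans (cardA0 j) _) _.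
- by rewrite addn2.
- by rewrite leq_addr.
- by rewrite norm1_emb sqnorm2_emb; exact: cone.
Qed.

Let rates j := lasso_rates n0 lj (hgh j) (@gs0 j) (gs_noise j) (divr_gt0 cmin0 (ltr0Sn R 1)) (RE j).

Let smR : 0 <= sm%:R :> R. Proof. exact: ler0n. Qed.

Lemma norm1_dir_err j : norm1 (v j - u j) <= 24 * kap * (sm%:R * l) / cmin.
Proof.
rewrite -/(d j) dE -scaleN1r norm1Z normrN1 mul1r norm1_emb.
have [_ h _ _] := rates j; apply: (le_trans h).
have : #|A0 j|%:R <= sm%:R :> R by rewrite ler_nat; exact: cardA0.
set a := #|A0 j|%:R => ha.
have -> : 12 * a * (kap * l) / (cmin / 2) = 24 * kap * (a * l) / cmin.
  by field; rewrite gt_eqF.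
rewrite ler_pM2r ?invr_gt0// ler_pM2l ?mulr_gt0// ler_pM2r//.
Qed.

Lemma qform_dir_err j : qform (Sigmahat X) (v j - u j) <= 18 * kap ^+ 2 * (sm%:R * l ^+ 2) / cmin.
Proof.
rewrite -/(d j) dE -scaleN1r qformZ sqrrN expr1n mul1r qform_Sigmahat mulmx_emb.
have [_ _ h _] := rates j; apply: (le_trans h).
have : #|A0 j|%:R <= sm%:R :> R by rewrite ler_nat; exact: cardA0.
set a := #|A0 j|%:R => ha.
have -> : 9 * a * (kap * l) ^+ 2 / (cmin / 2) = 18 * kap ^+ 2 * (a * l ^+ 2) / cmin.
  by field; rewrite gt_eqF.
by rewrite ler_pM2r ?invr_gt0// ler_pM2l ?mulr_gt0 ?exprn_gt0// ler_pM2r// exprn_gt0.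
Qed.

Let ql : l <= q.
Proof.
rewrite -(@ler_pXn2r _ 2)// ?nnegrE ?(ltW l0)// qE -[leLHS]mul1r ler_wpM2r ?sqr_ge0//.
by rewrite ler1n addn2.
Qed.

Let qsm : sm%:R * l ^+ 2 <= q ^+ 2.
Proof. by rewrite qE ler_wpM2r ?sqr_ge0// ler_nat leq_addr. Qed.

Let q2 : q ^+ 2 <= q. Proof. by rewrite expr2 ler_piMr. Qed.

(** With [v = u + d], the cross term sees only [D]: [S u] is a multiple of the basis vector [j], and
    [d] vanishes at [j]. It is then of the order [l * norm1 d], like the quadratic term in [d]. *)
Lemma resid_bound j : `|sqnorm2 (resid X gh j) / n%:R - (invmx S j j)^-1| <= cst_resid cmin kap * q.
Proof.
rewrite -mul_vdir -qform_Sigmahat.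
have -> : v j = u j + d j by rewrite /d addrC subrK.
rewrite qformD ?Sigmahat_sym//.
have dj : d j j 0 = 0 by rewrite dE mxE emb_self oppr0.
have e1 : bform (Sigmahat X) (u j) (d j) = bform D (u j) (d j).
  by rewrite bformBm (bform_sym _ _ sS) (bform_udir cmin0 Smin) dj mulr0 subr0.
have e2 : qform (Sigmahat X) (u j) = qform D (u j) + (invmx S j j)^-1.
  by rewrite /qform bformBm -!/(qform _ _) (qform_udir cmin0 Smin) subrK.
have h1 : `|bform D (u j) (d j)| <= x2 * norm1 (d j).
  rewrite (bform_sym _ _ sym_dev) bform_mulr (bform_sym _ _ (trmx1 _ _)).
  apply: bform1_le => k; rewrite -bform1_delta -bform_mulr; exact: RIP2.
have h2 := norm1_dir_err j; have h3 := qform_dir_err j; rewrite -/(d j) in h2 h3.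
have h4 : 0 <= qform (Sigmahat X) (d j) by rewrite qform_Sigmahat divr_ge0 ?sqnorm2_ge0.
have h5 := RIPu j.
rewrite e1 e2; set B := bform D _ _ in h1 *; set Q := qform D _ in h5 *; set E := qform _ (d j) in h3 h4 *.
have -> : Q + (invmx S j j)^-1 + 2 * B + E - (invmx S j j)^-1 = Q + 2 * B + E by ring.
have c0 : 0 < cmin^-1 by rewrite invr_gt0.
have x20 : 0 <= x2 by apply: le_trans (normr_ge0 _) h5.
have h6 : x2 * norm1 (d j) <= 12 * l * (24 * kap * (sm%:R * l) / cmin).
  by rewrite ler_pM ?norm1_ge0.
have h7 : 2 * (12 * l * (24 * kap * (sm%:R * l) / cmin)) <= 576 * kap / cmin * q.
  have -> : 2 * (12 * l * (24 * kap * (sm%:R * l) / cmin)) = 576 * kap / cmin * (sm%:R * l ^+ 2) by ring.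
  apply: ler_wpM2l; last exact: le_trans qsm q2.
  by apply: divr_ge0 (ltW cmin0); apply: mulr_ge0 (ler0n _ _) (ltW k0).
have h8 : 18 * kap ^+ 2 * (sm%:R * l ^+ 2) / cmin <= 18 * kap ^+ 2 / cmin * q.
  have -> : 18 * kap ^+ 2 * (sm%:R * l ^+ 2) / cmin = 18 * kap ^+ 2 / cmin * (sm%:R * l ^+ 2) by ring.
  apply: ler_wpM2l; last exact: le_trans qsm q2.
  by apply: divr_ge0 (ltW cmin0); apply: mulr_ge0 (ler0n _ _) (sqr_ge0 _).
have -> : cst_resid cmin kap * q = 12 * q + 576 * kap / cmin * q + 18 * kap ^+ 2 / cmin * q.
  by rewrite /cst_resid; ring.
move: h1 h5; rewrite !ler_norml => /andP[h1a h1b] /andP[h5a h5b].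
have h9 : 2 * (x2 * norm1 (d j)) <= 576 * kap / cmin * q.
  by apply: le_trans h7; rewrite ler_pM2l.
have h10 : x2 <= 12 * q by apply: le_trans x2l _; rewrite ler_pM2l// ql.
have h11 := le_trans h3 h8; move: h1a h1b h9 h11 => {h2 h3 h6 h7 h8}.
set G1 := 576 * kap / cmin * q; set G2 := 18 * kap ^+ 2 / cmin * q; set G3 := x2 * norm1 _.
by move=> ? ? ? ?; apply/andP; split; lra.
Qed.

(** By Cauchy-Schwarz on the support the target has l1-norm at most [sqrt (sm / cmin)], and [l]
    times this is of the order of [q]; the estimation error is of the order [q^2 <= q]. *)
Lemma penalty_bound j : kap * l * norm1 (gh j) <= cst_pen cmin kap * q.
Proof.
have e : norm1 (gh j) <= norm1 (row' j (u j)) + norm1 (d j).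
  have -> : norm1 (d j) = norm1 (gh j - gs j) by rewrite dE -scaleN1r norm1Z normrN1 mul1r norm1_emb.
  rewrite -[X in norm1 X <= _](subrK (gs j)) (le_trans (ler_norm1D _ _))// addrC lerD2r.
  by rewrite /gs -scaleN1r norm1Z normrN1 mul1r.
have h1 : norm1 (row' j (u j)) ^+ 2 <= sm%:R / cmin.
  have -> : norm1 (row' j (u j)) = \sum_(k in A0 j) `|row' j (u j) k 0|.
    rewrite /norm1 (bigID (mem (A0 j)))/= [X in _ + X]big1 ?addr0// => k.
    by move=> /gs0; rewrite /gs mxE => /eqP; rewrite oppr_eq0 => /eqP ->; rewrite normr0.
  apply: le_trans (sum_sqr_le _ _) _; apply: ler_pM; rewrite ?ler0n ?sqnorm2_ge0 ?ler_nat ?cardA0//.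
  apply: (@le_trans _ _ (sqnorm2 (u j))).
    rewrite /sqnorm2 [leRHS](@bigD1_ord _ _ _ _ j)//= [leRHS]addrC -[leLHS]addr0 lerD ?sqr_ge0//.
    by apply: ler_sum => k _; rewrite mxE.
  apply: le_trans (sqnorm2_udir cmin0 Smin j) _.
  by rewrite ler_piMl ?invr_ge0 ?(ltW cmin0)// (prec_inv_le1 cmin0 sS Smin Sd).
have h2 : kap * l * norm1 (row' j (u j)) <= kap / cmin * q.
  rewrite -(@ler_pXn2r _ 2)// ?nnegrE; last 2 first.
  - by rewrite mulr_ge0 ?norm1_ge0// (ltW lj).
  - by rewrite mulr_ge0// divr_ge0 ?(ltW k0) ?(ltW cmin0).
  rewrite exprMn (_ : (kap / cmin * q) ^+ 2 = kap ^+ 2 * (q ^+ 2 / cmin ^+ 2)); last first.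
    by field; rewrite gt_eqF.
  rewrite [(kap * l) ^+ 2]exprMn -mulrA ler_pM2l ?exprn_gt0//.
  apply: (@le_trans _ _ (l ^+ 2 * (sm%:R / cmin))); first by rewrite ler_pM2l ?exprn_gt0.
  apply: (@le_trans _ _ (q ^+ 2 / cmin)); first by rewrite mulrA ler_pM2r ?invr_gt0// mulrC.
  rewrite ler_wpM2l ?sqr_ge0// lef_pV2 ?posrE ?exprn_gt0//.
  by rewrite expr2 ler_piMr ?(ltW cmin0)// (cmin_le1 j).
have h3 : kap * l * norm1 (d j) <= 24 * kap ^+ 2 / cmin * q.
  apply: (@le_trans _ _ (kap * l * (24 * kap * (sm%:R * l) / cmin))).
    by rewrite ler_pM2l//; exact: norm1_dir_err.
  have -> : kap * l * (24 * kap * (sm%:R * l) / cmin) = 24 * kap ^+ 2 / cmin * (sm%:R * l ^+ 2) by ring.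
  apply: ler_wpM2l; last exact: le_trans qsm q2.
  by apply: divr_ge0 (ltW cmin0); apply: mulr_ge0 (ler0n _ _) (sqr_ge0 _).
apply: (le_trans (ler_wpM2l (ltW lj) e)).
by rewrite mulrDr /cst_pen !mulrDl; lra.
Qed.

Lemma sqnorm2_dir_err j : sqnorm2 (v j - u j) <= 36 * (kap ^+ 2 * (sm%:R * l ^+ 2)) / cmin ^+ 2.
Proof.
rewrite -/(d j) dE -scaleN1r sqnorm2Z sqrrN expr1n mul1r sqnorm2_emb.
have [_ _ _ h] := rates j; apply: (le_trans h).
have : #|A0 j|%:R <= sm%:R :> R by rewrite ler_nat; exact: cardA0.
set a := #|A0 j|%:R => ha.
have -> : 9 * a * (kap * l) ^+ 2 / (cmin / 2) ^+ 2 = a * (36 * (kap ^+ 2 * l ^+ 2 / cmin ^+ 2)).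
  by field; rewrite gt_eqF.
have -> : 36 * (kap ^+ 2 * (sm%:R * l ^+ 2)) / cmin ^+ 2 = sm%:R * (36 * (kap ^+ 2 * l ^+ 2 / cmin ^+ 2)) by ring.
apply: ler_wpM2r ha; apply: mulr_ge0 (ler0n _ _) _.
exact: (divr_ge0 (mulr_ge0 (sqr_ge0 _) (sqr_ge0 _)) (sqr_ge0 _)).
Qed.

Lemma gram_off k j : k != j -> `|(Sigmahat X *m v j) k 0| <= kap * l.
Proof.
move=> kj; rewrite Sigmahat_delta mul_vdir.
have [k' -> _] : {k' | k = lift j k' & unlift j k = Some k'} by apply: unlift_some; rewrite eq_sym.
have := lasso_kkt n0 lj (hgh j) k'; rewrite -/(resid X gh j) normrM normfV (gtr0_norm nR).
congr (`|_| / _ <= _).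
by rewrite !mxE; apply: eq_bigr => i _; rewrite !mxE.
Qed.

Lemma gram_diag j : `|(Sigmahat X *m v j) j 0| <= 1 + cst_resid cmin kap + cst_pen cmin kap.
Proof.
have -> : (Sigmahat X *m v j) j 0 = sqnorm2 (resid X gh j) / n%:R + kap * l * norm1 (gh j).
  rewrite Sigmahat_delta mul_vdir.
  have -> : (X^T *m resid X gh j) j 0 = bform 1%:M (col j X) (resid X gh j).
    by rewrite bform1E mxE; apply: eq_bigr => i _; rewrite !mxE.
  have -> : col j X = resid X gh j + col' j X *m gh j by rewrite subrK.
  rewrite bformDl mulrDl -/(qform _ _) -sqnorm2E -(lasso_inner (hgh j)) -/(resid X gh j).
  by rewrite bform_sym ?trmx1// bform1_mul.
have h1 := resid_bound j; have h2 := penalty_bound j; have h3 := prec_inv_le1 cmin0 sS Smin Sd j.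
have r0 : 0 <= sqnorm2 (resid X gh j) / n%:R by rewrite divr_ge0 ?sqnorm2_ge0.
have p0 : 0 <= kap * l * norm1 (gh j) by rewrite mulr_ge0 ?norm1_ge0// ltW.
rewrite ger0_norm ?addr_ge0//.
have c1 : cst_resid cmin kap * q <= cst_resid cmin kap.
  apply: ler_piMr q1; apply: addr_ge0 (ler0n _ _) _; apply: divr_ge0 (ltW cmin0).
  exact: (addr_ge0 (mulr_ge0 (ler0n _ _) (ltW k0)) (mulr_ge0 (ler0n _ _) (sqr_ge0 _))).
have c2 : cst_pen cmin kap * q <= cst_pen cmin kap.
  apply: ler_piMr q1; apply: divr_ge0 (ltW cmin0).
  exact: (addr_ge0 (ltW k0) (mulr_ge0 (ler0n _ _) (sqr_ge0 _))).
by move: h1; rewrite ler_norml => /andP[_ h1]; lra.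
Qed.

(* [rho_i . rho_j / n = (u_i + d_i) . m_j] with [m_j = Sigmahat v_j], whose
   off-diagonal entries are bounded by the KKT conditions. *)
Lemma gram_sum j :
  \sum_i (bform 1%:M (resid X gh i) (resid X gh j) / n%:R) ^+ 2 <= cst_gram cmin kap * (1 + p%:R * q ^+ 2).
Proof.
pose C := 1 + cst_resid cmin kap + cst_pen cmin kap; pose m := Sigmahat X *m v j.
have C0 : 0 <= C by apply: le_trans (gram_diag j).
have mj : `|m j 0| <= C by exact: gram_diag.
have mk k : k != j -> `|m k 0| <= kap * l by exact: gram_off.
have sq2 (a b : R) : 0 <= b -> `|a| <= b -> a ^+ 2 <= b ^+ 2.
  by move=> b0 ab; rewrite -[a ^+ 2]ger0_norm ?sqr_ge0// normrX lerXn2r ?nnegrE.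
have pR : 0 <= p%:R :> R by exact: ler0n.
have l2q : l ^+ 2 <= q ^+ 2 by rewrite lerXn2r ?nnegrE ?(ltW l0).
have m2 : sqnorm2 m <= C ^+ 2 + p%:R * (kap ^+ 2 * q ^+ 2).
  rewrite /sqnorm2 (bigD1 j)//=; apply: lerD; first exact: sq2.
  apply: (@le_trans _ _ (\sum_(i < p | i != j) (kap * l) ^+ 2)).
    by apply: ler_sum => i ij; apply: sq2 (mk i ij); exact: ltW.
  rewrite sumr_const -[leLHS]mulr_natl exprMn; apply: ler_pM.
  - exact: ler0n.
  - exact: (mulr_ge0 (sqr_ge0 _) (sqr_ge0 _)).
  - by rewrite ler_nat -[leqRHS]card_ord max_card.
  - by rewrite ler_wpM2l ?sqr_ge0.
(* The numbers [u i . m] are the entries of [invmx S *m m] times factors at most 1, so that summing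
   over [i] costs no factor [p]. *)
have hu : \sum_i (bform 1%:M (u i) m) ^+ 2 <= sqnorm2 m / cmin ^+ 2.
  apply: (@le_trans _ _ (sqnorm2 (invmx S *m m))).
    apply: ler_sum => i _.
    have -> : bform 1%:M (u i) m = (invmx S i i)^-1 * (invmx S *m m) i 0.
      rewrite /udir bformZl bform1E !mxE; congr (_ * _); apply: eq_bigr => k _.
      by rewrite mxE -[in LHS](prec_sym sS) mxE.
    have t0 : 0 <= (invmx S i i)^-1 by apply: le_trans (prec_inv_ge cmin0 Smin i); exact: ltW.
    have t1 := prec_inv_le1 cmin0 sS Smin Sd i.
    by rewrite exprMn ler_piMl ?sqr_ge0// exprn_ile1.
  have h1 : cmin * sqnorm2 (invmx S *m m) <= qform S (invmx S *m m) by exact: Smin.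
  have h2 : qform S (invmx S *m m) = qform (invmx S) m.
    rewrite /qform /bform trmx_mul (prec_sym sS) -!mulmxA [S *m _]mulmxA.
    by rewrite mulmxV ?(cov_unit cmin0 Smin)// mul1mx.
  have h3 := qform_prec cmin0 sS Smin m.
  rewrite ler_pdivlMr ?exprn_gt0// expr2 mulrA -ler_pdivlMr// mulrC.
  by apply: le_trans h1 _; rewrite h2.
(* The vector [m] has one entry of order 1, at [j], to be paired with the l2 error of [d i], and
   entries at most [kap l] elsewhere, to be paired with its l1 error. *)
have hd i : (bform 1%:M (d i) m) ^+ 2 <=
    (72 * (C ^+ 2 * kap ^+ 2) + 1152 * kap ^+ 4) / cmin ^+ 2 * q ^+ 2.
  have b1 : `|bform 1%:M (d i) m| <= C * `|d i j 0| + kap * l * norm1 (d i).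
    rewrite bform1E (bigD1 j)//= (le_trans (ler_normD _ _))// lerD//.
      by rewrite normrM mulrC ler_wpM2r.
    rewrite (le_trans (ler_norm_sum _ _ _))// /norm1 mulr_sumr [leRHS](bigD1 j)//= -[leLHS]add0r.
    rewrite lerD ?mulr_ge0 ?(ltW k0) ?(ltW l0)//; apply: ler_sum => k kj.
    by rewrite normrM mulrC ler_wpM2r// mk.
  have b0 : 0 <= C * `|d i j 0| + kap * l * norm1 (d i).
    by rewrite addr_ge0 ?mulr_ge0 ?norm1_ge0 ?(ltW k0) ?(ltW l0).
  apply: le_trans (sq2 _ _ b0 b1) _.
  have d2 : `|d i j 0| ^+ 2 <= 36 * (kap ^+ 2 * (sm%:R * l ^+ 2)) / cmin ^+ 2.
    apply: le_trans (sqnorm2_dir_err i); rewrite -/(d i) /sqnorm2 (bigD1 j)//= -normrX.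
    by rewrite ger0_norm ?sqr_ge0// lerDl sumr_ge0// => k _; exact: sqr_ge0.
  have d1 : norm1 (d i) ^+ 2 <= (24 * kap * (sm%:R * l) / cmin) ^+ 2.
    apply: sq2; last by rewrite ger0_norm ?norm1_ge0//; exact: norm1_dir_err.
    exact: le_trans (norm1_ge0 _) (norm1_dir_err i).
  have e1 : (C * `|d i j 0| + kap * l * norm1 (d i)) ^+ 2 <=
     2 * (C ^+ 2 * `|d i j 0| ^+ 2) + 2 * (kap ^+ 2 * l ^+ 2 * norm1 (d i) ^+ 2).
    have := sqr_ge0 (C * `|d i j 0| - kap * l * norm1 (d i)).
    by move: (C) (`|d i j 0|) (norm1 (d i)) => x y z; lra.
  apply: le_trans e1 _.
  have f1 := ler_wpM2l (sqr_ge0 C) d2.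
  have f2 := ler_wpM2l (mulr_ge0 (sqr_ge0 kap) (sqr_ge0 l)) d1.
  have g1 : C ^+ 2 * (36 * (kap ^+ 2 * (sm%:R * l ^+ 2)) / cmin ^+ 2) <=
     C ^+ 2 * (36 * (kap ^+ 2 * q ^+ 2) / cmin ^+ 2).
    apply: (ler_wpM2l (sqr_ge0 C)); apply: ler_wpM2r; first by rewrite invr_ge0 sqr_ge0.
    by apply: ler_wpM2l; [exact: ler0n|exact: (ler_wpM2l (sqr_ge0 kap) qsm)].
  have g2 : kap ^+ 2 * l ^+ 2 * (24 * kap * (sm%:R * l) / cmin) ^+ 2 <= 576 * kap ^+ 4 / cmin ^+ 2 * q ^+ 2.
    have -> : kap ^+ 2 * l ^+ 2 * (24 * kap * (sm%:R * l) / cmin) ^+ 2 =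
      576 * kap ^+ 4 / cmin ^+ 2 * (sm%:R * l ^+ 2) ^+ 2 by field; rewrite gt_eqF.
    apply: ler_wpM2l.
      exact: (divr_ge0 (mulr_ge0 (ler0n _ _) (exprn_ge0 _ (ltW k0))) (sqr_ge0 _)).
    have s0 : 0 <= sm%:R * l ^+ 2 by rewrite mulr_ge0 ?sqr_ge0.
    have s1 := le_trans qsm q2.
    rewrite expr2; apply: le_trans qsm; rewrite ler_piMr//; exact: le_trans s1 q1.
  have -> : (72 * (C ^+ 2 * kap ^+ 2) + 1152 * kap ^+ 4) / cmin ^+ 2 * q ^+ 2 =
    2 * (C ^+ 2 * (36 * (kap ^+ 2 * q ^+ 2) / cmin ^+ 2)) + 2 * (576 * kap ^+ 4 / cmin ^+ 2 * q ^+ 2) by ring.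
  apply: lerD; rewrite ler_pM2l//; [exact: le_trans f1 g1|exact: le_trans f2 g2].
have hi i : (bform 1%:M (resid X gh i) (resid X gh j) / n%:R) ^+ 2 <=
    2 * (bform 1%:M (u i) m) ^+ 2 + 2 * (bform 1%:M (d i) m) ^+ 2.
  rewrite -!mul_vdir -bform_Sigmahat bform_mulr -/m.
  have -> : v i = u i + d i by rewrite /d addrC subrK.
  rewrite bformDl; have := sqr_ge0 (bform 1%:M (u i) m - bform 1%:M (d i) m).
  by move: (bform _ (u i) _) (bform _ (d i) _) => x y; lra.
apply: (le_trans (ler_sum _ (fun i _ => hi i))); rewrite big_split/= -!mulr_sumr.
set B := (72 * _ + _) / _ in hd.
have hs : \sum_i bform 1%:M (d i) m ^+ 2 <= p%:R * (B * q ^+ 2).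
  apply: (@le_trans _ _ (\sum_(i < p) B * q ^+ 2)); first by apply: ler_sum => i _.
  by rewrite sumr_const card_ord -[leLHS]mulr_natl.
have ic : 0 <= (cmin ^+ 2)^-1 by rewrite invr_ge0 sqr_ge0.
have m3 : sqnorm2 m / cmin ^+ 2 <= (C ^+ 2 + p%:R * (kap ^+ 2 * q ^+ 2)) / cmin ^+ 2.
  by rewrite ler_wpM2r.
have -> : cst_gram cmin kap * (1 + p%:R * q ^+ 2) =
   2 * ((C ^+ 2 + p%:R * (kap ^+ 2 * q ^+ 2)) / cmin ^+ 2) + 2 * (p%:R * (B * q ^+ 2)) +
   2 * ((kap ^+ 2 + 72 * (C ^+ 2 * kap ^+ 2) + 1152 * kap ^+ 4 + C ^+ 2 * (p%:R * q ^+ 2)) / cmin ^+ 2).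
  by rewrite /cst_gram -/C /B; ring.
have rest : 0 <= 2 * ((kap ^+ 2 + 72 * (C ^+ 2 * kap ^+ 2) + 1152 * kap ^+ 4 + C ^+ 2 * (p%:R * q ^+ 2)) / cmin ^+ 2).
  apply: mulr_ge0 (ler0n _ _) _; apply: mulr_ge0 ic; apply: addr_ge0; last first.
    exact: (mulr_ge0 (sqr_ge0 _) (mulr_ge0 pR (sqr_ge0 _))).
  apply: addr_ge0; last exact: (mulr_ge0 (ler0n _ _) (exprn_ge0 _ (ltW k0))).
  exact: (addr_ge0 (sqr_ge0 _) (mulr_ge0 (ler0n _ _) (mulr_ge0 (sqr_ge0 _) (sqr_ge0 _)))).
have hu3 := le_trans hu m3.
move: hu3 hs rest; set a1 := \sum_i _; set a2 := \sum_i _; set a3 := _ / _; set a4 := p%:R * _; set a5 := 2 * (_ / _).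
move=> ? ? ?; lra.
Qed.

Variables (eps : 'cV[R]_n) (beta bh : 'cV[R]_p) (xs sigma : R) (s : nat).
Hypotheses (cmax0 : 0 <= cmax) (qsmall : cst_resid cmin kap * q <= cmin / 2) (s0 : (0 < s)%N)
  (betas : (sparsity beta <= s)%N) (sigma0 : 0 < sigma) (xs0 : 0 < xs) (xssmall : xs * (cmax + 64) <= cmin / 2).
(** The isometry is required on sums of a vector and a combination of the directions [u j]:
    polarisation then reaches [bform D (Umx *m b) h]. *)
Definition Umx : 'M[R]_p := \matrix_(i, j) udir S j i 0.
Hypotheses (RIPs : forall a b, `|qform (Sigmahat X - S) (a + Umx *m b)| <=
    xs * qform S (a + Umx *m b) + 4 * xs * (norm1 a + norm1 b) ^+ 2 / s%:R)
  (hbh : is_lasso X (response X eps beta) (8 * sigma * l) bh)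
  (noise : forall k, `|(X^T *m eps) k 0| / n%:R <= 4 * sigma * l).

Let lam := 8 * sigma * l.
Let lam0 : 0 < lam. Proof. by rewrite !mulr_gt0. Qed.
Let h := bh - beta.
Let sR : 0 < s%:R :> R. Proof. by rewrite ltr0n. Qed.
Let beta0 k : k \notin relevant beta -> beta k 0 = 0.
Proof. by rewrite inE negbK => /eqP. Qed.
Let noise' k : `|(X^T *m (response X eps beta - X *m beta)) k 0| / n%:R <= lam / 2.
Proof.
rewrite /response addrC addKr; apply: le_trans (noise k) _; rewrite /lam; lra.
Qed.

Let RIPs0 a : `|qform D a| <= xs * qform S a + 4 * xs * norm1 a ^+ 2 / s%:R.
Proof.
have := RIPs a 0; rewrite mulmx0 addr0.
have -> : norm1 (0 : 'cV[R]_p) = 0 by rewrite /norm1 big1// => i _; rewrite mxE normr0.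
by rewrite addr0.
Qed.

Let lasso_dev : [/\ norm1 h <= 24 * (s%:R * lam) / cmin,
   qform (Sigmahat X) h <= 18 * (s%:R * lam ^+ 2) / cmin &
   sqnorm2 h <= 36 * (s%:R * lam ^+ 2) / cmin ^+ 2].
Proof.
have cn := lasso_cone_sqr n0 lam0 hbh beta0 noise'.
have re := restricted_eigenvalue Smin Smax s0 (ltW xs0) xssmall RIPs0 betas cn.
have [_ h1 h2 h3] := lasso_rates n0 lam0 hbh beta0 noise' (divr_gt0 cmin0 (ltr0Sn R 1)) re.
have ks : #|relevant beta|%:R <= s%:R :> R by rewrite ler_nat.
rewrite qform_Sigmahat; set k : R := #|relevant beta|%:R in h1 h2 h3 ks.
have ci : 0 < cmin^-1 by rewrite invr_gt0.
have e1 : 0 < lam * cmin^-1 by rewrite mulr_gt0.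
split.
- apply: le_trans h1 _.
  rewrite (_ : 12 * k * lam / (cmin / 2) = k * (24 * (lam / cmin))); last by field; rewrite gt_eqF.
  rewrite (_ : 24 * (s%:R * lam) / cmin = s%:R * (24 * (lam / cmin))); last by ring.
  by apply: ler_wpM2r => //; apply: mulr_ge0 (ler0n _ _) (ltW e1).
- apply: le_trans h2 _.
  rewrite (_ : 9 * k * lam ^+ 2 / (cmin / 2) = k * (18 * (lam ^+ 2 / cmin))); last by field; rewrite gt_eqF.
  rewrite (_ : 18 * (s%:R * lam ^+ 2) / cmin = s%:R * (18 * (lam ^+ 2 / cmin))); last by ring.
  by apply: ler_wpM2r => //; apply: mulr_ge0 (ler0n _ _) (divr_ge0 (sqr_ge0 _) (ltW cmin0)).
- apply: le_trans h3 _.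
  rewrite (_ : 9 * k * lam ^+ 2 / (cmin / 2) ^+ 2 = k * (36 * (lam ^+ 2 / cmin ^+ 2))); last by field; rewrite gt_eqF.
  rewrite (_ : 36 * (s%:R * lam ^+ 2) / cmin ^+ 2 = s%:R * (36 * (lam ^+ 2 / cmin ^+ 2))); last by ring.
  by apply: ler_wpM2r => //; apply: mulr_ge0 (ler0n _ _) (divr_ge0 (sqr_ge0 _) (sqr_ge0 _)).
Qed.

Let gram_h k : `|(Sigmahat X *m h) k 0| <= 3 / 2 * lam.
Proof.
have h1 := lasso_kkt n0 lam0 hbh k; have h2 := noise k.
rewrite Sigmahat_delta.
have e : X^T *m (X *m h) = X^T *m eps - X^T *m (response X eps beta - X *m bh).
  rewrite -mulmxBr; apply: (congr1 (mulmx X^T)); rewrite /response /h mulmxBr.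
  by apply/matrixP => a b; rewrite !mxE; ring.
rewrite e submxE mulrBl (le_trans (ler_normB _ _))//.
rewrite !normrM normfV (gtr0_norm nR); rewrite /lam in h1 *; lra.
Qed.

Let resid_lb j : cmin / 2 <= sqnorm2 (resid X gh j) / n%:R.
Proof.
have := resid_bound j.
have := prec_inv_ge cmin0 Smin j; rewrite ler_norml; have := qsmall; move=> ? ? /andP[? ?]; lra.
Qed.

Notation tau2 := (tauhat2 X (fun=> kap * l) gh).
Let cR := cst_resid cmin kap.
Let cP := cst_pen cmin kap.

Let tau2E j : tau2 j = sqnorm2 (resid X gh j) / n%:R + 2 * (kap * l * norm1 (gh j)).
Proof. by rewrite /tauhat2 /lasso_obj -/(resid X gh j) !mulrA. Qed.

Let pen j : 0 <= kap * l * norm1 (gh j) <= cP * q.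
Proof.
rewrite (penalty_bound j) andbT.
by rewrite mulr_ge0 ?norm1_ge0// mulr_ge0 ?(ltW l0)// (le_trans _ kap24).
Qed.

Notation B := (bias_term X beta (fun=> kap * l) bh gh).

(** The KKT conditions of the nodewise Lasso pair with the l1 error of the Lasso: apart from the
    term in [h j], a bound of order [s l^2 sigma], useful when [s] is the smaller sparsity. *)
Let bias1 j : `|B j| <= cP * q * `|h j 0| + kap * l * norm1 h.
Proof.
rewrite /bias_term -/h.
have -> : bform (Sigmahat X) (v j) h =
    h j 0 * (tau2 j - kap * l * norm1 (gh j)) +
    bform 1%:M ((col' j X)^T *m resid X gh j) (row' j h) / n%:R.
  have e1 : h = h j 0 *: delta_mx j 0 + emb j (row' j h).
    apply/matrixP => k i; rewrite ord1 [RHS]addmxE scalemxE deltamxE [emb _ _ _ _]mxE.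
    case: unliftP => [k' ->|->]; last by rewrite eqxx mulr1 addr0.
    by rewrite eq_sym (negbTE (neq_lift _ _)) mulr0 add0r [row' _ _ _ _]mxE.
  rewrite {1}e1 bformDr bformZr bform_Sigmahat mul_vdir; congr (_ * _ + _).
    have := lasso_inner (hgh j); rewrite -/(resid X gh j) -bform1_mul => e2.
    rewrite tau2E -e2 -colE.
    have -> : col j X = resid X gh j + col' j X *m gh j by rewrite subrK.
    by rewrite bformDr -/(qform _ _) -sqnorm2E; ring.
  by rewrite bform_Sigmahat mul_vdir mulmx_emb bform1_mul.
have -> : tau2 j * h j 0 - (h j 0 * (tau2 j - kap * l * norm1 (gh j)) +
    bform 1%:M ((col' j X)^T *m resid X gh j) (row' j h) / n%:R) =
   kap * l * norm1 (gh j) * h j 0 - bform 1%:M ((col' j X)^T *m resid X gh j) (row' j h) / n%:R by ring.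
rewrite (le_trans (ler_normB _ _))// lerD//.
  rewrite normrM ler_wpM2r//; have /andP[a b] := pen j; by rewrite ger0_norm.
rewrite normrM normfV (gtr0_norm nR) ler_pdivrMr//.
apply: (@le_trans _ _ (kap * l * n%:R * norm1 (row' j h))).
  apply: bform1_le => k; have := lasso_kkt n0 (mulr_gt0 (lt_le_trans (ltr0Sn R 23) kap24) l0) (hgh j) k.
  by rewrite -/(resid X gh j) ler_pdivrMr.
have hr : norm1 (row' j h) <= norm1 h.
  rewrite /norm1 [leRHS](@bigD1_ord _ _ _ _ j)//= -[leLHS]add0r lerD//.
  by apply: ler_sum => k _; rewrite mxE.
rewrite (_ : kap * l * norm1 h * n%:R = kap * l * n%:R * norm1 h); last by ring.
apply: ler_wpM2l hr.
by rewrite !mulr_ge0 ?(ltW l0)// (le_trans _ kap24).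
Qed.

Let tau2_prec j : `|tau2 j - (invmx S j j)^-1| <= (cR + 2 * cP) * q.
Proof.
have := resid_bound j.
have /andP[] := pen j; rewrite tau2E -/cR !ler_norml => h1 h2 /andP[h3 h4]; apply/andP; split; lra.
Qed.

(** With [v j] replaced by [u j], the Lasso KKT conditions pair with the l1 error of the nodewise
    Lasso: a term of order [sm l^2 sigma], useful when [sm] is the smaller sparsity. The term in [D]
    and [u j] is small for most [j] only. *)
Let bias2 j : `|B j| <= (cR + 2 * cP) * q * `|h j 0| + `|bform D (u j) h|
   + 36 * (kap * (sm%:R * l) * lam / cmin).
Proof.
rewrite /bias_term -/h.
have -> : bform (Sigmahat X) (v j) h =
   bform D (u j) h + (invmx S j j)^-1 * h j 0 + bform (Sigmahat X) (v j - u j) h.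
  rewrite bformBm [bform S _ _]bform_sym// (bform_udir cmin0 Smin) subrK -bformDl.
  by rewrite addrC subrK.
set b1 := bform D _ _; set b2 := bform _ (_ - _) _; set t := (invmx S j j)^-1.
have -> : tau2 j * h j 0 - (b1 + t * h j 0 + b2) = (tau2 j - t) * h j 0 - b1 - b2 by ring.
have h2 : `|b2| <= 36 * (kap * (sm%:R * l) * lam / cmin).
  rewrite /b2 bform_mulr (bform_sym _ _ (trmx1 _ _)).
  apply: le_trans (bform1_le _ gram_h) _.
  have h0 := norm1_dir_err j.
  apply: le_trans (ler_wpM2l _ h0) _; first by apply: mulr_ge0 (ltW lam0); lra.
  rewrite (_ : 3 / 2 * lam * _ = 36 * (kap * (sm%:R * l) * lam / cmin))//; field.
  by rewrite gt_eqF.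
apply: le_trans (ler_normB _ _) _; apply: lerD h2.
apply: le_trans (ler_normB _ _) _; apply: lerD => //.
by rewrite normrM ler_wpM2r// tau2_prec.
Qed.

Let count_h (K : R) : 0 <= K ->
  #|[set j | K * lam < `|h j 0|]%SET|%:R * K ^+ 2 <= 36 / cmin ^+ 2 * s%:R.
Proof.
move=> K0; have [_ _ h2] := lasso_dev; set J := [set j | _]%SET.
have h1 : #|J|%:R * (K * lam) ^+ 2 <= sqnorm2 h.
  rewrite /sqnorm2 (bigID (mem J))/= -[leLHS]addr0 lerD//; last first.
    by apply: sumr_ge0 => i _; exact: sqr_ge0.
  rewrite mulr_natl -sumr_const; apply: ler_sum => j; rewrite inE => jJ.
  rewrite -[leRHS]ger0_norm ?sqr_ge0// normrX lerXn2r ?nnegrE ?(ltW jJ)//.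
  by rewrite mulr_ge0// ltW.
have l2 : 0 < lam ^+ 2 by rewrite exprn_gt0.
rewrite -(ler_pM2r l2); move: (le_trans h1 h2).
rewrite (_ : #|J|%:R * (K * lam) ^+ 2 = #|J|%:R * K ^+ 2 * lam ^+ 2); last by ring.
by rewrite (_ : 36 * (s%:R * lam ^+ 2) / cmin ^+ 2 = 36 / cmin ^+ 2 * s%:R * lam ^+ 2)//; ring.
Qed.

(* Polarisation of the restricted isometry against [Umx b], where [b] collects
   the signs of the large entries. *)
Let count_dir_sub (K : R) (J : {set 'I_p}) : 0 < K ->
  (forall j, j \in J -> K * xs * lam < `|bform D (u j) h|) -> (#|J| <= s)%N ->
  #|J|%:R * K ^+ 2 <= cst_dir cmin cmax * s%:R.
Proof.
move=> K0 hJ Js; set k : R := #|J|%:R.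
pose b : 'cV[R]_p := \col_j (if j \in J then Num.sg (bform D (u j) h) else 0).
have kk : 0 <= k by exact: ler0n.
have ks : k <= s%:R by rewrite ler_nat.
have b1 : norm1 b <= k.
  rewrite /k -sum1_card natr_sum /norm1 [leLHS](bigID (mem J))/= [X in _ + X]big1 ?addr0; last first.
    by move=> j jJ; rewrite mxE (negbTE jJ) normr0.
  by apply: ler_sum => j jJ; rewrite mxE jJ normr_sg; case: (_ != 0).
have bD : k * (K * xs * lam) <= bform D (Umx *m b) h.
  have -> : bform D (Umx *m b) h = \sum_j b j 0 * bform D (u j) h.
    have e : Umx *m b = \sum_j b j 0 *: u j.
      apply/matrixP => i z; rewrite ord1 mxE summxE; apply: eq_bigr => j _.
      by rewrite [RHS]scalemxE mulrC [Umx _ _]mxE.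
    rewrite e; elim/big_rec2: _ => [|j c w _ <-]; first exact: bform0l.
    by rewrite bformDl bformZl.
  rewrite (bigID (mem J))/= [X in _ + X]big1 ?addr0; last first.
    by move=> j jJ; rewrite mxE (negbTE jJ) mul0r.
  rewrite /k mulr_natl -sumr_const; apply: ler_sum => j jJ.
  by rewrite mxE jJ -normrEsg ltW// hJ.
have bS : qform S (Umx *m b) <= k / cmin.
  pose c : 'cV[R]_p := \col_j ((invmx S j j)^-1 * b j 0).
  have e : Umx *m b = invmx S *m c.
    apply/matrixP => i z; rewrite ord1 !mxE; apply: eq_bigr => j _.
    by rewrite !mxE; ring.
  have e2 : qform S (invmx S *m c) = qform (invmx S) c.
    rewrite /qform /bform trmx_mul (prec_sym sS) -!mulmxA [S *m _]mulmxA.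
    by rewrite mulmxV ?(cov_unit cmin0 Smin)// mul1mx.
  rewrite e e2; apply: le_trans (qform_prec cmin0 sS Smin c) _.
  rewrite ler_pM2r ?invr_gt0// /sqnorm2 /k -sum1_card natr_sum.
  rewrite [leLHS](bigID (mem J))/= [X in _ + X]big1 ?addr0; last first.
    by move=> j jJ; rewrite !mxE (negbTE jJ) mulr0 expr0n.
  apply: ler_sum => j jJ; rewrite !mxE jJ exprMn.
  have t1 := prec_inv_le1 cmin0 sS Smin Sd j.
  have t0 : 0 <= (invmx S j j)^-1 by apply: le_trans (prec_inv_ge cmin0 Smin j); exact: ltW.
  have s1 : Num.sg (bform D (u j) h) ^+ 2 <= 1 by rewrite sqr_sg; case: (_ != 0).
  have t2 : (invmx S j j)^-1 ^+ 2 <= 1 by rewrite exprn_ile1.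
  by rewrite -[leRHS]mulr1 ler_pM ?sqr_ge0.
have [h1 _ h2] := lasso_dev.
have hS : qform S h <= cmax * sqnorm2 h by exact: Smax.
have h0 : 0 <= norm1 h by exact: norm1_ge0.
pose D1 : R := 2 / cmin + 16; pose C' : R := (72 * cmax + 9216) / cmin ^+ 2.
have ci : 0 < cmin^-1 by rewrite invr_gt0.
have D10 : 0 < D1 by rewrite /D1 addr_gt0 ?divr_gt0.
(* [f] balances the two vectors of the polarisation: [h] enters as [f / lam] times itself, with
   l1-norm of order [f s], to be compared with the norm of [b]. *)
have phi (f : R) : 0 < f -> 4 * f * (K * k) <= D1 * k + f ^+ 2 * s%:R * C'.
  move=> f0; pose th := f / lam.
  have th0 : 0 < th by rewrite divr_gt0.
  have r1 := RIPs (th *: h) b; have r2 := RIPs ((- th) *: h) b.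
  rewrite !norm1Z normrN (gtr0_norm th0) in r1 r2.
  have sD : D^T = D by rewrite linearB/= Sigmahat_sym sS.
  rewrite (addrC (th *: h)) !(qformD _ _ sD) !(qformD _ _ sS) in r1.
  rewrite (addrC (- th *: h)) !(qformD _ _ sD) !(qformD _ _ sS) in r2.
  rewrite !bformZr !qformZ ?sqrrN in r1 r2.
  set z := (th * norm1 h + norm1 b) ^+ 2 in r1 r2.
  set bb := bform D _ _ in bD r1 r2; set qs := qform S (Umx *m b) in bS r1 r2.
  set qh := qform S h in hS r1 r2.
  have r3 : 4 * th * bb <= xs * (2 * qs + 2 * th ^+ 2 * qh) + 8 * xs * z / s%:R.
    have := polarization_arith r1 r2.
    rewrite (_ : 2 * (4 * xs * z / s%:R) = 8 * xs * z / s%:R); last by ring.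
    by rewrite [2 * (th ^+ 2 * qh)]mulrA.
  have hz : z / s%:R <= 2 * k + 1152 * f ^+ 2 * s%:R / cmin ^+ 2.
    have n1 : th * norm1 h <= 24 * f * s%:R / cmin.
      apply: le_trans (ler_wpM2l (ltW th0) h1) _.
      by apply: le_of_eq; rewrite /th; field; rewrite !gt_eqF.
    have n2 : z <= (24 * f * s%:R / cmin + k) ^+ 2.
      rewrite /z lerXn2r ?nnegrE ?addr_ge0 ?norm1_ge0//; last exact: lerD.
        by apply: mulr_ge0 (ltW th0) _.
      by apply: le_trans n1; apply: mulr_ge0 (ltW th0) _.
    rewrite ler_pdivrMr//; apply: le_trans n2 _.
    have e1 : (2 * k + 1152 * f ^+ 2 * s%:R / cmin ^+ 2) * s%:R - (24 * f * s%:R / cmin + k) ^+ 2 =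
      2 * k * (s%:R - k) + (24 * f * s%:R / cmin - k) ^+ 2 by field; rewrite gt_eqF.
    by rewrite -subr_ge0 e1 addr_ge0 ?sqr_ge0// !mulr_ge0// subr_ge0.
  have hq : th ^+ 2 * qh <= 36 * cmax * f ^+ 2 * s%:R / cmin ^+ 2.
    apply: le_trans (ler_wpM2l (sqr_ge0 th) (le_trans hS (ler_wpM2l cmax0 h2))) _.
    by apply: le_of_eq; rewrite /th; field; rewrite !gt_eqF.
  have r4 : 4 * th * (k * (K * xs * lam)) <= xs * (D1 * k + f ^+ 2 * s%:R * C').
    apply: le_trans (ler_wpM2l _ bD) _; first by rewrite mulr_ge0// ltW.
    apply: le_trans r3 _.
    rewrite (_ : 8 * xs * z / s%:R = xs * (8 * (z / s%:R))); last by ring.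
    rewrite -mulrDr ler_pM2l// /D1 /C'.
    rewrite (_ : (2 / cmin + 16) * k = 2 * (k / cmin) + 16 * k); last by ring.
    rewrite (_ : f ^+ 2 * s%:R * ((72 * cmax + 9216) / cmin ^+ 2) =
      2 * (36 * cmax * f ^+ 2 * s%:R / cmin ^+ 2) + 8 * (1152 * f ^+ 2 * s%:R / cmin ^+ 2)); last by ring.
    by rewrite -[2 * th ^+ 2 * qh]mulrA; exact: lin3_arith.
  rewrite -(ler_pM2l xs0); apply: le_trans r4.
  by apply: le_of_eq; rewrite /th; field; rewrite gt_eqF.
(* This [f] makes the left side [2 D1 k], twice the first term on the right, which is then
   absorbed. *)
have := phi (D1 / (2 * K)) (divr_gt0 D10 (mulr_gt0 (ltr0Sn R 1) K0)).
have -> : 4 * (D1 / (2 * K)) * (K * k) = 2 * D1 * k by field; rewrite gt_eqF.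
have -> : (D1 / (2 * K)) ^+ 2 * s%:R * C' = D1 * (cst_dir cmin cmax * s%:R / K ^+ 2).
  by rewrite /cst_dir -/D1 -/C'; field; rewrite gt_eqF.
move=> /lin2_arith.
by rewrite ler_pM2l// ler_pdivlMr// exprn_gt0.
Qed.

(** The isometry is only available at scale [s]. If more than [s] indices were large, [s] of them
    would already contradict [cst_dir cmin cmax < K ^+ 2]. *)
Let count_dir (K : R) : 0 < K -> cst_dir cmin cmax < K ^+ 2 ->
  #|[set j | K * xs * lam < `|bform D (u j) h|]%SET|%:R * K ^+ 2 <= cst_dir cmin cmax * s%:R.
Proof.
move=> K0 KC; set J := [set j | _]%SET.
have [Js|sJ] := leqP #|J| s.
  by apply: count_dir_sub => // j; rewrite inE.
have /card_geqP[t [ut st tJ]] := ltnW sJ.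
have := @count_dir_sub K [set j in t]%SET K0.
have -> : #|[set j in t]%SET| = s by rewrite cardsE (card_uniqP ut).
have tK j : j \in [set j in t]%SET -> K * xs * lam < `|bform D (u j) h|.
  by rewrite inE => /tJ; rewrite inE.
move=> /(_ tK (leqnn s)).
by rewrite [leRHS]mulrC ler_pM2l// leNgt KC.
Qed.

(** The exceptional set shrinks like [1 / K^2] relative to [s] while the bound on the others grows
    linearly in [K]; a large constant [K] therefore makes the exceptions negligible without harming
    the rates. *)
Lemma bias_count (K : R) : 1 <= K -> cst_dir cmin cmax < K ^+ 2 ->
  exists J : {set 'I_p},
    #|J|%:R * K ^+ 2 <= (36 / cmin ^+ 2 + cst_dir cmin cmax) * s%:R /\
    forall j, j \notin J ->
      `|sqrt n%:R * B j / (sigma * sqrt (sqnorm2 (resid X gh j) / n%:R))|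
      <= K * cst_bias cmin kap * (sqrt n%:R * l * (q + xs + (minn s sm)%:R * l)).
Proof.
move=> K1 KC; have K0 : 0 < K by apply: lt_le_trans K1.
exists ([set j | K * lam < `|h j 0|] :|: [set j | K * xs * lam < `|bform D (u j) h|])%SET; split.
  have h1 := count_h (ltW K0); have h2 := count_dir K0 KC.
  set J1 := [set j | _ < `|h j 0|]%SET in h1 *; set J2 := [set j | _]%SET in h2 *.
  have : #|(J1 :|: J2)%SET|%:R <= #|J1|%:R + #|J2|%:R :> R.
    by rewrite -natrD ler_nat cardsU leq_subr.
  move=> /(ler_wpM2r (sqr_ge0 K)); rewrite !mulrDl; lra.
move=> j; rewrite !inE negb_or -!leNgt => /andP[g1 g2].
have b1 := bias1 j; have b2 := bias2 j; have [n1 _ _] := lasso_dev.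
have c1 := cmin_le1 j.
have ci : 0 < cmin^-1 by rewrite invr_gt0.
have kap0 : 0 < kap by apply: lt_le_trans kap24.
have cP0 : 0 <= cP by exact: cst_pen_ge0 (ltW kap0).
have cR0 : 0 <= cR by exact: cst_resid_ge0 (ltW kap0).
pose kc := 36 * kap / cmin.
have kc0 : 0 <= kc by apply: divr_ge0 (ltW cmin0); apply: mulr_ge0 (ler0n _ _) (ltW kap0).
pose m : R := (minn s sm)%:R.
have m0 : 0 <= m by exact: ler0n.
have cc0 : 0 <= cR + 2 * cP by apply: addr_ge0 cR0 _; apply: mulr_ge0 cP0.
have ml0 : 0 <= m * l by apply: mulr_ge0 m0 (ltW l0).
have hB : `|B j| <= K * lam * ((cR + 2 * cP + 1 + kc) * (q + xs + m * l)).
  have t1 : (cR + 2 * cP) * q * `|h j 0| <= (cR + 2 * cP) * q * (K * lam).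
    by apply: ler_wpM2l g1; rewrite mulr_ge0//; lra.
  have t0 : cP * q * `|h j 0| <= (cR + 2 * cP) * q * `|h j 0|.
    by rewrite !ler_wpM2r//; lra.
  have key : `|B j| <= K * lam * ((cR + 2 * cP) * q + xs + kc * (m * l)).
    have l1 : 0 <= lam * l by rewrite mulr_ge0 ?ltW.
    have gk : kc * m * (lam * l) <= K * (kc * m * (lam * l)) by apply: ler_peMl => //; exact: mulr_ge0 (mulr_ge0 kc0 m0) l1.
    (* [bias1] when [s] is the minimum, [bias2] otherwise: this is how only the smaller of the two
       sparsities enters. *)
    rewrite /m in gk *; have [sle|sle] := leqP s sm.
      move: gk; rewrite (minn_idPl sle) => gk.
      have t2 : kap * l * norm1 h <= kc * s%:R * (lam * l).
        apply: (@le_trans _ _ (kap * l * (24 * (s%:R * lam) / cmin))).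
          by apply: ler_wpM2l n1; rewrite mulr_ge0 ?ltW.
        rewrite (_ : kap * l * (24 * (s%:R * lam) / cmin) = 24 * (kap / cmin * (s%:R * (lam * l)))); last by ring.
        rewrite (_ : kc * s%:R * (lam * l) = 36 * (kap / cmin * (s%:R * (lam * l)))); last by rewrite /kc; ring.
        apply: ler_wpM2r; last by rewrite ler_nat.
        exact: (mulr_ge0 (divr_ge0 (ltW kap0) (ltW cmin0)) (mulr_ge0 (ler0n _ _) l1)).
      have t3 : 0 <= K * lam * xs by rewrite !mulr_ge0 ?ltW.
      lra.
    move: gk; rewrite (minn_idPr (ltnW sle)) => gk.
    have -> : K * lam * ((cR + 2 * cP) * q + xs + kc * (sm%:R * l)) =
      (cR + 2 * cP) * q * (K * lam) + K * xs * lam + K * (kc * sm%:R * (lam * l)) by ring.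
    have t2 : 36 * (kap * (sm%:R * l) * lam / cmin) = kc * sm%:R * (lam * l) by rewrite /kc; ring.
    lra.
  apply: le_trans key _; apply: ler_wpM2l; first exact: mulr_ge0 (ltW K0) (ltW lam0).
  have -> : (cR + 2 * cP + 1 + kc) * (q + xs + m * l) = (cR + 2 * cP) * q + xs + kc * (m * l) +
     ((cR + 2 * cP) * (xs + m * l) + q + m * l + kc * (q + xs)) by ring.
  rewrite lerDl; apply: addr_ge0; last exact: mulr_ge0 kc0 (addr_ge0 q0 (ltW xs0)).
  exact: (addr_ge0 (addr_ge0 (mulr_ge0 cc0 (addr_ge0 (ltW xs0) ml0)) q0) ml0).
have rlb := resid_lb j; set rr := sqnorm2 _ / n%:R in rlb *.
have hR : cmin / 2 <= sqrt rr.
  rewrite -(@ler_pXn2r _ 2)// ?nnegrE ?sqrtr_ge0 ?divr_ge0 ?(ltW cmin0)//.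
  rewrite sqr_sqrtr; last by apply: le_trans rlb; rewrite divr_ge0 ?ltW.
  apply: le_trans rlb; rewrite expr2 ler_piMr ?divr_ge0 ?(ltW cmin0)//; lra.
have R0 : 0 < sqrt rr by apply: lt_le_trans hR; rewrite divr_gt0.
have c20 : 0 < cmin / 2 by rewrite divr_gt0.
rewrite !normrM normfV normrM (gtr0_norm sigma0) (gtr0_norm R0) ger0_norm ?sqrtr_ge0//.
rewrite ler_pdivrMr ?mulr_gt0//.
have E0 : 0 <= (cR + 2 * cP + 1 + kc) * (q + xs + m * l).
  apply: mulr_ge0; first by apply: addr_ge0 kc0; apply: addr_ge0 cc0 _.
  by apply: addr_ge0 ml0; apply: addr_ge0 q0 (ltW xs0).
apply: le_trans (ler_wpM2l (sqrtr_ge0 _) hB) _.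
have -> : sqrt n%:R * (K * lam * ((cR + 2 * cP + 1 + kc) * (q + xs + m * l))) =
  K * cst_bias cmin kap * (sqrt n%:R * l * (q + xs + m * l)) * sigma * (cmin / 2).
  by rewrite /cst_bias /lam -/cR -/cP -/kc; field; rewrite gt_eqF.
rewrite -[leLHS]mulrA; apply: ler_wpM2l; last by rewrite ler_pM2l.
apply: mulr_ge0.
  apply: mulr_ge0 (ltW K0) _; apply: mulr_ge0; first exact: divr_ge0 (ler0n _ _) (ltW cmin0).
  by apply: addr_ge0 kc0; apply: addr_ge0 cc0 _.
apply: mulr_ge0 (mulr_ge0 (sqrtr_ge0 _) (ltW l0)) _.
by apply: addr_ge0 ml0; apply: addr_ge0 q0 (ltW xs0).
Qed.

(** [tau2 j] is the mean square [rr] of the residual plus a nonnegative penalty, so the quotient is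
    at least [sqrt rr], and [resid_bound] compares [rr] with the population variance. The signal
    loses only a factor close to 1. *)
Lemma resid_scale j :
  (1 - cst_resid cmin kap / cmin * q) * sqrt (invmx S j j)^-1 <= tau2 j / sqrt (sqnorm2 (resid X gh j) / n%:R).
Proof.
have rlb := resid_lb j; set rr := sqnorm2 _ / n%:R in rlb *.
have rr0 : 0 < rr by apply: lt_le_trans rlb; rewrite divr_gt0.
have R0 : 0 < sqrt rr by rewrite sqrtr_gt0.
have h1 : sqrt rr <= tau2 j / sqrt rr.
  rewrite ler_pdivlMr// -expr2 sqr_sqrtr ?(ltW rr0)// tau2E lerDl mulr_ge0//.
  by have /andP[] := pen j.
apply: le_trans h1.
have := resid_bound j.
rewrite -/rr -/cR ler_norml => /andP[h2 _].
have tg := prec_inv_ge cmin0 Smin j; set t := (invmx S j j)^-1 in h2 tg *.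
have t0 : 0 < t by apply: lt_le_trans tg.
have c0 : 0 <= cR / cmin * q.
  apply: mulr_ge0 => //; apply: divr_ge0 (ltW cmin0).
  by apply: cst_resid_ge0 => //; apply: le_trans kap24.
have c1 : cR / cmin * q <= 2^-1.
  by rewrite mulrAC ler_pdivrMr//; have := qsmall; rewrite -/cR; lra.
rewrite -(@ler_pXn2r _ 2)// ?nnegrE ?sqrtr_ge0//; last by rewrite mulr_ge0 ?sqrtr_ge0//; lra.
rewrite exprMn !sqr_sqrtr ?(ltW rr0) ?(ltW t0)//.
set c := cR / cmin * q in c0 c1 *.
have h3 : c * cmin = cR * q by rewrite /c; field; rewrite gt_eqF.
have h4 : c * cmin <= c * t by rewrite ler_wpM2l.
have h5 : 0 <= t * (c * (1 - c)) by rewrite mulr_ge0 ?(ltW t0)// mulr_ge0//; lra.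
lra.
Qed.

Lemma tauhat2_gt0 j : 0 < tau2 j.
Proof.
rewrite tau2E; have := resid_lb j; have /andP[] := pen j; have := cmin0; lra.
Qed.

Lemma resid_gt0 j : 0 < sqnorm2 (resid X gh j).
Proof.
have := lt_le_trans (divr_gt0 cmin0 (ltr0Sn R 1)) (resid_lb j).
by rewrite pmulr_lgt0// invr_gt0.
Qed.

End Nodewise.

(** * Conditional bounds for functions of the design and the noise *)

Section JointMeasurability.
Context {R : realType} {d} {T : measurableType d}.
Variables G1 G2 : set (set T).

Let T1 : measurableType _ := g_sigma_algebraType G1.
Let T2 : measurableType _ := g_sigma_algebraType G2.

Definition jmeas (F : T -> T -> R) := mfunT (fun z : T1 * T2 => F z.1 z.2).

Lemma jmeas1 (g : T -> R) : smeas G1 g -> jmeas (fun a _ => g a).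
Proof.
move=> /smeasP mg; rewrite /jmeas.
exact: (measurableT_comp (f := g : T1 -> R) (g := fst : T1 * T2 -> T1)).
Qed.

Lemma jmeas2 (g : T -> R) : smeas G2 g -> jmeas (fun _ b => g b).
Proof.
move=> /smeasP mg; rewrite /jmeas.
exact: (measurableT_comp (f := g : T2 -> R) (g := snd : T1 * T2 -> T2)).
Qed.

Lemma jmeas_cst c : jmeas (fun _ _ => c).
Proof. exact: measurable_cst. Qed.

Lemma jmeasD F F' : jmeas F -> jmeas F' -> jmeas (fun a b => F a b + F' a b).
Proof. by move=> mF mF'; exact: measurable_funD. Qed.

Lemma jmeasM F F' : jmeas F -> jmeas F' -> jmeas (fun a b => F a b * F' a b).
Proof. by move=> mF mF'; exact: measurable_funM. Qed.

Lemma jmeas_comp (h : R -> R) F : mfunT h -> jmeas F -> jmeas (fun a b => h (F a b)).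
Proof. by move=> mh mF; exact: measurableT_comp. Qed.

Lemma jmeas_sum (I : Type) (r : seq I) (F : I -> T -> T -> R) :
  (forall i, jmeas (F i)) -> jmeas (fun a b => \sum_(i <- r) F i a b).
Proof.
move=> hF; elim: r => [|i r IH].
  by rewrite /jmeas; under eq_fun do rewrite big_nil; exact: measurable_cst.
apply: (eq_measurable_fun (fun z : T1 * T2 => F i z.1 z.2 + \sum_(j <- r) F j z.1 z.2)).
  by move=> z _; rewrite big_cons.
exact: jmeasD (hF i) IH.
Qed.

Lemma jmeas_lt F F' : jmeas F -> jmeas F' -> jmeas (fun a b => ((F a b < F' a b)%R%:R : R)).
Proof.
move=> mF mF'; rewrite /jmeas.
have mA := measurable_setlt mF mF'.
apply: (eq_measurable_fun (\1_[set z : T1 * T2 | F z.1 z.2 < F' z.1 z.2] : T1 * T2 -> R)).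
  move=> z _; rewrite indicE; have [h|h] := boolP (F z.1 z.2 < F' z.1 z.2).
    by rewrite mem_set.
  by rewrite memNset//; exact/negP.
exact: measurable_indic.
Qed.

End JointMeasurability.

Section DecoupleReal.
Context {R : realType} {d} {T : measurableType d}.
Variable P : probability T R.
Variables G1 G2 : set (set T).
Hypotheses (G1m : <<s G1 >> `<=` measurable) (G2m : <<s G2 >> `<=` measurable)
  (ind : forall A B, <<s G1 >> A -> <<s G2 >> B -> P (A `&` B) = (P A * P B)%E).

Let T1 : measurableType _ := g_sigma_algebraType G1.
Let T2 : measurableType _ := g_sigma_algebraType G2.

Lemma decouple_Ex (F : T -> T -> R) (M : R) : jmeas G1 G2 F -> (forall a b, 0 <= F a b <= M) ->
  [/\ forall a, bmf (F a), bmf (fun a => Ex P (F a)), bmf (fun w => F w w) &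
      Ex P (fun w => F w w) = Ex P (fun a => Ex P (F a))].
Proof.
move=> mF hF.
have F0 a b : 0 <= F a b by have /andP[] := hF a b.
have FM a b : `|F a b| <= M by rewrite ger0_norm//; have /andP[] := hF a b.
have bF a : bmf (F a).
  split; last by exists M.
  have h : mfunT (fun b : T2 => F a b).
    exact: (measurable_fun_pair2 (f := fun z : T1 * T2 => F z.1 z.2)).
  by move=> _ B mB; rewrite setTI; apply: G2m; have := h measurableT B mB; rewrite setTI.
have bd : bmf (fun w => F w w).
  split; last by exists M.
  pose dg (w : T) : T1 * T2 := (w, w).
  have mdg : mfunT dg.
    apply: measurable_fun_pair => _ A mA; rewrite setTI; [exact: G1m|exact: G2m].
  exact: (@measurableT_comp _ _ _ _ _ _ (fun z : T1 * T2 => F z.1 z.2) _ dg mF mdg).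
have eE a : (\int[P]_b (F a b)%:E = (Ex P (F a))%:E)%E by exact: ExE.
have bE : bmf (fun a => Ex P (F a)).
  split; last first.
    exists M => a; rewrite ger0_norm ?Ex_ge0// -(Ex_cst P M).
    by apply: Ex_le => //; [exact: bmf_cst|move=> b; have /andP[] := hF a b].
  have mi2 : mfunT (id : T -> T2).
    by move=> _ A mA; rewrite setTI; exact: G2m.
  have h : mfunT (fun a : T1 => (Ex P (F a))%:E).
    pose m2 : {mfun T >-> g_sigma_algebraType G2} := HB.pack (id : T -> T2)
      (isMeasurableFun.Build _ _ _ _ _ mi2).
    have -> : (fun a : T1 => (Ex P (F a))%:E) =
        (fun a => \int[distribution P m2]_b (F a b)%:E)%E.
      apply/funext => a; rewrite -eE ge0_integral_distribution//.
        by apply/measurable_EFinP; exact: (measurable_fun_pair2 (f := fun z : T1 * T2 => F z.1 z.2)).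
      by move=> b; rewrite lee_fin.
    apply: (@measurable_fun_fubini_tonelli_F _ _ _ _ _ (distribution P m2)
       (fun z : T1 * T2 => (F z.1 z.2)%:E)).
      by apply/measurable_EFinP.
    by move=> z; rewrite lee_fin.
  have /measurable_EFinP h2 := h.
  by move=> _ B mB; rewrite setTI; apply: G1m; have := h2 measurableT B mB; rewrite setTI.
split => //.
apply: EFin_inj; rewrite -!ExE//.
have := decouple G1m G2m ind (f := fun z => (F z.1 z.2)%:E).
move=> ->.
- by apply: eq_integral => a _; rewrite -eE.
- by apply/measurable_EFinP.
- by move=> z; rewrite lee_fin.
Qed.

Lemma decouple_le (F : T -> T -> R) (M c : R) : jmeas G1 G2 F -> (forall a b, 0 <= F a b <= M) ->
  (forall a, Ex P (F a) <= c) -> Ex P (fun w => F w w) <= c.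
Proof.
move=> mF hF hc; have [_ h1 _ ->] := decouple_Ex mF hF.
by rewrite -(Ex_cst P c); apply: Ex_le => //; exact: bmf_cst.
Qed.

End DecoupleReal.

(** * Events of high probability for the design and the noise *)

Section GoodEvents.
Context {R : realType} {d} {T : measurableType d}.
Variable P : probability T R.

Lemma tail2_le (t : R) : 1 <= t -> 2 * Phibar t <= expR (- t ^+ 2 / 2).
Proof.
move=> t1; have t0 : 0 < t by apply: lt_le_trans t1.
have h1 : Phibar t <= gpdf t.
  apply: le_trans (Phibar_mills t0) _; rewrite ler_pdivrMr//.
  by rewrite ler_peMr// gpdf_ge0.
have h2 : gpdf t <= 2^-1 * expR (- t ^+ 2 / 2).
  by rewrite /gpdf ler_pM2r ?expR_gt0// phi0_le.
lra.
Qed.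

Section Noise.
Variables (n : nat) (eps : T -> 'cV[R]_n) (sigma : R).
Hypotheses (geps : gaussian_vec P eps (sigma ^+ 2)%:M) (sigma0 : 0 < sigma).

Lemma qform_scalar m (a : R) (V : 'cV[R]_m) : qform a%:M V = a * sqnorm2 V.
Proof.
rewrite sqnorm2E /qform /bform mul_mx_scalar -scalemxAl mulmx1 scalemxE.
by [].
Qed.

Lemma noise_tail (a : 'cV[R]_n) (t : R) : 0 < sqnorm2 a -> 0 <= t ->
  Pr P [set w | t < `|lin1 a eps w / (sigma * sqrt (sqnorm2 a))|] = 2 * Phibar t.
Proof.
move=> v0 t0; set v := sqnorm2 a in v0 *.
have sv : 0 < sqrt v by rewrite sqrtr_gt0.
pose a' := (sigma * sqrt v)^-1 *: a.
have a1 : (a'^T *m (sigma ^+ 2)%:M *m a') 0 0 = 1.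
  rewrite -/(bform _ a' a') -/(qform _ a') qform_scalar sqnorm2Z -/v.
  rewrite exprVn exprMn sqr_sqrtr ?(ltW v0)//; field.
  by rewrite !gt_eqF.
rewrite -(gaussian_tail geps t0 a1); congr (Pr P _).
apply/seteqP; split=> w /=; rewrite /lin1 /a' [(_ *: a)^T]linearZ/= -scalemxAl scalemxE;
  by rewrite mulrC.
Qed.

End Noise.

Section Design.
Variables (n p : nat) (X : T -> 'M[R]_(n, p)) (S : 'M[R]_p) (cmin : R).
Hypotheses (mX : random_mx X) (gX : iid_gaussian_rows P X S) (n0 : (0 < n)%N) (p1 : (1 < p)%N)
  (cmin0 : 0 < cmin) (sS : S^T = S) (Smin : forall V, cmin * sqnorm2 V <= qform S V)
  (Sd : forall j, S j j <= 1).

Notation L := (ln p%:R : R).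
Let l : R := sqrt (L / n%:R).
Let nR : 0 < n%:R :> R. Proof. by rewrite ltr0n. Qed.
Let p1R : 1 < p%:R :> R. Proof. by rewrite ltr1n. Qed.
Let pR : 0 < p%:R :> R. Proof. by rewrite (lt_trans ltr01). Qed.
Let L0 : 0 < L. Proof. by rewrite ln_gt0. Qed.
Let l2 : l ^+ 2 * n%:R = L.
Proof. by rewrite sqr_sqrtr ?divfK ?gt_eqF// divr_ge0// ltW. Qed.
Let l0 : 0 < l. Proof. by rewrite sqrtr_gt0 divr_gt0. Qed.

(** The dictionary of Maurey's method: basis vectors together with the directions [udir], all of
    variance at most 1 under [S]. *)
Definition atoms : 'M[R]_(p, p + p) := row_mx 1%:M (Umx S).

Lemma atoms_mul (a b : 'cV[R]_p) : atoms *m col_mx a b = a + Umx S *m b.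
Proof. by rewrite /atoms mul_row_col mul1mx. Qed.

Lemma atoms_diag i : (atoms^T *m S *m atoms) i i <= 1.
Proof.
have -> : (atoms^T *m S *m atoms) i i = qform S (col i atoms).
  by rewrite -bform_delta -/(qform _ _) qform_conj colE.
rewrite /atoms; case: (splitP i) => [j ij|j ij].
  have -> : i = lshift p j by apply/val_inj.
  by rewrite colKl colE mul1mx /qform bform_delta.
have -> : i = rshift p j by apply/val_inj.
rewrite colKr (_ : col j (Umx S) = udir S j); last first.
  by apply/matrixP => a b; rewrite ord1 !mxE.
by rewrite (qform_udir cmin0 Smin) (prec_inv_le1 cmin0 sS Smin Sd).
Qed.

(** There are [(4 p)^m] signed sums, and [64 m L <= x^2 n] makes each tail at most [2 p^(- 6 m)];
    every factor [4 p * p^(- 6)] is at most [1 / p]. *)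
Lemma union_bound_le (m : nat) (x : R) : (0 < m)%N -> 64 * m%:R * L <= x ^+ 2 * n%:R ->
  (2 * (p + p))%:R ^+ m * (2 * expR (- (3 / 32 * x ^+ 2 * n%:R))) <= 2 / p%:R :> R.
Proof.
move=> m0 hx.
have e1 : expR (- (3 / 32 * x ^+ 2 * n%:R)) <= expR (- (6 * L)) ^+ m.
  by rewrite -expRM_natl ler_expR; lra.
have eL : expR (- (6 * L)) = p%:R^-1 ^+ 6.
  by rewrite -mulrN expRM_natl expRN lnK ?posrE.
pose a : R := (2 * (p + p))%:R * expR (- (6 * L)).
have a0 : 0 <= a by rewrite mulr_ge0 ?expR_ge0.
have ap : a <= p%:R^-1.
  rewrite /a eL -(ler_pM2r (exprn_gt0 6 pR)) -mulrA exprVn mulVf ?gt_eqF ?exprn_gt0// mulr1.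
  rewrite (_ : p%:R^-1 * p%:R ^+ 6 = p%:R ^+ 5); last by field; rewrite gt_eqF.
  have p2 : 2 <= p%:R :> R by rewrite ler_nat.
  have h4 : 2 ^+ 4 <= p%:R ^+ 4 :> R by rewrite lerXn2r ?nnegrE// ltW.
  by have := ler_wpM2r (ltW pR) h4; rewrite natrM natrD exprSr; lra.
have am : a ^+ m <= p%:R^-1.
  apply: (le_trans _ ap); case: (m) m0 => // k _; rewrite exprS ler_piMr// exprn_ile1//.
  by apply: le_trans ap _; rewrite invf_le1// ltW.
apply: (@le_trans _ _ (2 * a ^+ m)); last by rewrite ler_pM2l.
rewrite /a exprMn mulrCA ler_pM2l// ler_wpM2l ?exprn_ge0//.
Qed.

Lemma rip_atoms (m : nat) (x : R) : (0 < m)%N -> 0 < x -> x <= 1 ->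
  64 * m%:R * L <= x ^+ 2 * n%:R ->
  exists B : set T, [/\ measurable B, Pr P B <= 2 / p%:R &
    forall w, ~ B w -> forall f : {ffun 'I_m -> 'I_(p + p) * bool},
      `|qform (Sigmahat (X w) - S) (atoms *m ssum f)| <= x * qform S (atoms *m ssum f)].
Proof.
move=> m0 x0 x1 hx.
have [B [mB hB hf]] := rip mX gX m atoms (qform_pd cmin0 Smin) x0 x1 n0.
by exists B; split => //; apply: le_trans hB _; exact: union_bound_le.
Qed.

(** Three scales: [s] for the Lasso and its polarised form, [sm + 2] for the nodewise Lasso (the 2
    keeps [1 < m] when [sm = 0]), and pairs of atoms for single entries. *)
Definition good_design (M : 'M[R]_(n, p)) (s sm : nat) : Prop :=
  [/\ forall a b, `|qform (Sigmahat M - S) (a + Umx S *m b)| <=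
        8 * sqrt s%:R * l * qform S (a + Umx S *m b) +
        4 * (8 * sqrt s%:R * l) * (norm1 a + norm1 b) ^+ 2 / s%:R,
      forall a, `|qform (Sigmahat M - S) a| <=
        8 * sqrt (sm + 2)%:R * l * qform S a +
        4 * (8 * sqrt (sm + 2)%:R * l) * norm1 a ^+ 2 / (sm + 2)%:R,
      forall k j, `|bform (Sigmahat M - S) (delta_mx k 0) (udir S j)| <= 12 * l,
      forall j, `|qform (Sigmahat M - S) (udir S j)| <= 12 * l &
      forall j, `|qform (Sigmahat M - S) (delta_mx j 0)| <= 12 * l].

Lemma norm1_col m q (a : 'cV[R]_m) (b : 'cV[R]_q) : norm1 (col_mx a b) = norm1 a + norm1 b.
Proof.
rewrite /norm1 big_split_ord/=; congr (_ + _); apply: eq_bigr => i _.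
  by rewrite col_mxEu.
by rewrite col_mxEd.
Qed.

Lemma maurey_atoms (D : 'M[R]_p) (m : nat) (x : R) : (1 < m)%N -> 0 <= x ->
  (forall f : {ffun 'I_m -> 'I_(p + p) * bool},
      `|qform D (atoms *m ssum f)| <= x * qform S (atoms *m ssum f)) ->
  forall a b, `|qform D (a + Umx S *m b)| <=
    x * qform S (a + Umx S *m b) + 4 * x * (norm1 a + norm1 b) ^+ 2 / m%:R.
Proof.
move=> m1 x0 hf a b.
have h := maurey (A := atoms^T *m D *m atoms) (B := atoms^T *m S *m atoms) m1 x0 atoms_diag.
have {h} := h _ (col_mx a b); rewrite !qform_conj atoms_mul norm1_col mulr1; apply.
by move=> f; rewrite !qform_conj.
Qed.

Definition pairf (i j : 'I_(p + p) * bool) : {ffun 'I_2 -> 'I_(p + p) * bool} :=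
  [ffun k : 'I_2 => if k == 0 then i else j].

Lemma atoms_pair i j : atoms *m ssum (pairf i j) =
  (-1) ^+ i.2 *: col i.1 atoms + (-1) ^+ j.2 *: col j.1 atoms.
Proof.
rewrite /ssum !big_ord_recl big_ord0 addr0 !ffunE/= mulmxDr /scol -!scalemxAr -!colE.
by [].
Qed.

Lemma col_atoms_l k : col (lshift p k) atoms = delta_mx k 0.
Proof. by rewrite /atoms colKl colE mul1mx. Qed.

Lemma col_atoms_r j : col (rshift p j) atoms = udir S j.
Proof. by rewrite /atoms colKr; apply/matrixP => a b; rewrite ord1 !mxE. Qed.

Lemma good_design_event (s sm : nat) : (1 < s)%N ->
  8 * sqrt s%:R * l <= 1 -> 8 * sqrt (sm + 2)%:R * l <= 1 -> 12 * l <= 1 ->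
  exists B : set T, [/\ measurable B, Pr P B <= 6 / p%:R &
    forall w, ~ B w -> good_design (X w) s sm].
Proof.
move=> s1 hs hm h2.
have xpos (m : nat) : (0 < m)%N -> 0 < 8 * sqrt m%:R * l :> R.
  by move=> m0; rewrite mulr_gt0// mulr_gt0// sqrtr_gt0 ltr0n.
have xsq (m : nat) : 64 * m%:R * L <= (8 * sqrt m%:R * l) ^+ 2 * n%:R.
  rewrite exprMn -[leRHS]mulrA l2 exprMn sqr_sqrtr ?ler0n//.
  by apply: le_of_eq; ring.
have s0 := ltnW s1.
have m0 : (0 < sm + 2)%N by rewrite addn2.
have m1 : (1 < sm + 2)%N by rewrite addn2.
have [B1 [mB1 PB1 h1]] := rip_atoms s0 (xpos _ s0) hs (xsq s).
have [B2 [mB2 PB2 h2']] := rip_atoms m0 (xpos _ m0) hm (xsq _).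
have l12 : 0 < 12 * l by rewrite mulr_gt0.
(* [12 l] satisfies the requirement for pairs because [12^2 = 144 >= 64 * 2]. *)
have hx : 64 * 2%:R * L <= (12 * l) ^+ 2 * n%:R by rewrite exprMn -[leRHS]mulrA l2; have := L0; lra.
have [B3 [mB3 PB3 h3]] := rip_atoms (isT : (0 < 2)%N) l12 h2 hx.
exists (B1 `|` B2 `|` B3); split.
- by apply: measurableU => //; exact: measurableU.
- apply: (le_trans (Pr_subU _ (measurableU _ _ mB1 mB2) mB3)).
  have := Pr_subU P mB1 mB2; lra.
move=> w /not_orP[/not_orP[nB1 nB2] nB3].
have hp := h3 w nB3; set D := Sigmahat (X w) - S in hp *.
have sD : D^T = D by rewrite linearB/= Sigmahat_sym sS.
have atom1 i : qform S (col i atoms) <= 1.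
  by have := atoms_diag i; rewrite -bform_delta -/(qform _ _) qform_conj -colE.
have hd i : `|qform D (col i atoms)| <= 12 * l.
  have := hp (pairf (i, false) (i, false)); rewrite atoms_pair/= !scale1r.
  rewrite -mulr2n -scaler_nat !qformZ normrM.
  rewrite (ger0_norm (sqr_ge0 _)) [X in _ <= X]mulrCA ler_pM2l ?exprn_gt0//.
  by move=> hh; apply: le_trans hh _; rewrite ler_piMr// ltW.
(* Polarisation between the sum and the difference of two atoms; both variances being at most 1, the
   bilinear form inherits the bound [12 l]. *)
have ho i j : `|bform D (col i atoms) (col j atoms)| <= 12 * l.
  have := hp (pairf (i, false) (j, false)); have := hp (pairf (i, false) (j, true)).
  rewrite !atoms_pair/= !scale1r scaleN1r.
  rewrite !(qformB _ _ sD) !(qformB _ _ sS) !(qformD _ _ sD) !(qformD _ _ sS).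
  set b := bform D _ _; set c := bform S _ _; set q1 := qform D _; set q2 := qform D _.
  have t1 := ler_wpM2l (ltW l12) (atom1 i); have t2 := ler_wpM2l (ltW l12) (atom1 j).
  move: t1 t2; set Q1 := qform S _; set Q2 := qform S _.
  rewrite !ler_norml => ? ? /andP[? ?] /andP[? ?]; apply/andP; split; lra.
split.
- exact: maurey_atoms s1 (ltW (xpos _ s0)) (h1 w nB1).
- move=> a; have := maurey_atoms m1 (ltW (xpos _ m0)) (h2' w nB2) a 0.
  have -> : norm1 (0 : 'cV[R]_p) = 0 by rewrite /norm1 big1// => i _; rewrite mxE normr0.
  by rewrite mulmx0 !addr0.
- by move=> k j; have := ho (lshift p k) (rshift p j); rewrite col_atoms_l col_atoms_r.
- by move=> j; have := hd (rshift p j); rewrite col_atoms_r.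
- by move=> j; have := hd (lshift p j); rewrite col_atoms_l.
Qed.

Variables (eps : T -> 'cV[R]_n) (sigma : R).
Hypotheses (meps : random_mx eps) (geps : gaussian_noise_given P X eps (sigma ^+ 2)) (sigma0 : 0 < sigma).

(** Given a column with [sqnorm2 <= 2 n], the threshold is at least [sqrt (8 ln p)] standard
    deviations, so the tail is at most [p^(- 4)]. This pays for the [p] columns and for the factor 2
    of Markov's inequality at level [1/2]. *)
Lemma noise_event : exists B : set T, [/\ measurable B, Pr P B <= p%:R^-1 &
    forall w, ~ B w -> (forall k, sqnorm2 (col k (X w)) <= 2 * n%:R) ->
      forall k, `|((X w)^T *m eps w) k 0| / n%:R <= 4 * sigma * l].
Proof.
have [ind ge] := geps.
pose G1 := gen_mx X; pose G2 := gen_mx eps.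
pose N k (a : T) : R := \sum_i X a i k ^+ 2.
pose I k (a b : T) : R := \sum_i X a i k * eps b i 0.
have NE k a : N k a = sqnorm2 (col k (X a)).
  by rewrite /N /sqnorm2; apply: eq_bigr => i _; rewrite mxE.
have IE k a b : I k a b = lin1 (col k (X a)) eps b.
  by rewrite lin1E; apply: eq_bigr => i _; rewrite mxE.
have jN k : jmeas G1 G2 (fun a _ => N k a).
  apply: jmeas1; apply: smeas_sum => i; apply: (smeas_comp (h := fun z => z ^+ 2)).
    exact: exprn_measurable.
  exact: smeas_entry.
have jI k : jmeas G1 G2 (fun a b => I k a b).
  apply: jmeas_sum => i; apply: jmeasM; first by apply: jmeas1; exact: smeas_entry.
  by apply: jmeas2; exact: smeas_entry.
pose c : R := 4 * sigma * l * n%:R.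
have c0 : 0 < c by rewrite !mulr_gt0.
(* The first factor switches the event off when the column is too long, so that the conditional
   bound holds for every value of the design. *)
pose F k a b : R := (1 - (2 * n%:R < N k a)%R%:R) * (c < `|I k a b|)%R%:R.
have jF k : jmeas G1 G2 (F k).
  apply: jmeasM; last first.
    apply: jmeas_lt; first exact: jmeas_cst.
    by apply: (jmeas_comp (h := Num.norm)) => //.
  apply: (jmeas_comp (h := fun z => 1 - z)); first exact: measurable_funB.
  by apply: jmeas_lt => //; exact: jmeas_cst.
have F01 k a b : 0 <= F k a b <= 1.
  by rewrite /F; case: (_ < N k a); case: (c < _); rewrite ?subrr ?subr0 ?mul0r ?mulr0 ?mulr1 ?lexx ?ler01.
have hF k a : Ex P (F k a) <= p%:R^-1 ^+ 4.
  have p40 : 0 <= p%:R^-1 ^+ 4 :> R by rewrite exprn_ge0// invr_ge0.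
  have mI : measurable [set b | c < `|I k a b|].
    apply: measurable_setlt => //; apply: measurableT_comp => //.
    rewrite (_ : I k a = lin1 (col k (X a)) eps); first exact: measurable_lin1.
    by apply/funext => b; exact: IE.
  have [h|h] := ltP (2 * n%:R) (N k a).
    rewrite (Ex_ext P (g := fun=> 0)) ?Ex_cst// => b.
    by rewrite /F h subrr mul0r.
  rewrite (Ex_ext P (g := \1_[set b | c < `|I k a b|])); last first.
    move=> b; rewrite /F ltNge h subr0 mul1r indicE; have [hb|hb] := boolP (c < _).
      by rewrite mem_set.
    by rewrite memNset//; exact/negP.
  rewrite Ex_indic// -/(Pr P _).
  have [v0|v0] := leP (N k a) 0.
    have az : col k (X a) = 0.
      by apply: sqnorm2_eq0; apply/eqP; rewrite eq_le sqnorm2_ge0 andbT -NE.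
    rewrite (_ : [set b | _] = set0) ?Pr_set0//; apply/seteqP; split=> b //=.
    by rewrite IE az /lin1 trmx0 mul0mx mxE normr0 ltNge (ltW c0).
  rewrite NE in v0 h; set v := sqnorm2 _ in v0 h.
  pose t := c / (sigma * sqrt v).
  have sv : 0 < sigma * sqrt v by rewrite mulr_gt0// sqrtr_gt0.
  have t0 : 0 < t by rewrite divr_gt0.
  have t2 : 8 * L <= t ^+ 2.
    have -> : t ^+ 2 = c ^+ 2 / (sigma ^+ 2 * v).
      by rewrite /t expr_div_n [(_ * sqrt v) ^+ 2]exprMn sqr_sqrtr ?(ltW v0).
    rewrite ler_pdivlMr ?mulr_gt0 ?exprn_gt0//.
    rewrite /c 2!exprMn [(4 * sigma) ^+ 2]exprMn -l2.
    have : v * (sigma ^+ 2 * l ^+ 2 * n%:R) <= 2 * n%:R * (sigma ^+ 2 * l ^+ 2 * n%:R).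
      by apply: ler_wpM2r h; exact: (mulr_ge0 (mulr_ge0 (sqr_ge0 _) (sqr_ge0 _)) (ltW nR)).
    lra.
  have L2 : 2^-1 <= L.
    rewrite -[X in X <= _]expRK ler_ln ?posrE ?expR_gt0//.
    apply: (@le_trans _ _ 2); last by rewrite ler_nat.
    have := @expR_ge1Dx R (- 2^-1); rewrite expRN => hh.
    by rewrite -lef_pV2 ?posrE ?expR_gt0//; lra.
  have t1 : 1 <= t by rewrite -(@ler_pXn2r _ 2)// ?nnegrE ?(ltW t0)// expr1n; lra.
  have := noise_tail ge sigma0 v0 (ltW t0).
  rewrite (_ : [set b | t < _] = [set b | c < `|I k a b|]); last first.
    apply/seteqP; split=> b /=; rewrite -IE normrM normfV (gtr0_norm sv) /t ltr_pM2r ?invr_gt0//.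
  move=> ->; apply: le_trans (tail2_le t1) _.
  have -> : p%:R^-1 ^+ 4 = expR (- (4 * L)) :> R.
    by rewrite -mulrN expRM_natl expRN lnK ?posrE.
  by rewrite ler_expR; lra.
pose E k : set T := [set w | 2^-1 <= F k w w].
have bd k := decouple_Ex (sigma_mx_measurable mX) (sigma_mx_measurable meps) ind (jF k) (F01 k).
have mE k : measurable (E k).
  by have [_ _ [mf _] _] := bd k; apply: measurable_setle.
exists (\big[setU/set0]_(k < p) E k); split.
- exact: measurable_bigsetU.
- apply: (le_trans (Pr_bigU _ _ mE)).
  apply: (@le_trans _ _ (\sum_(k < p) 2 * p%:R^-1 ^+ 4)).
    apply: ler_sum => k _; have [_ _ b _] := bd k.
    apply: (@le_trans _ _ (Ex P (fun w => F k w w) / 2^-1)).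
      by apply: Pr_markov => // w; have /andP[] := F01 k w w.
    rewrite invrK mulrC ler_pM2l//.
    exact: (decouple_le (sigma_mx_measurable mX) (sigma_mx_measurable meps) ind (jF k) (F01 k) (hF k)).
  rewrite sumr_const card_ord -[leLHS]mulr_natl.
  have ip : p%:R^-1 <= 2^-1 :> R by rewrite lef_pV2 ?posrE// ler_nat.
  have ip0 : 0 < p%:R^-1 :> R by rewrite invr_gt0.
  rewrite (_ : p%:R * (2 * p%:R^-1 ^+ 4) = 2 * p%:R^-1 ^+ 2 * p%:R^-1 :> R); last by field; rewrite gt_eqF.
  rewrite ler_piMl ?(ltW ip0)//; set q := p%:R^-1 in ip ip0 *; nra.
move=> w wB hN k.
have nE : ~ E k w by move=> Ek; apply: wB; exact: mem_bigsetU Ek.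
rewrite ler_pdivrMr// leNgt; apply/negP => h; apply: nE; rewrite /E/= /F ltNge NE hN subr0 mul1r.
have -> : c < `|I k w w|.
  rewrite (_ : I k w w = ((X w)^T *m eps w) k 0)//.
  by rewrite /I mxE; apply: eq_bigr => i _; rewrite mxE.
by rewrite invf_le1// ler1n.
Qed.

End Design.
End GoodEvents.

(** * Covariance of tail indicators *)

Section CoshKernel.
Context {R : realType}.

Definition ch (x : R) : R := (expR x + expR (- x)) / 2.

Lemma cvg_finite_sum (I : Type) (s : seq I) (F : I -> nat -> R) (G : I -> R) :
  (forall i, F i n @[n --> \oo] --> G i) ->
  \sum_(i <- s) F i n @[n --> \oo] --> \sum_(i <- s) G i.
Proof.
move=> h; elim: s => [|i s IH].
  by under eq_fun do rewrite big_nil; rewrite big_nil; exact: cvg_cst.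
by under eq_fun do rewrite big_cons; rewrite big_cons; exact: cvgD.
Qed.

Lemma cvg_exp_series (x : R) : series (exp_coeff x) n @[n --> \oo] --> expR x.
Proof. exact: is_cvg_series_exp_coeff. Qed.

(* The kernel [r^2 (cosh(xy) - 1) - (cosh(rxy) - 1)] is positive semidefinite:
   its power series in [xy] has the nonnegative coefficients
   [(r^2 - r^n) / n!], for n even and positive. *)
Lemma cosh_psd (r : R) (s : seq (R * R)) : `|r| <= 1 ->
  0 <= \sum_(i <- s) \sum_(j <- s) i.1 * j.1 *
     (r ^+ 2 * (ch (i.2 * j.2) - 1) - (ch (r * (i.2 * j.2)) - 1)).
Proof.
move=> r1.
pose e (n : nat) : R := (1 + (-1) ^+ n) / 2.
(* [e n] keeps the even powers, and the constant term is set to 0 because the two [- 1] in the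
   kernel cancel it. *)
pose v (n : nat) : R := if n == 0%N then 0 else e n * (r ^+ 2 - r ^+ n).
have v0 n : 0 <= v n.
  rewrite /v; case: eqP => // /eqP n0; rewrite /e -signr_odd; case: (boolP (odd n)) => on.
    by rewrite expr1 subrr !mul0r.
  apply: mulr_ge0; first by rewrite expr0; lra.
  rewrite subr_ge0.
  have -> : n = ((n./2).*2)%N by rewrite -[LHS]odd_double_half (negbTE on).
  have : (0 < n./2)%N by case: n n0 on => [|[|n]].
  case: (n./2) => // k _; rewrite -mul2n exprM exprS ler_piMr ?sqr_ge0//.
  by rewrite exprn_ile1 ?sqr_ge0// -[r ^+ 2]ger0_norm ?sqr_ge0// normrX exprn_ile1.
pose K (x : R) := r ^+ 2 * (ch x - 1) - (ch (r * x) - 1).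
pose KN (x : R) (N : nat) : R := \sum_(0 <= n < N.+1) v n * (x ^+ n / n`!%:R).
have chN x : 2^-1 * (series (exp_coeff x) n.+1 + series (exp_coeff (- x)) n.+1) @[n --> \oo] --> ch x.
  rewrite (_ : ch x = 2^-1 * (expR x + expR (- x))); last by rewrite /ch mulrC.
  apply: cvgMr; apply: cvgD.
    by have := @cvg_exp_series x; rewrite -(cvg_shiftS (series (exp_coeff x))).
  by have := @cvg_exp_series (- x); rewrite -(cvg_shiftS (series (exp_coeff (- x)))).
have chS x N : 2^-1 * (series (exp_coeff x) N + series (exp_coeff (- x)) N) =
    \sum_(0 <= n < N) e n * (x ^+ n / n`!%:R).
  rewrite /series/= -big_split/= mulr_sumr; apply: eq_bigr => n _.
  by rewrite /exp_coeff/= /e [(- x) ^+ n]exprNn; ring.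
have KE x N : KN x N = r ^+ 2 * (2^-1 * (series (exp_coeff x) N.+1 + series (exp_coeff (- x)) N.+1) - 1) -
    (2^-1 * (series (exp_coeff (r * x)) N.+1 + series (exp_coeff (- (r * x))) N.+1) - 1).
  rewrite !chS /KN !big_nat_recl// !expr0 fact0 invr1 /v /= /e expr0.
  set A := \sum_(0 <= i < N) _; set B := \sum_(0 <= i < N) _; set C := \sum_(0 <= i < N) _.
  have -> : A = r ^+ 2 * B - C.
    rewrite /A /B /C mulr_sumr -sumrB; apply: eq_bigr => n _.
    by rewrite exprMn /e; ring.
  by field.
have KNK x : KN x N @[N --> \oo] --> K x.
  under eq_fun do rewrite KE; rewrite /K.
  apply: cvgB; last by apply: cvgB; [exact: chN|exact: cvg_cst].
  by apply: cvgMr; apply: cvgB; [exact: chN|exact: cvg_cst].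
have lim : \sum_(i <- s) \sum_(j <- s) i.1 * j.1 * KN (i.2 * j.2) N @[N --> \oo] -->
    \sum_(i <- s) \sum_(j <- s) i.1 * j.1 * K (i.2 * j.2).
  by apply: cvg_finite_sum => i; apply: cvg_finite_sum => j; apply: cvgMr.
rewrite -(cvg_lim _ lim)//; apply: limr_ge; first by apply/cvg_ex; eexists; exact: lim.
near=> N.
(* Each power [(x y)^n] is a kernel of rank one, so its quadratic form is a square, weighted by a
   nonnegative coefficient. *)
have -> : \sum_(i <- s) \sum_(j <- s) i.1 * j.1 * KN (i.2 * j.2) N =
    \sum_(0 <= n < N.+1) v n / n`!%:R * (\sum_(i <- s) i.1 * i.2 ^+ n) ^+ 2.
  transitivity (\sum_(i <- s) \sum_(j <- s) \sum_(0 <= n < N.+1) v n / n`!%:R * ((i.1 * i.2 ^+ n) * (j.1 * j.2 ^+ n))).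
    apply: eq_bigr => i _; apply: eq_bigr => j _; rewrite mulr_sumr; apply: eq_bigr => n _.
    by rewrite exprMn; ring.
  under eq_bigr do rewrite exchange_big/=.
  rewrite exchange_big/=; apply: eq_bigr => n _.
  under eq_bigr do rewrite -mulr_sumr -mulr_sumr.
  by rewrite -mulr_sumr -mulr_suml expr2.
by apply: sumr_ge0 => n _; rewrite mulr_ge0 ?sqr_ge0// divr_ge0.
Unshelve. all: by end_near.
Qed.

End CoshKernel.

Section TrigonometricClass.
Context {R : realType}.

Definition trig (s : seq (R * R)) (y : R) : R := \sum_(i <- s) i.1 * cos (i.2 * y).
Definition istrig (f : R -> R) := exists s, f =1 trig s.

Lemma istrig_cos a : istrig (fun y => cos (a * y)).
Proof. by exists [:: (1, a)] => y; rewrite /trig big_seq1 mul1r. Qed.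

Lemma istrig_cst c : istrig (fun=> c).
Proof. by exists [:: (c, 0)] => y; rewrite /trig big_seq1 mul0r cos0 mulr1. Qed.

Lemma istrigD f g : istrig f -> istrig g -> istrig (fun y => f y + g y).
Proof. by move=> [s fs] [t gt]; exists (s ++ t) => y; rewrite /trig big_cat/= fs gt. Qed.

Lemma istrigM f g : istrig f -> istrig g -> istrig (fun y => f y * g y).
Proof.
move=> [s fs] [t gt].
exists (flatten [seq [:: (i.1 * j.1 / 2, i.2 + j.2); (i.1 * j.1 / 2, i.2 - j.2)] | i <- s, j <- t]) => y.
rewrite fs gt /trig big_flatten big_allpairs_dep/= mulr_suml; apply: eq_bigr => i _.
rewrite mulr_sumr; apply: eq_bigr => j _; rewrite big_cons big_seq1/= mulrDl mulrBl cosD cosB.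
by field.
Qed.

Lemma istrigX f n : istrig f -> istrig (fun y => f y ^+ n).
Proof.
move=> tf; elim: n => [|n IH]; first exact: istrig_cst.
by have [s h] := istrigM tf IH; exists s => y; rewrite exprS h.
Qed.

Lemma istrig_bmf f : istrig f -> bmf f.
Proof.
move=> [s fs]; have -> : f = trig s by apply/funext.
by apply: bmf_sum => i; apply: bmfZ; apply: bmf_cos; exact: measurable_funM.
Qed.

(* The indicator of a tail is obtained from trigonometric polynomials by two
   bounded pointwise limits, from [((1 + cos (w y)) / 2) ^+ k] with [w] such
   that the value at [t] is one half. *)
Lemma tail_closure (C : (R -> R) -> Prop) :
  (forall f, istrig f -> C f) ->
  (forall (f_ : nat -> R -> R) (f : R -> R) (M : R), (forall n, mfunT (f_ n)) ->
     (forall n y, `|f_ n y| <= M) -> (forall y, f_ ^~ y @ \oo --> f y) ->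
     mfunT f -> (forall n, C (f_ n)) -> C f) ->
  forall t : R, 0 < t -> C (fun y => ((t < `|y|)%R%:R : R)).
Proof.
move=> trigC cvgC t t0.
(* Chosen so that [((1 + v k) / 2)^(k + 1) = 1/2]: with the frequency [w k] below, where
   [cos (w k * t) = v k], the power [g k] equals one half exactly at [t]. *)
pose v (k : nat) : R := 2 * expR (- (ln 2 / k.+1%:R)) - 1.
have l20 : 0 < ln 2 :> R by rewrite ln_gt0// ltr1n.
have v1 k : -1 <= v k <= 1.
  have h1 : 0 < expR (- (ln 2 / k.+1%:R)) :> R by exact: expR_gt0.
  have h2 : expR (- (ln 2 / k.+1%:R)) <= 1 :> R.
    by rewrite -[leRHS]expR0 ler_expR oppr_le0 divr_ge0// ltW.
  rewrite /v; lra.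
pose w (k : nat) : R := acos (v k) / t.
pose g (k : nat) (y : R) : R := ((1 + cos (w k * y)) / 2) ^+ k.+1.
have g01 k y : 0 <= g k y <= 1.
  have := cos_geN1 (w k * y); have := cos_le1 (w k * y) => h1 h2.
  by rewrite exprn_ge0 ?exprn_ile1//; lra.
have tg k : istrig (g k).
  apply: istrigX; have [s h] := istrigD (istrig_cst (1 / 2)) (istrigM (istrig_cst (1 / 2)) (istrig_cos (w k))).
  by exists s => y; rewrite -h; ring.
have mg k : mfunT (g k) by have [] := istrig_bmf (tg k).
have cg k : C (fun y => ((g k y < 2^-1)%R%:R : R)).
  apply: (cvgC (fun n y => (1 - g k y ^+ n) ^+ (n * 2 ^ n)%N) _ 1).
  - move=> n; apply: measurable_funX; apply: measurable_funB => //; exact: measurable_funX.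
  - move=> n y; have /andP[h1 h2] := g01 k y.
    have h3 : 0 <= g k y ^+ n <= 1 by apply/andP; split; [exact: exprn_ge0|exact: exprn_ile1].
    by rewrite normrX exprn_ile1// ger0_norm; lra.
  - by move=> y; have /andP[h1 h2] := g01 k y; exact: cvg_step_powers.
  - apply: (eq_measurable_fun (\1_[set y | g k y < 2^-1] : R -> R)).
      move=> y _; rewrite indicE; have [h|h] := boolP (g k y < 2^-1).
        by rewrite mem_set.
      by rewrite memNset//; exact/negP.
    by apply: measurable_indic; exact: measurable_setlt.
  - move=> n; apply: trigC; apply: istrigX.
    have [s h] := istrigD (istrig_cst 1) (istrigM (istrig_cst (-1)) (istrigX n (tg k))).
    by exists s => y; rewrite -h; ring.
apply: (cvgC (fun k y => (g k y < 2^-1)%R%:R) _ 1) => //.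
- move=> k; apply: (eq_measurable_fun (\1_[set y | g k y < 2^-1] : R -> R)).
    move=> y _; rewrite indicE; have [h|h] := boolP (g k y < 2^-1).
      by rewrite mem_set.
    by rewrite memNset//; exact/negP.
  by apply: measurable_indic; exact: measurable_setlt.
- by move=> k y; case: (_ < _); rewrite ?normr1 ?normr0.
- move=> y.
  have wt k : w k * t = acos (v k) by rewrite /w divfK// gt_eqF.
  have cw k : cos (w k * t) = v k by rewrite wt acosK// in_itv/= v1.
  have gt k : ((1 + v k) / 2) ^+ k.+1 = 2^-1 :> R.
    rewrite (_ : (1 + v k) / 2 = expR (- (ln 2 / k.+1%:R))); last by rewrite /v; field.
    rewrite -expRM_natl mulrN mulrCA divff ?pnatr_eq0// mulr1 expRN lnK// posrE.
    by rewrite ltr0n.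
  have w0 k : 0 <= w k by rewrite divr_ge0 ?acos_ge0// ltW.
  have wpi k : w k * t <= pi by rewrite wt acos_lepi.
  have ca k : cos (w k * y) = cos (w k * `|y|).
    by rewrite -cos_norm normrM (ger0_norm (w0 k)).
  (* For [|y| <= t] the cosine is monotone on [[0, w k t]], which is inside [[0, pi]], so that
     [g k y >= 1/2] for every [k]. For [|y| > t] periodicity could bring the value back, but [w k]
     tends to 0 and [w k |y| <= pi] eventually. *)
  have [ty|yt] := ltP t `|y|; last first.
    rewrite (_ : (fun k => _) = fun=> 0); first exact: cvg_cst.
    apply/funext => k; rewrite ltNge -(gt k) /g ca lerXn2r ?nnegrE//=.
    - by have /andP[] := v1 k; lra.
    - rewrite ler_pM2r ?invr_gt0// lerD2l -cw.
      have wy : w k * `|y| <= w k * t by rewrite ler_wpM2l.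
      have m1 : w k * `|y| \in `[0, pi] by rewrite in_itv/= (mulr_ge0 (w0 k) (normr_ge0 y)) (le_trans wy (wpi k)).
      have m2 : w k * t \in `[0, pi] by rewrite in_itv/= (mulr_ge0 (w0 k) (ltW t0)) wpi.
      by rewrite leNgt ltr_cos// -leNgt.
  have y0 : 0 < `|y| by apply: lt_trans ty.
  pose ep := pi * t / `|y|.
  have pi0 : 0 < pi :> R by exact: pi_gt0.
  have ep0 : 0 < ep by rewrite divr_gt0// mulr_gt0.
  have eppi : ep < pi by rewrite ltr_pdivrMr// ltr_pM2l.
  have cep : cos ep < 1 by rewrite -[ltRHS]cos0 ltr_cos ?in_itv/= ?lexx ?(ltW ep0) ?(ltW eppi) ?(ltW pi0).
  apply: cvg_near_cst; near=> k.
  have vk : cos ep < v k.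
    have h1 : 1 + - (ln 2 / k.+1%:R) <= expR (- (ln 2 / k.+1%:R)) :> R by exact: expR_ge1Dx.
    have h2 : 2 * ln 2 / (1 - cos ep) < k.+1%:R.
      by apply: (@lt_le_trans _ _ k%:R); [near: k; exact: nbhs_infty_gtr|rewrite ler_nat].
    have k0 : 0 < k.+1%:R :> R by rewrite ltr0n.
    rewrite ltr_pdivrMr ?subr_gt0// in h2.
    have h3 : 2 * (ln 2 / k.+1%:R) < 1 - cos ep by rewrite mulrA ltr_pdivrMr// [ltRHS]mulrC.
    move: h1 h3; rewrite /v; set u := ln 2 / _; set E := expR _; move=> h1 h3; lra.
  have v2 : v k < 1.
    have : expR (- (ln 2 / k.+1%:R)) < 1 :> R.
      by rewrite -[ltRHS]expR0 ltr_expR oppr_lt0 divr_gt0.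
    rewrite /v; lra.
  have wt0 : 0 < w k * t by rewrite wt acos_gt0// v2 andbT; have /andP[] := v1 k.
  have wk0 : 0 < w k by rewrite -(pmulr_lgt0 _ t0).
  have we : w k * t < ep.
    rewrite -ltr_cos ?in_itv/= ?(ltW wt0) ?wpi ?(ltW ep0) ?(ltW eppi)//.
    by rewrite cw.
  have wy : w k * `|y| <= pi.
    have : w k * t * (`|y| / t) <= ep * (`|y| / t) by rewrite ler_wpM2r ?(ltW we)// divr_ge0 ?ltW.
    rewrite (_ : w k * t * (`|y| / t) = w k * `|y|); last by field; rewrite gt_eqF.
    by rewrite (_ : ep * (`|y| / t) = pi)// /ep; field; rewrite !gt_eqF.
  rewrite (_ : g k y < 2^-1)// -(gt k) /g ca ltrXn2r// ?nnegrE//.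
  - rewrite ltr_pM2r ?invr_gt0// ltrD2l -cw.
    have m1 : w k * `|y| \in `[0, pi] by rewrite in_itv/= (mulr_ge0 (w0 k) (normr_ge0 y)) wy.
    have m2 : w k * t \in `[0, pi] by rewrite in_itv/= (mulr_ge0 (w0 k) (ltW t0)) wpi.
    by rewrite ltr_cos// ltr_pM2l.
- apply: (eq_measurable_fun (\1_[set y : R | t < `|y|] : R -> R)).
    move=> y _; rewrite indicE; have [h|h] := boolP (t < `|y|).
      by rewrite mem_set.
    by rewrite memNset//; exact/negP.
  by apply: measurable_indic; exact: measurable_tail.
Unshelve. all: by end_near.
Qed.

End TrigonometricClass.

Section CorrelatedPair.
Context {R : realType} {d} {T : measurableType d}.
Variable P : probability T R.
Notation nu := (@normal_prob R 0 1).
Variables (Y1 Y2 : T -> R) (r : R).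
Hypotheses (mY1 : mfunT Y1) (mY2 : mfunT Y2) (r1 : `|r| <= 1).
Hypothesis hY : forall a b, Ex P (fun w => cos (a * Y1 w + b * Y2 w)) =
  expR (- (a ^+ 2 + 2 * r * a * b + b ^+ 2) / 2).

(** A Gebelein-type inequality, meant for even [f]: after centring, their Hermite expansion starts
    at degree two, which explains [r ^+ 2] in place of [|r|]. The square is what allows a sum of
    squared Gram entries later. *)
Definition cov_le (f : R -> R) :=
  Ex P (fun w => f (Y1 w) * f (Y2 w)) - Ex nu f ^+ 2 <=
  r ^+ 2 * (Ex nu (fun y => f y ^+ 2) - Ex nu f ^+ 2).

Lemma cov_le_trig f : istrig f -> cov_le f.
Proof.
move=> [s fs]; have -> : f = trig s by apply/funext.
have bc a : bmf (fun y : R => cos (a * y)) by apply: bmf_cos; exact: measurable_funM.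
have bc2 a b (Z1 Z2 : T -> R) : mfunT Z1 -> mfunT Z2 ->
    bmf (fun w => cos (a * Z1 w + b * Z2 w)).
  by move=> m1 m2; apply: bmf_cos; apply: measurable_funD; exact: measurable_funM.
have Enu a : Ex nu (fun y => cos (a * y)) = expR (- a ^+ 2 / 2).
  by have := Ex_cos_normal a 0; rewrite cos0 mulr1 => <-; apply: Ex_ext => y; rewrite addr0.
have e1 : Ex nu (trig s) = \sum_(i <- s) i.1 * expR (- i.2 ^+ 2 / 2).
  rewrite Ex_sum; last by move=> i; exact: (bmfZ i.1 (bc i.2)).
  by apply: eq_bigr => i _; rewrite (ExZ nu i.1 (bc i.2)) Enu.
have prodc (a b : R) (x y : R) : cos (a * x) * cos (b * y) =
   2^-1 * cos (a * x + b * y) + 2^-1 * cos (a * x + (- b) * y).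
  by rewrite mulNr cosB cosD; field.
(* Averaging over the sign of [b] turns the Gaussian cross term into a hyperbolic cosine; [c = r]
   gives the pair and [c = 1] the variance. *)
have gch (c a b : R) : 2^-1 * expR (- (a ^+ 2 + 2 * c * a * b + b ^+ 2) / 2) +
   2^-1 * expR (- (a ^+ 2 + 2 * c * a * (- b) + (- b) ^+ 2) / 2) =
   expR (- a ^+ 2 / 2) * expR (- b ^+ 2 / 2) * ch (c * (a * b)).
  rewrite (_ : - (a ^+ 2 + 2 * c * a * b + b ^+ 2) / 2 = - a ^+ 2 / 2 + - b ^+ 2 / 2 + - (c * (a * b))); last by field.
  rewrite (_ : - (a ^+ 2 + 2 * c * a * - b + (- b) ^+ 2) / 2 = - a ^+ 2 / 2 + - b ^+ 2 / 2 + c * (a * b)); last by field.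
  by rewrite !expRD /ch; field.
have e2 : Ex P (fun w => trig s (Y1 w) * trig s (Y2 w)) =
   \sum_(i <- s) \sum_(j <- s) i.1 * j.1 *
      (expR (- i.2 ^+ 2 / 2) * expR (- j.2 ^+ 2 / 2) * ch (r * (i.2 * j.2))).
  transitivity (Ex P (fun w => \sum_(i <- s) \sum_(j <- s) i.1 * j.1 *
     (2^-1 * cos (i.2 * Y1 w + j.2 * Y2 w) + 2^-1 * cos (i.2 * Y1 w + (- j.2) * Y2 w)))).
    apply: Ex_ext => w; rewrite /trig mulr_suml; apply: eq_bigr => i _.
    by rewrite mulr_sumr; apply: eq_bigr => j _; rewrite -prodc; ring.
  have b0 i j : bmf (fun w => 2^-1 * cos (i * Y1 w + j * Y2 w) + 2^-1 * cos (i * Y1 w + (- j) * Y2 w)).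
    by apply: bmfD; apply: bmfZ; exact: bc2.
  rewrite Ex_sum; last by move=> i; apply: bmf_sum => j; exact: bmfZ.
  apply: eq_bigr => i _; rewrite Ex_sum; last by move=> j; exact: bmfZ.
  apply: eq_bigr => j _; rewrite ExZ// ExD; [|by apply: bmfZ; exact: bc2|by apply: bmfZ; exact: bc2].
  by rewrite !ExZ; [|exact: bc2|exact: bc2]; rewrite !hY gch.
have e3 : Ex nu (fun y => trig s y ^+ 2) =
   \sum_(i <- s) \sum_(j <- s) i.1 * j.1 *
      (expR (- i.2 ^+ 2 / 2) * expR (- j.2 ^+ 2 / 2) * ch (i.2 * j.2)).
  transitivity (Ex nu (fun y => \sum_(i <- s) \sum_(j <- s) i.1 * j.1 *
     (2^-1 * cos ((i.2 + j.2) * y) + 2^-1 * cos ((i.2 - j.2) * y)))).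
    apply: Ex_ext => y; rewrite expr2 /trig mulr_suml; apply: eq_bigr => i _.
    rewrite mulr_sumr; apply: eq_bigr => j _; rewrite mulrDl mulrBl -[- (j.2 * y)]mulNr -prodc; ring.
  have b0 i j : bmf (fun y : R => 2^-1 * cos (i * y) + 2^-1 * cos (j * y)).
    by apply: bmfD; apply: bmfZ; exact: bc.
  have b1 (i j : R * R) : bmf (fun y : R => i.1 * j.1 * (2^-1 * cos ((i.2 + j.2) * y) + 2^-1 * cos ((i.2 - j.2) * y))).
    exact: (bmfZ _ (b0 _ _)).
  rewrite Ex_sum; last by move=> i; apply: bmf_sum => j; exact: b1.
  apply: eq_bigr => i _; rewrite Ex_sum; last by move=> j; exact: b1.
  apply: eq_bigr => j _; rewrite (ExZ nu (i.1 * j.1) (b0 (i.2 + j.2) (i.2 - j.2))).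
  rewrite (ExD nu (bmfZ 2^-1 (bc (i.2 + j.2))) (bmfZ 2^-1 (bc (i.2 - j.2)))).
  rewrite (ExZ nu 2^-1 (bc (i.2 + j.2))) (ExZ nu 2^-1 (bc (i.2 - j.2))) !Enu.
  rewrite -[i.2 * j.2]mul1r -gch.
  by congr (_ * (_ * expR _ + _ * expR _)); field.
rewrite /cov_le e1 e2 e3 -subr_ge0.
have e4 : (\sum_(i <- s) i.1 * expR (- i.2 ^+ 2 / 2)) ^+ 2 =
   \sum_(i <- s) \sum_(j <- s) i.1 * j.1 * (expR (- i.2 ^+ 2 / 2) * expR (- j.2 ^+ 2 / 2)).
  rewrite expr2 mulr_suml; apply: eq_bigr => i _; rewrite mulr_sumr; apply: eq_bigr => j _; ring.
rewrite e4 -sumrB -sumrB mulr_sumr -sumrB.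
have := cosh_psd [seq (i.1 * expR (- i.2 ^+ 2 / 2), i.2) | i <- s] r1.
rewrite big_map => /le_trans; apply; apply: le_of_eq.
apply: eq_bigr => i _; rewrite big_map -!sumrB mulr_sumr -sumrB; apply: eq_bigr => j _ /=.
by ring.
Qed.

Lemma cov_le_cvg (f_ : nat -> R -> R) (f : R -> R) (M : R) :
  (forall n, mfunT (f_ n)) -> (forall n y, `|f_ n y| <= M) ->
  (forall y, f_ ^~ y @ \oo --> f y) -> mfunT f ->
  (forall n, cov_le (f_ n)) -> cov_le f.
Proof.
move=> mf_ hM cf mf hc.
have M0 : 0 <= M by apply: le_trans (hM 0%N 0).
have c1 : Ex nu (f_ n) @[n --> \oo] --> Ex nu f by exact: (Ex_dct (M := M)).
have c2 : Ex nu (fun y => f_ n y ^+ 2) @[n --> \oo] --> Ex nu (fun y => f y ^+ 2).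
  apply: (Ex_dct (M := M ^+ 2)) => [n|n y|y|].
  - exact: (measurable_funX 2 (mf_ n)).
  - by rewrite normrX lerXn2r ?nnegrE.
  - by rewrite expr2; under eq_fun do rewrite expr2; exact: cvgM.
  - exact: (measurable_funX 2 mf).
have c3 : Ex P (fun w => f_ n (Y1 w) * f_ n (Y2 w)) @[n --> \oo] --> Ex P (fun w => f (Y1 w) * f (Y2 w)).
  apply: (Ex_dct (M := M ^+ 2)) => [n|n w|w|].
  - by apply: measurable_funM; exact: measurableT_comp.
  - by rewrite normrM expr2 ler_pM.
  - exact: cvgM.
  - by apply: measurable_funM; exact: measurableT_comp.
have c4 : Ex nu (f_ n) ^+ 2 @[n --> \oo] --> Ex nu f ^+ 2.
  by rewrite expr2; under eq_fun do rewrite expr2; exact: cvgM.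
rewrite /cov_le -subr_ge0.
have lim : r ^+ 2 * (Ex nu (fun y => f_ n y ^+ 2) - Ex nu (f_ n) ^+ 2) -
   (Ex P (fun w => f_ n (Y1 w) * f_ n (Y2 w)) - Ex nu (f_ n) ^+ 2) @[n --> \oo] -->
   r ^+ 2 * (Ex nu (fun y => f y ^+ 2) - Ex nu f ^+ 2) -
   (Ex P (fun w => f (Y1 w) * f (Y2 w)) - Ex nu f ^+ 2).
  by apply: cvgB; [apply: cvgMr; exact: cvgB|exact: cvgB].
rewrite -(cvg_lim _ lim)//; apply: limr_ge; first by apply/cvg_ex; eexists; exact: lim.
by apply: nearW => n; rewrite subr_ge0; exact: hc.
Qed.

Lemma cov_le_tail (t : R) : 0 < t -> cov_le (fun y => ((t < `|y|)%R%:R : R)).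
Proof. exact: (tail_closure cov_le_trig cov_le_cvg). Qed.

End CorrelatedPair.

Section ExceedanceVariance.
Context {R : realType} {d} {T : measurableType d}.
Variable P : probability T R.
Notation nu := (@normal_prob R 0 1).
Variables (n p : nat) (eps : T -> 'cV[R]_n) (sigma : R) (a : 'I_p -> 'cV[R]_n) (t : R).
Hypotheses (meps : random_mx eps) (geps : gaussian_vec P eps (sigma ^+ 2)%:M) (sigma0 : 0 < sigma)
  (t0 : 0 < t) (a0 : forall j, 0 < sqnorm2 (a j)) (p0 : (0 < p)%N).

Let Y j w := lin1 (a j) eps w / (sigma * sqrt (sqnorm2 (a j))).
Let q := 2 * Phibar t.
Let I j w : R := (t < `|Y j w|)%R%:R.
Let r i j := bform 1%:M (a i) (a j) / (sqrt (sqnorm2 (a i)) * sqrt (sqnorm2 (a j))).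
Let s0 j : 0 < sqrt (sqnorm2 (a j)). Proof. by rewrite sqrtr_gt0. Qed.

Let mY j : mfunT (Y j).
Proof. by apply: measurable_funM => //; exact: measurable_lin1. Qed.

Let q01 : 0 <= q <= 1.
Proof.
rewrite /q mulr_ge0 ?Phibar_ge0//= -(noise_tail geps sigma0 (a0 (Ordinal p0)) (ltW t0)).
apply: Pr_le1; apply: measurable_setlt => //; apply: measurableT_comp => //; exact: mY.
Qed.

Let r_le1 i j : `|r i j| <= 1.
Proof.
have sq k : sqrt (sqnorm2 (a k)) ^+ 2 = sqnorm2 (a k) by rewrite sqr_sqrtr// ltW.
have h (e : R) : e ^+ 2 = 1 -> 0 <= 2 + 2 * e * r i j.
  move=> e1; pose u := (sqrt (sqnorm2 (a i)))^-1 *: a i; pose v := (e / sqrt (sqnorm2 (a j))) *: a j.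
  have := sqnorm2_ge0 (u + v); rewrite sqnorm2D !sqnorm2Z bformZl bformZr.
  rewrite expr_div_n exprVn !sq e1 mulVf ?gt_eqF// mul1r mulVf ?gt_eqF//.
  rewrite (_ : (sqrt _)^-1 * _ = e * r i j); first lra.
  by rewrite /r; field; rewrite !gt_eqF.
rewrite ler_norml; have := h 1 (expr1n _ _); have := h (-1); rewrite sqrrN expr1n => /(_ erefl); lra.
Qed.

Let pair_cos i j x y : Ex P (fun w => cos (x * Y i w + y * Y j w)) =
  expR (- (x ^+ 2 + 2 * r i j * x * y + y ^+ 2) / 2).
Proof.
pose ci := (sigma * sqrt (sqnorm2 (a i)))^-1; pose cj := (sigma * sqrt (sqnorm2 (a j)))^-1.
have sq k : sqrt (sqnorm2 (a k)) ^+ 2 = sqnorm2 (a k) by rewrite sqr_sqrtr// ltW.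
have := gaussian_cos meps geps ((x * ci) *: a i + (y * cj) *: a j) 0; rewrite cos0 mulr1.
rewrite -/(bform _ _ _) -/(qform _ _) qform_scalar sqnorm2D !sqnorm2Z bformZl bformZr.
set e := - _ / 2; set e' := - _ / 2; have -> : e = e'.
  have ex k : exists s, [/\ 0 < s, s ^+ 2 = sqnorm2 (a k) & sqrt (sqnorm2 (a k)) = s].
    by exists (sqrt (sqnorm2 (a k))); split.
  have [si [hi1 hi2 hi3]] := ex i; have [sj [hj1 hj2 hj3]] := ex j.
  rewrite /e /e' /r /ci /cj !hi3 !hj3 -!hi2 -!hj2; field.
  by rewrite !gt_eqF.
move=> <-; apply: Ex_ext => w; congr cos; rewrite addr0 /Y !lin1E !mulr_suml !mulr_sumr -big_split/=.
by apply: eq_bigr => k _; rewrite addmxE !scalemxE /ci /cj; ring.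
Qed.

Let bI j : bmf (I j).
Proof.
split; last by exists 1 => w; rewrite /I; case: (_ < _); rewrite ?normr1 ?normr0.
apply: (eq_measurable_fun (\1_[set w | t < `|Y j w|] : T -> R)).
  move=> w _; rewrite indicE /I; have [h|h] := boolP (t < `|Y j w|).
    by rewrite mem_set.
  by rewrite memNset//; exact/negP.
by apply: measurable_indic; apply: measurable_setlt => //; apply: measurableT_comp => //; exact: mY.
Qed.

Let EI j : Ex P (I j) = q.
Proof.
rewrite /q -(noise_tail geps sigma0 (a0 j) (ltW t0)) /Pr -Ex_indic; last first.
  by apply: measurable_setlt => //; apply: measurableT_comp => //; exact: mY.
apply: Ex_ext => w; rewrite indicE /I; have [h|h] := boolP (t < `|Y j w|).
  by rewrite mem_set.
by rewrite memNset//; exact/negP.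
Qed.

Let EII i j : Ex P (fun w => I i w * I j w) - q ^+ 2 <= r i j ^+ 2 * q.
Proof.
have h := cov_le_tail (mY i) (mY j) (r_le1 i j) (pair_cos i j) t0.
have e1 : Ex nu (fun y => ((t < `|y|)%R%:R : R)) = q.
  rewrite /q -nu_tail ?(ltW t0)// -Ex_indic; last exact: measurable_tail.
  apply: Ex_ext => y; rewrite indicE; have [hh|hh] := boolP (t < `|y|).
    by rewrite mem_set.
  by rewrite memNset//; exact/negP.
have e2 : Ex nu (fun y => ((t < `|y|)%R%:R : R) ^+ 2) = q.
  by rewrite -e1; apply: Ex_ext => y; case: (_ < _); rewrite ?expr1n ?expr0n.
move: h; rewrite /cov_le e1 e2 => /le_trans; apply.
by rewrite ler_wpM2l ?sqr_ge0// lerBlDr lerDl sqr_ge0.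
Qed.

(** The variance is a double sum of covariances, each at most [q] times a squared correlation of two
    residuals; the diagonal pairs are included, with correlation 1. No independence among the [p]
    statistics is required. *)
Lemma exceed_variance :
  bmf (fun w => ((\sum_j I j w) / p%:R - q) ^+ 2) /\
  Ex P (fun w => ((\sum_j I j w) / p%:R - q) ^+ 2) <=
  q * (\sum_i \sum_j (bform 1%:M (a i) (a j)) ^+ 2 / (sqnorm2 (a i) * sqnorm2 (a j))) / p%:R ^+ 2.
Proof.
have pR : 0 < p%:R :> R by rewrite ltr0n.
have e w : ((\sum_j I j w) / p%:R - q) ^+ 2 =
   (p%:R ^+ 2)^-1 * \sum_i \sum_j (I i w - q) * (I j w - q).
  have -> : (\sum_j I j w) / p%:R - q = p%:R^-1 * \sum_j (I j w - q).
    rewrite sumrB sumr_const card_ord -[q *+ p]mulr_natl; field.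
    by rewrite gt_eqF.
  rewrite exprMn exprVn; congr (_ * _).
  by rewrite expr2 mulr_suml; apply: eq_bigr => i _; rewrite mulr_sumr.
have bb i j : bmf (fun w => (I i w - q) * (I j w - q)).
  by apply: bmfM; apply: bmfB => //; exact: bmf_cst.
have bs : bmf (fun w => \sum_i \sum_j (I i w - q) * (I j w - q)).
  by apply: bmf_sum => i; apply: bmf_sum => j.
have -> : (fun w => ((\sum_j I j w) / p%:R - q) ^+ 2) =
  (fun w => (p%:R ^+ 2)^-1 * \sum_i \sum_j (I i w - q) * (I j w - q)) by apply/funext.
split; first exact: bmfZ.
rewrite ExZ// [leRHS]mulrC ler_wpM2l ?invr_ge0 ?sqr_ge0//.
rewrite Ex_sum; last by move=> i; apply: bmf_sum => j.
rewrite mulr_sumr; apply: ler_sum => i _; rewrite Ex_sum//.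
rewrite mulr_sumr; apply: ler_sum => j _.
have -> : Ex P (fun w => (I i w - q) * (I j w - q)) = Ex P (fun w => I i w * I j w) - q ^+ 2.
  transitivity (Ex P (fun w => I i w * I j w - (q * I i w + q * I j w - q ^+ 2))).
    by apply: Ex_ext => w; ring.
  have b1 : bmf (fun w => I i w * I j w) by exact: bmfM.
  have b2 : bmf (fun w => q * I i w + q * I j w) by apply: bmfD; exact: bmfZ.
  have bc : bmf (fun _ : T => q ^+ 2) by exact: bmf_cst.
  rewrite (ExB P b1 (bmfB b2 bc)) (ExB P b2 bc) (ExD P (bmfZ q (bI i)) (bmfZ q (bI j))).
  have eq1 k : Ex P (fun w => q * I k w) = q * q by rewrite (ExZ P q (bI k)) EI.
  by rewrite !eq1 Ex_cst; ring.
apply: le_trans (EII i j) _; rewrite mulrC ler_wpM2l//; first by have /andP[] := q01.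
by rewrite /r expr_div_n exprMn !sqr_sqrtr// ltW.
Qed.

End ExceedanceVariance.

(** * Measurability of Lasso residuals *)

Section LassoMeasurability.
Context {R : realType}.

(** An enumeration of the rational vectors, making the optimal value a countable infimum; codes of
    no vector are sent to 0, which does not change the infimum. *)
Definition ratv q (k : nat) : 'cV[R]_q :=
  if (@choice.unpickle 'cV[rat]_q k) is Some b then map_mx ratr b else 0.

Lemma ratv_dense q (f : 'cV[R]_q -> R) (b : 'cV[R]_q) (e : R) : continuous f -> 0 < e ->
  exists k, f (ratv q k) < f b + e.
Proof.
move=> cf e0.
have nb : nbhs b [set x | f x < f b + e].
  apply: (cf b [set y | y < f b + e]); apply: open_nbhs_nbhs; split; [exact: open_lt|by rewrite /=; lra].
case: nb => Q nQ sQ.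
have hr i j : {r : rat | Q i j (ratr r)}.
  apply: cid; have Uij := nbhs_interior (nQ i j).
  have [x [Ux [r _ rx]]] := dense_rat (ex_intro _ _ (nbhs_singleton Uij) : ((Q i j)^°)%classic !=set0) (@open_interior _ (Q i j)).
  by exists r; rewrite rx; exact: interior_subset.
exists (@choice.pickle 'cV[rat]_q (\matrix_(i, j) sval (hr i j) : 'cV[rat]_q)).
rewrite /ratv choice.pickleK; apply: sQ => i j; rewrite !mxE; exact: svalP (hr i j).
Qed.

Lemma continuous_add_fun (U : topologicalType) (f g : U -> R) : continuous f -> continuous g ->
  continuous (fun x => f x + g x).
Proof. by move=> cf cg x; apply: cvgD; [exact: cf|exact: cg]. Qed.

Lemma lasso_obj_continuous n q (A : 'M[R]_(n, q)) y lam : continuous (lasso_obj A y lam).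
Proof.
have cc i : continuous (fun b : 'cV[R]_q => b i 0) by exact: coord_continuous.
have -> : lasso_obj A y lam = (fun b => n%:R^-1 * (\sum_i (y i 0 + \sum_k (- A i k) * b k 0) * (y i 0 + \sum_k (- A i k) * b k 0)) +
   2 * lam * \sum_k `|b k 0|).
  apply/funext => b; rewrite /lasso_obj mulrC; congr (_ * _ + _); apply: eq_bigr => i _.
  have -> : (y - A *m b) i 0 = y i 0 + \sum_k - A i k * b k 0.
    by rewrite submxE mxE -sumrN; congr (_ + _); apply: eq_bigr => k _; rewrite mulNr.
  by rewrite expr2.
have cl i : continuous (fun b : 'cV[R]_q => y i 0 + \sum_k (- A i k) * b k 0).
  apply: continuous_add_fun; first exact: cst_continuous.
  apply: continuous_sum_fun => k; apply: continuous_mul_fun => //; exact: cst_continuous.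
apply: continuous_add_fun.
  apply: continuous_mul_fun; first exact: cst_continuous.
  by apply: continuous_sum_fun => i; apply: continuous_mul_fun.
apply: continuous_mul_fun; first exact: cst_continuous.
apply: continuous_sum_fun => k z; apply: (@continuous_comp _ _ _ (fun b : 'cV[R]_q => b k 0) Num.norm).
  exact: cc.
exact: norm_continuous.
Qed.

Lemma sqnorm2D_delta n (r : 'cV[R]_n) i (h : R) :
  sqnorm2 (r + h *: delta_mx i 0) = sqnorm2 r + 2 * h * r i 0 + h ^+ 2.
Proof.
rewrite sqnorm2D sqnorm2Z sqnorm2_delta bformZr [bform _ r _]bform_sym ?trmx1// bform1_delta.
by ring.
Qed.

Lemma lasso_obj_convex n q (A : 'M[R]_(n, q)) y1 y2 lam b1 b2 : 0 <= lam ->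
  lasso_obj A (2^-1 *: (y1 + y2)) lam (2^-1 *: (b1 + b2)) <=
  2^-1 * (lasso_obj A y1 lam b1 + lasso_obj A y2 lam b2).
Proof.
move=> lam0; rewrite /lasso_obj -scalemxAr -scalerBr mulmxDr.
set r1 := y1 - A *m b1; set r2 := y2 - A *m b2.
have -> : y1 + y2 - (A *m b1 + A *m b2) = r1 + r2.
  by rewrite /r1 /r2; apply/matrixP => i j; rewrite !mxE; ring.
have h1 : sqnorm2 (2^-1 *: (r1 + r2)) <= 2^-1 * (sqnorm2 r1 + sqnorm2 r2).
  have := sqnorm2_ge0 (r1 - r2); rewrite sqnorm2Z (sqnorm2B r1 r2) (sqnorm2D r1 r2) expr2.
  move: (sqnorm2 r1) (sqnorm2 r2) (bform _ r1 r2) => u v w; lra.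
have h2 : norm1 (2^-1 *: (b1 + b2)) <= 2^-1 * (norm1 b1 + norm1 b2).
  by rewrite norm1Z ger0_norm ?invr_ge0// ler_pM2l ?invr_gt0// ler_norm1D.
have n0 : 0 <= n%:R^-1 :> R by rewrite invr_ge0.
have h3 := ler_wpM2r n0 h1; have h4 := ler_wpM2l lam0 h2.
by move: h3 h4; rewrite !mulrDl !mulrDr; lra.
Qed.

(** The minimiser is an arbitrary choice, but its residual is [n / 2] times the gradient of the
    optimal value in the response. Entry [i] is thus a limit of difference quotients of the
    measurable functions [m h]. *)
Lemma lasso_resid_measurable d' (U : measurableType d') n q (A : U -> 'M[R]_(n, q))
    (y : U -> 'cV[R]_n) (lam : R) (g : U -> 'cV[R]_q) i : (0 < n)%N -> 0 <= lam ->
  (forall a b, mfunT (fun w => A w a b)) ->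
  (forall a, mfunT (fun w => y w a 0)) ->
  (forall w, is_lasso (A w) (y w) lam (g w)) ->
  mfunT (fun w => (y w - A w *m g w) i 0).
Proof.
move=> n0 lam0 mA my hg.
have nR : 0 < n%:R :> R by rewrite ltr0n.
pose obj (h : R) (k : nat) (w : U) := lasso_obj (A w) (y w + h *: delta_mx i 0) lam (ratv q k).
have mobj h k : mfunT (obj h k).
  apply: measurable_funD => //; apply: measurable_funM => //; apply: measurable_sum => a.
  apply: measurable_funX; under eq_fun do rewrite submxE addmxE mxE.
  apply: measurable_funB; first by apply: measurable_funD.
  have -> : (fun x => (A x *m ratv q k) a 0) = (fun x => \sum_b A x a b * ratv q k b 0).
    by apply/funext => x; rewrite mxE.
  by apply: measurable_sum => b; exact: measurable_funM.
have obj0 h k w : 0 <= obj h k w.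
  rewrite addr_ge0 ?divr_ge0 ?sqnorm2_ge0//.
  by rewrite mulr_ge0 ?norm1_ge0// mulr_ge0.
pose m h w := infs (fun k => obj h k w) 0%N.
have hlb h w : has_lbound (range (fun k => obj h k w)) by exists 0 => _ [k _ <-].
have mm h : mfunT (m h).
  by apply: measurable_fun_infs => // w _; exact: hlb.
pose rho w := (y w - A w *m g w) i 0.
pose m0 w := lasso_obj (A w) (y w) lam (g w).
have shift w h : lasso_obj (A w) (y w + h *: delta_mx i 0) lam (g w) =
    m0 w + 2 * h * rho w / n%:R + h ^+ 2 / n%:R.
  rewrite /m0 /lasso_obj (_ : y w + h *: delta_mx i 0 - A w *m g w = (y w - A w *m g w) + h *: delta_mx i 0).
    by rewrite sqnorm2D_delta -/(rho w); ring.
  by rewrite addrAC.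
(* Joint midpoint convexity: the value at [y + h] is bounded below by reflection through the minimum
   at [y], using the exact value at [y - h] for [g w]. *)
have lower w h b : m0 w + 2 * h * rho w / n%:R - h ^+ 2 / n%:R <=
    lasso_obj (A w) (y w + h *: delta_mx i 0) lam b.
  have := lasso_obj_convex (A w) (y w + h *: delta_mx i 0) (y w + (- h) *: delta_mx i 0) b (g w) lam0.
  rewrite (_ : 2^-1 *: _ = y w); last first.
    by apply/matrixP => a c; rewrite !mxE; field.
  rewrite shift sqrrN; have := hg w (2^-1 *: (b + g w)); rewrite -/(m0 w).
  move=> h1 h2; have := le_trans h1 h2.
  rewrite mulrN !mulNr; lra.
have mlow w h : m0 w + 2 * h * rho w / n%:R - h ^+ 2 / n%:R <= m h w.
  apply: lb_le_inf; first by exists (obj h 0%N w); exists 0%N.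
  by move=> _ [k _ <-]; exact: lower.
have mup w h : m h w <= m0 w + 2 * h * rho w / n%:R + h ^+ 2 / n%:R.
  rewrite -shift; apply/ler_addgt0Pr => e e0.
  have [k hk] := ratv_dense (g w) (@lasso_obj_continuous n q (A w) (y w + h *: delta_mx i 0) lam) e0.
  apply: le_trans (ltW hk); apply: ge_inf; first by exists 0 => _ [k' _ <-].
  by exists k.
pose hk (k : nat) : R := k.+1%:R^-1.
have hk0 k : 0 < hk k by rewrite invr_gt0 ltr0n.
apply: (@measurable_fun_cvg _ _ _ _ (fun k w => n%:R * (m (hk k) w - m 0 w) / (2 * hk k))).
  move=> k; apply: measurable_funM => //; apply: measurable_funM => //.
  exact: measurable_funB.
move=> w _; rewrite -/(rho w).
have bnd k : `|n%:R * (m (hk k) w - m 0 w) / (2 * hk k) - rho w| <= hk k.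
  have k0 := hk0 k.
  have := mlow w (hk k); have := mup w (hk k); have := mlow w 0; have := mup w 0.
  rewrite mulr0 !mul0r expr0n/= mul0r !addr0 subr0 => h1 h2 h3 h4.
  have -> : n%:R * (m (hk k) w - m 0 w) / (2 * hk k) - rho w =
     (n%:R * (m (hk k) w - m 0 w) - 2 * hk k * rho w) / (2 * hk k).
    by field; rewrite gt_eqF.
  rewrite normrM normfV (gtr0_norm (mulr_gt0 (ltr0Sn R 1) k0)) ler_pdivrMr ?mulr_gt0//.
  have e1 : m 0 w = m0 w by lra.
  have h3' := ler_wpM2l (ltW nR) h3; have h4' := ler_wpM2l (ltW nR) h4.
  have c1 : n%:R * (m0 w + 2 * hk k * rho w / n%:R + hk k ^+ 2 / n%:R) = n%:R * m0 w + 2 * hk k * rho w + hk k ^+ 2.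
    by field; rewrite gt_eqF.
  have c2 : n%:R * (m0 w + 2 * hk k * rho w / n%:R - hk k ^+ 2 / n%:R) = n%:R * m0 w + 2 * hk k * rho w - hk k ^+ 2.
    by field; rewrite gt_eqF.
  rewrite c1 in h3'; rewrite c2 in h4'; rewrite e1 ler_norml; apply/andP.
  have : 0 <= hk k ^+ 2 by exact: sqr_ge0.
  by split; rewrite expr2 in h3' h4' *; lra.
apply/cvgrPdist_le => e e0; near=> k.
rewrite distrC (le_trans (bnd k))//.
by apply: ltW; near: k; exact: (near_infty_natSinv_lt (PosNum e0)).
Unshelve. all: by end_near.
Qed.

(** Measurability of [gh] on [T] would not do: among several minimisers its choice could involve the
    noise. The residual is a function of [X] alone and may be frozen. *)
Lemma resid_smeas d (T : measurableType d) n p (X : T -> 'M[R]_(n, p)) (lam : R)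
    (gh : T -> 'I_p -> 'cV[R]_(p.-1)) j i : (0 < n)%N -> 0 <= lam ->
  (forall w, is_nodewise_lasso (X w) (fun=> lam) (gh w)) ->
  smeas (gen_mx X) (fun w => resid (X w) (gh w) j i 0).
Proof.
move=> n0 lam0 hg; apply/smeasP.
have mX a b : mfunT (fun w : g_sigma_algebraType (gen_mx X) => X w a b).
  by apply/smeasP; exact: smeas_entry.
apply: (@lasso_resid_measurable _ (g_sigma_algebraType (gen_mx X)) n p.-1
  (fun w => col' j (X w)) (fun w => col j (X w)) lam (fun w => gh w j)) => //.
- by move=> a b; under eq_fun do rewrite mxE; exact: mX.
- by move=> a; under eq_fun do rewrite mxE; exact: mX.
- by move=> w; exact: hg.
Qed.

End LassoMeasurability.

(** * Counting exceedances under a small perturbation *)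

Section Counting.
Context {R : realType} {p : nat}.
Implicit Types (z w : 'I_p -> R) (rel J : {set 'I_p}).

Lemma exceed_upper_pointwise (r i : bool) (x y t D : R) : 0 <= D ->
  (~~ i -> ~~ r -> x <= y + D) ->
  (t < x)%R%:R <= r%:R + i%:R + (t < y)%R%:R + (t - D < y <= t + D)%R%:R :> R.
Proof.
move=> D0; case: (ltP t x) => tx; last by rewrite !addr_ge0.
case: r; first by rewrite -!addrA lerDl !addr_ge0.
case: i; first by rewrite add0r -!addrA lerDl !addr_ge0.
case: (ltP t y) => ty; first by rewrite !add0r lerDl.
move=> /(_ isT isT) h; rewrite (_ : (t - D < y <= t + D)) ?addr0 ?add0r//.
by apply/andP; split; lra.
Qed.

(** The factor 2 is for a relevant index with [a < y]: it may lose its own unit and also the unit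
    counted by [t < y]. A relevant index with [y <= a <= t] contributes no such unit and is a gain
    of 1. *)
Lemma exceed_lower_pointwise (r i : bool) (x y t D a : R) : 0 <= D -> a <= t ->
  (~~ i -> ~~ r -> y <= x + D) -> (~~ i -> r -> y <= a -> t < x) ->
  r%:R - i%:R - 2 * (if r then (a < y)%R%:R else 0) + (t < y)%R%:R
    - (t - D < y <= t + D)%R%:R <= (t < x)%R%:R :> R.
Proof.
move=> D0 lat; case: (ltP t x) => tx; case: (ltP t y) => ty; case: (ltP a y) => ay;
  case: (boolP (t - D < y <= t + D)) => hs; case: i; case: r => /= g1 g2; try lra.
all: try by (have := g2 isT isT ay; lra).
all: move: hs; rewrite negb_and -!leNgt => /orP[|] hs; have := g1 isT isT; lra.
Qed.

Lemma exceed_propE z t : exceed_prop z t = (\sum_j (t < `|z j|)%R%:R) / p%:R.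
Proof.
rewrite /exceed_prop -sum1_card natr_sum big_mkcond/=; congr (_ / _); apply: eq_bigr => j _.
have -> : (j \in [set j | t < `|z j|]) = (t < `|z j|) by apply/idP/idP; rewrite inE.
by case: ifP.
Qed.

Definition shell w t D : R := (\sum_j (t - D < `|w j| <= t + D)%R%:R) / p%:R.

Lemma exceed_upper z w rel J t D : (0 < p)%N -> 0 <= D ->
  (forall j, j \notin J -> j \notin rel -> `|z j| <= `|w j| + D) ->
  exceed_prop z t <= #|rel|%:R / p%:R + #|J|%:R / p%:R + exceed_prop w t + shell w t D.
Proof.
move=> p0 D0 h; rewrite !exceed_propE /shell -!mulrDl ler_pM2r ?invr_gt0 ?ltr0n//.
have card (A : {set 'I_p}) : #|A|%:R = \sum_j (j \in A)%:R :> R.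
  by rewrite -sum1_card natr_sum big_mkcond; apply: eq_bigr => j _; case: ifP.
rewrite !card -!big_split/=; apply: ler_sum => j _.
by apply: exceed_upper_pointwise => //; exact: h.
Qed.

Lemma exceed_lower z w rel J t D a : (0 < p)%N -> 0 <= D -> a <= t ->
  (forall j, j \notin J -> j \notin rel -> `|w j| <= `|z j| + D) ->
  (forall j, j \notin J -> j \in rel -> `|w j| <= a -> t < `|z j|) ->
  #|rel|%:R / p%:R - #|J|%:R / p%:R - 2 * ((\sum_(j in rel) (a < `|w j|)%R%:R) / p%:R) +
    exceed_prop w t - shell w t D <= exceed_prop z t.
Proof.
move=> p0 D0 lat h1 h2.
have card (A : {set 'I_p}) : #|A|%:R = \sum_j (j \in A)%:R :> R.
  by rewrite -sum1_card natr_sum big_mkcond; apply: eq_bigr => j _; case: ifP.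
rewrite !exceed_propE /shell mulrA -!mulNr -!mulrDl ler_pM2r ?invr_gt0 ?ltr0n//.
rewrite !card [\sum_(j in rel) _]big_mkcond/= mulr_sumr -!sumrN -!big_split/=; apply: ler_sum => j _.
rewrite mulNr; apply: exceed_lower_pointwise => //; [exact: h1|exact: h2].
Qed.

End Counting.

Section FiniteSup.
Context {R : realType}.
Implicit Types (D : set nat) (f : nat -> R).

Lemma has_sup_bounded D f N : D !=set0 -> (forall t, D t -> (t < N)%N) ->
  has_sup [set f t | t in D].
Proof.
move=> [t0 Dt0] DN; split; first by exists (f t0); exists t0.
exists (\sum_(t < N) `|f t|) => _ [t Dt <-].
rewrite (bigD1 (Ordinal (DN t Dt)))//= (le_trans (ler_norm _))// lerDl.
by apply: sumr_ge0 => i _.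
Qed.

Lemma sup_ge D f N t : (forall t, D t -> (t < N)%N) -> D t -> f t <= sup [set f t | t in D].
Proof.
move=> DN Dt; have [_ h] := has_sup_bounded f (ex_intro _ t Dt) DN.
by apply: (ub_le_sup h); exists t.
Qed.

Lemma sup_le D f c : D !=set0 -> (forall t, D t -> f t <= c) -> sup [set f t | t in D] <= c.
Proof.
move=> [t0 Dt0] h; apply: ge_sup; first by exists (f t0); exists t0.
by move=> _ [t Dt <-]; exact: h.
Qed.

Lemma measurable_sup d (T : measurableType d) D N (f : nat -> T -> R) :
  (forall t, D t -> (t < N)%N) -> (forall t, mfunT (f t)) ->
  mfunT (fun w => sup [set f t w | t in D]).
Proof.
move=> DN mf; have [->|/set0P D0] := eqVneq D set0.
  under eq_fun do rewrite image_set0; exact: measurable_cst.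
apply: (measurability _ (RGenOInfty.measurableE R)) => //.
move=> _ [_ [x ->] <-]; rewrite setTI.
have -> : (fun w => sup [set f t w | t in D]) @^-1` `]x, +oo[%classic =
    \bigcup_(t in D) [set w | x < f t w].
  apply/seteqP; split => w /=; rewrite in_itv/= andbT.
    move=> h; apply: contrapT => hn; move: h; apply/negP; rewrite -leNgt; apply: sup_le => // t Dt.
    by rewrite leNgt; apply/negP => h; apply: hn; exists t.
  by move=> [t Dt /= h]; apply: (lt_le_trans h); exact: (@sup_ge D (f ^~ w) N).
by apply: bigcup_measurable => t _; apply: measurable_setlt.
Qed.

End FiniteSup.

Section Quantile.
Context {R : realType} {d} {T : measurableType d}.
Variable P : probability T R.

Lemma Pr_dct (A_ : nat -> set T) (A : set T) : (forall n, measurable (A_ n)) -> measurable A ->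
  (forall w, \forall n \near \oo, A_ n w <-> A w) -> Pr P (A_ n) @[n --> \oo] --> Pr P A.
Proof.
move=> mA_ mA h; rewrite /Pr -Ex_indic//.
under eq_fun do rewrite -Ex_indic//.
apply: (Ex_dct (M := 1)) => [n|n w|w|].
- by have [] := bmf_indic (R := R) (mA_ n).
- by rewrite indicE; case: (_ \in _); rewrite ?normr1 ?normr0.
- apply: cvg_near_cst; near=> n; rewrite !indicE; congr (_%:R); congr nat_of_bool.
  by apply/idP/idP; rewrite !inE => ?; apply/(near (h w) n).
by have [] := bmf_indic (R := R) mA.
Unshelve. all: by end_near.
Qed.

Lemma quantile_has_lbound (V : T -> R) (a : R) : mfunT V -> a < 1 ->
  has_lbound [set x | ((1 - a)%:E <= P [set w | (V w <= x)%R])%E].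
Proof.
move=> mV a1; have mle x : measurable [set w | V w <= x] by apply: measurable_setle.
have memE x : ((1 - a)%:E <= P [set w | (V w <= x)%R])%E -> 1 - a <= Pr P [set w | V w <= x].
  by rewrite PrE// lee_fin.
have h : Pr P [set w | V w <= - n%:R] @[n --> \oo] --> Pr P set0.
  apply: Pr_dct => // w; near=> n; split => //=; apply/negP; rewrite -ltNge.
  rewrite ltrNl; near: n; exact: nbhs_infty_gtr.
have a1' : Pr P set0 < 1 - a by rewrite Pr_set0; lra.
have [n _ hn] := @cvgr_lt _ _ _ _ _ _ h _ a1'.
exists (- n%:R) => x hx; rewrite leNgt; apply/negP => xn.
have := hn n (leqnn n); rewrite /= ltNge => /negP; apply; apply: (le_trans (memE _ hx)); apply: Pr_le => //.
by move=> w /= Vx; apply: (le_trans Vx); exact: ltW.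
Unshelve. all: by end_near.
Qed.

(** The infimum defining the quantile is attained: the distribution function is right continuous,
    here by dominated convergence along [inf E + 1 / (n + 1)]. *)
Lemma quantile_tail (V : T -> R) (a : R) : mfunT V -> 0 < a -> a < 1 ->
  Pr P [set w | quantile P V (1 - a) < V w] <= a.
Proof.
move=> mV a0 a1.
have mle x : measurable [set w | V w <= x] by apply: measurable_setle.
have memE x : ((1 - a)%:E <= P [set w | (V w <= x)%R])%E = (1 - a <= Pr P [set w | V w <= x]).
  by rewrite PrE// lee_fin.
set E := [set x | ((1 - a)%:E <= P [set w | (V w <= x)%R])%E].
have EE x : E x <-> 1 - a <= Pr P [set w | V w <= x] by rewrite /E/= memE.
have E0 : E !=set0.
  have h : Pr P [set w | V w <= n%:R] @[n --> \oo] --> Pr P setT.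
    apply: Pr_dct => // w; near=> n; split => // _ /=.
    by near: n; exact: nbhs_infty_ger.
  have a1' : 1 - a < Pr P setT by rewrite Pr_setT; lra.
  have := @cvgr_ge _ _ _ _ _ _ h _ a1'.
  move=> [n _ hn]; exists n%:R; apply/EE; exact: (hn n (leqnn n)).
have Elb : has_lbound E := quantile_has_lbound mV a1.
have hl : Pr P [set w | V w <= inf E + n.+1%:R^-1] @[n --> \oo] --> Pr P [set w | V w <= inf E].
  apply: Pr_dct => // w; have [Vw|Vw] := leP (V w) (inf E).
    by near=> n; split => // _ /=; apply: (le_trans Vw); rewrite lerDl invr_ge0.
  near=> n; split => /=; last by rewrite leNgt Vw.
  move=> h; exfalso; have : n.+1%:R^-1 < V w - inf E.
    near: n; have e0 : 0 < V w - inf E by rewrite subr_gt0.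
    exact: (near_infty_natSinv_lt (PosNum e0)).
  by rewrite ltrBrDl => h2; move: (lt_le_trans h2 h); rewrite ltxx.
have : 1 - a <= Pr P [set w | V w <= inf E].
  rewrite -(cvg_lim _ hl)//; apply: limr_ge; first by apply/cvg_ex; exists (Pr P [set w | V w <= inf E]).
  apply: nearW => n; have n0 : 0 < n.+1%:R^-1 :> R by rewrite invr_gt0.
  have [x /EE Ex hx] := inf_adherent n0 (conj E0 Elb).
  apply: (le_trans Ex); apply: Pr_le => // w /= Vx; apply: (le_trans Vx); exact: ltW.
have -> : [set w | inf E < V w] = ~` [set w | V w <= inf E].
  by apply/seteqP; split => w /=; [rewrite ltNge => /negP|move=> /negP; rewrite -ltNge].
rewrite Pr_setC//; lra.
Unshelve. all: by end_near.
Qed.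

(* A gap in the range of [V] below [0] keeps its quantiles away from [0]. *)
Lemma quantile_neq0_gap (V : T -> R) (a e : R) : mfunT V -> 0 < a -> a < 1 -> 0 < e ->
  (forall w, V w <= 0 -> V w <= - e) -> quantile P V (1 - a) != 0.
Proof.
move=> mV a0 a1 e0 h; have mle x : measurable [set w | V w <= x] by apply: measurable_setle.
apply/eqP => Q0; have := quantile_tail mV a0 a1; rewrite Q0.
have -> : [set w | 0 < V w] = ~` [set w | V w <= - e].
  apply/seteqP; split => w /=; first by move=> V0; apply/negP; rewrite -ltNge (lt_trans _ V0)// oppr_lt0.
  by move=> /negP; rewrite -ltNge => hw; rewrite ltNge; apply/negP => /h; rewrite leNgt hw.
rewrite Pr_setC// => hP.
have := ge_inf (quantile_has_lbound mV a1) (_ : [set x | ((1 - a)%:E <= P [set w | (V w <= x)%R])%E] (- e)).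
rewrite -/(quantile P V (1 - a)) Q0 => hi; have : 0 <= - e by apply: hi; rewrite /= PrE// lee_fin; lra.
by rewrite oppr_ge0 leNgt e0.
Qed.

End Quantile.

Lemma measurable_invr {R : realType} : mfunT (@GRing.inv R).
Proof.
have -> : @GRing.inv R = (fun x => x * (x ^+ 2) `^ (-1)).
  apply/funext => x; rewrite powR_inv1 ?sqr_ge0//; have [->|x0] := eqVneq x 0.
    by rewrite invr0 mul0r.
  by rewrite expr2 invfM mulVKf.
apply: measurable_funM => //.
apply: (measurableT_comp (f := @powR R ^~ (-1)) (g := fun x : R => x ^+ 2)).
  exact: measurable_powR.
exact: exprn_measurable.
Qed.

Lemma measurable_sqrtr {R : realType} : mfunT (@sqrt R).
Proof. by apply: continuous_measurable_fun; exact: sqrt_continuous. Qed.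

(** * Shells, relevant tails and variance given the design *)

Section ConditionalEvents.
Context {R : realType} {d} {T : measurableType d}.
Variable P : probability T R.
Variables (n p : nat) (X : T -> 'M[R]_(n, p)) (eps : T -> 'cV[R]_n) (sigma : R).
Variable rho : T -> 'I_p -> 'cV[R]_n.
Hypotheses (mX : random_mx X) (meps : random_mx eps) (geps : gaussian_noise_given P X eps (sigma ^+ 2))
  (sigma0 : 0 < sigma) (mrho : forall j i, smeas (gen_mx X) (fun w => rho w j i 0)) (p0 : (0 < p)%N).

Let G1 := gen_mx X.
Let G2 := gen_mx eps.
Let G1m : <<s G1 >> `<=` measurable := random_mxP mX.
Let G2m : <<s G2 >> `<=` measurable := random_mxP meps.
Let ind A B : <<s G1 >> A -> <<s G2 >> B -> P (A `&` B) = (P A * P B)%E.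
Proof. by move: geps => [h _]; exact: h. Qed.

Let Y (j : 'I_p) (a b : T) : R :=
  lin1 (rho a j) eps b / (sigma * sqrt (sqnorm2 (rho a j))).

Definition std_resid (w : T) (j : 'I_p) : R := Y j w w.

Let jsq j : jmeas G1 G2 (fun a _ => sqnorm2 (rho a j)).
Proof. by apply: jmeas_sum => i; apply: (jmeas_comp (h := fun x => x ^+ 2)); [exact: exprn_measurable|exact: jmeas1]. Qed.

Let jY j : jmeas G1 G2 (Y j).
Proof.
have -> : Y j = (fun a b => (\sum_i rho a j i 0 * eps b i 0) * (sigma * sqrt (sqnorm2 (rho a j)))^-1).
  by apply/funext => a; apply/funext => b; rewrite /Y lin1E.
apply: jmeasM.
  apply: jmeas_sum => i; apply: jmeasM; first exact: jmeas1.
  by apply: jmeas2; exact: smeas_entry.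
apply: (jmeas_comp (h := GRing.inv)); first exact: measurable_invr.
apply: jmeasM; first exact: jmeas_cst.
by apply: (jmeas_comp (h := sqrt)); [exact: measurable_sqrtr|exact: jsq].
Qed.


(** A vanishing residual gives the value 0, by the convention for division by 0, and then neither
    exceeds a threshold nor falls in a shell; the conditional bounds hold without excluding it. *)
Let lin0 j a b : sqnorm2 (rho a j) <= 0 -> Y j a b = 0.
Proof.
move=> h; rewrite /Y (_ : sqnorm2 (rho a j) = 0) ?sqrtr0 ?mulr0 ?invr0 ?mulr0//.
by apply/eqP; rewrite eq_le h sqnorm2_ge0.
Qed.

Let mYb j a : mfunT (Y j a).
Proof. by apply: measurable_funM => //; exact: measurable_lin1. Qed.

Let shell_cond j a (t D : R) : 0 <= D -> D <= t ->
  Ex P (fun b => (t - D < `|Y j a b| <= t + D)%R%:R) <= 2 * D * expR (- (t - D) ^+ 2 / 2).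
Proof.
move=> D0 Dt; have rhs0 : 0 <= 2 * D * expR (- (t - D) ^+ 2 / 2).
  by rewrite mulr_ge0 ?expR_ge0// mulr_ge0.
have tD : 0 <= t - D by rewrite subr_ge0.
have [h|h] := leP (sqnorm2 (rho a j)) 0.
  rewrite (Ex_ext P (g := fun=> 0)) ?Ex_cst// => b.
  by rewrite lin0// normr0 ltNge tD.
have tail (x : R) : 0 <= x -> Pr P [set b | x < `|Y j a b|] = 2 * Phibar x.
  by move=> x0; rewrite (noise_tail geps.2 sigma0 h x0).
have mt (x : R) : measurable [set b | x < `|Y j a b|].
  by apply: measurable_setlt => //; apply: measurableT_comp => //; exact: mYb.
rewrite (Ex_ext P (g := fun b => \1_[set b | t - D < `|Y j a b|] b - \1_[set b | t + D < `|Y j a b|] b)); last first.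
  move=> b; rewrite !indicE.
  have e x : (b \in [set b | x < `|Y j a b|]) = (x < `|Y j a b|) by apply/idP/idP; rewrite inE.
  rewrite !e leNgt; case: (ltP (t + D) `|Y j a b|) => h1; case: (ltP (t - D) `|Y j a b|) => h2 /=; try lra.
rewrite ExB ?Ex_indic//; try exact: bmf_indic.
rewrite -!/(Pr P _) !tail//; last by lra.
have := @nu_shell R (t - D) (t + D) tD; rewrite (_ : t + D - (t - D) = 2 * D); last by ring.
by apply; lra.
Qed.

Let b01 (b : bool) : 0 <= (b%:R : R) <= 1.
Proof. by case: b; rewrite ?lexx ler01. Qed.

(** Markov's inequality for the sum of the proportions over the whole grid, so that one event serves
    all [t]; beyond [x] the conditional mass bound of a shell is at most the one at [x]. *)
Lemma shells_event (N : nat) (x D y : R) : 0 <= D -> D <= x -> 0 < y ->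
  exists B : set T, [/\ measurable B,
    Pr P B <= N%:R * (2 * D * expR (- (x - D) ^+ 2 / 2)) / y &
    forall w, ~ B w -> forall t : nat, x <= t%:R -> (t < N)%N -> shell (std_resid w) t%:R D <= y].
Proof.
move=> D0 Dx y0; set e := 2 * D * _.
pose F (t : nat) j a b : R := (x <= t%:R)%R%:R * (t%:R - D < `|Y j a b| <= t%:R + D)%R%:R.
pose f w := \sum_(t < N) (\sum_j F t j w w) / p%:R.
have jF t j : jmeas G1 G2 (F t j).
  have jN : jmeas G1 G2 (fun a b => `|Y j a b|) by apply: (jmeas_comp (h := Num.norm)).
  have -> : F t j = (fun a b => (x <= t%:R)%R%:R * (((t%:R - D) < `|Y j a b|)%R%:R * (1 - (t%:R + D < `|Y j a b|)%R%:R))).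
    by apply/funext => a; apply/funext => b; rewrite /F [X in _ && X]leNgt;
       case: (x <= _); case: (_ < _); case: (_ < _) => /=; lra.
  apply: jmeasM; first exact: jmeas_cst.
  apply: jmeasM; first by apply: jmeas_lt => //; exact: jmeas_cst.
  apply: (jmeas_comp (h := fun z => 1 - z)); first exact: measurable_funB.
  by apply: jmeas_lt => //; exact: jmeas_cst.
have F01 t j a b : 0 <= F t j a b <= 1.
  by rewrite /F; case: (x <= _); case: (_ < `|_| <= _) => /=; lra.
have e0 : 0 <= e by rewrite /e mulr_ge0 ?expR_ge0// mulr_ge0.
have hF t j : bmf (fun w => F t j w w) /\ Ex P (fun w => F t j w w) <= e.
  have [bF _ bd _] := decouple_Ex G1m G2m ind (jF t j) (F01 t j); split => //.
  apply: (decouple_le G1m G2m ind (jF t j) (F01 t j)) => a.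
  rewrite /F; case: (boolP (x <= t%:R)) => xt; last first.
    by rewrite (Ex_ext P (g := fun=> 0)) ?Ex_cst// => b; rewrite mul0r.
  rewrite (Ex_ext P (g := fun b => (t%:R - D < `|Y j a b| <= t%:R + D)%R%:R)); last by move=> b; rewrite mul1r.
  apply: (le_trans (shell_cond j a D0 (le_trans Dx xt))).
  rewrite /e ler_wpM2l ?mulr_ge0// ler_expR ler_pM2r ?invr_gt0// lerN2.
  by rewrite ler_sqr ?nnegrE; lra.
have bf : bmf f.
  apply: bmf_sum => t; under eq_fun do rewrite mulrC; apply: bmfZ; apply: bmf_sum => j.
  by have [] := hF t j.
have f0 w : 0 <= f w.
  apply: sumr_ge0 => t _; rewrite divr_ge0//; apply: sumr_ge0 => j _.
  by have /andP[] := F01 t j w w.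
exists [set w | y <= f w]; split.
- by apply: measurable_setle => //; case: bf.
- apply: (le_trans (Pr_markov P bf f0 y0)); rewrite ler_pM2r ?invr_gt0//.
  rewrite /f Ex_sum; last first.
    move=> t; under eq_fun do rewrite mulrC; apply: bmfZ; apply: bmf_sum => j.
    by have [] := hF t j.
  rewrite (_ : N%:R * e = \sum_(t < N) e); last by rewrite sumr_const card_ord mulr_natl.
  apply: ler_sum => t _.
  rewrite (Ex_ext P (g := fun w => p%:R^-1 * \sum_j F t j w w)); last by move=> w; rewrite mulrC.
  rewrite ExZ; last by apply: bmf_sum => j; have [] := hF t j.
  rewrite Ex_sum; last by move=> j; have [] := hF t j.
  rewrite mulrC ler_pdivrMr ?ltr0n//.
  rewrite (_ : e * p%:R = \sum_(j < p) e); last by rewrite sumr_const card_ord mulr_natr.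
  by apply: ler_sum => j _; have [] := hF t j.
move=> w /= /negP; rewrite -ltNge => fy t xt tN; apply/ltW; apply: le_lt_trans fy.
rewrite /f (bigD1 (Ordinal tN))//= (_ : shell _ _ _ = (\sum_j F t j w w) / p%:R); last first.
  by rewrite /shell; congr (_ / _); apply: eq_bigr => j _; rewrite /F xt mul1r.
rewrite lerDl; apply: sumr_ge0 => t' _; rewrite divr_ge0//; apply: sumr_ge0 => j _.
by have /andP[] := F01 t' j w w.
Qed.

Lemma tails_event (A : {set 'I_p}) (x y : R) : 0 <= x -> 0 < y ->
  exists B : set T, [/\ measurable B, Pr P B <= #|A|%:R * (2 * Phibar x) / y &
    forall w, ~ B w -> \sum_(j in A) (x < `|std_resid w j|)%R%:R <= y].
Proof.
move=> x0 y0.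
pose F j a b : R := (x < `|Y j a b|)%R%:R.
have jF j : jmeas G1 G2 (F j).
  apply: jmeas_lt; first exact: jmeas_cst.
  by apply: (jmeas_comp (h := Num.norm)).
have F01 j a b : 0 <= F j a b <= 1 by exact: b01.
have hF j : bmf (fun w => F j w w) /\ Ex P (fun w => F j w w) <= 2 * Phibar x.
  have [bF _ bd _] := decouple_Ex G1m G2m ind (jF j) (F01 j); split => //.
  apply: (decouple_le G1m G2m ind (jF j) (F01 j)) => a; rewrite /F.
  have [h|h] := leP (sqnorm2 (rho a j)) 0.
    rewrite (Ex_ext P (g := fun=> 0)) ?Ex_cst ?mulr_ge0 ?Phibar_ge0// => b.
    by rewrite lin0// normr0 ltNge x0.
  have mt : measurable [set b | x < `|Y j a b|].
    by apply: measurable_setlt => //; apply: measurableT_comp => //; exact: mYb.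
  rewrite (Ex_ext P (g := \1_[set b | x < `|Y j a b|])); last first.
    by move=> b; rewrite indicE; congr (_%:R); congr nat_of_bool; apply/idP/idP; rewrite inE.
  by rewrite Ex_indic// -/(Pr P _) (noise_tail geps.2 sigma0 h x0).
pose f w := \sum_j (j \in A)%:R * F j w w.
have bf : bmf f by apply: bmf_sum => j; apply: bmfZ; have [] := hF j.
have f0 w : 0 <= f w by apply: sumr_ge0 => j _; rewrite mulr_ge0//; have /andP[] := F01 j w w.
exists [set w | y <= f w]; split.
- by apply: measurable_setle => //; case: bf.
- apply: (le_trans (Pr_markov P bf f0 y0)); rewrite ler_pM2r ?invr_gt0//.
  rewrite /f Ex_sum; last by move=> j; apply: bmfZ; have [] := hF j.
  rewrite -sum1_card natr_sum mulr_suml [X in _ <= X]big_mkcond; apply: ler_sum => j _.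
  rewrite ExZ; last by have [] := hF j.
  by case: (j \in A); rewrite ?mul0r// !mul1r; have [] := hF j.
move=> w /= /negP; rewrite -ltNge => /ltW; apply: le_trans.
rewrite /f big_mkcond; apply: ler_sum => j _.
by case: (j \in A); rewrite ?mul0r// mul1r.
Qed.

Lemma variance_event (t C y : R) : 0 < t -> 0 <= C -> 0 < y ->
  exists B : set T, [/\ measurable B, Pr P B <= 2 * Phibar t * C / y ^+ 2 &
    forall w, ~ B w -> (forall j, 0 < sqnorm2 (rho w j)) ->
      (\sum_i \sum_j (bform 1%:M (rho w i) (rho w j)) ^+ 2 / (sqnorm2 (rho w i) * sqnorm2 (rho w j)))
         / p%:R ^+ 2 <= C ->
      `|exceed_prop (std_resid w) t - 2 * Phibar t| <= y].
Proof.
move=> t0 C0 y0.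
pose S a := (\sum_i \sum_j (bform 1%:M (rho a i) (rho a j)) ^+ 2 / (sqnorm2 (rho a i) * sqnorm2 (rho a j))) / p%:R ^+ 2.
(* [h] vanishes unless the Gram sum is at most [C] and no residual vanishes, so that the conditional
   second moment is bounded for every [a]. *)
pose h a : R := (1 - (C < S a)%R%:R) * \prod_j (0 < sqnorm2 (rho a j))%R%:R.
pose G a b : R := (\sum_j (t < `|Y j a b|)%R%:R) / p%:R.
pose F a b := h a * (G a b - 2 * Phibar t) ^+ 2.
have jS : jmeas G1 G2 (fun a _ => S a).
  have -> : (fun a _ : T => S a) = (fun a _ => (\sum_i \sum_j (\sum_k rho a i k 0 * rho a j k 0) ^+ 2 * (sqnorm2 (rho a i) * sqnorm2 (rho a j))^-1) * (p%:R ^+ 2)^-1).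
    apply/funext => a; apply/funext => b; rewrite /S; congr (_ / _).
    by apply: eq_bigr => i _; apply: eq_bigr => j _; rewrite bform1E.
  apply: jmeasM; last exact: jmeas_cst.
  apply: jmeas_sum => i; apply: jmeas_sum => j; apply: jmeasM.
    apply: (jmeas_comp (h := fun z => z ^+ 2)); first exact: exprn_measurable.
    by apply: jmeas_sum => k; apply: jmeasM; exact: jmeas1.
  apply: (jmeas_comp (h := GRing.inv)); first exact: measurable_invr.
  by apply: jmeasM; exact: jsq.
have jprod (s : seq 'I_p) : jmeas G1 G2 (fun a _ => \prod_(j <- s) ((0 < sqnorm2 (rho a j))%R%:R : R)).
  elim: s => [|j s IH].
    rewrite (_ : (fun _ _ => _) = (fun _ _ => 1)); first exact: jmeas_cst.
    by apply/funext => a; apply/funext => b; rewrite big_nil.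
  rewrite (_ : (fun _ _ => _) = (fun a b => (0 < sqnorm2 (rho a j))%R%:R * \prod_(j <- s) (0 < sqnorm2 (rho a j))%R%:R)).
    by apply: (jmeasM _ IH); apply: (jmeas_lt _ (jsq j)); exact: jmeas_cst.
  by apply/funext => a; apply/funext => b; rewrite big_cons.
have jG : jmeas G1 G2 G.
  apply: jmeasM; last exact: jmeas_cst.
  apply: jmeas_sum => j; apply: jmeas_lt; first exact: jmeas_cst.
  by apply: (jmeas_comp (h := Num.norm)).
have jF : jmeas G1 G2 F.
  apply: jmeasM.
    apply: jmeasM; last exact: jprod.
    apply: (jmeas_comp (h := fun z => 1 - z)); first exact: measurable_funB.
    by apply: jmeas_lt => //; exact: jmeas_cst.
  apply: (jmeas_comp (h := fun z => (z - 2 * Phibar t) ^+ 2)) => //.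
  by apply: measurable_funX; apply: measurable_funB.
have q0 : 0 <= 2 * Phibar t by rewrite mulr_ge0 ?Phibar_ge0.
have G01 a b : 0 <= G a b <= 1.
  rewrite /G; apply/andP; split.
    by rewrite divr_ge0//; apply: sumr_ge0 => j _; have /andP[] := b01 (t < `|Y j a b|).
  rewrite ler_pdivrMr ?ltr0n// mul1r.
  rewrite (_ : p%:R = \sum_(j < p) 1); last by rewrite sumr_const card_ord.
  by apply: ler_sum => j _; have /andP[] := b01 (t < `|Y j a b|).
have h01 a : 0 <= h a <= 1.
  have : 0 <= \prod_j ((0 < sqnorm2 (rho a j))%R%:R : R) <= 1.
    by elim: (index_enum _) => [|j s IH]; rewrite ?big_nil ?big_cons; [lra|case: (0 < _) => /=; lra].
  by rewrite /h; case: (C < S a); rewrite /= ?subrr ?mul0r ?subr0 ?mul1r// lexx ler01.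
have F01 a b : 0 <= F a b <= (1 + 2 * Phibar t) ^+ 2.
  have /andP[h0 h1] := h01 a; have /andP[g0 g1] := G01 a b.
  rewrite /F mulr_ge0 ?sqr_ge0//= (le_trans (ler_piMl (sqr_ge0 _) h1))//.
  rewrite -[X in X <= _]real_normK ?num_real// ler_sqr ?nnegrE ?normr_ge0//; last by lra.
  by rewrite ler_norml; lra.
have [_ _ bd _] := decouple_Ex G1m G2m ind jF F01.
have hF : Ex P (fun w => F w w) <= 2 * Phibar t * C.
  apply: (decouple_le G1m G2m ind jF F01) => a.
  have z : h a = 0 -> Ex P (F a) <= 2 * Phibar t * C.
    by move=> h0; rewrite (Ex_ext P (g := fun=> 0)) ?Ex_cst ?(mulr_ge0 q0 C0)// => b; rewrite /F h0 mul0r.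
  have [pos|npos] := boolP [forall j, 0 < sqnorm2 (rho a j)]; last first.
    apply: z; move: npos; rewrite negb_forall => /existsP[j hj].
    by rewrite /h (bigD1 j)//= (negbTE hj) mul0r mulr0.
  have [SC|SC] := leP (S a) C; last by apply: z; rewrite /h SC subrr mul0r.
  have a0 j : 0 < sqnorm2 (rho a j) by exact: (forallP pos).
  have [b1 b2] := exceed_variance meps geps.2 sigma0 t0 a0 p0.
  apply: (@le_trans _ _ (Ex P (fun w => (G a w - 2 * Phibar t) ^+ 2))).
    apply: Ex_le => //; first by have [bF _ _ _] := decouple_Ex G1m G2m ind jF F01.
    by move=> b; apply: ler_piMl; [exact: sqr_ge0|have /andP[] := h01 a].
  apply: (le_trans b2); rewrite -mulrA; apply: ler_wpM2l => //.
have f0 w : 0 <= F w w by have /andP[] := F01 w w.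
exists [set w | y ^+ 2 <= F w w]; split.
- by apply: measurable_setle => //; case: bd.
- by apply: (le_trans (Pr_markov P bd f0 (exprn_gt0 2 y0))); rewrite ler_pM2r ?invr_gt0 ?exprn_gt0.
move=> w /= /negP; rewrite -ltNge => Fy pos SC.
have h1 : h w = 1.
  rewrite /h big1 => [|j _]; last by rewrite pos.
  by rewrite -/(S w) in SC; rewrite ltNge SC subr0 mulr1.
move: Fy; rewrite /F h1 mul1r => Fy; apply: ltW.
rewrite exceed_propE -[X in `|X|]/(G w w - 2 * Phibar t) -(ltr_pXn2r (n := 2))// ?nnegrE ?normr_ge0 ?ltW//.
by rewrite real_normK ?num_real.
Qed.

End ConditionalEvents.

(** * The diagonal case *)

Section SecondMoment.
Context {R : realType} {d} {T : measurableType d}.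
Variable P : probability T R.

(* Paley-Zygmund: [f <= 1 + f^2 / (2 M) + (M / 2) 1_(f > 1)]. *)
Lemma paley_zygmund (f : T -> R) (m M : R) : mfunT f -> (forall w, 0 <= f w) ->
  0 < M -> 2 <= m -> (\int[P]_w (f w)%:E = m%:E)%E ->
  (\int[P]_w (f w ^+ 2)%:E <= M%:E)%E -> M^-1 <= Pr P [set w | 1 < f w].
Proof.
move=> mf f0 M0 m2 If If2; set A := [set w | 1 < f w].
have mA : measurable A by exact: measurable_setlt.
have h w : f w <= 1 + ((2 * M)^-1 * f w ^+ 2 + M / 2 * \1_A w).
  have Mi : 0 < (2 * M)^-1 by rewrite invr_gt0 mulr_gt0.
  rewrite indicE; have [fw|fw] := leP (f w) 1.
    rewrite memNset ?mulr0 ?addr0; last by rewrite /A/=; apply/negP; rewrite -leNgt.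
    by apply: (le_trans fw); rewrite lerDl mulr_ge0 ?sqr_ge0// ltW.
  rewrite mem_set// mulr1.
  have := mulr_ge0 (ltW Mi) (sqr_ge0 (f w - M)).
  rewrite (_ : (2 * M)^-1 * (f w - M) ^+ 2 = (2 * M)^-1 * f w ^+ 2 + M / 2 - f w); first lra.
  by field; rewrite gt_eqF.
have mf2 : mfunT (fun w => f w ^+ 2) by exact: measurable_funX.
have c1 : 0 <= (2 * M)^-1 by rewrite invr_ge0 mulr_ge0// ltW.
have : (\int[P]_w (f w)%:E <= \int[P]_w (1%:E + (((2 * M)^-1)%:E * (f w ^+ 2)%:E + (M / 2)%:E * (\1_A w)%:E)))%E.
  apply: ge0_le_integral => //.
  - by move=> w _; rewrite lee_fin.
  - exact/measurable_EFinP.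
  - apply/measurable_EFinP; apply: measurable_funD => //; apply: measurable_funD; apply: measurable_funM => //.
  - by move=> w _; rewrite -!EFinM -!EFinD lee_fin; apply: le_trans (h w) _.
rewrite ge0_integralD//; last 2 first.
- by move=> w _; rewrite -!EFinM -EFinD lee_fin addr_ge0// mulr_ge0// ?sqr_ge0// ltW// divr_gt0.
- apply/measurable_EFinP; apply: measurable_funD; apply: measurable_funM => //.
rewrite ge0_integralD//; last 4 first.
- by move=> w _; rewrite -!EFinM lee_fin mulr_ge0// sqr_ge0.
- by apply/measurable_EFinP; apply: measurable_funM.
- by move=> w _; rewrite -!EFinM lee_fin mulr_ge0// ltW// divr_gt0.
- by apply/measurable_EFinP; apply: measurable_funM => //; apply: measurable_indic.
rewrite ge0_integralZl_EFin//; last 2 first.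
- by move=> w _; rewrite lee_fin sqr_ge0.
- exact/measurable_EFinP.
rewrite ge0_integralZl_EFin//; last 2 first.
- by apply/measurable_EFinP; apply: measurable_indic.
- by rewrite ltW// divr_gt0.
rewrite [X in (_ + (_ + _ * X))%E]integral_indic// setIT If [X in (_ + (_ + _ * X))%E]PrE//.
have -> : (\int[P]_(_ in [set: T]) 1%:E = 1%:E)%E.
  by rewrite (integral_cst P measurableT 1%:E) mul1e; exact: probability_setT.
have h2 : (((2 * M)^-1)%:E * \int[P]_w (f w ^+ 2)%:E <= (2^-1)%:E)%E.
  apply: (le_trans (lee_wpmul2l _ If2)); first by rewrite lee_fin.
  by rewrite -EFinM lee_fin invfM mulfVK// gt_eqF.
move=> h3; have : (m%:E <= 1%:E + ((2^-1)%:E + (M / 2)%:E * (Pr P A)%:E))%E.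
  by apply: (le_trans h3); rewrite leeD2l// leeD2r.
rewrite -EFinM -!EFinD lee_fin => h4.
rewrite -(ler_pM2l M0) mulfV ?gt_eqF//; lra.
Qed.

Lemma expR_le1Dx (y : R) : 0 <= y -> y <= 1 -> expR (y - y ^+ 2) <= 1 + y.
Proof.
move=> y0 y1; have h := expR_ge1Dx (- (y - y ^+ 2)).
have p : 0 < 1 + - (y - y ^+ 2) by have := sqr_ge0 y; nra.
rewrite -[y - y ^+ 2]opprK expRN -[leRHS]invrK lef_pV2 ?posrE ?expR_gt0 ?invr_gt0//; last lra.
apply: (le_trans _ h); rewrite -[leRHS](mulfK (_ : 1 + y != 0)); last by rewrite gt_eqF//; lra.
rewrite ler_pdivlMr; last lra.
rewrite mulVf ?gt_eqF//; last lra.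
have : 0 <= y ^+ 3 by rewrite exprn_ge0.
by rewrite !exprS expr0; nra.
Qed.

Lemma expR_ge_sqr (y : R) : -2 <= y -> (1 + y / 2) ^+ 2 <= expR y.
Proof.
move=> y2; rewrite (_ : expR y = expR (y / 2) ^+ 2); last by rewrite -expRM_natl; congr expR; field.
by rewrite lerXn2r ?nnegrE ?expR_ge0 ?expR_ge1Dx//; lra.
Qed.

Lemma expR_ge1Dx_sqr (x : R) : 0 <= x -> x <= 2 / 3 -> 1 + x <= expR (x - 3 / 16 * x ^+ 2).
Proof.
move=> x0 x1; apply: (le_trans _ (expR_ge_sqr _)).
  have h : 0 <= x ^+ 2 * (2 / 3 - x) by rewrite mulr_ge0 ?sqr_ge0// subr_ge0.
  have h' : 0 <= (x ^+ 2) ^+ 2 by rewrite sqr_ge0.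
  by move: h h'; rewrite !exprS !expr0; nra.
by nra.
Qed.

Lemma expR_ge1Bx_sqr (x : R) : 0 <= x -> x <= 1 -> 1 - x <= expR (- x - x ^+ 2 / 8).
Proof.
move=> x0 x1; apply: (le_trans _ (expR_ge_sqr _)); last by nra.
have h : 0 <= x ^+ 2 * x by rewrite mulr_ge0 ?sqr_ge0.
have h' : 0 <= (x ^+ 2) ^+ 2 by rewrite sqr_ge0.
by move: h h'; rewrite !exprS !expr0; nra.
Qed.

Section Count.
Variables (I : finType) (G : I -> set (set T)) (A : I -> set T) (q : I -> R).
Hypotheses (Gm : forall i, <<s G i >> `<=` measurable) (ind : indep_sigma P (fun i => <<s G i >>))
  (GA : forall i, <<s G i >> (A i)) (PA : forall i, Pr P (A i) = q i).

Let mA i : measurable (A i). Proof. by apply: Gm; exact: GA. Qed.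

Let mgf (s : R) : 0 <= s ->
  (\int[P]_w (\prod_i expR (s * \1_(A i) w))%:E = (\prod_i (1 + q i * (expR s - 1)))%:E)%E.
Proof.
move=> s0.
apply: (indep_prod_ge0 Gm ind (c := fun i => 1 + q i * (expR s - 1))).
- move=> i; apply: (smeas_comp (h := fun z => expR (s * z))).
    by apply: measurableT_comp => //; exact: measurable_funM.
  apply/smeasP; apply: measurable_indic; exact: GA.
- by move=> i w; exact: expR_ge0.
move=> i; have e w : expR (s * \1_(A i) w) = 1 + (expR s - 1) * \1_(A i) w.
  by rewrite indicE; case: (_ \in _); rewrite /= ?mulr1 ?mulr0 ?expR0; ring.
under eq_integral do rewrite e.
have b1 : bmf (fun w => (expR s - 1) * (\1_(A i) w : R)) by apply: bmfZ; exact: bmf_indic.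
rewrite ExE; last by apply: bmfD => //; exact: bmf_cst.
rewrite ExD ?Ex_cst//; last exact: bmf_cst.
by rewrite ExZ ?Ex_indic//; [rewrite -/(Pr P _) PA mulrC|exact: bmf_indic].
Qed.

(** The second moment method for the tilted variable [f = exp (th (N - m))], which exceeds 1 exactly
    when the count exceeds its mean. A constant probability, uniform in the family, is all that is
    needed, so no normal approximation is made. *)
Lemma indep_count_exceeds_mean : (forall i, q i <= 8^-1) -> 36 <= \sum_i q i ->
  expR (- 48) <= Pr P [set w | \sum_i q i < \sum_i \1_(A i) w].
Proof.
move=> q8; set m := \sum_i q i => m36.
have q0 i : 0 <= q i by rewrite -PA Pr_ge0.
have m0 : 0 < m by lra.
(* The tilt at the scale of the standard deviation: [m x^2 = 16] gives [E f >= exp 1] and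
   [E f^2 <= exp 48], and [36 <= m] ensures [x <= 2/3]. *)
pose x := 4 / sqrt m.
have sm : sqrt m ^+ 2 = m by rewrite sqr_sqrtr// ltW.
have sm6 : 6 <= sqrt m.
  by rewrite -(ger0_norm (_ : 0 <= 6)) -?sqrtr_sqr ?ler_wsqrtr//; lra.
have x0 : 0 < x by rewrite divr_gt0//; lra.
have x1 : x <= 2 / 3 by rewrite /x ler_pdivrMr; lra.
have mx2 : m * x ^+ 2 = 16.
  by rewrite /x -[X in X * _]sm; field; rewrite gt_eqF//; lra.
pose th := ln (1 + x).
have eth : expR th = 1 + x by rewrite lnK// posrE; lra.
have th0 : 0 <= th by rewrite ln_ge0; lra.
have th1 : th <= x - 3 / 16 * x ^+ 2.
  by rewrite -ler_expR eth; apply: expR_ge1Dx_sqr; lra.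
have th2 : x - x ^+ 2 <= th by rewrite -ler_expR eth; apply: expR_le1Dx; lra.
pose N w : R := \sum_i \1_(A i) w.
pose f w := expR (- (th * m)) * \prod_i expR (th * \1_(A i) w).
have fE w : f w = expR (th * (N w - m)).
  rewrite /f -expR_sum -expRD -mulr_sumr -/(N w); congr expR; ring.
have mN : mfunT N.
  have [] // : bmf N by apply: bmf_sum => i; exact: bmf_indic.
have mprod (s : R) : mfunT (fun w => \prod_i expR (s * \1_(A i) w)).
  under eq_fun do rewrite -expR_sum -mulr_sumr -/(N _).
  by apply: measurableT_comp => //; exact: measurable_funM.
have qx (z : R) : 0 <= z -> \prod_i (1 + q i * z) <= expR (m * z).
  move=> z0; rewrite /m mulr_suml expR_sum; apply: ler_prod => i _.
  by rewrite addr_ge0 ?(mulr_ge0 (q0 i))//= expR_ge1Dx.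
have qx' : expR (m * (x - 8^-1 * x ^+ 2)) <= \prod_i (1 + q i * x).
  rewrite /m mulr_suml expR_sum; apply: ler_prod => i _; rewrite expR_ge0/=.
  have x0' := ltW x0; have qi := q0 i; have q8i := q8 i.
  apply: (@le_trans _ _ (expR (q i * x - (q i * x) ^+ 2))).
    rewrite ler_expR.
    have : q i * (q i * x ^+ 2) <= q i * (8^-1 * x ^+ 2).
      by rewrite ler_wpM2l// ler_wpM2r ?sqr_ge0.
    rewrite mulrBr [(q i * x) ^+ 2]exprMn [q i ^+ 2]expr2 -mulrA.
    by move: (q i * (q i * _)) (q i * (8^-1 * _)) => u v; lra.
  apply: expR_le1Dx; first exact: mulr_ge0.
  by apply: (@le_trans _ _ (8^-1 * (2 / 3))); [apply: ler_pM|lra].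
have := @paley_zygmund f (expR (- (th * m)) * \prod_i (1 + q i * x)) (expR 48).
rewrite -expRN => pz; apply: le_trans (pz _ _ _ _ _ _) _.
- by apply: measurable_funM.
- by move=> w; rewrite fE expR_ge0.
- exact: expR_gt0.
- apply: (@le_trans _ _ (expR (- (th * m)) * expR (m * (x - 8^-1 * x ^+ 2)))); last first.
    by rewrite ler_wpM2l ?expR_ge0.
  rewrite -expRD; apply: (@le_trans _ _ (expR 1)).
    by have := @expR_ge1Dx R 1; lra.
  rewrite ler_expR.
  have h2 : th * m <= (x - 3 / 16 * x ^+ 2) * m by rewrite ler_wpM2r// ltW.
  have e1 : (x - 3 / 16 * x ^+ 2) * m = x * m - 3 / 16 * (m * x ^+ 2) by ring.
  have e2 : m * (x - 8^-1 * x ^+ 2) = x * m - 8^-1 * (m * x ^+ 2) by ring.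
  rewrite e2 mx2; rewrite e1 mx2 in h2; move: h2; set u := th * m; set v := x * m; move=> h2; lra.
- rewrite /f; under eq_integral do rewrite EFinM.
  rewrite ge0_integralZl_EFin//.
  + by rewrite (mgf th0) eth -EFinM (_ : 1 + x - 1 = x)//; ring.
  + by move=> w _; rewrite lee_fin prodr_ge0// => i _; exact: expR_ge0.
  + exact/measurable_EFinP.
- have f2 w : f w ^+ 2 = expR (- (2 * th * m)) * \prod_i expR (2 * th * \1_(A i) w).
    rewrite fE -expRM_natl -expR_sum -expRD -mulr_sumr -/(N w); congr expR; ring.
  under eq_integral do rewrite f2 EFinM.
  rewrite ge0_integralZl_EFin//; last 2 first.
  + by move=> w _; rewrite lee_fin prodr_ge0// => i _; exact: expR_ge0.
  + exact/measurable_EFinP.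
  rewrite mgf; last by rewrite mulr_ge0.
  rewrite -EFinM lee_fin expRM_natl eth.
  apply: (@le_trans _ _ (expR (- (2 * th * m)) * expR (m * ((1 + x) ^+ 2 - 1)))).
    by rewrite ler_wpM2l ?expR_ge0// qx//; nra.
  rewrite -expRD ler_expR.
  have h2 : (x - x ^+ 2) * m <= th * m by rewrite ler_wpM2r// ltW.
  have e1 : (x - x ^+ 2) * m = x * m - m * x ^+ 2 by ring.
  have e2 : m * ((1 + x) ^+ 2 - 1) = 2 * (x * m) + m * x ^+ 2 by ring.
  rewrite e2 mx2 -mulrA; rewrite e1 mx2 in h2; move: h2; set u := th * m; set v := x * m; move=> h2; lra.
apply: Pr_le.
- by apply: measurable_setlt => //; apply: measurable_funM.
- exact: measurable_setlt.
move=> w /=; rewrite fE -expR0 ltr_expR => h; rewrite -subr_gt0.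
by move: h; rewrite pmulr_rgt0// ln_gt0//; lra.
Qed.

End Count.
End SecondMoment.

Section NormalLaws.
Context {R : realType} {d} {T : measurableType d}.
Variable P : probability T R.
Notation nu := (@normal_prob R 0 1).

(** Two laws with the same even trigonometric moments give the same mass to symmetric tails, by
    [tail_closure]. *)
Lemma tail_of_cos (Y : T -> R) (t : R) : mfunT Y -> 0 < t ->
  (forall a, Ex P (fun w => cos (a * Y w)) = expR (- a ^+ 2 / 2)) ->
  Pr P [set w | t < `|Y w|] = 2 * Phibar t.
Proof.
move=> mY t0 hc.
have : Ex P (fun w => ((t < `|Y w|)%R%:R : R)) = Ex nu (fun y => ((t < `|y|)%R%:R : R)).
  apply: (@tail_closure _ (fun f => Ex P (fun w => f (Y w)) = Ex nu f)) => //.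
    move=> f [s fs]; rewrite (Ex_ext nu fs) (Ex_ext P (fun w => fs (Y w))) /trig.
    rewrite !Ex_sum; last 2 first.
    - by move=> i; apply: bmfZ; apply: bmf_cos; exact: measurable_funM.
    - by move=> i; apply: bmfZ; apply: bmf_cos; exact: measurable_funM.
    apply: eq_bigr => i _; rewrite !ExZ; last 2 first.
    - by apply: bmf_cos; exact: measurable_funM.
    - by apply: bmf_cos; exact: measurable_funM.
    rewrite hc; congr (_ * _); have := @Ex_cos_normal R i.2 0; rewrite cos0 mulr1 => <-.
    by apply: Ex_ext => y; rewrite addr0.
  move=> f_ f M mf_ hM cf mf hf.
  have c1 : Ex P (fun w => f_ n (Y w)) @[n --> \oo] --> Ex P (fun w => f (Y w)).
    by apply: (Ex_dct (M := M)) => // [n|]; exact: measurableT_comp.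
  have c2 : Ex nu (f_ n) @[n --> \oo] --> Ex nu f by exact: (Ex_dct (M := M)).
  have e : (fun n => Ex P (fun w => f_ n (Y w))) = (fun n => Ex nu (f_ n)) by apply/funext.
  by rewrite e in c1; exact: (cvg_unique _ c1 c2).
have mt : measurable [set w | t < `|Y w|] by apply: measurable_setlt => //; exact: measurableT_comp.
rewrite -(nu_tail (ltW t0)) -(Ex_indic nu (measurable_tail t)) -[Pr P _](Ex_indic P mt) => h.
rewrite (Ex_ext P (g := fun w => ((t < `|Y w|)%R%:R : R))); last first.
  by move=> w; rewrite indicE; congr (_%:R); congr nat_of_bool; apply/idP/idP; rewrite inE.
rewrite h; apply: Ex_ext => y.
by rewrite indicE; congr (_%:R); congr nat_of_bool; apply/idP/idP; rewrite inE.
Qed.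

(** [Y^2] is the limit of [(sin (h Y) / h)^2], whose mean is read off the characteristic function.
    Along [h = 2^(- k)] the limit is monotone, by the double angle formula. *)
Lemma second_moment (Y : T -> R) (v : R) : mfunT Y ->
  (forall a, Ex P (fun w => cos (a * Y w)) = expR (- (a ^+ 2 * v) / 2)) ->
  (\int[P]_w (Y w ^+ 2)%:E <= v%:E)%E.
Proof.
move=> mY hc.
pose h (k : nat) : R := 2^-1 ^+ k.
have h0 k : 0 < h k by rewrite exprn_gt0// invr_gt0.
pose g (k : nat) w : R := (sin (h k * Y w) / h k) ^+ 2.
have ge k w : g k w = (h k ^- 2 / 2) * (1 - cos (2 * h k * Y w)).
  rewrite (_ : 2 * h k * Y w = h k * Y w + h k * Y w); last by ring.
  rewrite cosD -!expr2 cos2sin2 /g; field; rewrite gt_eqF//.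
have mg k : mfunT (g k).
  apply: measurable_funX; apply: measurable_funM => //; apply: measurableT_comp; last exact: measurable_funM.
  by apply: continuous_measurable_fun; exact: continuous_sin.
have g0 k w : 0 <= g k w by exact: sqr_ge0.
have Eg k : (\int[P]_w (g k w)%:E <= v%:E)%E.
  have bc : bmf (fun w => cos (2 * h k * Y w)) by apply: bmf_cos; exact: measurable_funM.
  under eq_integral do rewrite ge.
  have b1 : bmf (fun w => 1 - cos (2 * h k * Y w)) by apply: bmfB => //; exact: bmf_cst.
  rewrite ExE; last exact: bmfZ.
  rewrite ExZ// ExB ?Ex_cst ?hc//; last exact: bmf_cst.
  rewrite lee_fin; have := @expR_ge1Dx R (- ((2 * h k) ^+ 2 * v) / 2).
  have hp : 0 <= h k ^- 2 / 2 by rewrite divr_ge0// invr_ge0 sqr_ge0.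
  move=> /(ler_wpM2l hp).
  rewrite (_ : h k ^- 2 / 2 * (1 + - ((2 * h k) ^+ 2 * v) / 2) = h k ^- 2 / 2 - v); last first.
    by field; rewrite gt_eqF.
  by rewrite mulrBr mulr1; set E := _ / 2 * expR _; set F := _ / 2; lra.
have gS k w : g k w <= g k.+1 w.
  have hS : h k = 2 * h k.+1 by rewrite /h exprS; field.
  rewrite /g hS (_ : 2 * h k.+1 * Y w = h k.+1 * Y w + h k.+1 * Y w); last by ring.
  set a := h k.+1 * Y w; have hk := h0 k.+1.
  rewrite sinD (_ : (sin a * cos a + cos a * sin a) / (2 * h k.+1) = sin a / h k.+1 * cos a); last by field; rewrite gt_eqF.
  have c1 : cos a ^+ 2 <= 1 by rewrite -[leRHS](cos2Dsin2 a) lerDl sqr_ge0.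
  by rewrite exprMn; apply: ler_piMr; rewrite ?sqr_ge0.
have cg w : g k w @[k --> \oo] --> Y w ^+ 2.
  have := is_derive_sin_lin (Y w) 0 0.
  rewrite mulr0 addr0 cos0 mulr1 => -[dv dvE].
  have hh : h k @[k --> \oo] --> (0 : R) by apply: cvg_expr; rewrite ger0_norm//; lra.
  have c0 : (fun h => h^-1 *: (sin (Y w * (h *: 1 + 0) + 0) - sin (Y w * 0 + 0))) @ 0^' -->
      'D_1 (fun x : R => sin (Y w * x + 0)) 0 by exact: dv.
  rewrite dvE in c0; move/cvgr_dnbhsP/(_ h): c0.
  move=> /(_ (conj (fun k => lt0r_neq0 (h0 k)) hh)) c.
  rewrite expr2; apply: cvg_trans (cvgM c c); apply: near_eq_cvg; near=> k.
  rewrite /= mulr0 !addr0 sin0 subr0 /g expr2 /GRing.scale/= mulr1 [Y w * _]mulrC.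
  by ring.
have e : (\int[P]_w (Y w ^+ 2)%:E = \int[P]_w limn (fun k => (g k w)%:E))%E.
  apply: eq_integral => w _; apply/esym/cvg_lim => //.
  by apply: cvg_EFin; [exact: nearW|exact: cg].
have c : (\int[P]_w (g k w)%:E)%E @[k --> \oo] --> (\int[P]_w limn (fun k => (g k w)%:E))%E.
  apply: cvg_monotone_convergence => //.
  - by move=> k; apply/measurable_EFinP; exact: mg.
  - by move=> k w _; rewrite lee_fin.
  - by move=> w _; apply/nondecreasing_seqP => k; rewrite lee_fin.
rewrite e -(cvg_lim _ c)//; apply: lime_le; first by apply/cvg_ex; eexists; exact: c.
exact: nearW.
Unshelve. all: by end_near.
Qed.

Section IndependentFamilies.
Variables (I J : finType) (Y : I -> T -> R) (Z : J -> T -> R).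
Hypotheses (mY : forall i, mfunT (Y i)) (mZ : forall i, mfunT (Z i)).
Hypothesis hc : forall u v t t',
  Ex P (fun w => cos (\sum_i u i * Y i w + t) * cos (\sum_j v j * Z j w + t')) =
  Ex P (fun w => cos (\sum_i u i * Y i w + t)) * Ex P (fun w => cos (\sum_j v j * Z j w + t')).

(** [orth_sigma] is used twice: first the centred cosines of [Y] are orthogonal to the events of
    [Z], then the centred indicator of [B] is orthogonal to the events of [Y]. *)
Lemma indep_of_cos A B :
  <<s [set E | exists i (B : set R), measurable B /\ E = Y i @^-1` B] >> A ->
  <<s [set E | exists i (B : set R), measurable B /\ E = Z i @^-1` B] >> B ->
  P (A `&` B) = (P A * P B)%E.
Proof.
move=> sA sB.
have mlin (K : finType) (F : K -> T -> R) (u : K -> R) t : (forall i, mfunT (F i)) ->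
    bmf (fun w => cos (\sum_i u i * F i w + t)).
  by move=> mF; apply: bmf_cos; apply: measurable_funD => //; apply: measurable_sum => i; exact: measurable_funM.
have h1 u t : measurable B /\ Ex P (fun w => (cos (\sum_i u i * Y i w + t) - Ex P (fun w => cos (\sum_i u i * Y i w + t))) * \1_B w) = 0.
  apply: (orth_sigma mZ _ sB); split.
    by apply: bmfB; [exact: mlin|exact: bmf_cst].
  move=> v t'; under Ex_ext do rewrite mulrBl.
  rewrite ExB; [|by apply: bmfM; exact: mlin|by apply: bmfZ; exact: mlin].
  by rewrite hc ExZ ?subrr//; exact: mlin.
have mB : measurable B by have [] := h1 (fun=> 0) 0.
have bB : bmf (\1_B : T -> R) by exact: bmf_indic.
have [mA h2] : measurable A /\ Ex P (fun w => (\1_B w - Pr P B) * \1_A w) = 0.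
  apply: (orth_sigma mY _ sA); split; first by apply: bmfB => //; exact: bmf_cst.
  move=> u t; have [_] := h1 u t; under Ex_ext do rewrite mulrBl.
  rewrite ExB; [|by apply: bmfM => //; exact: mlin|exact: bmfZ].
  rewrite ExZ// Ex_indic// -/(Pr P B) => h.
  under Ex_ext do rewrite mulrBl.
  rewrite ExB; [|by apply: bmfM => //; exact: mlin|by apply: bmfZ; exact: mlin].
  rewrite ExZ; last exact: mlin.
  move/eqP: h; rewrite subr_eq0 => /eqP h; apply/eqP; rewrite subr_eq0 [eqbRHS]mulrC -h; apply/eqP.
  by apply: Ex_ext => w; rewrite mulrC.
have bA : bmf (\1_A : T -> R) by exact: bmf_indic.
move: h2; under Ex_ext do rewrite mulrBl.
rewrite ExB; [|exact: bmfM|exact: bmfZ].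
rewrite ExZ// Ex_indic// -/(Pr P A) => /eqP; rewrite subr_eq0 => /eqP h.
rewrite !PrE//; last exact: measurableI.
rewrite -EFinM; congr EFin; rewrite mulrC -h /Pr -Ex_indic; last exact: measurableI.
by apply: Ex_ext => w; rewrite indicI mulrC.
Qed.

End IndependentFamilies.
End NormalLaws.

Section ChiSquareLower.
Context {R : realType} {d} {T : measurableType d}.
Variable P : probability T R.

(** The noise seen as a design with one column: its independent rows make the chi-square bounds
    apply to its norm. *)
Lemma noise_rows n (eps : T -> 'cV[R]_n) (sigma : R) :
  random_mx eps -> gaussian_vec P eps (sigma ^+ 2)%:M -> 0 < sigma ->
  iid_gaussian_rows P (eps : T -> 'M[R]_(n, 1)) (sigma ^+ 2)%:M.
Proof.
move=> meps geps s0; pose M w : 'M[R]_(n, 1) := eps w.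
have s2 : 0 < sigma ^+ 2 by rewrite exprn_gt0.
split.
  have h : indep_sigma P (fun i => sigma_mx (fun w => col i ((eps w)^T))).
    apply: (@columns_indep _ _ _ P 1 n (fun w => (eps w)^T) (fun=> sigma ^+ 2)).
      by move=> i j; under eq_fun do rewrite mxE; exact: meps.
    move=> C t; have := gaussian_cos meps geps C^T t.
    rewrite -/(bform _ _ _) -/(qform _ _) qform_scalar => e.
    rewrite -(_ : sigma ^+ 2 * sqnorm2 C^T = \sum_i \sum_j C i j ^+ 2 * sigma ^+ 2).
      rewrite -e; apply: Ex_ext => w; congr (cos (_ + _)).
      by rewrite lin1E big_ord1; apply: eq_bigr => j _; rewrite !mxE.
    by rewrite big_ord1 mulr_sumr; apply: eq_bigr => j _; rewrite mxE mulrC.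
  move=> E hE; apply: h => i; have := hE i; apply: sub_smallest2r => //.
  move=> _ [a [b [B [mB ->]]]]; exists a, b, B; split => //.
  by apply/seteqP; split => w /=; rewrite !mxE (ord1 a) (ord1 b).
move=> i; split.
- by rewrite tr_scalar_mx.
- by move=> a; rewrite -/(bform _ _ _) -/(qform _ _) qform_scalar mulr_ge0 ?sqnorm2_ge0// ltW.
- move=> a B mB; have [_ _ h] := geps.
  have := h (a 0 0 *: delta_mx i 0) B mB; rewrite -!/(bform _ _ _) -!/(qform _ _) !qform_scalar sqnorm2Z sqnorm2_delta mulr1.
  rewrite (_ : sqnorm2 a = a 0 0 ^+ 2); last by rewrite /sqnorm2 big_ord1.
  have -> : (fun w => ((a 0 0 *: delta_mx i 0)^T *m eps w) (0 : 'I_1) (0 : 'I_1)) = (fun w => (a^T *m (row i (M w))^T) 0 0).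
    apply/funext => w.
    rewrite -/(lin1 _ _ _) lin1E (bigD1 i)//= big1 ?addr0; last first.
      by move=> k ki; rewrite scalemxE deltamxE (negbTE ki) mulr0 mul0r.
    by rewrite scalemxE deltamxE eqxx mulr1 mxE big_ord1 !mxE.
  by [].
Qed.

(* The event has probability bounded below because [u] is at most of the order
   of the standard deviation of the chi-square law. *)
Lemma sqnorm2_noise_lower n (eps : T -> 'cV[R]_n) (sigma u : R) :
  random_mx eps -> gaussian_vec P eps (sigma ^+ 2)%:M -> 0 < sigma ->
  (4096 <= n)%N -> 0 <= u -> 4 * u <= sqrt n%:R ->
  expR (- 128) <= Pr P [set w | sigma ^+ 2 * (n%:R + u) <= sqnorm2 (eps w)].
Proof.
move=> meps geps s0 n4 u0 un.
have n0 : 0 < n%:R :> R by rewrite ltr0n (leq_trans _ n4).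
pose M w : 'M[R]_(n, 1) := eps w.
have s2 : 0 < sigma ^+ 2 by rewrite exprn_gt0.
have gM : iid_gaussian_rows P M (sigma ^+ 2)%:M := noise_rows meps geps s0.
have mM : random_mx M by [].
(* Here [n th^2 = 16] and [th u <= 1], so the tilted variable has mean at least [exp 1] and second
   moment at most [exp 128]; [4096 <= n] makes [th <= 1/16]. *)
pose th : R := 4 / sqrt n%:R.
have sn : sqrt n%:R ^+ 2 = n%:R :> R by rewrite sqr_sqrtr// ltW.
have sn64 : 64 <= sqrt n%:R :> R.
  rewrite -(ger0_norm (_ : 0 <= 64)) -?sqrtr_sqr ?ler_wsqrtr//.
  by rewrite -natrX ler_nat.
have th0 : 0 < th by rewrite divr_gt0//; lra.
have th1 : th <= 16^-1 by rewrite /th ler_pdivrMr; lra.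
have nth : n%:R * th ^+ 2 = 16 by rewrite /th -[X in X * _]sn; field; rewrite gt_eqF//; lra.
have thu : th * u <= 1 by rewrite /th mulrAC ler_pdivrMr; lra.
have mgf (s : R) : 2 * s < 1 ->
    (\int[P]_w (expR (s / sigma ^+ 2 * sqnorm2 (eps w)))%:E = ((sqrt (1 - 2 * s))^-1 ^+ n)%:E)%E.
  move=> s1; have := chi_mgf mM gM (V := 1%:M) (th := s / sigma ^+ 2).
  rewrite qform_scalar (_ : sqnorm2 1%:M = 1); last by rewrite /sqnorm2 big_ord1 mxE expr1n.
  rewrite mulr1 (_ : 2 * (s / sigma ^+ 2) * sigma ^+ 2 = 2 * s); last by field; rewrite gt_eqF.
  move=> <-//; apply: eq_integral => w _; by rewrite mulmx1.
have intZ (c s : R) : 0 <= c -> (\int[P]_w (c%:E * (expR (s * sqnorm2 (eps w)))%:E) =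
    c%:E * \int[P]_w (expR (s * sqnorm2 (eps w)))%:E)%E.
  move=> c0; apply: ge0_integralZl_EFin => //.
  by apply/measurable_EFinP; apply: measurableT_comp => //; apply: measurable_funM => //; exact: measurable_sqnorm2.
pose f w := expR (- (th * (n%:R + u))) * expR (th / sigma ^+ 2 * sqnorm2 (eps w)).
have fE w : f w = expR (th * (sqnorm2 (eps w) / sigma ^+ 2 - (n%:R + u))).
  by rewrite /f -expRD; congr expR; ring.
have me (s : R) : mfunT (fun w => expR (s * sqnorm2 (eps w))).
  by apply: measurableT_comp => //; apply: measurable_funM => //; exact: measurable_sqnorm2.
have := @paley_zygmund _ _ _ P f (expR (- (th * (n%:R + u))) * (sqrt (1 - 2 * th))^-1 ^+ n) (expR 128).
rewrite -expRN => pz; apply: le_trans (pz _ _ _ _ _ _) _.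
- by apply: measurable_funM.
- by move=> w; rewrite fE expR_ge0.
- exact: expR_gt0.
- have h1 : expR (th + th ^+ 2 / 4) <= (sqrt (1 - 2 * th))^-1.
    have h := @expR_ge1Bx_sqr R (2 * th).
    have sq0 : 0 < sqrt (1 - 2 * th) by rewrite sqrtr_gt0; lra.
    rewrite -[leLHS]invrK lef_pV2 ?posrE ?invr_gt0 ?expR_gt0//.
    rewrite -expRN -[leRHS](ger0_norm (expR_ge0 _)) -sqrtr_sqr ler_wsqrtr// -expRM_natl.
    apply: (le_trans (h _ _)); [lra|lra|rewrite ler_expR].
    by apply: le_of_eq; field.
  apply: (@le_trans _ _ (expR (- (th * (n%:R + u))) * expR (th + th ^+ 2 / 4) ^+ n)).
    rewrite -expRM_natl -expRD; apply: (@le_trans _ _ (expR 1)).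
      by have := @expR_ge1Dx R 1; lra.
    rewrite ler_expR (_ : n%:R * (th + th ^+ 2 / 4) = n%:R * th + n%:R * th ^+ 2 / 4); last by ring.
    by rewrite nth mulrDr [th * n%:R]mulrC; move: thu; set a := th * u; set b := n%:R * th; move=> thu; lra.
  rewrite ler_wpM2l ?expR_ge0// lerXn2r ?nnegrE ?expR_ge0// invr_ge0 sqrtr_ge0//.
- rewrite /f; under eq_integral do rewrite EFinM.
  rewrite intZ ?expR_ge0//.
  by rewrite mgf ?EFinM//; lra.
- have f2 w : f w ^+ 2 = expR (- (2 * th * (n%:R + u))) * expR (2 * th / sigma ^+ 2 * sqnorm2 (eps w)).
    by rewrite fE -expRM_natl -expRD; congr expR; ring.
  under eq_integral do rewrite f2 EFinM.
  rewrite intZ ?expR_ge0//.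
  rewrite mgf; last lra.
  rewrite -EFinM lee_fin.
  have h := @inv_sqrt_le R (4 * th).
  apply: (@le_trans _ _ (expR (- (2 * th * (n%:R + u))) * expR (4 * th / 2 + (4 * th) ^+ 2 / 2) ^+ n)).
    rewrite ler_wpM2l ?expR_ge0// lerXn2r ?nnegrE ?expR_ge0 ?invr_ge0 ?sqrtr_ge0//.
    rewrite (_ : 2 * (2 * th) = 4 * th); last by ring.
    by apply: h; rewrite ger0_norm; lra.
  rewrite -expRM_natl -expRD ler_expR.
  rewrite (_ : n%:R * (4 * th / 2 + (4 * th) ^+ 2 / 2) = 2 * (n%:R * th) + 8 * (n%:R * th ^+ 2)); last by field.
  rewrite nth (_ : 2 * th * (n%:R + u) = 2 * (n%:R * th) + 2 * (th * u)); last by ring.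
  have : 0 <= th * u by rewrite mulr_ge0// ltW.
  by set a := th * u; set b := n%:R * th; move=> ?; lra.
apply: Pr_le.
- by apply: measurable_setlt => //; apply: measurable_funM.
- by apply: measurable_setle => //; exact: measurable_sqnorm2.
move=> w /=; rewrite fE -expR0 ltr_expR pmulr_rgt0// subr_gt0 ltr_pdivlMr// => h.
by rewrite mulrC ltW.
Qed.

End ChiSquareLower.

Section SphericalTail.
Context {R : realType} {d} {T : measurableType d}.
Variable P : probability T R.

(* Given the part [z] of [x] orthogonal to [e], the probability is
   [2 Phibar (t |z| / sqrt (n v))] at least, a convex function of [|z|^2], to
   which Jensen's inequality applies. *)
Lemma spherical_tail n (x : T -> 'cV[R]_n) (v : R) (e : 'cV[R]_n) (t : R) :
  random_mx x -> 0 < v -> (0 < n)%N -> 0 < t ->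
  (forall c a, Ex P (fun w => cos (lin1 c x w + a)) = expR (- (v * sqnorm2 c) / 2) * cos a) ->
  n%:R + t ^+ 2 <= sqnorm2 e ->
  2 * Phibar t <= Pr P [set w | t * sqrt (sqnorm2 (x w)) < `|lin1 e x w|].
Proof.
move=> mx v0 n0 t0 hc he.
have nR : 0 < n%:R :> R by rewrite ltr0n.
have e0 : 0 < sqnorm2 e by apply: lt_le_trans he; rewrite ltr_wpDr ?sqr_ge0.
pose r := sqrt (sqnorm2 e); have r0 : 0 < r by rewrite sqrtr_gt0.
have r2 : r ^+ 2 = sqnorm2 e by rewrite sqr_sqrtr// ltW.
have [a [a1 ea]] : exists a, sqnorm2 a = 1 /\ e = r *: a.
  exists (r^-1 *: e); split; first by rewrite sqnorm2Z exprVn r2 mulVf// gt_eqF.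
  by rewrite scalerA divff ?scale1r// gt_eqF.
have linD c c' w : lin1 (c + c') x w = lin1 c x w + lin1 c' x w.
  by rewrite !lin1E -big_split; apply: eq_bigr => i _; rewrite addmxE mulrDl.
have linZ k c w : lin1 (k *: c) x w = k * lin1 c x w.
  by rewrite !lin1E mulr_sumr; apply: eq_bigr => i _; rewrite scalemxE mulrA.
pose sv := sqrt v; have sv0 : 0 < sv by rewrite sqrtr_gt0.
have sv2 : sv ^+ 2 = v by rewrite sqr_sqrtr// ltW.
pose y (i : 'I_1) w := lin1 a x w / sv.
pose z (i : 'I_n) w := x w i 0 - a i 0 * lin1 a x w.
have my i : mfunT (y i) by apply: measurable_funM => //; exact: measurable_lin1.
have mz i : mfunT (z i).
  by apply: measurable_funB; [exact: mx|apply: measurable_funM => //; exact: measurable_lin1].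
(* Linear forms in the part [z] orthogonal to [a] are linear forms in [x] with coefficients
   orthogonal to [a]; hence the factorisation of the cosines and the independence of [z] and [y]. *)
have [zc [zE zca]] : exists zc : ('I_n -> R) -> 'cV[R]_n,
    (forall c w, \sum_i c i * z i w = lin1 (zc c) x w) /\ (forall c, bform 1%:M a (zc c) = 0).
  exists (fun c => (\col_i c i) - (\sum_i c i * a i 0) *: a); split.
    move=> c w; rewrite linD -scaleN1r linZ linZ mulN1r [lin1 (\col_i c i) x w]lin1E mulr_suml -sumrN -big_split.
    by apply: eq_bigr => i _ /=; rewrite mxE /z; ring.
  move=> c; rewrite bformDr -scaleN1r !bformZr -/(qform _ a) -sqnorm2E a1 bform1E.
  under eq_bigr do rewrite mxE mulrC.
  by rewrite mulr1 mulN1r subrr.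
have bcos c k : bmf (fun w => cos (lin1 c x w + k)).
  by apply: bmf_cos; apply: measurable_funD => //; exact: measurable_lin1.
have ind : forall A B : set T,
   <<s [set E | exists (i : 'I_n) (B : set R), measurable B /\ E = z i @^-1` B] >> A ->
   <<s [set E | exists (i : 'I_1) (B : set R), measurable B /\ E = y i @^-1` B] >> B ->
   P (A `&` B) = (P A * P B)%E.
  apply: indep_of_cos => // c u k k'.
  have yE w : \sum_i u i * y i w = lin1 ((u 0 / sv) *: a) x w.
    by rewrite big_ord1 linZ /y; ring.
  have -> : Ex P (fun w => cos (\sum_i c i * z i w + k)) = expR (- (v * sqnorm2 (zc c)) / 2) * cos k.
    by rewrite -hc; apply: Ex_ext => w; rewrite zE.
  have -> : Ex P (fun w => cos (\sum_j u j * y j w + k')) = expR (- (v * sqnorm2 ((u 0 / sv) *: a)) / 2) * cos k'.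
    by rewrite -hc; apply: Ex_ext => w; rewrite yE.
  transitivity (Ex P (fun w => 2^-1 * cos (lin1 (zc c + (u 0 / sv) *: a) x w + (k + k')) +
     2^-1 * cos (lin1 (zc c + (- (u 0 / sv)) *: a) x w + (k - k')))).
    apply: Ex_ext => w; rewrite zE yE !linD !linZ.
    set p1 := lin1 (zc c) x w; set p2 := lin1 a x w.
    rewrite (_ : p1 + u 0 / sv * p2 + (k + k') = (p1 + k) + (u 0 / sv * p2 + k')); last by ring.
    rewrite (_ : p1 + - (u 0 / sv) * p2 + (k - k') = (p1 + k) - (u 0 / sv * p2 + k')); last by ring.
    by rewrite cosD cosB; field.
  rewrite ExD; try exact: bmfZ.
  rewrite !ExZ// !hc !sqnorm2D !sqnorm2Z !bformZr [bform _ (zc c) a]bform_sym ?trmx1// zca a1 !mulr0 !addr0 !mulr1 sqrrN.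
  rewrite cosD cosB.
  rewrite (_ : - (v * (sqnorm2 (zc c) + (u 0 / sv) ^+ 2)) / 2 = - (v * sqnorm2 (zc c)) / 2 + - (v * (u 0 / sv) ^+ 2) / 2); last by ring.
  by rewrite expRD; field.
pose G1 := [set E | exists (i : 'I_n) (B : set R), measurable B /\ E = z i @^-1` B].
pose G2 := [set E | exists (i : 'I_1) (B : set R), measurable B /\ E = y i @^-1` B].
have G1m : <<s G1 >> `<=` measurable.
  apply: smallest_sub; first exact: sigma_algebra_measurable.
  by move=> _ [i [B [mB ->]]]; rewrite -[X in measurable X]setTI; exact: mz.
have G2m : <<s G2 >> `<=` measurable.
  apply: smallest_sub; first exact: sigma_algebra_measurable.
  by move=> _ [i [B [mB ->]]]; rewrite -[X in measurable X]setTI; exact: my.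
have sz i : smeas G1 (z i) by move=> B mB; apply: sub_gen_smallest; exists i, B.
have sy : smeas G2 (y 0) by move=> B mB; apply: sub_gen_smallest; exists 0, B.
pose S2 w := (\sum_i z i w ^+ 2) / (n%:R * v).
pose S w := sqrt (S2 w).
have S20 w : 0 <= S2 w by rewrite divr_ge0 ?mulr_ge0 ?(ltW nR) ?(ltW v0)//; apply: sumr_ge0 => i _; exact: sqr_ge0.
have S0 w : 0 <= S w by exact: sqrtr_ge0.
have SS w : S w ^+ 2 = S2 w by rewrite sqr_sqrtr.
pose F (w1 w2 : T) : R := (t * S w1 < `|y 0 w2|)%R%:R.
have jS2 : jmeas G1 G2 (fun w1 _ => S2 w1).
  apply: (@jmeasM _ _ _ G1 G2 (fun w1 _ => \sum_i z i w1 ^+ 2)); last exact: jmeas_cst.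
  apply: jmeas_sum => i; apply: (jmeas_comp (h := fun b => b ^+ 2)); first exact: exprn_measurable.
  exact: jmeas1.
have jF : jmeas G1 G2 F.
  apply: jmeas_lt.
    apply: jmeasM; first exact: jmeas_cst.
    by apply: (jmeas_comp (h := sqrt)); [exact: measurable_sqrtr|exact: jS2].
  by apply: (jmeas_comp (h := Num.norm)) => //; exact: jmeas2.
have F01 w1 w2 : 0 <= F w1 w2 <= 1 by rewrite /F; case: (_ < _); rewrite lexx ler01.
have [bF bE bd dec] := decouple_Ex G1m G2m ind jF F01.
have ycos b : Ex P (fun w => cos (b * y 0 w)) = expR (- b ^+ 2 / 2).
  have := hc ((b / sv) *: a) 0; rewrite cos0 mulr1 sqnorm2Z a1 mulr1 expr_div_n sv2.
  rewrite (_ : v * (b ^+ 2 / v) = b ^+ 2); last by field; rewrite gt_eqF.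
  by move=> <-; apply: Ex_ext => w; rewrite addr0 linZ /y; congr cos; ring.
have mt c : measurable [set w | c < `|y 0 w|].
  by apply: measurable_setlt => //; exact: measurableT_comp.
have indF (w1 w2 : T) : F w1 w2 = \1_[set w | t * S w1 < `|y 0 w|] w2.
  by rewrite /F indicE; congr (_%:R); congr nat_of_bool; apply/idP/idP; rewrite inE.
have gp : 0 <= gpdf t / t by rewrite divr_ge0 ?gpdf_ge0// ltW.
(* The tangent at [S = 1] of the convex function of [S^2]. Its mean is at least [2 Phibar t] once
   [E S^2 <= 1]. The case [S w1 = 0] is reached through small positive thresholds. *)
have EF w1 : 2 * (Phibar t - gpdf t / t * ((t * S w1) ^+ 2 - t ^+ 2) / 2) <= Ex P (F w1).
  rewrite (Ex_ext P (indF w1)) Ex_indic// -/(Pr P _).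
  have [h|h] := leP (t * S w1) 0.
    have -> : S w1 = 0.
      by apply/eqP; rewrite eq_le S0 andbT -(pmulr_rle0 _ t0).
    rewrite mulr0 expr0n/= sub0r; apply/ler_addgt0Pr => b b0.
    pose B := gpdf t / t; pose c := sqrt (b / (B + 1)).
    have B1 : 0 < B + 1 by rewrite ltr_wpDl.
    have c0 : 0 < c by rewrite sqrtr_gt0 divr_gt0.
    have c2 : c ^+ 2 * (B + 1) = b by rewrite sqr_sqrtr ?divfK ?gt_eqF// divr_ge0// ltW.
    have : Pr P [set w | c < `|y 0 w|] <= Pr P [set w | 0 < `|y 0 w|].
      by apply: Pr_le => // w /=; exact: lt_trans.
    rewrite (tail_of_cos (my 0) c0 ycos); have := Phibar_tangent t0 (ltW c0); rewrite -/B => h1 h2.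
    have h3 : B * c ^+ 2 <= b by rewrite -c2 mulrC ler_wpM2l ?sqr_ge0// lerDl.
    have e1 : B * ((c ^+ 2 - t ^+ 2) / 2) = B * c ^+ 2 / 2 - B * t ^+ 2 / 2 by ring.
    have e2 : B * - t ^+ 2 / 2 = - (B * t ^+ 2 / 2) by ring.
    rewrite e1 in h1; rewrite e2.
    by move: h1 h2 h3; set u1 := B * c ^+ 2; set u2 := B * t ^+ 2; move=> h1 h2 h3; lra.
  rewrite (tail_of_cos (my 0) h ycos) ler_pM2l//.
  by rewrite -mulrA; apply: Phibar_tangent => //; exact: ltW.
have mS2 : mfunT S2.
  by apply: measurable_funM => //; apply: measurable_sum => i; apply: measurable_funX.
have zS w : \sum_i z i w ^+ 2 = sqnorm2 (x w) - lin1 a x w ^+ 2.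
  have h : \sum_i z i w ^+ 2 = sqnorm2 (x w - lin1 a x w *: a).
    by apply: eq_bigr => i _; rewrite submxE scalemxE /z mulrC.
  rewrite h sqnorm2B sqnorm2Z a1 bformZr [bform _ (x w) a]bform_sym ?trmx1// bform1E -lin1E.
  by ring.
have nv0 : 0 < n%:R * v by rewrite mulr_gt0.
have IS2 : (\int[P]_w (S2 w)%:E <= 1%:E)%E.
  have mx2 i : mfunT (fun w => (x w i 0 ^+ 2)%:E).
    by apply/measurable_EFinP; apply: measurable_funX; exact: mx.
  apply: (@le_trans _ _ (\int[P]_w (((n%:R * v)^-1)%:E * \sum_i (x w i 0 ^+ 2)%:E))%E).
    apply: ge0_le_integral => //.
    - by move=> w _; rewrite lee_fin.
    - exact/measurable_EFinP.
    - by apply: emeasurable_funM => //; exact: emeasurable_sum.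
    - move=> w _; rewrite sumEFin -EFinM lee_fin /S2 mulrC ler_wpM2l ?invr_ge0 ?(ltW nv0)//.
      by rewrite zS gerBl sqr_ge0.
  rewrite ge0_integralZl_EFin//; last 3 first.
  - by move=> w _; rewrite sumEFin lee_fin; apply: sumr_ge0 => i _; exact: sqr_ge0.
  - exact: emeasurable_sum.
  - by rewrite invr_ge0 ltW.
  rewrite ge0_integral_sum//; last by move=> i w _; rewrite lee_fin sqr_ge0.
  apply: (@le_trans _ _ (((n%:R * v)^-1)%:E * \sum_(i < n) v%:E)%E).
    apply: lee_wpmul2l; first by rewrite lee_fin invr_ge0 ltW.
    apply: lee_sum => i _; apply: second_moment; first exact: mx.
    move=> b; have := hc (b *: delta_mx i 0) 0; rewrite cos0 mulr1 sqnorm2Z sqnorm2_delta mulr1 [v * _]mulrC => <-.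
    apply: Ex_ext => w; rewrite addr0 linZ; congr cos; congr (_ * _).
    rewrite lin1E (bigD1 i)//= big1 ?addr0; last by move=> j ji; rewrite deltamxE (negbTE ji) mul0r.
    by rewrite deltamxE eqxx mul1r.
  by rewrite sumEFin sumr_const card_ord -EFinM lee_fin -[v *+ n]mulr_natl mulVf// gt_eqF.
have E1 : 2 * Phibar t <= Ex P (fun w => F w w).
  rewrite dec; pose k := gpdf t / t * t ^+ 2.
  have k0 : 0 <= k by rewrite mulr_ge0 ?sqr_ge0.
  have h w : 2 * Phibar t + k <= Ex P (F w) + k * S2 w.
    have := EF w; rewrite exprMn SS.
    rewrite (_ : 2 * _ = 2 * Phibar t + k - k * S2 w); first by rewrite lerBlDr.
    by rewrite /k; field; rewrite gt_eqF.
  have : ((2 * Phibar t + k)%:E <= (Ex P (fun w => Ex P (F w)))%:E + k%:E)%E.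
    rewrite -ExE//.
    apply: (@le_trans _ _ (\int[P]_w ((Ex P (F w))%:E + k%:E * (S2 w)%:E))%E).
      rewrite -[leLHS]mule1 -(@probability_setT _ _ _ P) -integral_cst//.
      apply: ge0_le_integral => //.
      - by move=> w _; rewrite lee_fin addr_ge0// mulr_ge0// Phibar_ge0.
      - by apply/measurable_EFinP; apply: measurable_funD; [by case: bE|exact: measurable_funM].
      - by move=> w _; rewrite -EFinM -EFinD lee_fin.
    rewrite ge0_integralD//; last 4 first.
    - by move=> w _; rewrite lee_fin Ex_ge0// => w2; have /andP[] := F01 w w2.
    - by apply/measurable_EFinP; case: bE.
    - by move=> w _; rewrite -EFinM lee_fin mulr_ge0.
    - by apply/measurable_EFinP; exact: measurable_funM.
    rewrite leeD2l// ge0_integralZl_EFin//; last 2 first.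
    - by move=> w _; rewrite lee_fin.
    - exact/measurable_EFinP.
    by rewrite -[leRHS]mule1; apply: lee_wpmul2l => //; rewrite lee_fin.
  by rewrite -EFinD lee_fin; lra.
apply: (le_trans E1).
have mA : measurable [set w | t * sqrt (sqnorm2 (x w)) < `|lin1 e x w|].
  apply: measurable_setlt.
    by apply: measurable_funM => //; apply: (measurableT_comp measurable_sqrtr); exact: measurable_sqnorm2.
  by apply: measurableT_comp => //; exact: measurable_lin1.
rewrite -[Pr P _](Ex_indic P mA); apply: Ex_le => //; first exact: bmf_indic.
move=> w; rewrite /F indicE; case: (ltP (t * S w) `|y 0 w|) => h //; rewrite mem_set//=.
have y2 : lin1 a x w ^+ 2 = y 0 w ^+ 2 * v by rewrite /y expr_div_n sv2 divfK// gt_eqF.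
have h2 : (t * S w) ^+ 2 < y 0 w ^+ 2.
  by rewrite -[y 0 w ^+ 2]real_normK ?num_real// ltr_sqr ?nnegrE// mulr_ge0// ltW.
rewrite exprMn SS /S2 zS mulrA ltr_pdivrMr// (_ : y 0 w ^+ 2 * (n%:R * v) = lin1 a x w ^+ 2 * n%:R) in h2; last first.
  by rewrite y2; ring.
rewrite -ltr_sqr ?nnegrE ?normr_ge0//; last by rewrite mulr_ge0 ?sqrtr_ge0// ltW.
rewrite real_normK ?num_real// exprMn sqr_sqrtr ?sqnorm2_ge0// ea linZ exprMn r2.
(* From [n y^2 > t^2 (|x|^2 - y^2)], with [y = a . x], follows [(n + t^2) y^2 > t^2 |x|^2]; this is
   why the direction needs squared norm at least [n + t^2]. *)
apply: (@lt_le_trans _ _ ((n%:R + t ^+ 2) * lin1 a x w ^+ 2)); last by rewrite ler_wpM2r ?sqr_ge0.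
rewrite mulrBr in h2.
by move: h2; set u1 := t ^+ 2 * _; rewrite mulrDl; set u2 := t ^+ 2 * _; rewrite [n%:R * _]mulrC; set u3 := _ * n%:R; move=> ?; lra.
Qed.

End SphericalTail.

Section CountAboveMean.
Context {R : realType} {d} {T : measurableType d}.
Variable P : probability T R.
Variables (n p : nat) (X : T -> 'M[R]_(n, p)) (S : 'M[R]_p) (eps : T -> 'cV[R]_n) (sigma t : R).
Hypotheses (mX : random_mx X) (gX : iid_gaussian_rows P X S) (Soff : forall i j, i != j -> S i j = 0)
  (Sd : forall j, 0 < S j j) (meps : random_mx eps) (geps : gaussian_noise_given P X eps (sigma ^+ 2))
  (sigma0 : 0 < sigma) (n4 : (4096 <= n)%N) (t0 : 0 < t) (tn : 4 * t ^+ 2 <= sqrt n%:R)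
  (t16 : 2 * Phibar (t / 2) <= 16^-1) (pt : 36 <= p%:R * (2 * Phibar t)).

Let n0 : 0 < n%:R :> R. Proof. by rewrite ltr0n (leq_trans _ n4). Qed.

Let x j w : 'cV[R]_n := col j (X w).
Let mx j : random_mx (x j).
Proof. by move=> a b; rewrite /x; under eq_fun do rewrite mxE; exact: mX. Qed.

Let qdiag (C : 'rV[R]_p) : (C *m S *m C^T) 0 0 = \sum_j C 0 j ^+ 2 * S j j.
Proof.
rewrite mxE; apply: eq_bigr => j _; rewrite !mxE (bigD1 j)//= big1 ?addr0 => [|k kj].
  by rewrite expr2 mulrAC.
by rewrite Soff ?mulr0.
Qed.

Let col_cos j c a : Ex P (fun w => cos (lin1 c (x j) w + a)) = expR (- (S j j * sqnorm2 c) / 2) * cos a.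
Proof.
have := rows_cos mX gX (c *m delta_mx 0 j) a.
under [in RHS]eq_bigr do rewrite qdiag.
rewrite (_ : \sum_i \sum_k _ = S j j * sqnorm2 c); last first.
  rewrite mulr_sumr; apply: eq_bigr => i _; rewrite (bigD1 j)//= big1 ?addr0.
    by rewrite !mxE big_ord1 !mxE !eqxx mulr1 mulrC.
  by move=> k kj; rewrite !mxE big_ord1 !mxE (negbTE kj) andbF mulr0 expr0n mul0r.
move=> <-; apply: Ex_ext => w; rewrite lin1E; congr (cos (_ + _)); apply: eq_bigr => i _.
rewrite (bigD1 j)//= big1 ?addr0.
  by rewrite !mxE big_ord1 !mxE !eqxx mulr1.
by move=> k kj; rewrite !mxE big_ord1 !mxE (negbTE kj) andbF mulr0 mul0r.
Qed.

Let cols_indep : indep_sigma P (fun j => <<s gen_mx (x j) >>).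
Proof.
apply: (columns_indep (v := fun j => S j j) mX) => C a.
rewrite (rows_cos mX gX); congr (expR (- _ / 2) * _); apply: eq_bigr => i _.
by rewrite qdiag; apply: eq_bigr => j _; rewrite mxE.
Qed.

Let E (e : 'cV[R]_n) j : set T := [set w | t * sqrt (sqnorm2 (x j w)) < `|lin1 e (x j) w|].

Let sE e j : <<s gen_mx (x j) >> (E e j).
Proof.
have h1 : smeas (gen_mx (x j)) (lin1 e (x j)).
  rewrite (_ : lin1 e (x j) = fun w => \sum_i e i 0 * x j w i 0); last by apply/funext => w; rewrite lin1E.
  by apply: smeas_sum => i; apply: smeasM; [exact: smeas_cst|exact: smeas_entry].
have h2 : smeas (gen_mx (x j)) (fun w => t * sqrt (sqnorm2 (x j w))).
  apply: smeasM; first exact: smeas_cst.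
  apply: (smeas_comp measurable_sqrtr); apply: smeas_sum => i.
  by apply: (smeas_comp (h := fun b => b ^+ 2)); [exact: exprn_measurable|exact: smeas_entry].
move/smeasP : h1 => h1; move/smeasP : h2 => h2.
apply: (@measurable_setlt _ _ (g_sigma_algebraType (gen_mx (x j)))) => //.
by apply: measurableT_comp.
Qed.

Let gm j : <<s gen_mx (x j) >> `<=` measurable := random_mxP (@mx j).

Let mE e j : measurable (E e j).
Proof. by apply: (@gm j); exact: sE. Qed.

(** The lower bound, slightly above the typical squared length, makes each exceedance probability at
    least [2 Phibar t]; the upper bound keeps it below [1/8]. *)
Let good (e : 'cV[R]_n) := n%:R + t ^+ 2 <= sqnorm2 e /\ sqnorm2 e <= 2 * n%:R.

(** An exceedance forces either a column of squared norm at most half its mean, or a standard normal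
    variable beyond [t / 2]; each has probability at most [1/16]. *)
Let prob_le e j : good e -> Pr P (E e j) <= 8^-1.
Proof.
move=> [e1 e2]; have v0 := Sd j; set v := S j j in v0.
have e0 : 0 < sqnorm2 e by apply: lt_le_trans e1; rewrite ltr_wpDr ?sqr_ge0.
have nv0 : 0 < n%:R * v by rewrite mulr_gt0.
pose Y w := lin1 e (x j) w / sqrt (v * sqnorm2 e).
have r0 : 0 < sqrt (v * sqnorm2 e) by rewrite sqrtr_gt0 mulr_gt0.
have mY : mfunT Y by apply: measurable_funM => //; exact: measurable_lin1.
have hY b : Ex P (fun w => cos (b * Y w)) = expR (- b ^+ 2 / 2).
  have := col_cos j ((b / sqrt (v * sqnorm2 e)) *: e) 0.
  rewrite cos0 mulr1 sqnorm2Z expr_div_n sqr_sqrtr; last by rewrite mulr_ge0// ltW.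
  rewrite (_ : S j j * _ = b ^+ 2); last by rewrite -/v; field; rewrite !gt_eqF.
  move=> <-; apply: Ex_ext => w; rewrite addr0 /Y !lin1E; congr cos.
  rewrite mulr_suml mulr_sumr; apply: eq_bigr => i _; rewrite scalemxE; ring.
pose A1 : set T := [set w | sqnorm2 (x j w) <= n%:R * v / 2].
pose A2 : set T := [set w | t / 2 < `|Y w|].
have mA1 : measurable A1 by apply: measurable_setle => //; exact: measurable_sqnorm2.
have mA2 : measurable A2 by apply: measurable_setlt => //; exact: measurableT_comp.
have P1 : Pr P A1 <= 16^-1.
  have q1 : qform S (delta_mx j 0) = v by rewrite /qform bform_delta.
  have := @chi_chernoff _ _ _ P n p X S mX gX (delta_mx j 0) (- 8^-1).
  rewrite q1 => /(_ v0 _) h; have {}h := h _.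
  have -> : A1 = [set w | 4 * (- 8^-1) ^+ 2 * (n%:R * v) <= - 8^-1 * (sqnorm2 (X w *m delta_mx j 0) - n%:R * v)].
    have e8 : 4 * (- 8^-1) ^+ 2 = 16^-1 :> R by field.
    by rewrite /A1; apply/seteqP; split => w /=; rewrite -colE -/(x j w) e8; move: (sqnorm2 _) (n%:R * v) => u b; lra.
  apply: (le_trans (h _)); first by rewrite normrN ger0_norm; lra.
  have n4' : 4096 <= n%:R :> R by rewrite ler_nat.
  apply: (@le_trans _ _ (expR (- 96))).
    by rewrite ler_expR sqrrN; lra.
  rewrite expRN lef_pV2 ?posrE ?expR_gt0//.
  by have := @expR_ge1Dx R 96; lra.
have P2 : Pr P A2 <= 16^-1.
  by rewrite (tail_of_cos mY (divr_gt0 t0 (ltr0Sn R 1)) hY).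
apply: (@le_trans _ _ (Pr P (A1 `|` A2))).
  apply: Pr_le; [exact: mE|exact: measurableU|].
  move=> w /=; rewrite /E/= => h; have [h1|h1] := leP (sqnorm2 (x j w)) (n%:R * v / 2); [by left|right].
  have nx : 0 <= sqnorm2 (x j w) by exact: sqnorm2_ge0.
  rewrite /A2/= /Y normrM normfV (gtr0_norm r0) ltr_pdivlMr//.
  apply: le_lt_trans h; rewrite -ler_sqr ?nnegrE ?mulr_ge0 ?sqrtr_ge0 ?divr_ge0 ?(ltW t0)//.
  rewrite !exprMn !sqr_sqrtr//; last by rewrite mulr_ge0// ltW.
  have h2 : v * sqnorm2 e <= 4 * sqnorm2 (x j w).
    by apply: (@le_trans _ _ (v * (2 * n%:R))); [rewrite ler_wpM2l// ltW|lra].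
  rewrite (_ : _ * (v * sqnorm2 e) = t ^+ 2 * (v * sqnorm2 e / 4)); last by field.
  by rewrite ler_wpM2l ?sqr_ge0//; lra.
by apply: (le_trans (Pr_subU P mA1 mA2)); lra.
Qed.

Let count_prob e : good e ->
  expR (- 48) <= Pr P [set w | p%:R * (2 * Phibar t) < \sum_j \1_(E e j) w].
Proof.
move=> ge; have sumE : p%:R * (2 * Phibar t) <= \sum_j Pr P (E e j).
  rewrite (_ : p%:R * _ = \sum_(j < p) 2 * Phibar t); last by rewrite sumr_const card_ord mulr_natl.
  apply: ler_sum => j _; apply: (@spherical_tail _ _ _ P n (x j) (S j j) e t (@mx j) (Sd j)) => //.
  - by rewrite (leq_trans _ n4).
  - by case: ge.
apply: (le_trans (@indep_count_exceeds_mean _ _ _ P _ _ (E e) (fun j => Pr P (E e j)) gm cols_indep (sE e) (fun=> erefl) _ _)).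
- by move=> j; exact: prob_le.
- exact: le_trans sumE.
have mN : mfunT (fun w => \sum_j \1_(E e j) w : R).
  have [] // : bmf (fun w => \sum_j \1_(E e j) w : R).
  by apply: bmf_sum => j; apply: bmf_indic; exact: mE.
apply: Pr_le; try exact: measurable_setlt.
by move=> w /=; exact: le_lt_trans.
Qed.

Let good_prob : expR (- 128) - expR (- 384) <= Pr P [set w | good (sigma^-1 *: eps w)].
Proof.
have s2 : 0 < sigma ^+ 2 by rewrite exprn_gt0.
have me : mfunT (fun w => sqnorm2 (eps w)) by exact: measurable_sqnorm2.
pose A1 : set T := [set w | sigma ^+ 2 * (n%:R + t ^+ 2) <= sqnorm2 (eps w)].
pose A2 : set T := [set w | sigma ^+ 2 * (2 * n%:R) < sqnorm2 (eps w)].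
have mA1 : measurable A1 by exact: measurable_setle.
have mA2 : measurable A2 by exact: measurable_setlt.
have P1 : expR (- 128) <= Pr P A1.
  by apply: (sqnorm2_noise_lower meps geps.2 sigma0 n4) => //; exact: sqr_ge0.
have P2 : Pr P A2 <= expR (- 384).
  have q1 : qform (sigma ^+ 2)%:M (1%:M : 'cV[R]_1) = sigma ^+ 2.
    by rewrite qform_scalar /sqnorm2 big_ord1 mxE expr1n mulr1.
  have := chi_chernoff (meps : random_mx (eps : T -> 'M[R]_(n, 1))) (noise_rows meps geps.2 sigma0) (V := 1%:M) (y := 4^-1).
  rewrite q1 ger0_norm// => /(_ s2 (lexx _)) h.
  apply: (@le_trans _ _ (Pr P [set w | 4 * 4^-1 ^+ 2 * (n%:R * sigma ^+ 2) <=
      4^-1 * (sqnorm2 (eps w *m 1%:M) - n%:R * sigma ^+ 2)])); last first.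
    apply: (le_trans h); rewrite ler_expR.
    have n4' : 4096 <= n%:R :> R by rewrite ler_nat.
    have -> : 3 / 2 * 4^-1 ^+ 2 * n%:R = 3 / 32 * n%:R :> R by field.
    lra.
  apply: Pr_le => //.
    apply: measurable_setle => //; apply: measurable_funM => //; apply: measurable_funB => //.
    by under eq_fun do rewrite mulmx1.
  have e4 : 4 * 4^-1 ^+ 2 = 4^-1 :> R by field.
  move=> w; rewrite /A2/= mulmx1 e4 mulrCA [sigma ^+ 2 * _]mulrC.
  by move: (sqnorm2 _) (n%:R * _) => u b; lra.
have hg w : good (sigma^-1 *: eps w) <-> A1 w /\ ~ A2 w.
  rewrite /good /A1 /A2 /= sqnorm2Z exprVn; split.
    by rewrite ler_pdivlMl// ler_pdivrMl// => -[-> h]; split => //; apply/negP; rewrite -leNgt.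
  by rewrite ler_pdivlMl// ler_pdivrMl// => -[-> /negP]; rewrite -leNgt.
rewrite (_ : [set w | _] = A1 `\` A2); last by apply/seteqP; split => w /hg.
have : Pr P A1 <= Pr P (A1 `\` A2) + Pr P A2.
  apply: (le_trans (Pr_le P mA1 (measurableU _ _ (measurableD mA1 mA2) mA2) _)).
    by move=> w h; have [h2|h2] := pselect (A2 w); [right|left].
  by apply: Pr_subU => //; exact: measurableD.
lra.
Qed.

(** Here the noise is frozen and the design random, the reverse of the other conditional arguments:
    given a direction, independent columns make the exceedances independent. *)
Lemma columns_count_above_mean :
  expR (- 48) * (expR (- 128) - expR (- 384)) <=
  Pr P [set w | 2 * Phibar t <
    (\sum_j (t < `|lin1 (x j w) eps w / (sigma * sqrt (sqnorm2 (x j w)))|)%R%:R) / p%:R].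
Proof.
pose G1 := gen_mx eps; pose G2 := gen_mx X.
have G1m : <<s G1 >> `<=` measurable := random_mxP meps.
have G2m : <<s G2 >> `<=` measurable := random_mxP mX.
have ind A B : <<s G1 >> A -> <<s G2 >> B -> P (A `&` B) = (P A * P B)%E.
  by move=> sA sB; rewrite setIC muleC; apply: geps.1.
pose N (a b : T) : R := \sum_j (t * sqrt (sqnorm2 (x j b)) < `|lin1 (sigma^-1 *: eps a) (x j) b|)%R%:R.
pose F (a b : T) : R := (p%:R * (2 * Phibar t) < N a b)%R%:R.
have linE a b j : lin1 (sigma^-1 *: eps a) (x j) b = \sum_i (sigma^-1 * eps a i 0) * X b i j.
  by rewrite lin1E; apply: eq_bigr => i _; rewrite scalemxE /x mxE.
have jF : jmeas G1 G2 F.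
  apply: jmeas_lt; first exact: jmeas_cst.
  apply: jmeas_sum => j; apply: jmeas_lt.
    apply: jmeasM; first exact: jmeas_cst.
    apply: jmeas2; apply: (smeas_comp measurable_sqrtr); apply: smeas_sum => i.
    apply: (smeas_comp (h := fun b => b ^+ 2)); first exact: exprn_measurable.
    by rewrite (_ : (fun w => x j w i 0) = (fun w => X w i j)); [exact: smeas_entry|apply/funext => w; rewrite /x mxE].
  apply: (jmeas_comp (h := Num.norm)) => //.
  rewrite (_ : (fun a b => _) = (fun a b => \sum_i (sigma^-1 * eps a i 0) * X b i j)); last first.
    by apply/funext => a; apply/funext => b; rewrite linE.
  apply: jmeas_sum => i; apply: jmeasM; last by apply: jmeas2; exact: smeas_entry.
  by apply: jmeas1; apply: smeasM; [exact: smeas_cst|exact: smeas_entry].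
have F01 a b : 0 <= F a b <= 1 by rewrite /F; case: (_ < _); rewrite lexx ler01.
have [bF bE bd dec] := decouple_Ex G1m G2m ind jF F01.
have EN e j w : (t * sqrt (sqnorm2 (x j w)) < `|lin1 e (x j) w|)%R%:R = \1_(E e j) w :> R.
  by rewrite indicE; congr (_%:R); congr nat_of_bool; apply/idP/idP; rewrite inE.
have mgood : measurable [set w | good (sigma^-1 *: eps w)].
  have ms : random_mx (fun w => sigma^-1 *: eps w).
    by move=> i j; under eq_fun do rewrite scalemxE; apply: measurable_funM => //; exact: meps.
  by apply: measurableI; apply: measurable_setle => //; exact: measurable_sqnorm2.
have h : expR (- 48) * Pr P [set w | good (sigma^-1 *: eps w)] <= Ex P (fun w => F w w).
  rewrite dec -[Pr P _](Ex_indic P mgood) -ExZ; last exact: bmf_indic.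
  apply: Ex_le => //; first by apply: bmfZ; exact: bmf_indic.
  move=> a; rewrite indicE; have [ga|ga] := pselect (good (sigma^-1 *: eps a)).
    rewrite mem_set// mulr1; apply: (le_trans (count_prob ga)).
    have mN : mfunT (fun w => \sum_j \1_(E (sigma^-1 *: eps a) j) w : R).
      have [] // : bmf (fun w => \sum_j \1_(E (sigma^-1 *: eps a) j) w : R).
      by apply: bmf_sum => j; apply: bmf_indic; exact: mE.
    rewrite -[Pr P _]Ex_indic; last exact: measurable_setlt.
    apply: le_of_eq; apply: Ex_ext => w.
    rewrite /F /N indicE; congr (_%:R); congr nat_of_bool; under eq_bigr do rewrite EN.
    by apply/idP/idP; rewrite inE.
  by rewrite memNset// mulr0 Ex_ge0// => b; have /andP[] := F01 a b.
have p0 : 0 < p%:R :> R.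
  by rewrite ltr0n lt0n; apply: contraTneq pt => ->; rewrite mul0r -ltNge.
apply: (@le_trans _ _ (Ex P (fun w => F w w))).
  by apply: le_trans h; rewrite ler_pM2l ?expR_gt0//; exact: good_prob.
set B := [set w | _].
have NE w : N w w = \sum_j (t < `|lin1 (x j w) eps w / (sigma * sqrt (sqnorm2 (x j w)))|)%R%:R.
  apply: eq_bigr => j _; congr (_%:R); congr nat_of_bool.
  rewrite (_ : lin1 (sigma^-1 *: eps w) (x j) w = lin1 (x j w) eps w / sigma); last first.
    by rewrite linE lin1E mulr_suml; apply: eq_bigr => i _; rewrite /x mxE; ring.
  have [h0|h0] := leP (sqnorm2 (x j w)) 0; last first.
    have r0 : 0 < sqrt (sqnorm2 (x j w)) by rewrite sqrtr_gt0.
    by rewrite invfM mulrA [in RHS]normrM [X in _ = (_ < _ * X)]gtr0_norm ?invr_gt0// ltr_pdivlMr.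
  have z0 : sqnorm2 (x j w) = 0 by apply/eqP; rewrite eq_le h0 sqnorm2_ge0.
  have -> : lin1 (x j w) eps w = 0.
    by rewrite lin1E big1// => i _; rewrite (sqnorm2_eq0 z0) mxE mul0r.
  by rewrite !mul0r normr0 z0 sqrtr0 mulr0 ltxx ltNge (ltW t0).
have BE w : F w w = \1_B w.
  rewrite /F NE indicE; congr (_%:R); congr nat_of_bool.
  rewrite mulrC -ltr_pdivlMr//; apply/idP/idP; rewrite inE//.
have mB : measurable B.
  rewrite (_ : B = [set w | 2^-1 < F w w]); first by apply: measurable_setlt => //; case: bd.
  apply/seteqP; split => w /= h1; rewrite BE indicE in h1 *.
    by rewrite mem_set//=; lra.
  by apply: contrapT => h2; move: h1; rewrite memNset//=; apply/negP; rewrite -leNgt; lra.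
rewrite -[Pr P B](Ex_indic P mB) le_eqVlt; apply/orP; left; apply/eqP; apply: Ex_ext => w.
exact: BE.
Qed.

End CountAboveMean.

(** * The estimator on a good design *)

Section StatisticMeasurability.
Context {R : realType} {d} {T : measurableType d}.

Lemma random_mulmx m q r (A : T -> 'M[R]_(m, q)) (B : T -> 'M[R]_(q, r)) :
  random_mx A -> random_mx B -> random_mx (fun w => A w *m B w).
Proof.
move=> mA mB i j; under eq_fun do rewrite mxE; apply: measurable_sum => k.
by apply: measurable_funM; [exact: mA|exact: mB].
Qed.

Lemma random_addmx m q (A B : T -> 'M[R]_(m, q)) :
  random_mx A -> random_mx B -> random_mx (fun w => A w + B w).
Proof. by move=> mA mB i j; under eq_fun do rewrite mxE; apply: measurable_funD; [exact: mA|exact: mB]. Qed.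

Lemma random_submx m q (A B : T -> 'M[R]_(m, q)) :
  random_mx A -> random_mx B -> random_mx (fun w => A w - B w).
Proof. by move=> mA mB i j; under eq_fun do rewrite submxE; apply: measurable_funB; [exact: mA|exact: mB]. Qed.

Lemma random_scalemx m q (a : T -> R) (A : T -> 'M[R]_(m, q)) :
  mfunT a -> random_mx A -> random_mx (fun w => a w *: A w).
Proof. by move=> ma mA i j; under eq_fun do rewrite mxE; apply: measurable_funM => //; exact: mA. Qed.

Lemma random_trmx m q (A : T -> 'M[R]_(m, q)) : random_mx A -> random_mx (fun w => (A w)^T).
Proof. by move=> mA i j; under eq_fun do rewrite mxE; exact: mA. Qed.

Lemma random_cstmx m q (A : 'M[R]_(m, q)) : random_mx (fun _ : T => A).
Proof. by move=> i j; exact: measurable_cst. Qed.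

Variables (n p : nat) (X : T -> 'M[R]_(n, p)) (eps : T -> 'cV[R]_n) (beta : 'cV[R]_p).
Variables (sigma : R) (lamj : 'I_p -> R).
Variables (bh : T -> 'cV[R]_p) (gh : T -> 'I_p -> 'cV[R]_(p.-1)).
Hypotheses (mX : random_mx X) (meps : random_mx eps) (mbh : random_mx bh)
  (mgh : forall j, random_mx (fun w => gh w j)).

Let random_Thetahat : random_mx (fun w => Thetahat (X w) lamj (gh w)).
Proof.
have mt j : mfunT (fun w => tauhat2 (X w) lamj (gh w) j).
  apply: measurable_funD.
    apply: measurable_funM => //; apply: measurable_sqnorm2; apply: random_submx.
      by move=> a b; under eq_fun do rewrite mxE; exact: mX.
    by apply: random_mulmx => // a b; under eq_fun do rewrite mxE; exact: mX.
  apply: measurable_funM => //; apply: measurable_sum => i; apply: measurableT_comp => //; exact: mgh.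
have mti j : mfunT (fun w => (tauhat2 (X w) lamj (gh w) j)^-1).
  exact: (measurableT_comp measurable_invr).
move=> j k; under eq_fun do rewrite mxE.
case: (unlift j k) => [k'|]; last exact: mti.
by apply: measurable_funM; [exact: measurableT_comp|exact: mgh].
Qed.

Let random_Omegahat : random_mx (fun w => Omegahat (X w) lamj (gh w)).
Proof.
apply: random_mulmx; last by apply: random_trmx; exact: random_Thetahat.
apply: random_mulmx; first exact: random_Thetahat.
by apply: random_scalemx => //; apply: random_mulmx => //; exact: random_trmx.
Qed.

Let measurable_sqrtOmega j :
  mfunT (fun w => sqrt (Omegahat (X w) lamj (gh w) j j)).
Proof. by apply: (measurableT_comp measurable_sqrtr); exact: random_Omegahat. Qed.

Lemma measurable_zstat j :
  mfunT (fun w => zstat (X w) (eps w) beta sigma lamj (bh w) (gh w) j).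
Proof.
have mD : random_mx (fun w => debiased (X w) (eps w) beta lamj (bh w) (gh w)).
  apply: random_addmx => //; apply: random_scalemx => //; apply: random_mulmx.
    by apply: random_mulmx; [exact: random_Thetahat|exact: random_trmx].
  apply: random_submx; last exact: random_mulmx.
  by apply: random_addmx => //; apply: random_mulmx => //; exact: random_cstmx.
apply: measurable_funM; last exact: (measurableT_comp measurable_invr).
by apply: measurable_funM => //; apply: measurable_funM => //; exact: mD.
Qed.

Lemma measurable_wstd j :
  mfunT (fun w => wstd (X w) (eps w) sigma lamj (gh w) j).
Proof.
apply: measurable_funM.
  have mW : random_mx (fun w => wnoise (X w) (eps w) lamj (gh w)).
    apply: random_scalemx => //; apply: random_mulmx => //.
    by apply: random_mulmx; [exact: random_Thetahat|exact: random_trmx].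
  exact: mW.
by apply: (measurableT_comp measurable_invr); apply: measurable_funM.
Qed.

End StatisticMeasurability.

Section EstimatorMeasurability.
Context {R : realType} {d} {T : measurableType d}.
Variables (p : nat) (tau0 tau1 : R).

Lemma measurable_exceed_prop (z : T -> 'I_p -> R) t : (forall j, mfunT (fun w => z w j)) ->
  mfunT (fun w => exceed_prop (z w) t).
Proof.
move=> mz; under eq_fun do rewrite exceed_propE.
apply: measurable_funM => //; apply: measurable_sum => j.
apply: (eq_measurable_fun (\1_[set w | t < `|z w j|] : T -> R)).
  by move=> w _; rewrite indicE; congr (_%:R); congr nat_of_bool; apply/idP/idP; rewrite inE.
by apply: measurable_indic; apply: measurable_setlt => //; exact: measurableT_comp.
Qed.

Lemma Tgrid_bounded : {N | forall t, Tgrid p tau0 tau1 t -> (t < N)%N &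
  N%:R <= sqrt (tau1 * ln p%:R) + 1}.
Proof.
exists (Num.trunc (sqrt (tau1 * ln p%:R))).+1 => [t /andP[_ h]|]; last first.
  by rewrite -natr1 lerD2r truncn_le sqrtr_ge0.
by rewrite -(ltr_nat R); apply: (le_lt_trans h); exact: truncnS_gt.
Qed.

Lemma measurable_Vstar (z : T -> 'I_p -> R) : (forall j, mfunT (fun w => z w j)) ->
  mfunT (fun w => Vstar (z w) tau0 tau1).
Proof.
move=> mz; have [N hN _] := Tgrid_bounded; apply: (measurable_sup hN) => t.
apply: measurable_funM => //; apply: measurable_funB => //; exact: measurable_exceed_prop.
Qed.

Lemma measurable_pihat (z : T -> 'I_p -> R) c : (forall j, mfunT (fun w => z w j)) ->
  mfunT (fun w => pihat (z w) tau0 tau1 c).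
Proof.
move=> mz; have [N hN _] := Tgrid_bounded; apply: (measurable_sup hN) => t.
apply: measurable_funM => //; apply: measurable_funB => //; apply: measurable_funB => //.
exact: measurable_exceed_prop.
Qed.

End EstimatorMeasurability.

Definition cst_corr {R : realType} (cmin kap : R) : R := 4 / cmin ^+ 2 * cst_gram cmin kap.

Lemma cst_corr_ge0 {R : realType} (cmin kap : R) : 0 <= cst_corr cmin kap.
Proof.
apply: mulr_ge0; first by apply: divr_ge0; [exact: ler0n|exact: sqr_ge0].
apply: divr_ge0; last exact: sqr_ge0.
apply: mulr_ge0; first exact: ler0n.
apply: addr_ge0; last first.
  by apply: mulr_ge0; [exact: ler0n|rewrite -[4%N]/(2 * 2)%N exprM; exact: sqr_ge0].
apply: addr_ge0; first by apply: addr_ge0; exact: sqr_ge0.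
by apply: mulr_ge0; [exact: ler0n|apply: mulr_ge0; exact: sqr_ge0].
Qed.

(** The bound of [bias_count] with [q = sqrt (sm + 2) l] and the isometry constant [8 sqrt s l]. *)
Definition shell_width {R : realType} (n p sm s : nat) (cmin kap K : R) : R :=
  let l := sqrt (ln p%:R / n%:R) in
  K * cst_bias cmin kap * (sqrt n%:R * l *
    (sqrt (sm + 2)%:R * l + 8 * sqrt s%:R * l + (minn s sm)%:R * l)).

Section DiagonalCovariance.
Context {R : realType} {p : nat}.
Variables (S : 'M[R]_p) (cmin : R).
Hypotheses (cmin0 : 0 < cmin) (sS : S^T = S) (Smin : forall V, cmin * sqnorm2 V <= qform S V)
  (sm0 : smax S = 0%N).

Lemma udir_diag j : udir S j = delta_mx j 0.
Proof.
apply/matrixP => k i; rewrite ord1 !mxE eqxx andbT; have [->|kj] := eqVneq k j.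
  by have := udir_self cmin0 Smin j; rewrite !mxE.
apply/eqP/negPn/negP => h; have := udir_sparsity sS j; rewrite sm0 leqn0 cards_eq0 => /eqP/setP/(_ k).
by rewrite !inE kj -[_ != _]/(~~ _) => /negbT/negP; apply; rewrite !mxE.
Qed.

Lemma cov_diag i j : i != j -> S i j = 0.
Proof.
move=> ij; have /matrixP/(_ i 0) := cov_udir cmin0 Smin j.
by rewrite udir_diag -colE !mxE (negbTE ij) mulr0.
Qed.

End DiagonalCovariance.

Section GoodDesign.
Context {R : realType} {n p : nat}.
Variables (X : 'M[R]_(n, p)) (eps : 'cV[R]_n) (beta : 'cV[R]_p) (S : 'M[R]_p) (cmin cmax : R).
Variables (kap sigma : R) (s : nat) (bh : 'cV[R]_p) (gh : 'I_p -> 'cV[R]_(p.-1)).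
Let l : R := sqrt (ln p%:R / n%:R).
Let sm := smax S.
Let q : R := sqrt (sm + 2)%:R * l.
Hypotheses (n0 : (0 < n)%N) (p1 : (1 < p)%N) (cmin0 : 0 < cmin) (sS : S^T = S)
  (Smin : forall V, cmin * sqnorm2 V <= qform S V) (cmax0 : 0 <= cmax)
  (Smax : forall V, qform S V <= cmax * sqnorm2 V) (Sd : forall j, S j j <= 1) (kap24 : 24 <= kap)
  (s0 : (0 < s)%N) (betas : (sparsity beta <= s)%N) (sigma0 : 0 < sigma) (l12 : 12 * l <= 1) (q1 : q <= 1)
  (xmsmall : 8 * q * (cmax + 64) <= cmin / 2) (qsmall : cst_resid cmin kap * q <= cmin / 2)
  (xssmall : 8 * sqrt s%:R * l * (cmax + 64) <= cmin / 2) (gd : good_design S X s sm)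
  (noise : forall k, `|(X^T *m eps) k 0| / n%:R <= 4 * sigma * l)
  (hbh : is_lasso X (response X eps beta) (8 * sigma * l) bh) (hgh : is_nodewise_lasso X (fun=> kap * l) gh).

Let nR : 0 < n%:R :> R. Proof. by rewrite ltr0n. Qed.
Let l0 : 0 < l.
Proof. by rewrite sqrtr_gt0 divr_gt0// ln_gt0// ltr1n. Qed.
Let q0 : 0 <= q. Proof. by rewrite mulr_ge0 ?sqrtr_ge0// ltW. Qed.
Let qE : q ^+ 2 = (sm + 2)%:R * l ^+ 2.
Proof. by rewrite exprMn sqr_sqrtr. Qed.
Let xm0 : 0 <= 8 * q. Proof. by rewrite mulr_ge0. Qed.
Let xs0 : 0 < 8 * sqrt s%:R * l.
Proof. by rewrite !mulr_gt0// sqrtr_gt0 ltr0n. Qed.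
Let RIPm : forall a, `|qform (Sigmahat X - S) a| <=
  8 * q * qform S a + 4 * (8 * q) * norm1 a ^+ 2 / (sm + 2)%:R.
Proof. by case: gd => _ h _ _ _ a; have := h a; rewrite /q -!mulrA. Qed.
Let RIP2 : forall k j, `|bform (Sigmahat X - S) (delta_mx k 0) (udir S j)| <= 12 * l.
Proof. by case: gd. Qed.
Let RIPu : forall j, `|qform (Sigmahat X - S) (udir S j)| <= 12 * l.
Proof. by case: gd. Qed.
Let RIPs : forall a b, `|qform (Sigmahat X - S) (a + Umx S *m b)| <=
  8 * sqrt s%:R * l * qform S (a + Umx S *m b) +
        4 * (8 * sqrt s%:R * l) * (norm1 a + norm1 b) ^+ 2 / s%:R.
Proof. by case: gd. Qed.

Notation rho := (resid X gh).
Notation lamj := (fun=> kap * l).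

Let smS : (smax S <= sm)%N := leqnn _.
Let x2l : 12 * l <= 12 * l := lexx _.
Let rho0 j : 0 < sqnorm2 (rho j).
Proof. exact: (resid_gt0 n0 cmin0 sS Smin Smax smS l0 kap24 xm0 xmsmall RIPm x2l RIP2 RIPu q0 q1 qE hgh qsmall). Qed.
Let tau0 j : 0 < tauhat2 X lamj gh j.
Proof. exact: (tauhat2_gt0 n0 cmin0 sS Smin Smax Sd smS l0 kap24 xm0 xmsmall RIPm x2l RIP2 RIPu q0 q1 qE hgh qsmall). Qed.

Let resid_ge j : cmin / 2 <= sqnorm2 (rho j) / n%:R.
Proof.
have := resid_bound n0 cmin0 sS Smin Smax smS l0 kap24 xm0 xmsmall RIPm x2l RIP2 RIPu q0 q1 qE hgh j.
have := prec_inv_ge cmin0 Smin j; rewrite ler_norml => h /andP[h1 _].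
by move: h h1 qsmall; set a := sqnorm2 _ / _; set b := _ * q; set c := _^-1; move=> *; lra.
Qed.

Let corr_sum : (\sum_i \sum_j (bform 1%:M (rho i) (rho j)) ^+ 2 /
    (sqnorm2 (rho i) * sqnorm2 (rho j))) / p%:R ^+ 2 <= cst_corr cmin kap * (p%:R^-1 + q ^+ 2).
Proof.
have pR : 0 < p%:R :> R by rewrite ltr0n ltnW.
rewrite exchange_big ler_pdivrMr ?exprn_gt0//.
apply: (@le_trans _ _ (\sum_(j < p) cst_corr cmin kap * (1 + p%:R * q ^+ 2))); last first.
  rewrite sumr_const card_ord -mulr_natl le_eqVlt; apply/orP; left; apply/eqP; field.
  by rewrite gt_eqF.
apply: ler_sum => j _.
have := gram_sum n0 cmin0 sS Smin Smax Sd smS l0 kap24 xm0 xmsmall RIPm x2l RIP2 RIPu q0 q1 qE hgh j.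
have c40 : 0 <= 4 / cmin ^+ 2 by rewrite divr_ge0// sqr_ge0.
move=> /(ler_wpM2l c40); rewrite mulrA -/(cst_corr cmin kap); apply: le_trans; rewrite mulr_sumr.
apply: ler_sum => i _; set b := bform _ _ _.
have [ri rj] := (resid_ge i, resid_ge j).
have a0 : 0 < cmin / 2 * n%:R by rewrite mulr_gt0// divr_gt0.
rewrite !ler_pdivlMr// in ri rj.
have h : (cmin / 2 * n%:R) ^+ 2 <= sqnorm2 (rho i) * sqnorm2 (rho j).
  by rewrite expr2; apply: ler_pM => //; exact: ltW.
have -> : 4 / cmin ^+ 2 * (b / n%:R) ^+ 2 = b ^+ 2 / (cmin / 2 * n%:R) ^+ 2.
  by field; rewrite !gt_eqF.
by rewrite ler_wpM2l ?sqr_ge0// lef_pV2 ?posrE ?mulr_gt0// exprn_gt0.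
Qed.

(** For [sm = 0] the l1 error bound of the nodewise Lasso is proportional to [sm], hence 0: the
    regression selects exactly nothing. *)
Lemma resid_diag j : smax S = 0%N -> resid X gh j = col j X.
Proof.
move=> sm0; rewrite -mul_vdir colE; congr (X *m _); rewrite -(udir_diag cmin0 sS Smin sm0).
have := norm1_dir_err n0 cmin0 sS Smin Smax smS l0 kap24 xm0 xmsmall RIPm x2l RIP2 hgh j.
rewrite /sm sm0 mul0r mulr0 mul0r => h.
apply/matrixP => k i; rewrite ord1; apply/eqP; rewrite -subr_eq0 -normr_le0; apply: le_trans h.
by rewrite /norm1 (bigD1 k)//= !mxE lerDl sumr_ge0.
Qed.

(* [m j] is the signal, the contribution of [beta j] to the statistic. *)
Lemma good_design_statistics (K : R) : 1 <= K -> cst_dir cmin cmax < K ^+ 2 ->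
  [/\ forall j, wstd X eps sigma lamj gh j = bform 1%:M (rho j) eps / (sigma * sqrt (sqnorm2 (rho j))),
    forall j, 0 < sqnorm2 (rho j),
    (\sum_i \sum_j (bform 1%:M (rho i) (rho j)) ^+ 2 /
      (sqnorm2 (rho i) * sqnorm2 (rho j))) / p%:R ^+ 2 <= cst_corr cmin kap * (p%:R^-1 + q ^+ 2) &
    exists (J : {set 'I_p}) (m : 'I_p -> R),
      [/\ #|J|%:R * K ^+ 2 <= (36 / cmin ^+ 2 + cst_dir cmin cmax) * s%:R,
        forall j, j \notin J ->
          `|zstat X eps beta sigma lamj bh gh j - wstd X eps sigma lamj gh j - m j| <= shell_width n p sm s cmin kap K,
        forall j, (1 - cst_resid cmin kap / cmin * q) *
           (sqrt n%:R * `|beta j 0| / sigma / sqrt (invmx S j j)) <= `|m j| &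
        forall j, beta j 0 = 0 -> m j = 0]].
Proof.
move=> K1 KC; split => //.
- by move=> j; exact: wstd_resid.
have [J [cardJ hJ]] := bias_count n0 cmin0 sS Smin Smax Sd smS l0 kap24 xm0 xmsmall RIPm x2l RIP2 RIPu q0 q1 qE hgh cmax0 qsmall s0 betas sigma0 xs0 xssmall RIPs hbh noise K1 KC.
pose Rj j := sqrt (sqnorm2 (rho j) / n%:R).
have Rj0 j : 0 < Rj j by rewrite sqrtr_gt0 divr_gt0.
exists J, (fun j => sqrt n%:R * (tauhat2 X lamj gh j * beta j 0) / (sigma * Rj j)); split => //.
- move=> j jJ; rewrite (zstat_decomp _ _ _ n0 sigma0 (rho0 j) (tau0 j)); apply: le_trans (hJ j jJ).
  apply: le_of_eq; congr `|_|; rewrite -/(Rj j); field.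
  by rewrite !gt_eqF.
- move=> j; have h := resid_scale n0 cmin0 sS Smin Smax Sd smS l0 kap24 xm0 xmsmall RIPm x2l RIP2 RIPu q0 q1 qE hgh qsmall j.
  have c0 : 0 <= sqrt n%:R * `|beta j 0| / sigma.
    by rewrite divr_ge0 ?(ltW sigma0)// mulr_ge0 ?sqrtr_ge0.
  have -> : `|sqrt n%:R * (tauhat2 X lamj gh j * beta j 0) / (sigma * Rj j)| =
      tauhat2 X lamj gh j / Rj j * (sqrt n%:R * `|beta j 0| / sigma).
    rewrite normrM (ger0_norm (_ : 0 <= (sigma * Rj j)^-1)); last by rewrite invr_ge0 mulr_ge0 ?ltW.
    rewrite normrM (ger0_norm (sqrtr_ge0 _)) normrM (gtr0_norm (tau0 j)); field.
    by rewrite !gt_eqF.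
  have := ler_wpM2r c0 h; rewrite sqrtrV; last exact: ltW (prec_gt0 cmin0 Smin j).
  by rewrite -/(Rj j); apply: le_trans; apply: le_of_eq; ring.
- by move=> j ->; rewrite !mulr0 mul0r.
Qed.

End GoodDesign.

Section SandwichArithmetic.
Context {R : realType}.

Lemma upper_arith (E G Sh Jp q c pr nJ ys : R) : E <= pr + Jp + G + Sh -> G - q <= c ->
  Jp <= nJ -> Sh <= ys -> E - q - c <= pr + nJ + ys.
Proof. lra. Qed.

Lemma signal_arith (t a D w z m x mu : R) : t + a + D < mu -> mu <= x -> x <= m ->
  m <= z + w + D -> w <= a -> t < z.
Proof. lra. Qed.

Lemma lower_arith (E G Sh Jp tl q c c' pr nJ yt ys yv : R) :
  pr - Jp - 2 * tl + G - Sh <= E -> - yv <= G - q -> c <= c' -> Jp <= nJ -> tl <= yt -> Sh <= ys ->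
  pr - nJ - 2 * yt - ys - yv - c' <= E - q - c.
Proof. lra. Qed.

End SandwichArithmetic.

Section FiniteSample.
Context {R : realType} {d} {T : measurableType d}.
Variable P : probability T R.
Variables (n p : nat) (X : T -> 'M[R]_(n, p)) (S : 'M[R]_p) (eps : T -> 'cV[R]_n).
Variables (beta : 'cV[R]_p) (sigma kap cmin cmax tau0 tau1 alpha cs : R).
Variables (bh : T -> 'cV[R]_p) (gh : T -> 'I_p -> 'cV[R]_(p.-1)).
Let L : R := ln p%:R.
Let l : R := sqrt (L / n%:R).
Let s := sparsity beta.
Let sm := smax S.
Let q : R := sqrt (sm + 2)%:R * l.
Let lamj : 'I_p -> R := fun=> kap * l.
Let prop : R := s%:R / p%:R.
Let z w := zstat (X w) (eps w) beta sigma lamj (bh w) (gh w).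
Let W w := wstd (X w) (eps w) sigma lamj (gh w).
Hypotheses (n0 : (0 < n)%N) (p1 : (1 < p)%N) (mX : random_mx X) (meps : random_mx eps)
  (geps : gaussian_noise_given P X eps (sigma ^+ 2)) (gX : iid_gaussian_rows P X S) (mbh : random_mx bh)
  (mgh : forall j, random_mx (fun w => gh w j))
  (hbh : forall w, is_lasso (X w) (response (X w) (eps w) beta) (8 * sigma * l) (bh w))
  (hgh : forall w, is_nodewise_lasso (X w) lamj (gh w)) (cmin0 : 0 < cmin) (sS : S^T = S)
  (Smin : forall V, cmin * sqnorm2 V <= qform S V) (cmax0 : 0 <= cmax)
  (Smax : forall V, qform S V <= cmax * sqnorm2 V) (Sd : forall j, S j j <= 1) (kap24 : 24 <= kap)
  (s2 : (1 < s)%N) (sigma0 : 0 < sigma) (l12 : 12 * l <= 1) (q8 : 8 * q <= 1)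
  (xmsmall : 8 * q * (cmax + 64) <= cmin / 2) (qsmall : cst_resid cmin kap * q <= cmin / 2)
  (xs1 : 8 * sqrt s%:R * l <= 1) (xssmall : 8 * sqrt s%:R * l * (cmax + 64) <= cmin / 2).

Let pR : 0 < p%:R :> R. Proof. by rewrite ltr0n ltnW. Qed.
Let l0 : 0 < l. Proof. by rewrite sqrtr_gt0 divr_gt0 ?ltr0n// ln_gt0// ltr1n. Qed.
Let rho w := resid (X w) (gh w).

Lemma good_event : exists B : set T, [/\ measurable B, Pr P B <= 7 / p%:R &
  forall w, ~ B w -> good_design S (X w) s sm /\
    forall k, `|((X w)^T *m eps w) k 0| / n%:R <= 4 * sigma * l].
Proof.
have [B1 [mB1 PB1 hB1]] : exists B : set T, [/\ measurable B, Pr P B <= 6 / p%:R &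
    forall w, ~ B w -> good_design S (X w) s sm].
  by apply: (good_design_event mX gX n0 p1 cmin0 sS Smin Sd) => //; rewrite -mulrA.
have [B2 [mB2 PB2 hB2]] := noise_event mX n0 p1 meps geps sigma0.
exists (B1 `|` B2); split; first exact: measurableU.
  apply: (le_trans (Pr_subU P mB1 mB2)); rewrite (_ : 7 / p%:R = 6 / p%:R + p%:R^-1); first exact: lerD.
  by field; rewrite gt_eqF.
move=> w /not_orP[h1 h2]; have gd := hB1 w h1; split => //; apply: (hB2 w h2) => k.
case: gd => _ _ _ _ /(_ k); have := @qform_gram_dev.
rewrite /qform bformBm -!/(qform _ _) qform_Sigmahat -colE (_ : qform S _ = S k k); last by rewrite /qform bform_delta.
rewrite ler_norml => _ /andP[_ h]; have nR : 0 < n%:R :> R by rewrite ltr0n.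
have hl : sqnorm2 (col k (X w)) / n%:R - S k k <= 12 * l := h.
rewrite -ler_pdivrMr//; rewrite lerBlDr in hl; apply: (le_trans hl).
by apply: (le_trans (lerD l12 (Sd k))).
Qed.

Let std w := std_resid eps sigma rho w.

(** The exceptional sets are those of the design and noise, of the quantile, of the shells, of the
    relevant tails and of the variance. The lower bound assumes a nonnegative left side, because
    dividing by [1 - 2 Phibar t <= 1] only enlarges nonnegative numbers. *)
Lemma consistency_event (K t a ys yt yv : R) (N : nat) :
  0 < alpha -> alpha < 1 -> cs = quantile P (fun w => Vstar (W w) tau0 tau1) (1 - alpha) ->
  1 <= K -> cst_dir cmin cmax < K ^+ 2 ->
  let D := shell_width n p sm s cmin kap K in
  let t0 := sqrt (tau0 * L) in
  let nJ := (36 / cmin ^+ 2 + cst_dir cmin cmax) / K ^+ 2 in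
  0 <= D -> D <= t0 -> 1 <= t0 -> 0 < ys -> 0 < yt -> 0 < yv -> 0 <= a -> a <= t ->
  (forall t, Tgrid p tau0 tau1 t -> (t < N)%N) ->
  (exists2 m, Tgrid p tau0 tau1 m & t = m%:R) ->
  t + a + D < (1 - cst_resid cmin kap / cmin * q) * mu_min n beta sigma S ->
  exists B : set T, [/\ measurable B,
    Pr P B <= 7 / p%:R + alpha + N%:R * (2 * D * expR (- (t0 - D) ^+ 2 / 2)) / (ys * prop)
       + 2 * Phibar a / yt + 2 * Phibar t * (cst_corr cmin kap * (p%:R^-1 + q ^+ 2)) / (yv * prop) ^+ 2 &
    forall w, ~ B w ->
      (0 <= (1 - nJ - 2 * yt - ys - yv) * prop - `|cs| * sigmabar t ->
       (1 - nJ - 2 * yt - ys - yv) * prop - `|cs| * sigmabar t <= pihat (z w) tau0 tau1 cs) /\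
      pihat (z w) tau0 tau1 cs <= (1 + nJ + ys) * prop / (1 - 2 * Phibar t0)].
Proof.
move=> al0 al1 csE K1 KC D t0 nJ D0 Dt t01 ys0 yt0 yv0 a0 at_ hN [m mg tE] hsig.
have sR : 0 < s%:R :> R by rewrite ltr0n ltnW.
have prop0 : 0 < prop by rewrite divr_gt0.
have p0 : (0 < p)%N by rewrite ltnW.
have t0t : t0 <= t by rewrite tE; case/andP: mg.
have tpos : 0 < t by lra.
have kl0 : 0 <= kap * l by rewrite mulr_ge0 ?(ltW l0)// (le_trans _ kap24)//.
have mrho j i : smeas (gen_mx X) (fun w => rho w j i 0) by exact: (resid_smeas j i n0 kl0 hgh).
have mW j : mfunT (fun w => W w j) by exact: measurable_wstd.
have mV : mfunT (fun w => Vstar (W w) tau0 tau1) by exact: measurable_Vstar.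
have q0 : 0 <= q by rewrite mulr_ge0 ?sqrtr_ge0// ltW.
have C0 : 0 <= cst_resid cmin kap by apply: cst_resid_ge0 => //; exact: le_trans kap24.
have corr0 : 0 <= cst_corr cmin kap * (p%:R^-1 + q ^+ 2).
  apply: mulr_ge0; last by rewrite addr_ge0 ?sqr_ge0// invr_ge0 ltW.
  exact: cst_corr_ge0.
have [Bg [mBg PBg hBg]] := good_event.
pose Bq : set T := [set w | cs < Vstar (W w) tau0 tau1].
have mBq : measurable Bq by exact: measurable_setlt.
have PBq : Pr P Bq <= alpha by rewrite /Bq csE; exact: quantile_tail.
have [Bs [mBs PBs hBs]] := shells_event mX meps geps sigma0 mrho p0 N D0 Dt (mulr_gt0 ys0 prop0).
have [Bt [mBt PBt hBt]] := tails_event mX meps geps sigma0 mrho (relevant beta) a0 (mulr_gt0 yt0 sR).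
have [Bv [mBv PBv hBv]] := variance_event mX meps geps sigma0 mrho p0 tpos corr0 (mulr_gt0 yv0 prop0).
exists (Bg `|` Bq `|` Bs `|` Bt `|` Bv); split.
- by do !apply: measurableU.
- have m2 := measurableU _ _ mBg mBq; have m3 := measurableU _ _ m2 mBs; have m4 := measurableU _ _ m3 mBt.
  apply: (le_trans (Pr_subU P m4 mBv)); apply: lerD => //.
  apply: (le_trans (Pr_subU P m3 mBt)); apply: lerD; last first.
    apply: (le_trans PBt); rewrite -/s le_eqVlt; apply/orP; left; apply/eqP; field.
    by rewrite !gt_eqF.
  apply: (le_trans (Pr_subU P m2 mBs)); apply: lerD => //.
  by apply: (le_trans (Pr_subU P mBg mBq)); apply: lerD.
move=> w /not_orP[/not_orP[/not_orP[/not_orP[h1 h2] h3] h4] h5].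
have [gd noise] := hBg w h1.
have q1 : q <= 1 by apply: (le_trans _ q8); rewrite ler_peMl// ler1n.
have s0 : (0 < s)%N by rewrite ltnW.
have [Wstd rpos corr [J [ms [cardJ zJ sigJ nullJ]]]] :=
  good_design_statistics n0 p1 cmin0 sS Smin cmax0 Smax Sd kap24 s0 (leqnn _) sigma0 q1 xmsmall qsmall xssmall gd noise (hbh w) (hgh w) K1 KC.
have WE : W w = std w.
  apply/funext => j; rewrite /W Wstd /std /std_resid lin1E bform1E//.
have shellW u : Tgrid p tau0 tau1 u -> shell (W w) u%:R D <= ys * prop.
  by move=> gu; rewrite WE; apply: hBs => //; [case/andP: gu|exact: hN].
have cardJ' : #|J|%:R / p%:R <= nJ * prop.
  have K20 : 0 < K ^+ 2 by rewrite exprn_gt0//; lra.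
  rewrite /prop mulrA ler_pM2r ?invr_gt0// /nJ mulrAC ler_pdivlMr//.
have sE : #|relevant beta|%:R / p%:R = prop by [].
have q1t u : t0 <= u -> 2 * Phibar u <= 2 * Phibar t0 by move=> h; rewrite ler_pM2l// Phibar_le.
have qlt1 : 2 * Phibar t0 < 1.
  apply: (le_lt_trans (tail2_le t01)); rewrite -[ltRHS]expR0 ltr_expR.
  by rewrite mulNr oppr_lt0 divr_gt0// exprn_gt0//; lra.
have qgt0 u : 0 <= u -> 0 < 2 * Phibar u.
  move=> u0; rewrite mulr_gt0//; apply: lt_le_trans (Phibar_ge u0).
  by rewrite /gpdf mulr_gt0 ?phi0_gt0 ?expR_gt0.
have t00 : 0 <= t0 by lra.
(* Upper bound, for every grid point: the quantile event bounds the null exceedances by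
   [cs sigmabar], which is exactly what the estimator subtracts. *)
split; last first.
  apply: sup_le; first by exists m.
  move=> u gu; have ut0 : t0 <= u%:R by case/andP: gu.
  have u0 : 0 <= u%:R :> R by exact: ler0n.
  have Du : 0 < 1 - 2 * Phibar (u%:R : R) by rewrite subr_gt0 (le_lt_trans (q1t _ ut0)).
  have B0 : 0 <= (1 + nJ + ys) * prop.
    have : 0 <= nJ * prop by apply: le_trans cardJ'; rewrite divr_ge0.
    have : 0 <= ys * prop by rewrite mulr_ge0// ltW.
    by rewrite !mulrDl mul1r; lra.
  apply: (@le_trans _ _ ((1 + nJ + ys) * prop / (1 - 2 * Phibar (u%:R : R)))); last first.
    apply: ler_wpM2l => //; rewrite lef_pV2 ?posrE//; last by rewrite subr_gt0.
    exact: lerB (lexx _) (q1t _ ut0).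
  rewrite ler_pM2r ?invr_gt0//.
  have hV : Hstat (W w) u%:R <= cs.
    apply: (le_trans (@sup_ge R _ (fun u => Hstat (W w) u%:R) N u hN gu)).
    by rewrite leNgt; exact/negP.
  have sb0 : 0 < sigmabar (u%:R : R) by rewrite sqrtr_gt0 mulr_gt0// qgt0.
  rewrite ler_pdivrMr// in hV.
  have := @exceed_upper _ _ (z w) (W w) (relevant beta) J u%:R D p0 D0.
  rewrite sE => up; have {}up := up _; have := shellW u gu.
  have nul : forall j, j \notin J -> j \notin relevant beta -> `|z w j| <= `|W w j| + D.
    move=> j jJ; rewrite inE negbK => /eqP b0; have := zJ j jJ; rewrite (nullJ j b0) subr0 => hz.
    by rewrite -lerBlDl; apply: le_trans hz; exact: lerB_dist.
  have {}up := up nul; have -> : (1 + nJ + ys) * prop = prop + nJ * prop + ys * prop by ring.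
  by move=> hsh; exact: (upper_arith up hV cardJ' hsh).
move=> LB0.
have mu_le j : j \in relevant beta -> mu_min n beta sigma S <=
    sqrt n%:R * `|beta j 0| / sigma / sqrt (invmx S j j).
  move=> jr; apply: ge_inf; last by exists j.
  exists 0 => _ [k _ <-]; apply: divr_ge0; last exact: sqrtr_ge0.
  by apply: divr_ge0; [rewrite mulr_ge0 ?sqrtr_ge0|exact: ltW].
have Cq : 0 <= 1 - cst_resid cmin kap / cmin * q.
  rewrite subr_ge0 mulrAC ler_pdivrMr// mul1r; apply: (le_trans qsmall).
  by rewrite ler_pdivrMr// ler_peMr ?ler1n// ltW.
(* The signal must overcome the threshold [t], the noise of a relevant index, at most [a], and the
   bias [D], after its attenuation. *)
have big j : j \notin J -> j \in relevant beta -> `|W w j| <= a -> t < `|z w j|.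
  move=> jJ jr Wa; have h := zJ j jJ; have hm := sigJ j.
  have hmu := ler_wpM2l Cq (mu_le j jr).
  have tri : `|ms j| <= `|z w j| + `|W w j| + shell_width n p sm s cmin kap K.
    have -> : ms j = z w j - W w j - (z w j - W w j - ms j) by ring.
    apply: (le_trans (ler_normB _ _)); apply: lerD => //; exact: ler_normB.
  exact: (signal_arith hsig hmu hm tri Wa).
have nul : forall j, j \notin J -> j \notin relevant beta -> `|W w j| <= `|z w j| + D.
  move=> j jJ; rewrite inE negbK => /eqP b0; have := zJ j jJ; rewrite (nullJ j b0) subr0 => hz.
  by rewrite -lerBlDl; apply: le_trans hz; rewrite distrC; exact: lerB_dist.
have low := exceed_lower p0 D0 at_ nul big; rewrite sE in low.
have tl : (\sum_(j in relevant beta) (a < `|W w j|)%R%:R) / p%:R <= yt * prop.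
  rewrite /prop mulrA ler_pM2r ?invr_gt0// WE; exact: hBt.
have vr : `|exceed_prop (W w) t - 2 * Phibar t| <= yv * prop by rewrite WE; exact: hBv.
have sh : shell (W w) t D <= ys * prop by rewrite tE; exact: shellW.
have Dt' : 0 < 1 - 2 * Phibar t <= 1.
  by rewrite subr_gt0 (le_lt_trans (q1t _ t0t))//= gerBl ltW// qgt0// ltW.
set LB := _ * prop - _ in LB0 *.
pose num := exceed_prop (z w) t - 2 * Phibar t - cs * sigmabar t.
have hnum : LB <= num.
  have csb : cs * sigmabar t <= `|cs| * sigmabar t.
    by rewrite ler_wpM2r ?sqrtr_ge0// ler_norm.
  move: vr; rewrite ler_norml => /andP[vr _].
  have -> : LB = prop - nJ * prop - 2 * (yt * prop) - ys * prop - yv * prop - `|cs| * sigmabar t.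
    by rewrite /LB; ring.
  exact: (lower_arith low vr csb cardJ' tl sh).
apply: (@le_trans _ _ (num / (1 - 2 * Phibar t))).
  case/andP: Dt' => d1 d2; rewrite ler_pdivlMr//; apply: le_trans hnum.
  by rewrite ler_piMr.
rewrite /num tE; exact: (@sup_ge R _ (fun u => (exceed_prop (z w) u%:R - 2 * Phibar u%:R - cs * sigmabar u%:R) / (1 - 2 * Phibar u%:R)) N m hN mg).
Qed.

Hypothesis sm0 : sm = 0%N.

(* For a diagonal covariance matrix the nodewise Lasso selects nothing with
   high probability, and [W] comes from independent Gaussian columns. *)
Lemma cutoff_neq0_diag (m N : nat) :
  0 < alpha -> alpha < 1 -> cs = quantile P (fun w => Vstar (W w) tau0 tau1) (1 - alpha) ->
  (forall t, Tgrid p tau0 tau1 t -> (t < N)%N) -> Tgrid p tau0 tau1 m ->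
  (4096 <= n)%N -> 0 < m%:R :> R -> 4 * m%:R ^+ 2 <= sqrt n%:R :> R ->
  2 * Phibar (m%:R / 2 : R) <= 16^-1 -> 36 <= p%:R * (2 * Phibar (m%:R : R)) ->
  alpha + 7 / p%:R < expR (- 48) * (expR (- 128) - expR (- 384)) -> cs != 0.
Proof.
move=> al0 al1 csE hN mg n4 t0 tn t16 pt hal; apply/eqP => cs0; move: hal; apply/negP; rewrite -leNgt.
have mW j : mfunT (fun w => W w j).
  by apply: measurable_wstd.
have mV : mfunT (fun w => Vstar (W w) tau0 tau1) by exact: measurable_Vstar.
have PV : Pr P [set w | 0 < Vstar (W w) tau0 tau1] <= alpha.
  by have := quantile_tail P mV al0 al1; rewrite -csE cs0.
have mVs : measurable [set w | 0 < Vstar (W w) tau0 tau1] by exact: measurable_setlt.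
have [B [mB PB hB]] := good_event.
have Sdg j : 0 < S j j.
  by rewrite -bform_delta -/(qform _ _); apply: lt_le_trans (Smin _); rewrite sqnorm2_delta mulr1.
have h := columns_count_above_mean mX gX (cov_diag cmin0 sS Smin sm0) Sdg meps geps sigma0 n4 t0 tn t16 pt.
apply: (le_trans h); apply: (@le_trans _ _ (Pr P ([set w | 0 < Vstar (W w) tau0 tau1] `|` B))); last first.
  by apply: (le_trans (Pr_subU P mVs mB)); exact: lerD.
have qm0 : 0 < 2 * Phibar (m%:R : R).
  by rewrite -(pmulr_rgt0 _ pR); apply: lt_le_trans pt.
have qm1 : 2 * Phibar (m%:R : R) < 1.
  apply: (@le_lt_trans _ _ 16^-1); last by rewrite invf_lt1// ltr1n.
  by apply: le_trans t16; rewrite ler_pM2l// Phibar_le// ler_pdivrMr// ler_peMr ?ler1n// ltW.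
have sb0 : 0 < sigmabar (m%:R : R) by rewrite sqrtr_gt0 mulr_gt0// subr_gt0.
pose Y w (j : 'I_p) := lin1 (col j (X w)) eps w / (sigma * sqrt (sqnorm2 (col j (X w)))).
have mc j : random_mx (fun w => col j (X w)) by move=> a b; under eq_fun do rewrite mxE; exact: mX.
have mY j : mfunT (fun w => Y w j).
  apply: measurable_funM; last first.
    apply: (measurableT_comp measurable_invr); apply: measurable_funM => //.
    by apply: (measurableT_comp measurable_sqrtr); exact: measurable_sqnorm2.
  under eq_fun do rewrite lin1E; apply: measurable_sum => i.
  by apply: measurable_funM; [exact: mc|exact: meps].
under eq_set do rewrite -(exceed_propE (Y _) m%:R).
apply: Pr_le; [|exact: measurableU|].
  by apply: measurable_setlt => //; exact: measurable_exceed_prop.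
move=> w /= hY; have [Bw|/hB[gd noise]] := pselect (B w); [by right|left].
pose K : R := `|cst_dir cmin cmax| + 1.
have K1 : 1 <= K by rewrite lerDr.
have KC : cst_dir cmin cmax < K ^+ 2.
  apply: (le_lt_trans (ler_norm _)); apply: (@lt_le_trans _ _ K); first by rewrite ltrDl.
  by rewrite expr2 ler_peMl// (le_trans _ K1).
have q0 : 0 <= q by rewrite mulr_ge0 ?sqrtr_ge0// ltW.
have q1 : q <= 1 by apply: (le_trans _ q8); rewrite ler_peMl// ler1n.
have s0 : (0 < s)%N by rewrite ltnW.
have [Wstd _ _ _] :=
  good_design_statistics n0 p1 cmin0 sS Smin cmax0 Smax Sd kap24 s0 (leqnn _) sigma0 q1 xmsmall qsmall xssmall gd noise (hbh w) (hgh w) K1 KC.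
apply: (@lt_le_trans _ _ (Hstat (W w) m%:R)); last first.
  exact: (@sup_ge R _ (fun u => Hstat (W w) u%:R) N m hN mg).
rewrite divr_gt0// subr_gt0; apply: (lt_le_trans hY); apply: le_of_eq.
congr exceed_prop; apply/funext => j; rewrite /W Wstd.
have -> : resid (X w) (gh w) j = col j (X w).
  exact: (resid_diag n0 p1 cmin0 sS Smin Smax kap24 xmsmall gd (hgh w) j sm0).
by rewrite /Y lin1E bform1E.
Qed.

End FiniteSample.

(** With less than one expected exceedance at each grid point, [Hstat <= 0] forces the exceedance
    proportion, a multiple of [1 / p], to be 0. The statistic is then bounded away from 0, at most
    [- 2 Phibar N]. *)
Lemma cutoff_neq0_gap {R : realType} {d} {T : measurableType d}
    (P : probability T R) (p : nat) (w' : T -> 'I_p -> R) (tau0 tau1 alpha : R) (m N : nat) :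
  (0 < p)%N -> (forall j, mfunT (fun w => w' w j)) -> 0 < alpha -> alpha < 1 ->
  (forall t, Tgrid p tau0 tau1 t -> (t < N)%N) -> Tgrid p tau0 tau1 m ->
  (forall t, Tgrid p tau0 tau1 t -> p%:R * (2 * Phibar (t%:R : R)) < 1) ->
  quantile P (fun w => Vstar (w' w) tau0 tau1) (1 - alpha) != 0.
Proof.
move=> p0 mw al0 al1 hN mg hg; have pR : 0 < p%:R :> R by rewrite ltr0n.
have q0 u : 0 < 2 * Phibar (u%:R : R).
  by rewrite mulr_gt0//; apply: lt_le_trans (Phibar_ge _) => //; rewrite mulr_gt0 ?phi0_gt0 ?expR_gt0.
apply: (quantile_neq0_gap P (measurable_Vstar tau0 tau1 mw) al0 al1 (q0 N)) => w V0.
apply: sup_le; first by exists m.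
move=> u gu; have h0 : Hstat (w' w) u%:R <= 0.
  exact: le_trans (@sup_ge R _ (fun u => Hstat (w' w) u%:R) N u hN gu) V0.
have q1 : 2 * Phibar (u%:R : R) < 1.
  by apply: le_lt_trans (hg u gu); rewrite ler_peMl ?(ltW (q0 _))// ler1n.
have a0 : 0 < 2 * Phibar (u%:R : R) * (1 - 2 * Phibar (u%:R : R)) by rewrite mulr_gt0// subr_gt0.
have sb0 : 0 < sigmabar (u%:R : R) by rewrite sqrtr_gt0.
have sb1 : sigmabar (u%:R : R) <= 1.
  rewrite -[leRHS]sqrtr1 ler_wsqrtr//; have := q0 u; move: (2 * _) q1 => x x1 x0; nra.
rewrite ler_pdivrMr// mul0r subr_le0 in h0.
have e0 : exceed_prop (w' w) (u%:R : R) = 0.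
  apply/eqP; move: h0; rewrite /exceed_prop mulf_eq0 invr_eq0 (gt_eqF pR) orbF pnatr_eq0 => h0.
  rewrite -leqn0 -ltnS -(ltr_nat R); apply: le_lt_trans (hg u gu).
  by rewrite mulrC -ler_pdivrMr.
rewrite /Hstat e0 sub0r ler_pdivrMr// mulNr lerN2.
apply: (@le_trans _ _ (2 * Phibar (N%:R : R))); first by rewrite ler_piMr// ltW.
by rewrite ler_pM2l// Phibar_le// ler_nat ltnW// hN.
Qed.

(** * Rates *)

Section Rates.
Context {R : realType}.

(** With [x = ln p], this is a negative power of [p] against [(1 + ln p)^2], which stands for all
    logarithmic factors below. *)
Lemma exp_rate (k e : R) : 0 < k -> 0 < e ->
  exists M : R, forall x, M <= x -> (1 + x) ^+ 2 * expR (- (k * x)) <= e.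
Proof.
move=> k0 e0; exists (Num.max 1 (108 / (k ^+ 3 * e))) => x.
rewrite ge_max => /andP[x1 xM].
have x0 : 0 < x by lra.
have kx : 0 < k * x by rewrite mulr_gt0.
have h : (k * x / 3) ^+ 3 <= expR (k * x).
  rewrite (_ : expR (k * x) = expR (k * x / 3) ^+ 3); last by rewrite -expRM_natl; congr expR; field.
  rewrite lerXn2r ?nnegrE ?expR_ge0 ?divr_ge0 ?(ltW kx)//.
  by apply: le_trans (expR_ge1Dx _); rewrite lerDr.
have h2 : (1 + x) ^+ 2 <= 4 * x ^+ 2.
  have -> : 4 * x ^+ 2 = (2 * x) ^+ 2 by ring.
  by rewrite lerXn2r ?nnegrE//; lra.
have ke : 0 < k ^+ 3 * e by rewrite mulr_gt0// exprn_gt0.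
rewrite ler_pdivrMr// in xM.
rewrite expRN ler_pdivrMr ?expR_gt0//; apply: (le_trans h2).
apply: (@le_trans _ _ (e * (k * x / 3) ^+ 3)); last by rewrite ler_pM2l.
rewrite (_ : e * _ = x * (k ^+ 3 * e) / 27 * x ^+ 2); last by field.
by rewrite ler_wpM2r ?sqr_ge0// ler_pdivlMr//; lra.
Qed.

Lemma exp_rate_le (a k x : R) : k <= a -> 0 <= x -> expR (- (a * x)) <= expR (- (k * x)).
Proof. by move=> ka x0; rewrite ler_expR lerN2 ler_wpM2r. Qed.

End Rates.

(* The three bounds on [E = p^(-tau0 / 2)] express [2 gamma < tau0]. *)
Section ShellRates.
Context {R : realType}.
Variables (n sm s r mn E L : R).
Hypotheses (n0 : 0 < n) (sm1 : 1 <= sm) (smn : sm <= n) (s1 : 1 <= s) (r1 : 1 <= r) (mn0 : 0 <= mn)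
  (mns : mn <= s) (mnsm : mn <= sm) (E0 : 0 < E).
(** The tenth root of [p] serves as a unit of measure, so that all comparisons of powers have
    integer exponents. *)
Let p := r ^+ 10.
Let pr := s / p.
Hypotheses (g2 : E <= pr ^+ 2 * sqrt (n / sm)) (g3 : E <= sqrt n / s ^+ 2).

Let p0 : 0 < p. Proof. by rewrite exprn_gt0// (lt_le_trans _ r1). Qed.
Let s0 : 0 < s. Proof. by rewrite (lt_le_trans _ s1). Qed.
Let sm0 : 0 < sm. Proof. by rewrite (lt_le_trans _ sm1). Qed.
Let r0 : 0 < r. Proof. by rewrite (lt_le_trans _ r1). Qed.
Let pr0 : 0 < pr. Proof. by rewrite divr_gt0. Qed.

Lemma shell_rate_sm : sqrt (sm / n) * E <= pr * sqrt E.
Proof.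
have d0 : 0 <= sm / n by rewrite divr_ge0 ?ltW.
have d1 : sqrt (sm / n) <= 1.
  by rewrite -[leRHS]sqrtr1 ler_wsqrtr// ler_pdivrMr// mul1r.
have dd : sqrt (sm / n) * sqrt (n / sm) = 1.
  by rewrite -sqrtrM// mulrA divfK ?gt_eqF// divff ?sqrtr1// gt_eqF.
rewrite -ler_sqr ?nnegrE ?(mulr_ge0 (sqrtr_ge0 _) (ltW E0)) ?(mulr_ge0 (ltW pr0) (sqrtr_ge0 _))//.
rewrite [X in X <= _]exprMn [X in _ <= X]exprMn [sqrt E ^+ 2]sqr_sqrtr ?(ltW E0)//.
have h1 : sqrt (sm / n) * E <= pr ^+ 2.
  apply: (le_trans (ler_wpM2l (sqrtr_ge0 _) g2)).
  by rewrite mulrCA dd mulr1.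
rewrite [E ^+ 2]expr2 mulrA; apply: ler_wpM2r; first exact: ltW.
apply: le_trans h1; rewrite expr2 -mulrA.
by apply: ler_piMl => //; rewrite mulr_ge0 ?sqrtr_ge0// ltW.
Qed.

Let sqs : sqrt s ^+ 2 = s. Proof. by rewrite sqr_sqrtr// ltW. Qed.
Let sqn : sqrt n ^+ 2 = n. Proof. by rewrite sqr_sqrtr// ltW. Qed.
Let sqsm : sqrt sm ^+ 2 = sm. Proof. by rewrite sqr_sqrtr// ltW. Qed.
Let qs0 : 0 < sqrt s. Proof. by rewrite sqrtr_gt0. Qed.
Let qn0 : 0 < sqrt n. Proof. by rewrite sqrtr_gt0. Qed.
Let qsm1 : 1 <= sqrt sm. Proof. by rewrite -sqrtr1 ler_wsqrtr. Qed.
Let qs1 : 1 <= sqrt s. Proof. by rewrite -sqrtr1 ler_wsqrtr. Qed.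
Let qsm0 : 0 < sqrt sm. Proof. exact: lt_le_trans qsm1. Qed.
Let g2' : E <= pr ^+ 2 * (sqrt n / sqrt sm).
Proof. by rewrite -sqrtrV ?(ltW sm0)// -sqrtrM ?(ltW n0). Qed.

(** The cut at [r^6] serves both regimes: below it [s^(3/2) r <= r^10], as used here; above it
    [s^2 >= r^11], as needed with [g3]. *)
Let small : s <= r ^+ 6 -> pr ^+ 2 * sqrt s <= pr / r.
Proof.
move=> sr; have h : sqrt s <= r ^+ 3.
  by rewrite -ler_sqr ?nnegrE ?sqrtr_ge0 ?exprn_ge0 ?(ltW r0)// sqs -exprM.
rewrite expr2 -mulrA ler_pM2l// -[leRHS]div1r ler_pdivlMr//.
rewrite [leLHS](_ : _ = s * sqrt s * r / p); last by rewrite /pr; ring.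
rewrite ler_pdivrMr// mul1r.
rewrite /p (_ : r ^+ 10 = r ^+ 6 * r ^+ 3 * r); last by ring.
by rewrite ler_wpM2r ?(ltW r0)//; apply: ler_pM => //; rewrite ltW.
Qed.

Lemma shell_rate_s : sqrt (s / n) * E <= pr / r.
Proof.
have -> : sqrt (s / n) = sqrt s / sqrt n.
  by rewrite -sqrtrV ?(ltW n0)// -sqrtrM ?(ltW s0).
have c0 : 0 <= sqrt s / sqrt n by rewrite divr_ge0 ?sqrtr_ge0.
have [sr|sr] := leP s (r ^+ 6).
  apply: le_trans (small sr); apply: (le_trans (ler_wpM2l c0 g2')).
  rewrite [leLHS](_ : _ = pr ^+ 2 * sqrt s * (sqrt sm)^-1); last by field; rewrite !gt_eqF.
  apply: ler_piMr; first by rewrite mulr_ge0 ?sqr_ge0 ?sqrtr_ge0.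
  by rewrite invf_le1.
apply: (le_trans (ler_wpM2l c0 g3)).
rewrite [leLHS](_ : _ = sqrt s / s ^+ 2); last by field; rewrite !gt_eqF.
rewrite /pr -[s in s / p]sqs -[s in s ^+ 2]sqs.
have := sqs; have := qs1; have := qs0; set v := sqrt s => v0 v1 vs.
have vr : r ^+ 3 <= v.
  by rewrite -ler_sqr ?nnegrE ?exprn_ge0 ?(ltW r0) ?(ltW v0)// vs -exprM ltW.
rewrite ler_pdivrMr ?exprn_gt0// (_ : v ^+ 2 / p / r * (v ^+ 2) ^+ 2 = v * (v ^+ 5 / (r ^+ 11))); last first.
  by rewrite /p; field; rewrite gt_eqF.
rewrite ler_peMr ?(ltW v0)// ler_pdivlMr ?exprn_gt0// mul1r.
have v3 : (r ^+ 3) ^+ 5 <= v ^+ 5 by rewrite lerXn2r ?nnegrE ?exprn_ge0 ?(ltW r0) ?(ltW v0).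
by apply: le_trans v3; rewrite -exprM; apply: ler_weXn2l.
Qed.

Lemma shell_rate_min : mn / sqrt n * E <= pr / r.
Proof.
have c0 : 0 <= mn / sqrt n by rewrite divr_ge0 ?sqrtr_ge0.
have [sr|sr] := leP s (r ^+ 6).
  apply: le_trans (small sr); apply: (le_trans (ler_wpM2l c0 g2')).
  have mm : mn <= sqrt s * sqrt sm.
    rewrite -ler_sqr ?nnegrE ?mulr_ge0 ?sqrtr_ge0// exprMn sqs sqsm expr2; exact: ler_pM.
  rewrite [leLHS](_ : _ = pr ^+ 2 * (mn / sqrt sm)); last by field; rewrite !gt_eqF.
  by rewrite ler_wpM2l ?sqr_ge0// ler_pdivrMr.
apply: (le_trans (ler_wpM2l c0 g3)).
rewrite [leLHS](_ : _ = mn / s ^+ 2); last by field; rewrite !gt_eqF.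
apply: (@le_trans _ _ s^-1).
  by rewrite ler_pdivrMr ?exprn_gt0// expr2 mulKf ?gt_eqF.
rewrite /pr -[leLHS]mul1r ler_pdivrMr// (_ : s / p / r * s = s ^+ 2 / r ^+ 11); last first.
  by rewrite /p; field; rewrite gt_eqF.
rewrite ler_pdivlMr ?exprn_gt0// mul1r.
apply: (@le_trans _ _ ((r ^+ 6) ^+ 2)); first by rewrite -exprM; apply: ler_weXn2l.
by rewrite lerXn2r ?nnegrE ?exprn_ge0 ?(ltW r0) ?(ltW s0)// ltW.
Qed.

End ShellRates.

Section ShellWidthRate.
Context {R : realType}.

Lemma shell_width_rate (n p sm s : nat) (cmin kap K E r : R) :
  (0 < n)%N -> (0 < sm)%N -> (sm <= n)%N -> (0 < s)%N -> 1 <= r -> p%:R = r ^+ 10 ->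
  0 <= K * cst_bias cmin kap -> 0 < E ->
  E <= (s%:R / p%:R) ^+ 2 * sqrt (n%:R / sm%:R) -> E <= sqrt n%:R / s%:R ^+ 2 ->
  shell_width n p sm s cmin kap K * E <=
  K * cst_bias cmin kap * (11 * ln p%:R * (s%:R / p%:R)) * (sqrt E + r^-1).
Proof.
move=> n0 sm0 smn s0 r1 pr Kc0 E0 g2 g3; rewrite /shell_width.
have p1 : 1 <= p%:R :> R by rewrite pr exprn_ege1.
have n0R : 0 < n%:R :> R by rewrite ltr0n.
set L := ln p%:R; have L0 : 0 <= L by rewrite ln_ge0.
set q := s%:R / p%:R in g2 *.
have sm1R : 1 <= sm%:R :> R by rewrite ler1n.
have smnR : sm%:R <= n%:R :> R by rewrite ler_nat.
have s1R : 1 <= s%:R :> R by rewrite ler1n.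
have mns : (minn s sm)%:R <= s%:R :> R by rewrite ler_nat geq_minl.
have mnsm : (minn s sm)%:R <= sm%:R :> R by rewrite ler_nat geq_minr.
have q0 : 0 <= q by rewrite divr_ge0.
rewrite /q pr in g2.
have h1 := shell_rate_sm n0R sm1R smnR s1R r1 E0 g2.
have h2 := shell_rate_s n0R sm1R s1R r1 g2 g3.
have h3 := shell_rate_min n0R sm1R s1R r1 (ler0n _ _) mns mnsm g2 g3.
rewrite -pr -/q in h1 h2 h3.
have sL : sqrt L ^+ 2 = L by rewrite sqr_sqrtr.
have nl : sqrt n%:R * sqrt (L / n%:R) = sqrt L.
  by rewrite -sqrtrM ?(ltW n0R)// mulrC divfK// gt_eqF.
have lE : sqrt (L / n%:R) = sqrt L / sqrt n%:R.
  by rewrite sqrtrM// sqrtrV// ltW.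
have a1 : sqrt (sm + 2)%:R * sqrt (L / n%:R) * E <= 2 * sqrt L * (q * sqrt E).
  (* [sm >= 1] gives [sm + 2 <= 4 sm]. *)
  have e : sqrt (sm + 2)%:R <= 2 * sqrt sm%:R :> R.
    rewrite -[X in X * _](ger0_norm (ler0n _ 2)) -sqrtr_sqr -sqrtrM ?sqr_ge0// ler_wsqrtr//.
    by rewrite -natrX -natrM ler_nat -[(2 ^ 2)%N]/4%N mulSn leq_add2l (leq_trans _ (leq_pmulr 3 sm0)).
  apply: (@le_trans _ _ (2 * sqrt L * (sqrt (sm%:R / n%:R) * E))).
    rewrite [sqrt (sm%:R / _)]sqrtrM// sqrtrV ?(ltW n0R)// lE.
    rewrite (_ : 2 * sqrt L * _ = 2 * sqrt sm%:R * (sqrt L / sqrt n%:R * E)); last by ring.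
    rewrite -mulrA; apply: ler_wpM2r => //.
    by apply: mulr_ge0; [apply: divr_ge0; exact: sqrtr_ge0|exact: ltW].
  by apply: ler_wpM2l => //; apply: mulr_ge0.
have a2 : 8 * sqrt s%:R * sqrt (L / n%:R) * E <= 8 * sqrt L * (q / r).
  rewrite (_ : _ * E = 8 * sqrt L * (sqrt (s%:R / n%:R) * E)).
    by apply: ler_wpM2l => //; apply: mulr_ge0.
  by rewrite lE [sqrt (s%:R / _)]sqrtrM// sqrtrV ?(ltW n0R)//; ring.
have a3 : (minn s sm)%:R * sqrt (L / n%:R) * E <= sqrt L * (q / r).
  rewrite (_ : _ * E = sqrt L * ((minn s sm)%:R / sqrt n%:R * E)).
    by apply: ler_wpM2l => //; exact: sqrtr_ge0.
  by rewrite lE; ring.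
rewrite nl -[leLHS]mulrA -[leRHS]mulrA; apply: ler_wpM2l => //.
have rV : 0 <= r^-1 by rewrite invr_ge0 (le_trans _ r1).
rewrite [leLHS](_ : _ = sqrt L * (sqrt (sm + 2)%:R * sqrt (L / n%:R) * E +
   8 * sqrt s%:R * sqrt (L / n%:R) * E + (minn s sm)%:R * sqrt (L / n%:R) * E)); last by ring.
apply: (le_trans (ler_wpM2l (sqrtr_ge0 L) (lerD (lerD a1 a2) a3))).
rewrite [leLHS](_ : _ = sqrt L ^+ 2 * q * (2 * sqrt E + 9 * r^-1)); last by ring.
rewrite sL [leRHS](_ : _ = L * q * (11 * (sqrt E + r^-1))); last by ring.
apply: ler_wpM2l; first exact: mulr_ge0.
have := sqrtr_ge0 E; move: rV; move: (sqrt E) r^-1 => u v; lra.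
Qed.

End ShellWidthRate.

Section GammaBounds.
Context {R : realType}.

Lemma sqrt_expR (x : R) : 0 < x -> sqrt x = expR (ln x / 2).
Proof.
move=> x0; rewrite -{1}(lnK (_ : x \in Num.pos)) ?posrE//.
have -> : expR (ln x) = expR (ln x / 2) ^+ 2 by rewrite -expRM_natl; congr expR; field.
by rewrite sqrtr_sqr ger0_norm ?expR_ge0.
Qed.

(** Everything is a power of [p]: the two entries of the minimum in [gamma1] give the first two
    bounds and [gamma2] the third. *)
Lemma gamma_bounds (p n sm s : nat) (eta tau0 : R) : (1 < p)%N -> (0 < n)%N -> (0 < sm)%N ->
  s%:R = p%:R `^ (1 - eta) -> 2 * gammastar eta p n sm < tau0 ->
  let E := expR (- (tau0 / 2 * ln p%:R)) in
  [/\ E <= (s%:R / p%:R) ^+ 2 * p%:R, E <= (s%:R / p%:R) ^+ 2 * sqrt (n%:R / sm%:R) &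
      E <= sqrt n%:R / s%:R ^+ 2].
Proof.
move=> p1 n0 sm0 sE tg E.
have pR : 0 < p%:R :> R by rewrite ltr0n ltnW.
have nR : 0 < n%:R :> R by rewrite ltr0n.
have smR : 0 < sm%:R :> R by rewrite ltr0n.
set L := ln p%:R in E *; have L0 : 0 < L by rewrite ln_gt0// ltr1n.
have pE : p%:R = expR L by rewrite lnK// posrE.
have sE' : s%:R = expR ((1 - eta) * L) by rewrite sE /powR gt_eqF.
have prE : s%:R / p%:R = expR (- (eta * L)).
  by rewrite sE' pE -expRN -expRD; congr expR; ring.
have prE2 : (s%:R / p%:R) ^+ 2 = expR (- (2 * eta * L)).
  by rewrite prE -expRM_natl; congr expR; ring.
have [g1 g2] : gamma1 eta p n sm < tau0 / 2 /\ gamma2 eta p n < tau0 / 2.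
  have : gammastar eta p n sm < tau0 / 2 by rewrite ltr_pdivlMr// mulrC.
  by rewrite /gammastar gt_max => /andP[].
rewrite /gamma1 -[sm == 0]/(sm == 0)%N gtn_eqF// -/L in g1; rewrite /gamma2 -/L in g2.
set a := ln (n%:R / sm%:R) in g1.
have m1 : Num.min 1 (a / (2 * L)) <= 1 by rewrite ge_min lexx.
have m2 : Num.min 1 (a / (2 * L)) <= a / (2 * L) by rewrite ge_min lexx orbT.
have b1 : 2 * eta - 1 <= tau0 / 2 by lra.
have b2 : 2 * eta - a / (2 * L) <= tau0 / 2 by lra.
have b3 : 2 - 2 * eta - ln n%:R / (2 * L) <= tau0 / 2 by lra.
split.
- rewrite prE2 pE -expRD ler_expR; have := ler_wpM2r (ltW L0) b1; lra.
- rewrite sqrt_expR ?divr_gt0// -/a prE2 -expRD ler_expR.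
  have := ler_wpM2r (ltW L0) b2; rewrite mulrBl (_ : a / (2 * L) * L = a / 2); first lra.
  by field; rewrite gt_eqF.
- rewrite sqrt_expR// sE' -expRM_natl -expRN -expRD ler_expR.
  have := ler_wpM2r (ltW L0) b3; rewrite !mulrBl (_ : ln n%:R / (2 * L) * L = ln n%:R / 2); last by field; rewrite gt_eqF.
  lra.
Qed.

End GammaBounds.

(** * Consequences of the sparsity conditions for large indices *)

Section Asymptotics.
Context {R : realType}.
Variables (p n s sm : nat -> nat) (eta : nat -> R).
Hypotheses (p1 : forall k, (1 < p k)%N) (n0 : forall k, (0 < n k)%N) (pinf : p @ \oo --> \oo)
  (A3 : @condA3 R p n s sm) (eta01 : forall k, 0 < eta k < 1)
  (sE : forall k, (s k)%:R = (p k)%:R `^ (1 - eta k)).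

Let L k : R := ln (p k)%:R.
Let l k : R := sqrt (L k / (n k)%:R).
Let L0 k : 0 < L k. Proof. by rewrite ln_gt0// ltr1n. Qed.
Let nR k : 0 < (n k)%:R :> R. Proof. by rewrite ltr0n. Qed.

(** Since [eta k < 1], [s k] is a positive power of [p k], hence above 1; this is the [1 < m] of
    Maurey's method. *)
Lemma sparsity_gt1 k : (1 < s k)%N.
Proof.
rewrite -(ltr_nat R) sE /powR gt_eqF ?ltr0n 1?ltnW// -[X in X < _]expR0 ltr_expR.
by rewrite mulr_gt0 ?L0// subr_gt0; have /andP[] := eta01 k.
Qed.

Lemma near_ln (M : R) : \forall k \near \oo, M <= L k.
Proof.
have [N _ hN] : \forall m \near \oo, expR M <= m%:R :> R by exact: nbhs_infty_ger.
have h : \forall k \near \oo, (N <= p k)%N by exact: pinf (nbhs_infty_ge N).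
apply: filterS h => k hk; rewrite -ler_expR lnK ?posrE ?ltr0n 1?ltnW//.
exact: hN.
Qed.

Lemma near_pinv (e : R) : 0 < e -> \forall k \near \oo, (p k)%:R^-1 <= e.
Proof.
move=> e0; near=> k; rewrite -[leRHS]invrK lef_pV2 ?posrE ?invr_gt0 ?ltr0n 1?ltnW//.
rewrite -[X in _ <= X]lnK ?posrE ?ltr0n 1?ltnW//; apply: (@le_trans _ _ (1 + L k)); last exact: expR_ge1Dx.
suff : e^-1 <= L k by rewrite -/(L k); lra.
by near: k; exact: near_ln.
Unshelve. all: by end_near.
Qed.

Let max_rate (e : R) : 0 < e ->
  \forall k \near \oo, (maxn (s k) (sm k))%:R * (L k / (n k)%:R) <= e.
Proof.
move=> e0; case: A3 => /eqoP/(_ e e0) h _ _; apply: filterS h => k.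
rewrite /= (ger0_norm (ler0n _ _)) (ger0_norm (divr_ge0 (ler0n _ _) (ltW (L0 k)))).
by rewrite mulrA [e * _]mulrA ler_pdivlMr ?L0// ler_pdivrMr.
Qed.

Lemma near_width (e : R) : 0 < e -> \forall k \near \oo,
  [/\ sqrt (sm k + 2)%:R * l k <= e, sqrt (s k)%:R * l k <= e,
      (minn (s k) (sm k))%:R * l k <= e, l k <= e & (maxn (s k) (sm k) <= n k)%N].
Proof.
move=> e0; have e20 : 0 < e ^+ 2 / 3 by rewrite divr_gt0// exprn_gt0.
case: A3 => _ /eqoP/(_ e e0) h3 _.
near=> k.
have Ln0 : 0 <= L k / (n k)%:R by rewrite divr_ge0 ?ltW.
have s1 : (1 <= maxn (s k) (sm k))%N by rewrite leq_max (ltnW (sparsity_gt1 k)).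
have h1 : (maxn (s k) (sm k))%:R * (L k / (n k)%:R) <= e ^+ 2 / 3 by near: k; exact: max_rate.
(* The slack 3 covers [sm + 2], as [max (s, sm) >= 1]. *)
have sq (m : nat) : (m <= 3 * maxn (s k) (sm k))%N -> sqrt m%:R * l k <= e.
  move=> hm; rewrite -[leRHS](ger0_norm (ltW e0)) -sqrtr_sqr /l -sqrtrM// ler_wsqrtr//.
  apply: (@le_trans _ _ (3 * ((maxn (s k) (sm k))%:R * (L k / (n k)%:R)))); last lra.
  by rewrite mulrA ler_wpM2r// -natrM ler_nat.
split.
- apply: sq; rewrite mulSn; apply: leq_add; first exact: leq_maxr.
  exact: leq_pmulr.
- by apply: sq; rewrite mulSn; exact: leq_trans (leq_maxl _ (sm k)) (leq_addr _ _).
- have h : (minn (sm k) (s k))%:R <= e * (sqrt (n k)%:R / L k).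
    have : `|(minn (sm k) (s k))%:R : R| <= e * `|sqrt (n k)%:R / L k| by near: k.
    by rewrite ger0_norm// ger0_norm// divr_ge0 ?sqrtr_ge0// ltW.
  have L1 : 1 <= L k by near: k; exact: near_ln.
  have sL : 1 <= sqrt (L k) by rewrite -sqrtr1 ler_wsqrtr.
  have sL2 : sqrt (L k) ^+ 2 = L k by rewrite sqr_sqrtr// ltW.
  rewrite minnC; apply: (le_trans (ler_wpM2r (sqrtr_ge0 _) h)).
  have lE : l k = sqrt (L k) / sqrt (n k)%:R.
    by rewrite /l sqrtrM ?(ltW (L0 k))// sqrtrV// ltW.
  rewrite -/(l k) lE [leLHS](_ : _ = e / sqrt (L k)).
    by rewrite ler_pdivrMr ?ler_peMr// ?(ltW e0)// (lt_le_trans _ sL).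
  rewrite -[X in e * (_ / X) * _]sL2; field.
  by rewrite !gt_eqF ?sqrtr_gt0// (lt_le_trans _ sL).
- by rewrite -[leLHS]mul1r -[X in X * _]sqrtr1; apply: (sq 1); rewrite muln_gt0.
- rewrite -(ler_nat R); have h2 : (maxn (s k) (sm k))%:R * (L k / (n k)%:R) <= 1 by near: k; exact: max_rate.
  have L1 : 1 <= L k by near: k; exact: near_ln.
  rewrite mulrA ler_pdivrMr// mul1r in h2; apply: le_trans h2.
  by rewrite ler_peMr.
Unshelve. all: by end_near.
Qed.

Lemma near_sm_le : \forall k \near \oo, (sm k <= n k)%N.
Proof. by apply: filterS (near_width ltr01) => k [_ _ _ _]; rewrite geq_max => /andP[]. Qed.

(* [s = o(n / log^2 p)] and [s >= 1]. *)
Lemma near_n_large (M : R) : \forall k \near \oo, M * L k ^+ 2 <= (n k)%:R.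
Proof.
have e0 : 0 < (`|M| + 1)^-1 by rewrite invr_gt0 ltr_wpDl.
case: A3 => _ _ /eqoP/(_ _ e0) h; near=> k.
have : `|(s k)%:R : R| <= (`|M| + 1)^-1 * `|(n k)%:R / L k ^+ 2| by near: k.
have L20 : 0 < L k ^+ 2 by rewrite exprn_gt0.
rewrite (ger0_norm (ler0n _ _)) (ger0_norm (divr_ge0 (ler0n _ _) (ltW L20))).
rewrite ler_pdivlMl ?ltr_wpDl// ler_pdivlMr// => h2; apply: le_trans h2.
rewrite ler_wpM2r ?(ltW L20)//; apply: (@le_trans _ _ (`|M| + 1)); first by have := ler_norm M; lra.
by rewrite ler_peMr ?ler1n 1?ltnW ?sparsity_gt1// addr_ge0.
Unshelve. all: by end_near.
Qed.

End Asymptotics.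

Section StaticRates.
Context {R : realType}.

Lemma expR_sqrt (x : R) : sqrt (expR x) = expR (x / 2).
Proof. by rewrite sqrt_expR ?expR_gt0// expRK. Qed.

Lemma tail_rate (u b L : R) : 0 <= L -> 1 <= u -> b * L <= u ^+ 2 ->
  2 * Phibar u <= expR (- (b / 2 * L)).
Proof.
move=> L0 u1 h; apply: (le_trans (tail2_le u1)); rewrite ler_expR; lra.
Qed.

Lemma shell_exp_rate (t0 D a k L : R) : t0 ^+ 2 = a * L -> t0 * D <= k * L ->
  expR (- (t0 - D) ^+ 2 / 2) <= expR (- (a / 2 * L)) * expR (k * L).
Proof.
move=> h1 h2; rewrite -expRD ler_expR; have := sqr_ge0 D.
rewrite (_ : (t0 - D) ^+ 2 = t0 ^+ 2 - 2 * (t0 * D) + D ^+ 2); last by ring.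
rewrite h1; move: (D ^+ 2) h2; set u := t0 * D; set v := k * L => w h2 w0; lra.
Qed.

Lemma shell_prob_arith (N D E e1 pr y L W C t1 k0 : R) :
  0 <= N -> 0 < pr -> 0 < y -> 1 <= L -> 0 <= C -> 0 <= t1 -> 0 <= D ->
  0 <= E -> 0 <= e1 ->
  N <= t1 * sqrt L + 1 -> D * E <= C * (11 * L * pr) * W ->
  W <= 2 * expR (- (k0 * L)) -> e1 <= E * expR (k0 / 2 * L) ->
  N * (2 * D * e1) / (y * pr) <= 44 * C * (t1 + 1) / y * ((1 + L) ^+ 2 * expR (- (k0 / 2 * L))).
Proof.
move=> N0 pr0 y0 L1 C0 t10 D0 E0 e10 hN hD hW he.
have L0 : 0 <= L by lra.
have sL : sqrt L <= 1 + L.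
  rewrite -[leRHS]ger0_norm -?sqrtr_sqr ?ler_wsqrtr//; last lra.
  by have := sqr_ge0 L; nra.
have hN' : N <= (t1 + 1) * (1 + L).
  by apply: (le_trans hN); have := ler_wpM2l t10 sL; nra.
have hDe : D * e1 <= 22 * C * L * pr * expR (- (k0 / 2 * L)).
  apply: (le_trans (ler_wpM2l D0 he)); rewrite mulrA.
  apply: (@le_trans _ _ (C * (11 * L * pr) * (2 * expR (- (k0 * L))) * expR (k0 / 2 * L))).
    apply: ler_wpM2r; first exact: expR_ge0.
    apply: (le_trans hD); apply: ler_wpM2l => //.
    by apply: mulr_ge0 => //; apply: mulr_ge0; [apply: mulr_ge0; [exact: ler0n|]|exact: ltW].
  rewrite [leLHS](_ : _ = 22 * C * L * pr * (expR (- (k0 * L)) * expR (k0 / 2 * L))); last by ring.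
  rewrite -expRD (_ : - (k0 * L) + k0 / 2 * L = - (k0 / 2 * L))//; lra.
rewrite ler_pdivrMr ?mulr_gt0//.
have Z0 := expR_ge0 (- (k0 / 2 * L)); set Z := expR (- (k0 / 2 * L)) in hDe Z0 *.
apply: (@le_trans _ _ ((t1 + 1) * (1 + L) * (2 * (22 * C * L * pr * Z)))).
  apply: ler_pM => //; first by rewrite mulr_ge0// mulr_ge0.
  by rewrite -mulrA ler_pM2l.
rewrite [leRHS](_ : _ = 44 * C * (t1 + 1) * pr * Z * ((1 + L) * (1 + L))); last by field; rewrite gt_eqF.
rewrite [leLHS](_ : _ = 44 * C * (t1 + 1) * pr * Z * ((1 + L) * L)); last by ring.
apply: ler_wpM2l; last by nra.
apply: mulr_ge0 => //; apply: mulr_ge0; last exact: ltW.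
by apply: mulr_ge0; [apply: mulr_ge0; [exact: ler0n|]|lra].
Qed.

Lemma variance_rate_arith (q pr y C L E Z pinv u w : R) :
  0 < pr -> 0 < y -> 0 <= C -> 1 <= L -> 0 <= E -> 0 <= Z ->
  0 <= q -> q <= E * Z -> 0 <= pinv -> 0 <= u -> E * pinv <= pr ^+ 2 -> E * w <= pr ^+ 2 -> u <= 3 * L * w -> 0 <= w ->
  q * (C * (pinv + u)) / (y * pr) ^+ 2 <= 3 * C / y ^+ 2 * ((1 + L) ^+ 2 * Z).
Proof.
move=> pr0 y0 C0 L1 E0 Z0 q0 hq pi0 u0 h1 h2 h3 w0.
have pr2 : 0 < pr ^+ 2 by rewrite exprn_gt0.
have s1 : E * (pinv + u) <= pr ^+ 2 * (1 + 3 * L).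
  have : E * u <= 3 * L * (E * w) by rewrite mulrCA; apply: ler_wpM2l.
  have : 3 * L * (E * w) <= 3 * L * pr ^+ 2 by rewrite ler_wpM2l// mulr_ge0//; lra.
  by rewrite mulrDr mulrDr mulr1; move: (E * u) (E * w) (E * pinv) h1 => a b c; nra.
rewrite ler_pdivrMr ?exprn_gt0 ?mulr_gt0//.
apply: (@le_trans _ _ (C * Z * (pr ^+ 2 * (1 + 3 * L)))).
  apply: (@le_trans _ _ (E * Z * (C * (pinv + u)))).
    by apply: ler_wpM2r => //; apply: mulr_ge0 => //; apply: addr_ge0.
  rewrite [leLHS](_ : _ = C * Z * (E * (pinv + u))); last by ring.
  by apply: ler_wpM2l => //; apply: mulr_ge0.
rewrite [leRHS](_ : _ = C * Z * (pr ^+ 2 * (3 * (1 + L) ^+ 2))); last by field; rewrite gt_eqF.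
apply: ler_wpM2l; first exact: mulr_ge0.
by apply: ler_wpM2l; [exact: ltW|nra].
Qed.

Lemma threshold_rate_arith (cs sb pr y M L E Z v q : R) :
  0 < pr -> 0 < y -> 0 <= M -> 0 <= L -> 0 <= E -> 0 <= Z -> 0 <= sb -> 0 <= v ->
  `|cs| <= M * (v * L) -> sb ^+ 2 <= q -> q <= E * Z -> v ^+ 2 * E <= pr ^+ 2 ->
  M ^+ 2 * ((1 + L) ^+ 2 * Z) <= y ^+ 2 -> `|cs| * sb <= y * pr.
Proof.
move=> pr0 y0 M0 L0 E0 Z0 sb0 v0 hcs hsb hq hv hM.
have prn := ltW pr0; have yn := ltW y0.
rewrite -ler_sqr ?nnegrE ?mulr_ge0// exprMn.
have c2 : `|cs| ^+ 2 <= (M * (v * L)) ^+ 2 by rewrite ler_sqr ?nnegrE ?mulr_ge0.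
apply: (@le_trans _ _ ((M * (v * L)) ^+ 2 * (E * Z))).
  by apply: ler_pM; rewrite ?sqr_ge0//; exact: le_trans hq.
rewrite [leLHS](_ : _ = M ^+ 2 * (L ^+ 2 * Z) * (v ^+ 2 * E)); last by ring.
apply: (@le_trans _ _ (M ^+ 2 * (L ^+ 2 * Z) * pr ^+ 2)).
  by apply: ler_wpM2l => //; rewrite mulr_ge0 ?sqr_ge0// mulr_ge0 ?sqr_ge0.
rewrite exprMn; apply: ler_wpM2r; first exact: sqr_ge0.
apply: le_trans hM; apply: ler_wpM2l; first exact: sqr_ge0.
by apply: ler_wpM2r => //; nra.
Qed.

End StaticRates.

Section FinalRates.
Context {R : realType}.
Variables (p n s sm : nat -> nat) (eta cs : nat -> R) (cmin kap c tau0 tau1 M : R).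
Hypotheses (p1 : forall k, (1 < p k)%N) (n0 : forall k, (0 < n k)%N) (pinf : p @ \oo --> \oo)
  (A3 : @condA3 R p n s sm) (eta01 : forall k, 0 < eta k < 1)
  (sE : forall k, (s k)%:R = (p k)%:R `^ (1 - eta k)).
Let L k : R := ln (p k)%:R.
Let l k : R := sqrt (L k / (n k)%:R).
Let gam k := gammastar (eta k) (p k) (n k) (sm k).
Let pr k : R := (s k)%:R / (p k)%:R.
Hypotheses (c0 : 0 < c) (t00 : 0 < tau0) (gam_tau0 : forall k, 2 * gam k < tau0 < 2 * gam k + c)
  (gam_tau1 : forall k, 2 * (gam k + c) < tau1) (smpos : \forall k \near \oo, (0 < sm k)%N)
  (csM : \forall k \near \oo, `|cs k| <= M * (((sm k)%:R / (n k)%:R) `^ 4^-1 * L k)).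

Lemma exp_rate_scaled (C k e : R) : 0 <= C -> 0 < k -> 0 < e ->
  exists N : R, forall x, N <= x -> C * ((1 + x) ^+ 2 * expR (- (k * x))) <= e.
Proof.
move=> C0 k0 e0; have C1 : 0 < C + 1 by rewrite ltr_wpDl.
have [N hN] := exp_rate k0 (divr_gt0 e0 C1); exists N => x /hN h.
apply: (@le_trans _ _ ((C + 1) * (e / (C + 1)))); last by rewrite mulrC divfK ?gt_eqF.
apply: ler_pM => //; first by rewrite mulr_ge0 ?sqr_ge0 ?expR_ge0.
by rewrite lerDl.
Qed.

Let g : R := sqrt (tau0 + c) - sqrt (tau0 + c / 2).
Let g0 : 0 < g.
Proof. by rewrite subr_gt0 ltr_sqrt; have := c0; have := t00; lra. Qed.

(** [g] is the gap between the signal scale [sqrt (tau0 + c)] and the threshold scale. One quarter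
    each goes to the noise, the bias and the attenuation; the other bound keeps the noise level
    below [t]. *)
Definition signal_slack : R := Num.min (g / 4) (sqrt tau0).
Let xi := signal_slack.
Let xi0 : 0 < xi.
Proof. by rewrite /xi /signal_slack lt_min; apply/andP; split; [rewrite divr_gt0|rewrite sqrtr_gt0]. Qed.

(** The interval between the two square roots has length proportional to [sqrt (ln p)] and so
    eventually contains an integer, although the grid is made of integers. *)
Lemma near_grid : \forall k \near \oo, exists m : nat,
  (tau0 + c / 4) * L k <= m%:R ^+ 2 /\ m%:R ^+ 2 <= (tau0 + c / 2) * L k.
Proof.
pose h := sqrt (tau0 + c / 2) - sqrt (tau0 + c / 4).
have h0 : 0 < h by rewrite subr_gt0 ltr_sqrt; have := c0; have := t00; lra.
near=> k.
have L1 : 1 <= L k by near: k; exact: (near_ln p1 pinf).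
have L2 : (h^-1) ^+ 2 <= L k by near: k; exact: (near_ln p1 pinf).
have hL : 1 <= h * sqrt (L k).
  rewrite -ler_pdivrMl// mulr1 -[leLHS]ger0_norm ?invr_ge0 ?(ltW h0)// -sqrtr_sqr ler_wsqrtr//.
have Lk0 : 0 <= L k by lra.
pose b := sqrt ((tau0 + c / 2) * L k); exists (Num.trunc b).
have /andP[h1 h2] := truncn_itv (sqrtr_ge0 ((tau0 + c / 2) * L k)).
rewrite -/b in h1 h2.
have a2 : 0 <= tau0 + c / 2 by have := c0; have := t00; lra.
have a4 : 0 <= tau0 + c / 4 by have := c0; have := t00; lra.
have b2 : b ^+ 2 = (tau0 + c / 2) * L k by rewrite sqr_sqrtr// mulr_ge0.
have m0 : 0 <= (Num.trunc b)%:R :> R by [].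
split; last by rewrite -b2 ler_sqr ?nnegrE// sqrtr_ge0.
pose b' := sqrt ((tau0 + c / 4) * L k).
have b'2 : b' ^+ 2 = (tau0 + c / 4) * L k by rewrite sqr_sqrtr// mulr_ge0.
rewrite -b'2 ler_sqr ?nnegrE ?sqrtr_ge0//.
have e1 : b = sqrt (tau0 + c / 2) * sqrt (L k) by rewrite /b sqrtrM.
have e2 : b' = sqrt (tau0 + c / 4) * sqrt (L k) by rewrite /b' sqrtrM.
have : b' + 1 <= b by rewrite e1 e2; move: hL; rewrite /h mulrBl; lra.
rewrite -natr1 in h2; lra.
Unshelve. all: by end_near.
Qed.

Lemma near_shell_width (K x : R) : 0 <= K * cst_bias cmin kap -> 0 < x ->
  \forall k \near \oo, 0 <= shell_width (n k) (p k) (sm k) (s k) cmin kap K /\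
    shell_width (n k) (p k) (sm k) (s k) cmin kap K <= x * sqrt (L k).
Proof.
move=> Kc0 x0; set C := K * _ in Kc0.
have C1 : 0 < C + 1 by rewrite ltr_wpDl.
have e0 : 0 < x / (10 * (C + 1)) by rewrite divr_gt0// mulr_gt0.
apply: filterS (near_width p1 n0 pinf A3 eta01 sE e0) => k /= [w1 w2 w3 _ _].
rewrite -/(l k) in w1 w2 w3.
have nR : 0 < (n k)%:R :> R by rewrite ltr0n.
have Lk0 : 0 < L k by rewrite ln_gt0// ltr1n.
have nl : sqrt (n k)%:R * l k = sqrt (L k).
  by rewrite -sqrtrM ?(ltW nR)// mulrC divfK// gt_eqF.
have l0 : 0 <= l k by exact: sqrtr_ge0.
rewrite /shell_width -/(L k) -/(l k) -/C nl.
set A := _ + 8 * _ * _ + _.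
have A0 : 0 <= A by rewrite !addr_ge0// mulr_ge0// mulr_ge0.
have A1 : A <= 10 * (x / (10 * (C + 1))) by rewrite /A -[8 * _ * _]mulrA; lra.
split; first by apply: mulr_ge0 => //; apply: mulr_ge0.
rewrite mulrCA [leRHS]mulrC; apply: ler_wpM2l; first exact: sqrtr_ge0.
apply: (@le_trans _ _ ((C + 1) * (10 * (x / (10 * (C + 1)))))).
  by apply: ler_pM => //; rewrite lerDl.
by apply: le_of_eq; field; rewrite gt_eqF.
Qed.

Let fact k : (0 < sm k)%N -> let E := expR (- (tau0 / 2 * L k)) in
  [/\ E <= pr k ^+ 2 * (p k)%:R, E <= pr k ^+ 2 * sqrt ((n k)%:R / (sm k)%:R) &
      E <= sqrt (n k)%:R / (s k)%:R ^+ 2].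
Proof. by move=> sm0; apply: gamma_bounds => //; have /andP[] := gam_tau0 k. Qed.

Let pr0 k : 0 < pr k.
Proof. by rewrite divr_gt0 ?ltr0n// ltnW// (sparsity_gt1 p1 eta01 sE). Qed.

Lemma near_shell_prob (K y e : R) : 0 <= K * cst_bias cmin kap -> 0 < y -> 0 < e ->
  \forall k \near \oo, forall (N : nat) (D : R), N%:R <= sqrt (tau1 * L k) + 1 ->
   D = shell_width (n k) (p k) (sm k) (s k) cmin kap K ->
   N%:R * (2 * D * expR (- (sqrt (tau0 * L k) - D) ^+ 2 / 2)) / (y * pr k) <= e.
Proof.
move=> Kc0 y0 e0; set C := K * _ in Kc0.
(* The smaller of the two gains of [shell_width_rate]: [sqrt E = p^(- tau0 / 4)] and
   [1 / r = p^(- 1 / 10)]. *)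
pose k0 : R := Num.min (tau0 / 4) 10^-1.
have k00 : 0 < k0 by rewrite lt_min divr_gt0//= invr_gt0.
have k20 : 0 < k0 / 2 by rewrite divr_gt0.
have st0 : 0 < sqrt tau0 by rewrite sqrtr_gt0.
(* With this width the cross term [t0 D] in the exponent costs at most [p^(k0 / 2)], half of the
   gain. *)
have x0 : 0 < k0 / 2 / sqrt tau0 by rewrite divr_gt0.
have C'0 : 0 <= 44 * C * (sqrt tau1 + 1) / y.
  apply: divr_ge0; last exact: ltW.
  by apply: mulr_ge0; [apply: mulr_ge0; [exact: ler0n|]|rewrite addr_ge0 ?sqrtr_ge0].
have [N1 hN1] := exp_rate_scaled C'0 k20 e0.
near=> k.
move=> N D hN DE.
have L1 : 1 <= L k by near: k; exact: (near_ln p1 pinf).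
have LN : N1 <= L k by near: k; exact: (near_ln p1 pinf).
have sm0 : (0 < sm k)%N by near: k.
have [D0 Dx] : 0 <= D /\ D <= k0 / 2 / sqrt tau0 * sqrt (L k).
  by rewrite DE; near: k; exact: near_shell_width.
have smn : (sm k <= n k)%N by near: k; exact: (near_sm_le p1 n0 pinf A3 eta01 sE).
have Lk0 : 0 <= L k by lra.
have [g1 g2 g3] := fact sm0; set E := expR _ in g1 g2 g3.
have E0 : 0 < E by exact: expR_gt0.
pose r := expR (L k / 10).
have r1 : 1 <= r by rewrite -[leLHS]expR0 ler_expR divr_ge0.
have rp : (p k)%:R = r ^+ 10.
  rewrite /r -expRM_natl (_ : 10%:R * (L k / 10) = L k); last by field.
  by rewrite lnK// posrE ltr0n ltnW.
have s0 : (0 < s k)%N by rewrite ltnW// (sparsity_gt1 p1 eta01 sE).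
have hD := shell_width_rate (n0 k) sm0 smn s0 r1 rp Kc0 E0 g2 g3; rewrite -DE in hD.
have hW : sqrt E + r^-1 <= 2 * expR (- (k0 * L k)).
  have a1 : sqrt E <= expR (- (k0 * L k)).
    rewrite /E expR_sqrt (_ : - (tau0 / 2 * L k) / 2 = - (tau0 / 4 * L k)); last by field.
    by apply: exp_rate_le => //; rewrite ge_min lexx.
  have a2 : r^-1 <= expR (- (k0 * L k)).
    rewrite /r -expRN (_ : L k / 10 = 10^-1 * L k); last by rewrite mulrC.
    by apply: exp_rate_le => //; rewrite ge_min lexx orbT.
  by rewrite mulr2n mulrDl mul1r lerD.
have st : sqrt (tau0 * L k) = sqrt tau0 * sqrt (L k) by rewrite sqrtrM// ltW.
have sL : sqrt (L k) ^+ 2 = L k by rewrite sqr_sqrtr.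
have he : expR (- (sqrt (tau0 * L k) - D) ^+ 2 / 2) <= E * expR (k0 / 2 * L k).
  apply: shell_exp_rate; first by rewrite sqr_sqrtr// mulr_ge0// ltW.
  rewrite st; apply: (le_trans (ler_wpM2l (mulr_ge0 (ltW st0) (sqrtr_ge0 _)) Dx)).
  rewrite [leLHS](_ : _ = k0 / 2 * sqrt (L k) ^+ 2); first by rewrite sL.
  by field; rewrite gt_eqF.
apply: le_trans (hN1 _ LN).
have hN' : N%:R <= sqrt tau1 * sqrt (L k) + 1.
  apply: (le_trans hN); rewrite sqrtrM//.
  have := c0; have := t00; have := gam_tau1 k; have /andP[] := gam_tau0 k; lra.
exact: (shell_prob_arith (ler0n _ _) (pr0 k) y0 L1 Kc0 (sqrtr_ge0 _) D0 (ltW E0) (expR_ge0 _) hN' hD hW he).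
Unshelve. all: by end_near.
Qed.

Let sqL k : sqrt (L k) ^+ 2 = L k.
Proof. by rewrite sqr_sqrtr// ln_ge0// ler1n ltnW. Qed.

Lemma near_sqrt_ln (x N : R) : 0 < x -> \forall k \near \oo, N <= x * sqrt (L k).
Proof.
move=> x0; near=> k.
have h : (N / x) ^+ 2 <= L k by near: k; exact: (near_ln p1 pinf).
rewrite -ler_pdivrMl// mulrC; apply: (le_trans (ler_norm _)).
by rewrite -sqrtr_sqr ler_wsqrtr.
Unshelve. all: by end_near.
Qed.

Lemma near_tail (x y e : R) : 0 < x -> 0 < y -> 0 < e ->
  \forall k \near \oo, 2 * Phibar (x * sqrt (L k)) / y <= e.
Proof.
move=> x0 y0 e0; have b0 : 0 < x ^+ 2 / 2 by rewrite divr_gt0// exprn_gt0.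
have [N hN] := exp_rate b0 (mulr_gt0 e0 y0); near=> k.
have L1 : 1 <= L k by near: k; exact: (near_ln p1 pinf).
have LN : N <= L k by near: k; exact: (near_ln p1 pinf).
have h1 : 1 <= x * sqrt (L k) by near: k; exact: near_sqrt_ln.
have L0 : 0 <= L k by lra.
rewrite ler_pdivrMr//; apply: le_trans (hN _ LN).
have hb : x ^+ 2 * L k <= (x * sqrt (L k)) ^+ 2 by rewrite exprMn sqL.
apply: (le_trans (tail_rate L0 h1 hb)).
by apply: ler_peMl; [exact: expR_ge0|rewrite exprn_ege1//; lra].
Unshelve. all: by end_near.
Qed.

(** The factor [p^(- tau0 / 2)] is matched with powers of the proportion through [gamma_bounds]; the
    surplus [p^(- c / 8)] is kept for the logarithms. *)
Let tail_split t k : 1 <= t -> 0 <= L k -> (tau0 + c / 4) * L k <= t ^+ 2 ->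
  2 * Phibar t <= expR (- (tau0 / 2 * L k)) * expR (- (c / 8 * L k)).
Proof.
move=> t1 L0 h; apply: (le_trans (tail_rate L0 t1 h)).
by rewrite -expRD ler_expR; lra.
Qed.

Let grid_ge1 : \forall k \near \oo, 1 <= L k /\
  forall t, 0 <= t -> (tau0 + c / 4) * L k <= t ^+ 2 -> 1 <= t.
Proof.
have a0 : 0 < tau0 + c / 4 by have := c0; have := t00; lra.
near=> k.
have L1 : 1 <= L k by near: k; exact: (near_ln p1 pinf).
have La : (tau0 + c / 4)^-1 <= L k by near: k; exact: (near_ln p1 pinf).
split=> // t u0 h; rewrite -ler_sqr ?nnegrE// expr1n; apply: le_trans h.
by rewrite -ler_pdivrMl// mulr1.
Unshelve. all: by end_near.
Qed.

Let c80 : 0 < c / 8. Proof. by rewrite divr_gt0. Qed.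

(** The form in which [gamma1] is used: [w] comes from the variance of the exceedances and [sqrt w]
    from the square of [cs]. *)
Let vb k : (0 < sm k)%N -> (sm k <= n k)%N ->
  let w : R := (sm k)%:R / (n k)%:R in let E := expR (- (tau0 / 2 * L k)) in
  [/\ 0 <= w, sqrt w * E <= pr k ^+ 2 & E * w <= pr k ^+ 2].
Proof.
move=> sm0 smn w E; have [_ g2 _] := fact sm0; rewrite -/E in g2.
have nR : 0 < (n k)%:R :> R by rewrite ltr0n.
have sR : 0 < (sm k)%:R :> R by rewrite ltr0n.
have w0 : 0 < w by rewrite divr_gt0.
have w1 : sqrt w <= 1 by rewrite -sqrtr1 ler_wsqrtr// ler_pdivrMr// mul1r ler_nat.
have dd : sqrt w * sqrt ((n k)%:R / (sm k)%:R) = 1.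
  by rewrite -sqrtrM ?(ltW w0)// mulrA divfK ?gt_eqF// divff ?sqrtr1// gt_eqF.
have h : sqrt w * E <= pr k ^+ 2.
  by apply: (le_trans (ler_wpM2l (sqrtr_ge0 _) g2)); rewrite mulrCA dd mulr1.
split => //; first exact: ltW.
apply: le_trans h; rewrite mulrC; apply: ler_wpM2r; first exact: expR_ge0.
by rewrite -[leLHS](sqr_sqrtr (ltW w0)) expr2 ler_piMr// sqrtr_ge0.
Qed.

Lemma near_variance (C y e : R) : 0 <= C -> 0 < y -> 0 < e ->
  \forall k \near \oo, forall t, 0 <= t -> (tau0 + c / 4) * L k <= t ^+ 2 ->
  2 * Phibar t * (C * ((p k)%:R^-1 + (sqrt (sm k + 2)%:R * l k) ^+ 2)) / (y * pr k) ^+ 2 <= e.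
Proof.
move=> C0 y0 e0; have C'0 : 0 <= 3 * C / y ^+ 2.
  by apply: divr_ge0; [exact: mulr_ge0|exact: sqr_ge0].
have [N hN] := exp_rate_scaled C'0 c80 e0.
near=> k.
move=> t u0 ht.
have [L1 /(_ _ u0 ht) t1] : 1 <= L k /\ forall t, 0 <= t -> (tau0 + c / 4) * L k <= t ^+ 2 -> 1 <= t.
  by near: k; exact: grid_ge1.
have LN : N <= L k by near: k; exact: (near_ln p1 pinf).
have sm0 : (0 < sm k)%N by near: k.
have smn : (sm k <= n k)%N by near: k; exact: (near_sm_le p1 n0 pinf A3 eta01 sE).
have L0 : 0 <= L k by lra.
have pR : 0 < (p k)%:R :> R by rewrite ltr0n ltnW.
have [w0 _ Ew] := vb sm0 smn; have [g1 _ _] := fact sm0.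
have q0 : 0 <= 2 * Phibar t by rewrite mulr_ge0// Phibar_ge0.
apply: le_trans (hN _ LN).
apply: (variance_rate_arith (pr0 k) y0 C0 L1 (expR_ge0 _) (expR_ge0 _) q0 (tail_split t1 L0 ht) _ _ _ Ew _ w0).
- by rewrite invr_ge0 ltW.
- exact: sqr_ge0.
- by rewrite ler_pdivrMr.
rewrite exprMn sqr_sqrtr// sqr_sqrtr ?divr_ge0// mulrCA mulrA [3 * L k * _]mulrA.
rewrite ler_wpM2r ?invr_ge0// [3 * _]mulrC -mulrA ler_wpM2l// -natrM ler_nat.
by rewrite mulSn leq_add2l leq_pmulr.
Unshelve. all: by end_near.
Qed.

(** Squared, the exponent [1/4] of [cs] gives [sqrt (sm / n)], which times [p^(- tau0 / 2)] is at
    most the squared proportion; [p^(- c / 8)] absorbs [(ln p)^2]. *)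
Lemma near_threshold (y : R) : 0 < y ->
  \forall k \near \oo, forall t, 0 <= t -> (tau0 + c / 4) * L k <= t ^+ 2 ->
  `|cs k| * sigmabar t <= y * pr k.
Proof.
move=> y0; have [N hN] := exp_rate_scaled (sqr_ge0 M) c80 (exprn_gt0 2 y0).
near=> k.
move=> t u0 ht.
have [L1 /(_ _ u0 ht) t1] : 1 <= L k /\ forall t, 0 <= t -> (tau0 + c / 4) * L k <= t ^+ 2 -> 1 <= t.
  by near: k; exact: grid_ge1.
have LN : N <= L k by near: k; exact: (near_ln p1 pinf).
have sm0 : (0 < sm k)%N by near: k.
have smn : (sm k <= n k)%N by near: k; exact: (near_sm_le p1 n0 pinf A3 eta01 sE).
have hcs : `|cs k| <= M * (((sm k)%:R / (n k)%:R) `^ 4^-1 * L k) by near: k.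
have L0 : 0 <= L k by lra.
have [w0 sw _] := vb sm0 smn.
have v2 : (((sm k)%:R / (n k)%:R) `^ 4^-1) ^+ 2 = sqrt ((sm k)%:R / (n k)%:R) :> R.
  rewrite -powR_mulrn ?powR_ge0// -powRrM -powR12_sqrt// (_ : 4^-1 * 2 = 2^-1)//.
  by rewrite [in LHS](_ : 4 = 2 * 2) 1?invfM ?mulfVK//; rewrite -natrM.
have sv0 : 0 <= ((sm k)%:R / (n k)%:R) `^ 4^-1 :> R by exact: powR_ge0.
have q0 : 0 <= 2 * Phibar t by rewrite mulr_ge0// Phibar_ge0.
have q1 : 2 * Phibar t <= 1 by apply: (le_trans (tail2_le t1)); rewrite -[leRHS]expR0 ler_expR; have := sqr_ge0 t; lra.
have sb : sigmabar t ^+ 2 <= 2 * Phibar t.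
  rewrite sqr_sqrtr; first by rewrite ler_piMr// gerBl.
  by rewrite mulr_ge0// subr_ge0.
have M0 : 0 <= M.
  rewrite leNgt; apply/negP => Mn; move: hcs; apply/negP; rewrite -ltNge.
  apply: lt_le_trans (normr_ge0 _); rewrite nmulr_rlt0// mulr_gt0 ?powR_gt0//; last lra.
  by rewrite divr_gt0 ?ltr0n.
rewrite -v2 in sw.
exact: (threshold_rate_arith (pr0 k) y0 M0 L0 (expR_ge0 _) (expR_ge0 _) (sqrtr_ge0 _) sv0 hcs sb (tail_split t1 L0 ht) sw (hN _ LN)).
Unshelve. all: by end_near.
Qed.

(** [tau0 < 2 gam + c] puts the signal scale above [sqrt (tau0 + c)], while [t] is at most at scale
    [sqrt (tau0 + c / 2)]; the three losses take three quarters of the gap. *)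
Lemma near_signal (C : R) : 0 <= C ->
  \forall k \near \oo, forall t D, 0 <= t -> t ^+ 2 <= (tau0 + c / 2) * L k ->
  D <= signal_slack * sqrt (L k) ->
  t + signal_slack * sqrt (L k) + D <
  (1 - C * (sqrt (sm k + 2)%:R * l k)) * sqrt (2 * (gam k + c) * L k).
Proof.
move=> C0; set r2 := sqrt (tau0 + c).
have r20 : 0 < r2 by rewrite sqrtr_gt0; have := c0; have := t00; lra.
have C1 : 0 < C + 1 by rewrite ltr_wpDl.
have e0 : 0 < Num.min (g / (4 * (C + 1) * r2)) (C + 1)^-1.
  by rewrite lt_min invr_gt0 C1 andbT divr_gt0// mulr_gt0// mulr_gt0.
apply: filterS (filterI (near_ln p1 pinf 1) (near_width p1 n0 pinf A3 eta01 sE e0)) => k /= [L1 [qe _ _ _ _]].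
rewrite -/(L k) -/(l k) in L1 qe.
move=> t D u0 ht hD.
set q := _ * l k in qe *; rewrite le_min in qe; case/andP: qe => qe1 qe2.
have q0 : 0 <= q by rewrite mulr_ge0 ?sqrtr_ge0.
have L0 : 0 <= L k := le_trans ler01 L1.
have sL1 : 1 <= sqrt (L k) by rewrite -sqrtr1 ler_wsqrtr.
have CC : C * q <= (C + 1) * q by rewrite ler_wpM2r// lerDl.
have Cq : C * q <= 1 by apply: (le_trans CC); rewrite mulrC -ler_pdivlMr// mul1r.
have Cg : C * q * r2 <= g / 4.
  apply: (@le_trans _ _ ((C + 1) * q * r2)); first by rewrite ler_wpM2r// ltW.
  have d0 : 0 < 4 * (C + 1) * r2 by rewrite mulr_gt0// mulr_gt0.
  by rewrite ler_pdivlMr// in qe1; lra.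
have a2 : 0 <= tau0 + c / 2 by have := c0; have := t00; lra.
have ht' : t <= sqrt (tau0 + c / 2) * sqrt (L k).
  by rewrite -sqrtrM// -[leLHS](ger0_norm u0) -sqrtr_sqr ler_wsqrtr.
have a3 : 0 <= tau0 + c by have := c0; have := t00; lra.
have hr : r2 * sqrt (L k) <= sqrt (2 * (gam k + c) * L k).
  rewrite -sqrtrM// ler_wsqrtr// ler_wpM2r//.
  by have := c0; have /andP[] := gam_tau0 k; lra.
apply: (@lt_le_trans _ _ ((1 - C * q) * (r2 * sqrt (L k)))); last first.
  by rewrite ler_wpM2l// subr_ge0.
have xg : signal_slack <= g / 4 by rewrite ge_min lexx.
have gE : g = r2 - sqrt (tau0 + c / 2) by [].
have xs : signal_slack * sqrt (L k) <= g / 4 * sqrt (L k) by rewrite ler_wpM2r.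
have gs : 0 < g * sqrt (L k) by rewrite mulr_gt0// (lt_le_trans _ sL1).
have Cs : C * q * r2 * sqrt (L k) <= g / 4 * sqrt (L k) by rewrite ler_wpM2r.
have gs' : g * sqrt (L k) = r2 * sqrt (L k) - sqrt (tau0 + c / 2) * sqrt (L k).
  by rewrite gE mulrBl.
rewrite mulrBl mul1r mulrA.
move: ht' hD xs gs Cs gs'.
move: (C * q * r2 * _) (signal_slack * _) (r2 * _) (sqrt (tau0 + c / 2) * _) => A E B F.
rewrite [g / 4 * _]mulrAC; move: (g * _) => G; lra.
Qed.

End FinalRates.

Section GridRates.
Context {R : realType}.

Lemma Tgrid_sqr (p m : nat) (tau0 tau1 : R) :
  tau0 * ln p%:R <= m%:R ^+ 2 -> m%:R ^+ 2 <= tau1 * ln p%:R -> Tgrid p tau0 tau1 m.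
Proof.
move=> h0 h1; rewrite /Tgrid/= -[m%:R](ger0_norm (ler0n _ _)) -sqrtr_sqr.
by apply/andP; split; apply: ler_wsqrtr.
Qed.

Lemma Tgrid_ge (p m : nat) (tau0 tau1 : R) : 0 <= tau0 * ln p%:R ->
  Tgrid p tau0 tau1 m -> tau0 * ln p%:R <= m%:R ^+ 2.
Proof.
move=> h0 /andP[h _]; rewrite -[leLHS]sqr_sqrtr// ler_sqr ?nnegrE ?sqrtr_ge0//.
Qed.

(** By Young's inequality, [2 m <= d m^2 + 1 / d] with [d = (2 - b) / (2 b)], the shift from [m] to
    [m + 1] uses half of the margin [2 - b]; the other half grows with [L]. *)
Lemma subcritical_tail (L phi b m e : R) : 0 < phi -> 0 < b -> b < 2 -> 0 <= m -> m ^+ 2 <= b * L ->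
  (18 / phi + (1 + 2 * b / (2 - b)) / 2) <= (2 - b) / 4 * L ->
  e = 2 * (phi * expR (- (m + 1) ^+ 2 / 2)) -> 36 <= expR L * e.
Proof.
move=> phi0 b0 b2 m0 hm hL ->.
have -> : expR L * (2 * (phi * expR (- (m + 1) ^+ 2 / 2))) = 2 * phi * expR (L - (m + 1) ^+ 2 / 2).
  by rewrite expRD mulNr; ring.
pose d := (2 - b) / (2 * b); have d0 : 0 < d by rewrite divr_gt0 ?subr_gt0 ?mulr_gt0.
have h2m : 2 * m <= d * m ^+ 2 + d^-1.
  rewrite -(ler_pM2l d0) (_ : d * (d * m ^+ 2 + d^-1) = (d * m) ^+ 2 + 1); last by field; rewrite gt_eqF.
  by have := sqr_ge0 (d * m - 1); rewrite sqrrB1 -mulr_natr; lra.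
have dE : d^-1 = 2 * b / (2 - b) by rewrite /d invf_div.
have h3 : (m + 1) ^+ 2 / 2 <= (2 + b) / 4 * L + (1 + 2 * b / (2 - b)) / 2.
  have : (1 + d) * m ^+ 2 <= (1 + d) * (b * L) by rewrite ler_wpM2l// addr_ge0// ltW.
  have -> : (1 + d) * (b * L) = (2 + b) / 2 * L by rewrite /d; field; rewrite gt_eqF.
  rewrite -dE (_ : (m + 1) ^+ 2 = m ^+ 2 + 2 * m + 1); last by ring.
  move: h2m; rewrite [in X in _ -> X -> _]mulrDl mul1r.
  by move: (d * m ^+ 2) (d^-1) (m ^+ 2) => u v w; lra.
have h4 : 18 / phi <= L - (m + 1) ^+ 2 / 2.
  by move: hL h3; move: ((m + 1) ^+ 2 / 2) (2 * b / (2 - b)) (18 / phi) => u v w; lra.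
rewrite -ler_pdivrMl ?mulr_gt0//; apply: (@le_trans _ _ (18 / phi)).
  by apply: le_of_eq; field; rewrite gt_eqF.
by apply: (le_trans h4); apply: le_trans (expR_ge1Dx _); rewrite lerDr.
Qed.

Variables (p n s sm : nat -> nat) (eta : nat -> R) (tau0 tau1 : R).
Hypotheses (p1 : forall k, (1 < p k)%N) (n0 : forall k, (0 < n k)%N) (pinf : p @ \oo --> \oo)
  (A3 : @condA3 R p n s sm) (eta01 : forall k, 0 < eta k < 1)
  (sE : forall k, (s k)%:R = (p k)%:R `^ (1 - eta k)) (t00 : 0 < tau0) (t01 : tau0 < tau1).
Let L k : R := ln (p k)%:R.
Let l k : R := sqrt (L k / (n k)%:R).

Lemma near_small (cmin cmax kap : R) : 0 < cmin -> 0 <= cmax -> 0 <= kap ->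
  \forall k \near \oo, let q := sqrt (sm k + 2)%:R * l k in
  [/\ 12 * l k <= 1, 8 * q <= 1, 8 * q * (cmax + 64) <= cmin / 2, cst_resid cmin kap * q <= cmin / 2 &
      8 * sqrt (s k)%:R * l k <= 1 /\ 8 * sqrt (s k)%:R * l k * (cmax + 64) <= cmin / 2].
Proof.
move=> cm0 cM0 k0; have C0 := cst_resid_ge0 cm0 k0; set C := cst_resid _ _ in C0 *.
pose a1 := 16 * (cmax + 64) / cmin; pose a2 := 2 * C / cmin.
have a10 : 0 <= a1 by rewrite divr_ge0 ?(ltW cm0)// mulr_ge0// addr_ge0.
have a20 : 0 <= a2 by rewrite divr_ge0 ?(ltW cm0)// mulr_ge0.
have e0 : 0 < (12 + a1 + a2)^-1 by rewrite invr_gt0; lra.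
have w := near_width p1 n0 pinf A3 eta01 sE e0.
apply: filterS w => k [w1 w2 _ w4 _].
have aux x a : 0 <= x -> x <= (12 + a1 + a2)^-1 -> a <= 12 + a1 + a2 -> a * x <= 1.
  move=> x0 hx ha; apply: (le_trans (ler_wpM2r x0 ha)).
  by rewrite mulrC -ler_pdivlMr ?div1r//; lra.
have l0 : 0 <= l k by exact: sqrtr_ge0.
have q0 (u : R) : 0 <= sqrt u * l k by rewrite mulr_ge0 ?sqrtr_ge0.
have b1 x : 0 <= x -> x <= (12 + a1 + a2)^-1 -> 8 * x * (cmax + 64) <= cmin / 2.
  move=> x0 hx; have : a1 * x <= 1 by apply: aux => //; lra.
  rewrite /a1 mulrAC ler_pdivrMr// mul1r; move: (cmax + 64) => y; lra.
split.
- by apply: aux w4 _ => //; lra.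
- by apply: aux w1 _ => //; lra.
- exact: b1.
- have : a2 * (sqrt (sm k + 2)%:R * l k) <= 1 by apply: aux => //; lra.
  by rewrite /a2 mulrAC ler_pdivrMr// mul1r; lra.
split; first by rewrite -mulrA; apply: aux w2 _ => //; lra.
by rewrite -[8 * _ * l k]mulrA; exact: b1.
Qed.

(** At [tau0 = 2] the exponential alone only gives 1; the factor [1 / t] of Mills' bound makes the
    inequality strict. *)
Lemma near_grid_sparse : 2 <= tau0 -> \forall k \near \oo,
  (exists m, Tgrid (p k) tau0 tau1 m) /\
  (forall t, Tgrid (p k) tau0 tau1 t -> (p k)%:R * (2 * Phibar (t%:R : R)) < 1).
Proof.
move=> t02; have c0 : 0 < tau1 - tau0 by rewrite subr_gt0.
apply: filterS (filterI (near_ln p1 pinf 1) (near_grid p1 pinf c0 t00)) => k [L1 [m [m1 m2]]].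
rewrite -/(L k) in L1 m1 m2.
have {}L1 : 1 <= L k := L1; have L0 : 0 <= L k by lra.
split.
  exists m; apply: Tgrid_sqr; [apply: le_trans m1|apply: (le_trans m2)]; rewrite -/(L k) ler_wpM2r//; lra.
move=> t gt; have t2 : tau0 * L k <= t%:R ^+ 2 by apply: Tgrid_ge gt; rewrite -/(L k) mulr_ge0// ltW.
have t2' : 2 * L k <= t%:R ^+ 2 by apply: le_trans t2; rewrite ler_wpM2r.
have u0 : 0 <= t%:R :> R by [].
have t1 : 1 < t%:R :> R.
  by rewrite -(@ltr_pXn2r _ 2)// ?nnegrE// expr1n; apply: lt_le_trans t2'; lra.
have tp : 0 < t%:R :> R by lra.
have pE : (p k)%:R = expR (L k) by rewrite lnK// posrE ltr0n ltnW.
apply: (@le_lt_trans _ _ (t%:R^-1)); last by rewrite invf_lt1.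
have h : 2 * Phibar (t%:R : R) <= expR (- t%:R ^+ 2 / 2) / t%:R.
  apply: (le_trans (ler_wpM2l (ler0n R 2) (Phibar_mills tp))); rewrite mulrA ler_pM2r ?invr_gt0// /gpdf.
  by have := @phi0_le R; have := expR_ge0 (- t%:R ^+ 2 / 2 : R); move: (expR _) => x; nra.
apply: (le_trans (ler_wpM2l (ler0n _ _) h)); rewrite mulrA ler_piMl ?invr_ge0//.
by rewrite pE -expRD -[leRHS]expR0 ler_expR; move: t2'; move: (t%:R ^+ 2) => x; lra.
Qed.

(** The expected number of exceedances is [p^(1 - tau0 / 2)] up to smaller factors, hence large near
    [tau0 < 2]; [c] is shrunk to keep the chosen point below 2. *)
Lemma near_grid_dense : tau0 < 2 -> \forall k \near \oo, exists2 m, Tgrid (p k) tau0 tau1 m &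
  [/\ (4096 <= n k)%N, 0 < m%:R :> R, 4 * m%:R ^+ 2 <= sqrt (n k)%:R :> R,
      2 * Phibar (m%:R / 2 : R) <= 16^-1 & 36 <= (p k)%:R * (2 * Phibar (m%:R : R))].
Proof.
move=> t02; pose c := Num.min (tau1 - tau0) (2 - tau0).
have c0 : 0 < c by rewrite lt_min !subr_gt0 t01.
have cm : c <= tau1 - tau0 /\ c <= 2 - tau0 by rewrite !ge_min !lexx orbT.
pose b := tau0 + c / 2; have b0 : 0 < b by rewrite /b; have := t00; lra.
have b2 : b < 2 by case: cm => _; rewrite /b; have := t02; lra.
have hb : 0 < (2 - b) / 4 by rewrite divr_gt0// subr_gt0.
have f1 := near_n_large p1 A3 eta01 sE 4096.
have f2 := near_ln p1 pinf ((18 / (phi0 : R) + (1 + 2 * b / (2 - b)) / 2) / ((2 - b) / 4)).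
apply: filterS (filterI (near_ln p1 pinf 1) (filterI (near_grid p1 pinf c0 t00) (filterI f1
  (filterI f2 (near_ln p1 pinf (128 / tau0)))))) => k [L1 [[m [m1 m2]] [nL [L2 L3]]]].
rewrite -/(L k) -/b in L1 m1 m2 nL L2 L3.
rewrite ler_pdivrMr// [X in _ <= X]mulrC in L2; rewrite ler_pdivrMr// in L3.
have {}L1 : 1 <= L k := L1; have L0 : 0 <= L k by lra.
have u0 : 0 <= m%:R :> R by [].
have mt : tau0 * L k <= m%:R ^+ 2 by apply: le_trans m1; rewrite ler_wpM2r//; lra.
have pE : (p k)%:R = expR (L k) by rewrite lnK// posrE ltr0n ltnW.
have m128 : 128 <= m%:R ^+ 2 :> R by apply: le_trans mt; rewrite mulrC.
have m2' : 2 <= m%:R :> R by rewrite -ler_sqr ?nnegrE//; apply: le_trans m128; rewrite -natrX ler_nat.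
exists m.
  apply: Tgrid_sqr => //; apply: (le_trans m2); rewrite -/(L k) ler_wpM2r// /b; lra.
split.
- rewrite -(ler_nat R); apply: le_trans nL; rewrite ler_peMr ?ler0n// exprn_ege1//.
- by apply: lt_le_trans m2'.
- apply: (@le_trans _ _ (sqrt ((64 * L k) ^+ 2))).
    rewrite sqrtr_sqr ger0_norm; last by rewrite mulr_ge0.
    by have : b * L k <= 2 * L k; [rewrite ler_wpM2r// ltW|lra].
  by rewrite ler_wsqrtr// exprMn -natrX.
- have h1 : 1 <= m%:R / 2 :> R by rewrite ler_pdivlMr// mul1r.
  apply: (le_trans (tail2_le h1)).
  have -> : - (m%:R / 2) ^+ 2 / 2 = - (m%:R ^+ 2 / 8) :> R by field.
  rewrite expRN lef_pV2 ?posrE ?expR_gt0//; apply: le_trans (expR_ge1Dx _).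
  by move: m128; move: (m%:R ^+ 2) => x; lra.
rewrite pE; apply: (@le_trans _ _ (expR (L k) * (2 * gpdf (m%:R + 1)))).
  apply: (subcritical_tail (@phi0_gt0 R) b0 b2 u0 m2).
    exact: L2.
  by [].
by rewrite ler_wpM2l ?expR_ge0// ler_wpM2l// Phibar_ge.
Qed.

End GridRates.

Lemma eqTheta_bound {R : realType} (f g : nat -> R) : f =Theta_\oo g ->
  exists M : R, \forall k \near \oo, `|f k| <= M * `|g k|.
Proof. by rewrite eqThetaE bigThetaE => -[/eqO_exP[M _ h] _]; exists M. Qed.

(** In units of [dl / 16] the lower bound loses 6; on the upper side [1 + 2 dl / 16], divided by
    [1 - dl / 16], still stays below [1 + dl]. *)
Lemma ratio_close {R : realType} (dl pr h nJ q x : R) : 0 < dl -> dl <= 1 -> 0 < pr ->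
  nJ <= dl / 16 -> q <= dl / 16 -> x <= dl / 16 * pr ->
  (0 <= (1 - nJ - 2 * (dl / 16) - dl / 16 - dl / 16) * pr - x ->
   (1 - nJ - 2 * (dl / 16) - dl / 16 - dl / 16) * pr - x <= h) ->
  h <= (1 + nJ + dl / 16) * pr / (1 - q) -> `|h / pr - 1| < dl.
Proof.
move=> dl0 dl1 pr0 hJ hq hx lo up.
have ep : (1 - 6 * (dl / 16)) * pr <= (1 - nJ - 2 * (dl / 16) - dl / 16 - dl / 16) * pr - x.
  have : (1 - 6 * (dl / 16)) * pr <= (1 - nJ - 5 * (dl / 16)) * pr - 0 * x.
    by rewrite mul0r subr0 ler_pM2r//; lra.
  have : nJ * pr <= dl / 16 * pr by rewrite ler_pM2r.
  by rewrite !mulrBl !mul1r; lra.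
have p0 : 0 <= (1 - 6 * (dl / 16)) * pr by rewrite mulr_ge0 ?(ltW pr0)//; lra.
have {lo} := le_trans ep (lo (le_trans p0 ep)).
rewrite -ler_pdivlMr// => lo.
have q1 : 0 < 1 - q by lra.
have {}up : h / pr <= (1 + nJ + dl / 16) / (1 - q).
  by rewrite ler_pdivrMr// mulrAC.
have {}up : h / pr < 1 + dl.
  apply: (le_lt_trans up); rewrite ltr_pdivrMr//.
  have : (1 + dl) * (1 - dl / 16) <= (1 + dl) * (1 - q) by rewrite ler_wpM2l//; lra.
  have : dl * dl <= dl by rewrite ler_piMr// ltW.
  by move: hJ hq dl0; clear; move: (_ * (1 - q)) => y; rewrite mulrDl mulrBr; lra.
by rewrite ltr_norml; apply/andP; split; lra.
Qed.

(** * Consistency along the sequence of models *)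

Section Consistency.
Context {R : realType}.
Unset Implicit Arguments.
Variables (p n : nat -> nat) (d : nat -> measure_display) (T : forall k, measurableType (d k)).
Variables (P : forall k, probability (T k) R) (X : forall k, T k -> 'M[R]_(n k, p k)).
Variables (eps : forall k, T k -> 'cV[R]_(n k)) (S : forall k, 'M[R]_(p k)).
Variables (beta : forall k, 'cV[R]_(p k)) (sigma : nat -> R).
Variables (bh : forall k, T k -> 'cV[R]_(p k)) (gh : forall k, T k -> 'I_(p k) -> 'cV[R]_((p k).-1)).
Variables (cmin cmax kap c tau0 tau1 : R) (eta alpha cs : nat -> R).
Set Implicit Arguments.
Let s k := sparsity (beta k).
Let sm k := smax (S k).
Let L k : R := ln (p k)%:R.
Let l k : R := sqrt (L k / (n k)%:R).
Let lamj k : 'I_(p k) -> R := fun=> kap * l k.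
Let gam k := gammastar (eta k) (p k) (n k) (sm k).
Let prop k : R := (s k)%:R / (p k)%:R.
Let z k w := zstat (X k w) (eps k w) (beta k) (sigma k) (@lamj k) (bh k w) (@gh k w).
Let W k w := wstd (X k w) (eps k w) (sigma k) (@lamj k) (@gh k w).
Hypotheses (p1 : forall k, (1 < p k)%N) (n0 : forall k, (0 < n k)%N) (pinf : p @ \oo --> \oo)
  (mX : forall k, random_mx (X k)) (meps : forall k, random_mx (eps k))
  (geps : forall k, gaussian_noise_given (P k) (X k) (eps k) (sigma k ^+ 2)) (sigma0 : forall k, 0 < sigma k)
  (mbh : forall k, random_mx (bh k)) (mgh : forall k j, random_mx (fun w => @gh k w j))
  (hbh : forall k w, is_lasso (X k w) (response (X k w) (eps k w) (beta k)) (8 * sigma k * l k) (bh k w))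
  (hgh : forall k w, is_nodewise_lasso (X k w) (@lamj k) (@gh k w)) (cmin0 : 0 < cmin) (cmax0 : 0 <= cmax)
  (gX : forall k, iid_gaussian_rows (P k) (X k) (S k)) (sS : forall k, (S k)^T = S k)
  (Smin : forall k V, cmin * sqnorm2 V <= qform (S k) V)
  (Smax : forall k V, qform (S k) V <= cmax * sqnorm2 V) (Sd : forall k j, S k j j <= 1) (kap24 : 24 <= kap)
  (A3 : @condA3 R p n s sm) (eta01 : forall k, 0 < eta k < 1)
  (sE : forall k, (s k)%:R = (p k)%:R `^ (1 - eta k)) (c0 : 0 < c)
  (mu : forall k, sqrt (2 * (gam k + c) * L k) <= mu_min (n k) (beta k) (sigma k) (S k)) (t00 : 0 < tau0)
  (t01 : tau0 < tau1) (gam_tau0 : forall k, 2 * gam k < tau0 < 2 * gam k + c)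
  (gam_tau1 : forall k, 2 * (gam k + c) < tau1) (al01 : forall k, 0 < alpha k < 1)
  (al_cvg : alpha @ \oo --> (0 : R))
  (csE : forall k, cs k = quantile (P k) (fun w => Vstar (W w) tau0 tau1) (1 - alpha k))
  (csTheta : cs =Theta_\oo (fun k => ((sm k)%:R / (n k)%:R) `^ 4^-1 * L k : R)).

Let kap0 : 0 <= kap. Proof. by apply: le_trans kap24. Qed.
Let s2 k : (1 < s k)%N. Proof. exact: (sparsity_gt1 p1 eta01 sE). Qed.
Let p0 k : (0 < p k)%N. Proof. exact: ltnW. Qed.

Let near_alpha (e : R) : 0 < e -> \forall k \near \oo, alpha k <= e.
Proof. by move=> e0; apply: cvgr_le al_cvg _ e0. Qed.

(* If [sm k = 0] the assumption on the order of [cs] forces [cs k = 0]. *)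
Lemma near_smax_gt0 : \forall k \near \oo, (0 < sm k)%N.
Proof.
have [M hM] := eqTheta_bound csTheta.
have [x0 x00 x0E] : exists2 x : R, 0 < x & x = expR (- 48) * (expR (- 128) - expR (- 384)).
  by eexists; last reflexivity; rewrite mulr_gt0 ?expR_gt0// subr_gt0 ltr_expR ltrN2 ltr_nat.
have sum_small (a b : R) : b <= x0 / 14 -> a <= x0 / 4 -> a + 7 * b < x0 by move: x00; lra.
have x140 : 0 < x0 / 14 by rewrite divr_gt0.
have x40 : 0 < x0 / 4 by rewrite divr_gt0.
have cs_eq0 k : `|cs k| <= M * `|((sm k)%:R / (n k)%:R) `^ 4^-1 * L k| -> sm k = 0%N -> cs k = 0.
  move=> h sm0; apply/eqP; rewrite -normr_le0; apply: (le_trans h).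
  by rewrite sm0 mul0r powR0 ?invr_eq0 ?pnatr_eq0// mul0r normr0 mulr0.
have al k : 0 < alpha k /\ alpha k < 1 by apply/andP.
(* Above 2 fewer than one exceedance is expected at each grid point and [V_p] has a gap below 0;
   under 2 some grid point has many, and [V_p] is positive with probability bounded below, against
   [alpha k] tending to 0. *)
have [t02|t02] := leP 2 tau0.
  apply: filterS (filterI hM (near_grid_sparse p1 pinf t00 t01 t02)) => k [/cs_eq0 cs0 [[m mg] hg]].
  rewrite lt0n; apply/negP => /eqP/cs0/eqP; have [N hN _] := Tgrid_bounded (p k) tau0 tau1; have [al0 al1] := al k.
  apply/negP; rewrite csE; apply: (cutoff_neq0_gap (P k) (p0 k) _ al0 al1 hN mg hg) => j.
  by apply: measurable_wstd => //.
have f1 := near_grid_dense p1 pinf A3 eta01 sE t00 t01 t02.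
have f2 := near_small p1 n0 pinf A3 eta01 sE cmin0 cmax0 kap0.
apply: filterS (filterI hM (filterI f1 (filterI f2 (filterI (near_pinv p1 pinf x140) (near_alpha x40))))) => k.
move=> [/cs_eq0 cs0 [[m mg [n4 m0 mn m16 m36]] [[h1 h2 h3 h4 [h5 h6]] [hp ha]]]].
rewrite lt0n; apply/negP => /eqP sm0; have /eqP := cs0 sm0.
have [N hN _] := Tgrid_bounded (p k) tau0 tau1; have [al0 al1] := al k.
have hal := sum_small _ _ hp ha; rewrite x0E in hal.
apply/negP.
exact: (cutoff_neq0_diag (@n0 k) (@p1 k) (@mX k) (@meps k) (@geps k) (@gX k) (@mgh k) (@hbh k) (@hgh k) cmin0 (@sS k)
  (@Smin k) cmax0 (@Smax k) (@Sd k) kap24 (s2 k) (sigma0 k) h1 h2 h3 h4 h5 h6 sm0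
  al0 al1 (csE k) hN mg n4 m0 mn m16 m36 hal).
Qed.

Let csM : exists M : R, \forall k \near \oo, `|cs k| <= M * (((sm k)%:R / (n k)%:R) `^ 4^-1 * L k).
Proof.
have [M hM] := eqTheta_bound csTheta; exists M; apply: filterS hM => k; rewrite [X in M * X]ger0_norm//.
by rewrite mulr_ge0 ?powR_ge0// ln_ge0// ler1n ltnW.
Qed.

(** [K] depends on [dl] and the fixed constants only; this uniformity in [k] lets the width keep its
    rate. *)
Let bias_constant (dl : R) : 0 < dl -> dl <= 1 -> exists K : R,
  [/\ 1 <= K, cst_dir cmin cmax < K ^+ 2 & (36 / cmin ^+ 2 + cst_dir cmin cmax) / K ^+ 2 <= dl / 16].
Proof.
move=> dl0 dl1; pose B := 36 / cmin ^+ 2 + `|cst_dir cmin cmax|.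
have i0 : 0 <= 36 / cmin ^+ 2 by rewrite divr_ge0// sqr_ge0.
have B0 : 0 <= B by rewrite addr_ge0.
have cB : cst_dir cmin cmax <= B by have := ler_norm (cst_dir cmin cmax); rewrite /B; lra.
pose K := 1 + B * (16 / dl).
have h16 : 1 <= 16 / dl by rewrite ler_pdivlMr// mul1r; lra.
have BK : B <= B * (16 / dl) by rewrite ler_peMr.
have K1 : 1 <= K by rewrite lerDl; lra.
have KK : K <= K ^+ 2 by rewrite expr2 ler_peMr//; lra.
exists K; split => //; first by move: KK; rewrite {1}/K; lra.
rewrite ler_pdivrMr ?exprn_gt0//; last lra.
apply: (@le_trans _ _ (dl / 16 * K)); last by rewrite ler_pM2l// divr_gt0.
rewrite /K mulrDr mulr1 (_ : dl / 16 * (B * (16 / dl)) = B); last by field; rewrite gt_eqF.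
by have := ler_norm (cst_dir cmin cmax); rewrite /B; lra.
Qed.

Let cst_bias0 : 0 <= cst_bias cmin kap.
Proof.
have := cst_resid_ge0 cmin0 kap0; have := cst_pen_ge0 cmin0 kap0.
have : 0 <= 36 * kap / cmin by rewrite divr_ge0 ?(ltW cmin0)// mulr_ge0.
have : 0 <= 16 / cmin by rewrite divr_ge0// ltW.
rewrite /cst_bias => h1 h2 h3 h4; apply: mulr_ge0 => //; lra.
Qed.

(** Each source of failure receives [e / 5] and each relative loss [dl / 16]; [K] is fixed first,
    since all rates are taken with [K] as a constant. *)
Lemma near_pihat (dl e : R) : 0 < dl -> dl <= 1 -> 0 < e ->
  \forall k \near \oo, 1 - e <= Pr (P k) [set w | `|pihat (z w) tau0 tau1 (cs k) / prop k - 1| < dl].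
Proof.
move=> dl0 dl1 e0; have [K [K1 KC hK]] := bias_constant dl0 dl1; have [M hM] := csM.
have smp := near_smax_gt0.
have y0 : 0 < dl / 16 by rewrite divr_gt0.
have e5 : 0 < e / 5 by rewrite divr_gt0.
have e35 : 0 < e / 35 by rewrite divr_gt0.
have Kc0 : 0 <= K * cst_bias cmin kap by rewrite mulr_ge0// (le_trans _ K1).
have st0 : 0 < sqrt tau0 by rewrite sqrtr_gt0.
have xi0 : 0 < signal_slack c tau0.
  rewrite /signal_slack lt_min st0 andbT divr_gt0// subr_gt0 ltr_sqrt; have := c0; have := t00; lra.
have Cr0 : 0 <= cst_resid cmin kap / cmin by rewrite divr_ge0 ?(ltW cmin0)// cst_resid_ge0.
have f1 := near_grid p1 pinf c0 t00.
have f2 := near_small p1 n0 pinf A3 eta01 sE cmin0 cmax0 kap0.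
have f3 := near_shell_prob p1 n0 pinf A3 eta01 sE c0 t00 gam_tau0 gam_tau1 smp Kc0 y0 e5.
have f4 := near_tail p1 pinf xi0 y0 e5.
have f5 := near_variance p1 n0 pinf A3 eta01 sE c0 t00 gam_tau0 smp (cst_corr_ge0 cmin kap) y0 e5.
have f6 := near_threshold p1 n0 pinf A3 eta01 sE c0 t00 gam_tau0 smp hM y0.
have f7 := near_signal p1 n0 pinf A3 eta01 sE c0 t00 gam_tau0 Cr0.
have f8 := near_shell_width p1 n0 pinf A3 eta01 sE Kc0 xi0.
have f9 := near_shell_width p1 n0 pinf A3 eta01 sE Kc0 st0.
have f10 := near_sqrt_ln p1 pinf 1 st0.
have f11 := near_tail p1 pinf st0 ltr01 y0.
have f12 := near_pinv p1 pinf e35; have f13 := near_alpha e5.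
apply: filterS (filterI f1 (filterI f2 (filterI f3 (filterI f4 (filterI f5 (filterI f6 (filterI f7
  (filterI f8 (filterI f9 (filterI f10 (filterI f11 (filterI f12 f13)))))))))))) => k.
move=> [[m [m1 m2]] [[h1 h2 h3 h4 [h5 h6]] [sh [ta [va [th [si [[D0 Dx] [[_ Dt] [sL1 [ql [hp ha]]]]]]]]]]]].
rewrite divr1 in ql.
have [N hN hN2] := Tgrid_bounded (p k) tau0 tau1; have /andP[al0 al1] := al01 k.
have L0 : 0 <= L k by rewrite ln_ge0// ler1n ltnW.
have u0 : 0 <= m%:R :> R by [].
have tE : sqrt (tau0 * L k) = sqrt tau0 * sqrt (L k) by rewrite sqrtrM// ltW.
have gm : Tgrid (p k) tau0 tau1 m.
  apply: Tgrid_sqr; [apply: le_trans m1|apply: (le_trans m2)]; rewrite -/(L k) ler_wpM2r//.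
    by rewrite lerDl; have := c0; lra.
  by have := gam_tau1 k; have /andP[] := gam_tau0 k; have := c0; lra.
have at_ : signal_slack c tau0 * sqrt (L k) <= m%:R.
  apply: (@le_trans _ _ (sqrt (tau0 * L k))); last by case/andP: gm.
  by rewrite tE ler_wpM2r ?sqrtr_ge0// /signal_slack ge_min lexx orbT.
have a0 : 0 <= signal_slack c tau0 * sqrt (L k) by rewrite mulr_ge0 ?sqrtr_ge0// ltW.
have Cq : 0 <= 1 - cst_resid cmin kap / cmin * (sqrt (sm k + 2)%:R * l k).
  rewrite subr_ge0 mulrAC ler_pdivrMr// mul1r; apply: (le_trans h4).
  by rewrite ler_pdivrMr// ler_peMr ?ler1n// ltW.
have hsig := lt_le_trans (si _ _ u0 m2 Dx) (ler_wpM2l Cq (mu k)).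
rewrite -tE in sL1 ql Dt.
have [B [mB PB hB]] := consistency_event (@n0 k) (@p1 k) (@mX k) (@meps k) (@geps k) (@gX k) (@mgh k) (@hbh k) (@hgh k)
  cmin0 (@sS k) (@Smin k) cmax0 (@Smax k) (@Sd k) kap24 (s2 k) (sigma0 k) h1 h2 h3 h4 h5 h6
  al0 al1 (csE k) K1 KC D0 Dt sL1 y0 y0 y0 a0 at_ hN (ex_intro2 _ _ m gm erefl) hsig.
have PB' : Pr (P k) B <= e.
  apply: (le_trans PB); apply: (@le_trans _ _ (7 * (e / 35) + e / 5 + e / 5 + e / 5 + e / 5)).
    apply: lerD (va _ u0 m1); apply: lerD ta; apply: lerD (sh _ _ hN2 erefl); apply: lerD ha.
    by rewrite ler_pM2l.
  by apply: le_of_eq; field.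
have prop0 : 0 < prop k by rewrite divr_gt0 ?ltr0n// ltnW.
apply: (@le_trans _ _ (Pr (P k) (~` B))); first by rewrite Pr_setC// lerD2l lerN2.
apply: Pr_le.
- exact: measurableC.
- have mz j : mfunT (fun w => z w j) by exact: measurable_zstat.
  apply: measurable_setlt => //; apply: measurableT_comp => //; apply: measurable_funB => //.
  by apply: measurable_funM => //; exact: measurable_pihat.
move=> w /hB /= [lo up].
have thk := th _ u0 m1.
exact: (ratio_close dl0 dl1 prop0 hK ql thk lo up).
Qed.

End Consistency.

Theorem theorem2p2 (R : realType) :
  exists2 kappa0 : R, 0 < kappa0 &
  forall kappa : R, kappa0 <= kappa ->
  forall (p n : nat -> nat)
    (d : nat -> measure_display) (T : forall k, measurableType (d k))
    (P : forall k, probability (T k) R)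
    (X : forall k, T k -> 'M[R]_(n k, p k))
    (eps : forall k, T k -> 'cV[R]_(n k))
    (Sigma : forall k, 'M[R]_(p k))
    (beta : forall k, 'cV[R]_(p k))
    (sigma lam : nat -> R)
    (lamj : forall k, 'I_(p k) -> R)
    (betahat : forall k, T k -> 'cV[R]_(p k))
    (gammahat : forall k, T k -> 'I_(p k) -> 'cV[R]_((p k).-1))
    (Cmin Cmax rho c tau0 tau1 : R) (eta alpha cstar : nat -> R),
  let s k := sparsity (beta k) in
  let sm k := smax (Sigma k) in
  let gam k := gammastar (eta k) (p k) (n k) (sm k) in
  let prop k : R := (s k)%:R / (p k)%:R in
  let z k w := zstat (X k w) (eps k w) (beta k) (sigma k) (@lamj k)
                 (betahat k w) (@gammahat k w) in
  let w' k w := wstd (X k w) (eps k w) (sigma k) (@lamj k) (@gammahat k w) in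
  let V k w := Vstar (w' k w) tau0 tau1 in
  let pi_hat k w := pihat (z k w) tau0 tau1 (cstar k) in
  let s_hat k w := pi_hat k w * (p k)%:R in
  (* asymptotic regime *)
  (forall k, (1 < p k)%N) -> (forall k, (0 < n k)%N) -> p @ \oo --> \oo ->
  (* linear model *)
  (forall k, random_mx (X k)) -> (forall k, random_mx (eps k)) ->
  (forall k, gaussian_noise_given (P k) (X k) (eps k) (sigma k ^+ 2)) ->
  (forall k, 0 < sigma k) ->
  (fun k => sigma k ^+ 2) =O_\oo (fun=> 1 : R) ->
  (* Lasso and nodewise Lasso *)
  (forall k, random_mx (betahat k)) ->
  (forall k j, random_mx (fun w => @gammahat k w j)) ->
  (forall k w, is_lasso (X k w) (response (X k w) (eps k w) (beta k))
                 (lam k) (betahat k w)) ->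
  (forall k w, is_nodewise_lasso (X k w) (@lamj k) (@gammahat k w)) ->
  (* conditions A1, A2, A3 *)
  0 < Cmin -> Cmin <= Cmax -> 0 < rho ->
  (forall k, condA1 (P k) (X k) (Sigma k) (s k) Cmin Cmax rho) ->
  (forall k, condA2 (n k) (sigma k) kappa (lam k) (@lamj k)) ->
  @condA3 R p n s sm ->
  (* sparsity and signal strength *)
  (forall k, 0 < eta k < 1) ->
  (forall k, (s k)%:R = (p k)%:R `^ (1 - eta k)) ->
  0 < c ->
  (forall k, Num.sqrt (2 * (gam k + c) * ln (p k)%:R) <=
             mu_min (n k) (beta k) (sigma k) (Sigma k)) ->
  (* grid and bounding sequence *)
  0 < tau0 -> tau0 < tau1 ->
  (forall k, 2 * gam k < tau0 < 2 * gam k + c) ->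
  (forall k, 2 * (gam k + c) < tau1) ->
  (forall k, 0 < alpha k < 1) -> alpha @ \oo --> (0 : R) ->
  (forall k, cstar k = quantile (P k) (V k) (1 - alpha k)) ->
  cstar =Theta_\oo
    (fun k => ((sm k)%:R / (n k)%:R) `^ 4^-1 * ln (p k)%:R : R) ->
  (forall delta : R, 0 < delta ->
     (fun k => P k [set w | `|pi_hat k w / prop k - 1| < delta])
       @ \oo --> 1%E) /\
  (forall delta : R, 0 < delta ->
     (fun k => P k [set w | `|s_hat k w / (s k)%:R - 1| < delta])
       @ \oo --> 1%E).
Proof.
(* 24 makes half of the nodewise penalty dominate the entry deviation [12 l], and depends on nothing
   else. *)
exists 24 => // kap kap24 p n d T P X eps S beta sigma lam lamj bh gh cmin cmax rho c tau0 tau1 eta alpha cs.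
move=> s sm gam prop z w' V pi_hat s_hat p1 n0 pinf mX meps geps sigma0 _ mbh mgh hbh hgh cmin0 cminmax _.
move=> A1 A2 A3 eta01 sE c0 mu t00 t01 gam_tau0 gam_tau1 al01 al_cvg csE csTheta.
have lamjE : lamj = fun k _ => kap * sqrt (ln (p k)%:R / (n k)%:R).
  apply: functional_extensionality_dep => k; apply/funext => j; exact: (A2 k).2.
have mz k j : mfunT (fun w => z k w j) by exact: measurable_zstat.
have mA k dl : measurable [set w | `|pi_hat k w / prop k - 1| < dl].
  apply: measurable_setlt => //; apply: measurableT_comp => //; apply: measurable_funB => //.
  by apply: measurable_funM => //; exact: measurable_pihat.
have sS k : (S k)^T = S k by have [[_ /(_ (Ordinal (n0 k)))[]]] := A1 k.
have gX k : iid_gaussian_rows (P k) (X k) (S k) by case: (A1 k).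
have Sd k j : S k j j <= 1 by case: (A1 k).
have eig k a : eigenvalue (S k) a -> cmin <= a /\ a <= cmax by case: (A1 k) => _ _ h _ /h/andP.
have Smin k v : cmin * sqnorm2 v <= qform (S k) v by apply: qform_eig_ge => // a /eig[].
have Smax k v : qform (S k) v <= cmax * sqnorm2 v by apply: qform_eig_le => // a /eig[].
have cmax0 : 0 <= cmax by apply: le_trans cminmax; exact: ltW.
have hbh' k w : is_lasso (X k w) (response (X k w) (eps k w) (beta k))
    (8 * sigma k * sqrt (ln (p k)%:R / (n k)%:R)) (bh k w).
  by case: (A2 k) => <- _; exact: hbh.
have cvg1 dl : 0 < dl -> (fun k => P k [set w | `|pi_hat k w / prop k - 1| < dl]) @ \oo --> 1%E.
  (* The finite-sample comparison is for [dl <= 1]; the event grows with [dl]. *)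
  move=> dl0; pose dm := Num.min dl 1; have dm0 : 0 < dm by rewrite lt_min dl0/=.
  have dm1 : dm <= 1 by rewrite ge_min lexx orbT.
  under eq_fun do rewrite PrE//.
  apply: cvg_EFin; first exact: nearW.
  apply/cvgrPdist_le => e e0.
  have h : \forall k \near \oo, 1 - e <= Pr (P k) [set w | `|pi_hat k w / prop k - 1| < dm].
    subst lamj; exact: (near_pihat p1 n0 pinf mX meps geps sigma0 mbh mgh hbh' hgh cmin0 cmax0 gX sS Smin Smax
      Sd kap24 A3 eta01 sE c0 mu t00 t01 gam_tau0 gam_tau1 al01 al_cvg csE csTheta dm0 dm1 e0).
  apply: filterS h => k h; rewrite /= ger0_norm ?subr_ge0 ?Pr_le1// lerBlDr -lerBlDl.
  apply: (le_trans h); apply: Pr_le => // w /=; rewrite lt_min => /andP[//].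
split=> // dl dl0; rewrite (_ : (fun k => _) = (fun k => P k [set w | `|pi_hat k w / prop k - 1| < dl])).
  exact: cvg1.
apply/funext => k; congr (P k _); apply/seteqP.
by split => w /=; rewrite /s_hat /prop invf_div mulrA.
Qed.
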